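(* Let $\mathcal{C}$ be an $\infty$-category, $D$ a natural system of $R$-modules on $\mathcal{C}$, $p\colon\mathcal{B}\to\mathcal{C}$ a functor, and let $f\colon\mathcal{E}\to\mathcal{B}$ be a linear extension of $\mathcal{B}$ by $D$, with classifying functor $k\colon\mathcal{B}\to\mathcal{D}^2$. Fix $X\in\mathcal{B}$ and set $\Lambda=pX\in\mathcal{C}$. Then the spaces $\mathrm{Lifts}^{\mathcal{E}}_\varepsilon(X)$ for $\varepsilon\in\{0,1\}$ sit in cartesian squares: the first has edges $$\mathrm{Lifts}_0^{\mathcal{E}}(X)\to B\mathrm{Aut}_{\mathcal{C}}(\Lambda),\quad \mathrm{Lifts}_0^{\mathcal{E}}(X)\to B\mathrm{Aut}_{\mathcal{B}}(X),\quad 0\colon B\mathrm{Aut}_{\mathcal{C}}(\Lambda)\to(\Omega^\infty\Sigma^2D(\mathrm{id}_\Lambda))_{\mathrm{h}\mathrm{Aut}(\Lambda)},\quad k\colon B\mathrm{Aut}_{\mathcal{B}}(X)\to(\Omega^\infty\Sigma^2D(\mathrm{id}_\Lambda))_{\mathrm{h}\mathrm{Aut}(\Lambda)},$$ and the second has edges $$\mathrm{Lifts}_1^{\mathcal{E}}(X)\to\{0\},\quad \mathrm{Lifts}_1^{\mathcal{E}}(X)\to\{k(X)\},\quad \{0\}\to\Omega^\infty\Sigma^2D(\mathrm{id}_\Lambda),\quad \{k(X)\}\to\Omega^\infty\Sigma^2D(\mathrm{id}_\Lambda).$$ In particular, canonically associated to $X$ is an obstruction class $k(X)\in\pi_{-2}D(\mathrm{id}_\Lambda)$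 to exhibiting a lift of $X$ to $\mathcal{E}$, and a choice of nullhomotopy of $k(X)$ provides an equivalence $$\mathrm{Lifts}_1^{\mathcal{E}}(X)\simeq\mathrm{map}_{\mathcal{D}^2}(0\Lambda,0\Lambda)_{\mathrm{id}_\Lambda}\simeq\Omega^\infty\Sigma D(\mathrm{id}_\Lambda).$$
   Context: $R$ is a connective $\mathbf{E}_1$-ring spectrum. For an $\infty$-category $\mathcal{C}$, $\mathrm{Tw}(\mathcal{C})$ is the twisted arrow category (with projection to $\mathcal{C}^{\mathrm{op}}\times\mathcal{C}$), and a natural system of $R$-modules on $\mathcal{C}$ is a functor $D\colon\mathrm{Tw}(\mathcal{C})\to\mathrm{RMod}_R$. By Harpaz--Nuiten--Prasma there is an equivalence $\mathrm{RMod}_R((\mathrm{Cat}_\infty)_{/\mathcal{C}})\simeq\mathrm{Fun}(\mathrm{Tw}(\mathcal{C}),\mathrm{RMod}_R)$, where the left side is the $\infty$-category of right $R$-module objects in $(\mathrm{Cat}_\infty)_{/\mathcal{C}}$. The object $\mathcal{D}^\bullet$ corresponding to $D$, with $n$-th $\infty$-category $\mathcal{D}^n\simeq\Omega_{\mathcal{C}}\mathcal{D}^{n+1}$ over $\mathcal{C}$ for $n\ge0$, projection $q\colon\mathcal{D}^n\to\mathcal{C}$ and zero-section $0\colon\mathcal{C}\to\mathcal{D}^n$, satisfies $\Omega^\infty\Sigma^nD(\phi\colon\Gamma\to\Lambda)\simeq\mathrm{map}_{\mathcal{D}^{n+1}}(0\Gamma,0\Lambda)_\phi$, where the subscript $\phi$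 denotes the fibre over $\phi$ of the map $\mathrm{map}_{\mathcal{D}^{n+1}}(0\Gamma,0\Lambda)\to\mathrm{map}_{\mathcal{C}}(\Gamma,\Lambda)$ induced by $q$. Underlying groupoids satisfy $(\mathcal{D}^n)^{\simeq}\simeq\mathrm{colim}_{\Lambda\in\mathcal{C}^{\simeq}}\Omega^\infty\Sigma^nD(\mathrm{id}_\Lambda)$. Given $p\colon\mathcal{B}\to\mathcal{C}$, a linear extension of $\mathcal{B}$ by $D$ is a functor $f\colon\mathcal{E}\to\mathcal{B}$ together with a specified cartesian square of $\infty$-categories over $\mathcal{C}$ with edges $t\colon\mathcal{E}\to\mathcal{C}$, $f\colon\mathcal{E}\to\mathcal{B}$, $0\colon\mathcal{C}\to\mathcal{D}^2$, $k\colon\mathcal{B}\to\mathcal{D}^2$, where $q\circ k\simeq p$. Such an $f$ is conservative. For a conservative functor $f\colon\mathcal{E}\to\mathcal{B}$ and $X\in\mathcal{B}$: $\mathrm{Lifts}_0^{\mathcal{E}}(X)=B\mathrm{Aut}_{\mathcal{B}}(X)\times_{\mathcal{B}}\mathcal{E}$, the full subspace of $\mathcal{E}^{\simeq}$ of objects $\tilde X$ for which there exists an equivalence $f(\tilde X)\simeq X$; and $\mathrm{Lifts}_1^{\mathcal{E}}(X)=\{X\}\times_{\mathcal{B}}\mathcal{E}$, the space of $\tilde X\in\mathcal{E}$ equipped with an equivalence $f(\tilde X)\simeq X$. $(-)_{\mathrm{h}\mathrm{Aut}(\Lambda)}$ denotes homotopy orbits, and $B\mathrm{Aut}$ the full subspace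 of the underlying groupoid on the given object. *)

(* Defs.v *)
(* MathComp (finite ordinals, finite sets, permutations), with the classical
   axioms of mathcomp.classical.boolp.

   Infinity-categories are quasi-categories, spaces are Kan complexes, and
   spectra are symmetric spectra of simplicial sets.  All constructions below
   are made for arbitrary simplicial sets; they have the intended homotopical
   meaning on quasi-categories, resp. on Kan complexes. *)
#[export] Set Warnings "-notation-overridden".
From mathcomp Require Import all_boot fingroup perm boolp zify.

Set Implicit Arguments.
Unset Strict Implicit.
Unset Printing Implicit Defensive.
#[local] Obligation Tactic := intros; simpl.

(** * Simplicial sets *)

Definition hom (m n : nat) : Type :=
  {f : 'I_m.+1 -> 'I_n.+1 | forall i j : 'I_m.+1, i <= j -> f i <= f j}.
Definition happ m n (f : hom m n) : 'I_m.+1 -> 'I_n.+1 := sval f.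
Coercion happ : hom >-> Funclass.

Lemma hom_eq m n (f g : hom m n) : (forall i, f i = g i) -> f = g.
Proof. by case: f g => f hf [g hg] /= e; apply: eq_exist; apply: funext. Qed.

Definition mk_hom m n (f : 'I_m.+1 -> 'I_n.+1)
  (Hf : forall i j : 'I_m.+1, i <= j -> f i <= f j) : hom m n := exist _ f Hf.
Definition hid n : hom n n := @mk_hom n n (fun i => i) (fun i j h => h).
Definition hcomp l m n (g : hom m n) (f : hom l m) : hom l n :=
  @mk_hom l n (fun i => g (f i)) (fun i j h => svalP g _ _ (svalP f _ _ h)).
Definition hconst m n (i : 'I_n.+1) : hom m n :=
  @mk_hom m n (fun _ => i) (fun _ _ _ => leqnn i).

Definition small_type := Type.

Record simplicial (X : nat -> Type) : Type := Simplicial {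
  s_act : forall m n, hom m n -> X n -> X m;
  s_act_id : forall n (x : X n), s_act (hid n) x = x;
  s_act_comp : forall l m n (g : hom m n) (f : hom l m) (x : X n),
    s_act (hcomp g f) x = s_act f (s_act g x) }.

Record sSet : Type := SSet { simp :> nat -> Type; simpP : simplicial simp }.

(* Simplicial sets whose simplices live in a fixed smaller universe.  Spectra
   are built from these, so that R-modules form a set of vertices for a
   simplicial set in the sense of sSet. *)
Record small_sSet : Type :=
  SmallSSet { ssimp :> nat -> small_type; ssimpP : simplicial ssimp }.
Canonical sSet_of_small (X : small_sSet) : sSet := SSet (ssimpP X).
Coercion sSet_of_small : small_sSet >-> sSet.

Definition act (X : sSet) m n (f : hom m n) (x : X n) : X m :=
  s_act (simpP X) f x.
Arguments act X [m n] f x : simpl never.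

Lemma act_id (X : sSet) n (x : X n) : act X (hid n) x = x.
Proof. exact: s_act_id. Qed.
Lemma act_comp (X : sSet) l m n (g : hom m n) (f : hom l m) (x : X n) :
  act X (hcomp g f) x = act X f (act X g x).
Proof. exact: s_act_comp. Qed.

(* The totally degenerate k-simplex on a vertex. *)
Definition deg (X : sSet) k (x : X 0) : X k := act X (hconst k ord0) x.
Arguments deg X k x : clear implicits.
Definition vertex (X : sSet) n (i : 'I_n.+1) (x : X n) : X 0 :=
  act X (hconst 0 i) x.

Lemma act_deg (X : sSet) m k (f : hom m k) (x : X 0) :
  act X f (deg X k x) = deg X m x.
Proof. by rewrite /deg -act_comp; congr (act X _ x); apply: hom_eq. Qed.

Record smap (X Y : sSet) : Type := SMap {
  smap_fun :> forall n, X n -> Y n;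
  smapE : forall m n (f : hom m n) (x : X n),
    @smap_fun m (act X f x) = act Y f (@smap_fun n x) }.
Arguments smap_fun [X Y] s n x : rename.

Lemma smap_eq (X Y : sSet) (f g : smap X Y) :
  (forall n x, f n x = g n x) -> f = g.
Proof.
case: f g => f hf [g hg] /= e.
have E : f = g by apply: functional_extensionality_dep => n; apply: funext.
by subst g; congr SMap; apply: Prop_irrelevance.
Qed.

Lemma smap_deg (X Y : sSet) (f : smap X Y) k (x : X 0) :
  f k (deg X k x) = deg Y k (f 0 x).
Proof. exact: smapE. Qed.

Definition sid (X : sSet) : smap X X := @SMap X X (fun _ x => x) (fun _ _ _ _ => erefl).
Program Definition scomp (X Y Z : sSet) (g : smap Y Z) (f : smap X Y) : smap X Z :=
  @SMap X Z (fun n x => g n (f n x)) _.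
Next Obligation. by rewrite !smapE. Qed.

Program Definition simplex (n : nat) : sSet :=
  @SSet (fun m => hom m n) (@Simplicial _ (fun _ _ f x => hcomp x f) _ _).
Next Obligation. exact: hom_eq. Qed.
Next Obligation. exact: hom_eq. Qed.

Program Definition simplex_map m n (f : hom m n) : smap (simplex m) (simplex n) :=
  @SMap (simplex m) (simplex n) (fun _ x => hcomp f x) _.
Next Obligation. exact: hom_eq. Qed.

Definition point : sSet :=
  @SSet (fun _ => unit)
    (@Simplicial (fun _ => unit) (fun _ _ _ x => x) (fun _ _ => erefl) (fun _ _ _ _ _ _ => erefl)).

Definition at_vertex (X : sSet) (x : X 0) : smap point X :=
  @SMap point X (fun k _ => deg X k x) (fun _ _ f _ => esym (act_deg f x)).

(* The nerve of the groupoid with two uniquely isomorphic objects. *)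
Definition J : sSet :=
  @SSet (fun m => 'I_m.+1 -> bool)
    (@Simplicial (fun m => 'I_m.+1 -> bool) (fun _ _ f x i => x (f i)) (fun _ _ => erefl)
       (fun _ _ _ _ _ _ => erefl)).
Definition J_end (b : bool) : J 0 := fun _ => b.

Program Definition sprod (X Y : sSet) : sSet :=
  @SSet (fun m => X m * Y m)%type
    (@Simplicial (fun m => X m * Y m)%type (fun _ _ f x => (act X f x.1, act Y f x.2)) _ _).
Next Obligation. by case: x => a b; rewrite /= !act_id. Qed.
Next Obligation. by rewrite !act_comp. Qed.

Definition subclosed (X : sSet) (P : forall n, X n -> Prop) : Prop :=
  forall m n (f : hom m n) (x : X n), P n x -> P m (act X f x).

Program Definition subsset (X : sSet) (P : forall n, X n -> Prop)
    (HP : subclosed P) : sSet :=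
  @SSet (fun m => {x : X m | P m x})
    (@Simplicial (fun m => {x : X m | P m x}) (fun _ _ f x => exist _ (act X f (sval x)) (HP _ _ f _ (svalP x))) _ _).
Next Obligation. by case: x => x hx; apply: eq_exist; rewrite act_id. Qed.
Next Obligation. by apply: eq_exist; rewrite act_comp. Qed.

Definition incl (X : sSet) P (HP : @subclosed X P) : smap (subsset HP) X :=
  @SMap (subsset HP) X (fun _ x => sval x) (fun _ _ _ _ => erefl).

Program Definition sub_lift (X Y : sSet) P (HP : @subclosed Y P) (f : smap X Y)
    (Hf : forall n x, P n (f n x)) : smap X (subsset HP) :=
  @SMap X (subsset HP) (fun n x => exist _ (f n x) (Hf n x)) _.
Next Obligation. by apply: eq_exist; rewrite smapE. Qed.

Lemma pullback_closed (X Y Z : sSet) (f : smap X Z) (g : smap Y Z) :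
  @subclosed (sprod X Y) (fun n p => f n p.1 = g n p.2).
Proof. by move=> m n h p e; rewrite /= !smapE e. Qed.
Definition pullback (X Y Z : sSet) (f : smap X Z) (g : smap Y Z) : sSet :=
  subsset (@pullback_closed X Y Z f g).

Definition pb_fst (X Y Z : sSet) (f : smap X Z) (g : smap Y Z) :
    smap (pullback f g) X :=
  @SMap (pullback f g) X (fun _ p => (sval p).1) (fun _ _ _ _ => erefl).
Definition pb_snd (X Y Z : sSet) (f : smap X Z) (g : smap Y Z) :
    smap (pullback f g) Y :=
  @SMap (pullback f g) Y (fun _ p => (sval p).2) (fun _ _ _ _ => erefl).

Program Definition mapsp (K X : sSet) : sSet :=
  @SSet (fun m => smap (sprod (simplex m) K) X)
    (@Simplicial (fun m => smap (sprod (simplex m) K) X) (fun m n f g =>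
       @SMap (sprod (simplex m) K) X (fun j p => g j (hcomp f p.1, p.2)) _) _ _).
Next Obligation.
rewrite -smapE /=; congr (smap_fun g _ _).
by congr (_, _); apply: hom_eq.
Qed.
Next Obligation.
by apply: smap_eq => j [p q] /=; congr (smap_fun x _ (_, _)); apply: hom_eq.
Qed.
Next Obligation.
by apply: smap_eq => j [p q] /=; congr (smap_fun x _ (_, _)); apply: hom_eq.
Qed.

Program Definition mapsp_post (K X Y : sSet) (f : smap X Y) :
    smap (mapsp K X) (mapsp K Y) :=
  @SMap (mapsp K X) (mapsp K Y) (fun _ g => scomp f g) _.
Next Obligation. by apply: smap_eq. Qed.

Program Definition eval_at (K X : sSet) (v : K 0) : smap (mapsp K X) X :=
  @SMap (mapsp K X) X (fun m g => g m (hid m, deg K m v)) _.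
Next Obligation.
rewrite -smapE /=; congr (smap_fun x _ (_, _)); last by rewrite -/(act K f _) act_deg.
exact: hom_eq.
Qed.

(** * Quasi-categories and Kan complexes *)

Lemma faces_closed n (P : 'I_n.+1 -> Prop) :
  @subclosed (simplex n) (fun m f => exists2 j, P j & forall i, happ f i <> j).
Proof. by move=> m k h f [j Pj Hj]; exists j => // i; apply: Hj. Qed.

(* The union of the faces of the n-simplex opposite to the vertices in P. *)
Definition faces n (P : 'I_n.+1 -> Prop) : sSet := subsset (@faces_closed n P).
Definition boundary n := faces (fun _ : 'I_n.+1 => True).
Definition horn n (k : 'I_n.+1) := faces (fun j => j <> k).

Definition fills_horn (X : sSet) n (k : 'I_n.+1) : Prop :=
  forall h : smap (horn k) X, exists g : smap (simplex n) X,
    forall m x, g m (sval x) = h m x.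

Definition is_quasicategory (X : sSet) : Prop :=
  forall n (k : 'I_n.+1), 0 < k < n -> fills_horn X k.
Definition is_kan (X : sSet) : Prop :=
  forall n (k : 'I_n.+1), 0 < n -> fills_horn X k.

Record infty_cat : Type :=
  InftyCat { ic_sset :> sSet; ic_qcat : is_quasicategory ic_sset }.

Definition trivial_kan_fibration (X Y : sSet) (f : smap X Y) : Prop :=
  forall n (u : smap (boundary n) X) (v : smap (simplex n) Y),
    (forall m x, f m (u m x) = v m (sval x)) ->
    exists w : smap (simplex n) X,
      (forall m x, w m (sval x) = u m x) /\ (forall m x, f m (w m x) = v m x).

Definition path_space (X : sSet) : sSet := mapsp J X.
Definition path_start (X : sSet) : smap (path_space X) X := eval_at X (J_end false).
Definition path_end (X : sSet) : smap (path_space X) X := eval_at X (J_end true).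

(* Equivalence of functors (for X a simplicial set and Y a quasi-category). *)
Definition homotopic (X Y : sSet) (f g : smap X Y) : Prop :=
  exists h : smap X (path_space Y),
    (forall n x, path_start Y n (h n x) = f n x) /\
    (forall n x, path_end Y n (h n x) = g n x).

Definition is_equiv (X Y : sSet) (f : smap X Y) : Prop :=
  exists g : smap Y X, homotopic (scomp g f) (sid X) /\ homotopic (scomp f g) (sid Y).

(* The homotopy fibre product of a and b, with simplices (x, gamma, y), where
   gamma is an equivalence from a x to b y. *)
Program Definition pair_map (X Y Z : sSet) (f : smap X Y) (g : smap X Z) :
    smap X (sprod Y Z) := @SMap X (sprod Y Z) (fun n x => (f n x, g n x)) _.
Next Obligation. by rewrite !smapE. Qed.
Program Definition prod_map (X Y X' Y' : sSet) (f : smap X X') (g : smap Y Y') :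
    smap (sprod X Y) (sprod X' Y') :=
  @SMap (sprod X Y) (sprod X' Y') (fun n x => (f n x.1, g n x.2)) _.
Next Obligation. by rewrite !smapE. Qed.

Definition hpullback (A B D : sSet) (a : smap A D) (b : smap B D) : sSet :=
  pullback (prod_map a b) (pair_map (path_start D) (path_end D)).

Definition hpb_fst (A B D : sSet) (a : smap A D) (b : smap B D) : smap (hpullback a b) A :=
  @SMap (hpullback a b) A (fun _ p => (sval p).1.1) (fun _ _ _ _ => erefl).
Definition hpb_snd (A B D : sSet) (a : smap A D) (b : smap B D) : smap (hpullback a b) B :=
  @SMap (hpullback a b) B (fun _ p => (sval p).1.2) (fun _ _ _ _ => erefl).
Definition hpb_path (A B D : sSet) (a : smap A D) (b : smap B D) :
  smap (hpullback a b) (path_space D) := pb_snd _ _.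

(* A square
       E ---top---> A
       |            | a
      left          v
       B -----b---> D
   commuting up to a specified equivalence  a o top ~ b o left. *)
Record square (E A B D : sSet) (a : smap A D) (b : smap B D) : Type := Square {
  sq_map : smap E (hpullback a b) }.

Definition sq_top (E A B D : sSet) (a : smap A D) (b : smap B D)
  (s : square E a b) : smap E A := scomp (hpb_fst a b) (sq_map s).
Definition sq_left (E A B D : sSet) (a : smap A D) (b : smap B D)
  (s : square E a b) : smap E B := scomp (hpb_snd a b) (sq_map s).
Definition sq_filling (E A B D : sSet) (a : smap A D) (b : smap B D)
  (s : square E a b) : smap E (path_space D) := scomp (hpb_path a b) (sq_map s).
Definition cartesian (E A B D : sSet) (a : smap A D) (b : smap B D)
  (s : square E a b) : Prop := is_equiv (sq_map s).

(** * Mapping spaces, underlying groupoids, lifts *)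

Definition Delta1_end (b : bool) : simplex 1 0 :=
  hconst 0 (if b then ord_max else ord0).

Lemma map_space_closed (X : sSet) (x y : X 0) : @subclosed (mapsp (simplex 1) X) (fun n g =>
  eval_at X (Delta1_end false) n g = deg X n x /\
  eval_at X (Delta1_end true) n g = deg X n y).
Proof. by move=> m n f g [e1 e2]; rewrite !smapE e1 e2 !act_deg. Qed.
Definition map_space (X : sSet) (x y : X 0) : sSet := subsset (@map_space_closed X x y).

Program Definition map_space_map (X Y : sSet) (f : smap X Y) (x y : X 0) :
    smap (map_space x y) (map_space (f 0 x) (f 0 y)) :=
  @SMap (map_space x y) (map_space (f 0 x) (f 0 y))
    (fun n g => exist _ (mapsp_post (simplex 1) f n (sval g)) _) _.
Next Obligation.
by case: g => g [/= e1 e2]; rewrite -!smap_deg -e1 -e2.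
Qed.
Next Obligation. by apply: eq_exist; apply: smap_eq. Qed.

Program Definition map_id (X : sSet) (x : X 0) : map_space x x 0 :=
  exist _ (@SMap (sprod (simplex 0) (simplex 1)) X (fun k _ => deg X k x) _) _.
Next Obligation. by rewrite act_deg. Qed.
Next Obligation. by []. Qed.

(* An edge of a quasi-category is an equivalence when it has a left and a right
   inverse up to homotopy, each witnessed by a 2-simplex. *)
Definition v2 (i : nat) : 'I_3 := inord i.
Definition edge_hom (i j : nat) : 'I_2 -> 'I_3 := fun a => if a == ord0 then v2 i else v2 j.
Lemma edge_hom_mono i j : i <= j < 3 ->
  forall a b : 'I_2, a <= b -> edge_hom i j a <= edge_hom i j b.
Proof.
move=> /andP[ij j3] a b; rewrite /edge_hom.
have i3 : i < 3 by apply: leq_ltn_trans j3.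
case: (eqVneq a ord0) => [->|na]; case: (eqVneq b ord0) => [->|nb] //=.
  by rewrite !inordK.
by rewrite leqn0 => /eqP e; case/negP: na; apply/eqP/val_inj.
Qed.
Definition e01 : hom 1 2 := mk_hom (@edge_hom_mono 0 1 isT).
Definition e02 : hom 1 2 := mk_hom (@edge_hom_mono 0 2 isT).
Definition e12 : hom 1 2 := mk_hom (@edge_hom_mono 1 2 isT).

Definition src (X : sSet) (e : X 1) : X 0 := vertex ord0 e.
Definition tgt (X : sSet) (e : X 1) : X 0 := vertex ord_max e.

Definition is_equivalence (X : sSet) (e : X 1) : Prop :=
  (exists s : X 2, act X e01 s = e /\ act X e02 s = deg X 1 (src e)) /\
  (exists t : X 2, act X e12 t = e /\ act X e02 t = deg X 1 (tgt e)).

Definition equivalent (X : sSet) (x y : X 0) : Prop :=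
  exists e : X 1, [/\ src e = x, tgt e = y & is_equivalence e].

(* [over f y] is the full subspace of the underlying groupoid of X on the
   vertices x for which there is an equivalence f x ~ y. *)
Lemma over_closed (X Y : sSet) (f : smap X Y) (y : Y 0) : @subclosed X (fun n x =>
  (forall e : hom 1 n, is_equivalence (act X e x)) /\
  (forall i, equivalent (f 0 (vertex i x)) y)).
Proof.
move=> m n h x [He Hv]; split=> [e|i]; first by rewrite -act_comp.
have -> : vertex i (act X h x) = vertex (h i) x.
  by rewrite /vertex -act_comp; congr (act X _ x); apply: hom_eq.
exact: Hv.
Qed.
Definition over (X Y : sSet) (f : smap X Y) (y : Y 0) : sSet :=
  subsset (@over_closed X Y f y).
Definition over_incl (X Y : sSet) (f : smap X Y) (y : Y 0) : smap (over f y) X :=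
  incl (@over_closed X Y f y).

Definition BAut (X : sSet) (x : X 0) : sSet := over (sid X) x.
Definition BAut_incl (X : sSet) (x : X 0) : smap (BAut x) X := over_incl (sid X) x.

Definition Lifts0 (E B : sSet) (f : smap E B) (X : B 0) : sSet := over f X.
Definition Lifts1 (E B : sSet) (f : smap E B) (X : B 0) : sSet :=
  hpullback (at_vertex X) f.

Lemma smap_is_equivalence (X Y : sSet) (h : smap X Y) (e : X 1) :
  is_equivalence e -> is_equivalence (h 1 e).
Proof.
case=> -[s [s1 s2]] [t [t1 t2]]; split; [exists (h 2 s)|exists (h 2 t)];
  by rewrite /src /tgt /vertex -!smapE ?s1 ?s2 ?t1 ?t2 -smap_deg.
Qed.

(* A map h over Y induces a map between these subspaces. *)
Program Definition over_map (X X' Y : sSet) (f : smap X Y) (f' : smap X' Y)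
    (h : smap X X') (H : forall x, f' 0 (h 0 x) = f 0 x) (y : Y 0) :
    smap (over f y) (over f' y) :=
  @sub_lift (over f y) X' _ (@over_closed X' Y f' y) (scomp h (over_incl f y)) _.
Next Obligation.
case: x => x [He Hv] /=; split=> [e|i].
  by rewrite -smapE; apply: smap_is_equivalence.
by rewrite /vertex -smapE H; apply: Hv.
Qed.

(* Path components of a Kan complex. *)
Definition connected (X : sSet) (x y : X 0) : Prop :=
  exists e : X 1, src e = x /\ tgt e = y.
Definition pi0 (X : sSet) : Type :=
  {A : X 0 -> Prop | exists x, A = connected x}.
Definition component (X : sSet) (x : X 0) : pi0 X :=
  exist _ (connected x) (ex_intro _ x erefl).

(** * The twisted arrow category *)

(* [tw f] is the join of the opposite of f with f. *)
Definition tw_fun m n (f : hom m n) (i : 'I_m.*2.+2) : 'I_n.*2.+2 :=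
  inord (if i <= m then n - f (inord (m - i)) else n.+1 + f (inord (i - m.+1))).

Lemma tw_funE m n (f : hom m n) i : tw_fun f i =
  (if i <= m then n - f (inord (m - i)) else n.+1 + f (inord (i - m.+1))) :> nat.
Proof.
rewrite /tw_fun inordK //; case: ifP => _.
  by have := ltn_ord (f (inord (m - i))); lia.
by have := ltn_ord (f (inord (i - m.+1))); lia.
Qed.

Lemma tw_mono m n (f : hom m n) (i j : 'I_m.*2.+2) :
  i <= j -> tw_fun f i <= tw_fun f j.
Proof.
move=> ij; rewrite !tw_funE.
have hi := ltn_ord i; have hj := ltn_ord j.
case: ifP => im; case: ifP => jm; try lia.
- apply: leq_sub2l; apply: (svalP f); rewrite !inordK; lia.
- rewrite leq_add2l; apply: (svalP f); rewrite !inordK; lia.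
Qed.

Definition tw_hom m n (f : hom m n) : hom m.*2.+1 n.*2.+1 :=
  mk_hom (@tw_mono m n f).

Lemma tw_hom_id n : tw_hom (hid n) = hid _.
Proof.
apply: hom_eq => i; apply: val_inj; rewrite /= tw_funE /=.
have hi := ltn_ord i; case: ifP => im; rewrite inordK; lia.
Qed.

Lemma tw_hom_comp l m n (g : hom m n) (f : hom l m) :
  tw_hom (hcomp g f) = hcomp (tw_hom g) (tw_hom f).
Proof.
apply: hom_eq => i; apply: val_inj; rewrite /= !tw_funE /=.
have hi := ltn_ord i; case: ifP => im.
- have h1 := ltn_ord (f (inord (l - i))).
  rewrite leq_subr; congr (_ - nat_of_ord (happ g _)); apply: val_inj => /=.
  by rewrite inordK; lia.
- have h1 := ltn_ord (f (inord (i - l.+1))).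
  rewrite leqNgt ltn_addr //=; congr (_ + nat_of_ord (happ g _)); apply: val_inj => /=.
  by rewrite inordK; lia.
Qed.

(* An m-simplex of Tw(X) is a (2m+1)-simplex of X; an arrow in Tw from
   x0 -> y0 to x1 -> y1 is a string x1 -> x0 -> y0 -> y1. *)
Program Definition Tw (X : sSet) : sSet :=
  @SSet (fun m => X m.*2.+1)
    (@Simplicial (fun m => X m.*2.+1) (fun _ _ f x => act X (tw_hom f) x) _ _).
Next Obligation. by rewrite tw_hom_id act_id. Qed.
Next Obligation. by rewrite tw_hom_comp act_comp. Qed.

Definition Tw_map (X Y : sSet) (f : smap X Y) : smap (Tw X) (Tw Y) :=
  @SMap (Tw X) (Tw Y) (fun m x => f _ x) (fun _ _ h x => smapE f (tw_hom h) x).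

Definition tw_id (X : sSet) (x : X 0) : Tw X 0 := deg X 1 x.

Definition tgt_fun m (i : 'I_m.+1) : 'I_m.*2.+2 := inord (m.+1 + i).
Lemma tgt_funE m (i : 'I_m.+1) : tgt_fun i = m.+1 + i :> nat.
Proof. by rewrite /tgt_fun inordK //; have := ltn_ord i; lia. Qed.
Lemma tgt_mono m (i j : 'I_m.+1) : i <= j -> tgt_fun i <= tgt_fun j.
Proof. by rewrite !tgt_funE leq_add2l. Qed.
Definition tgt_hom m : hom m m.*2.+1 := mk_hom (@tgt_mono m).

Lemma tgt_homE m n (f : hom m n) :
  hcomp (tw_hom f) (tgt_hom m) = hcomp (tgt_hom n) f.
Proof.
apply: hom_eq => i; apply: val_inj; rewrite /= tw_funE !tgt_funE.
rewrite leqNgt ltn_addr //=; congr (_ + nat_of_ord (happ f _)).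
by apply: val_inj; rewrite /= addKn inordK.
Qed.

(* The projection to the target; an equivalence when X is a Kan complex. *)
Program Definition Tw_tgt (X : sSet) : smap (Tw X) X :=
  @SMap (Tw X) X (fun m x => act X (tgt_hom m) x) _.
Next Obligation. by rewrite -!act_comp tgt_homE. Qed.

(** * Symmetric ring spectra and their modules *)

(* Symmetric sequences of pointed simplicial sets.  Since
   (s * t)%g i = t (s i) for permutations, this is a left action for the usual
   composition of permutations. *)
Record symseq : Type := SymSeq {
  lev :> nat -> small_sSet;
  bp : forall n, lev n 0;
  sg : forall n, 'S_n -> smap (lev n) (lev n);
  sg_bp : forall n (s : 'S_n), sg s 0 (bp n) = bp n;
  sg1 : forall n k (x : lev n k), sg 1%g k x = x;
  sgM : forall n (s t : 'S_n) k (x : lev n k), sg (s * t)%g k x = sg t k (sg s k x) }.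

Arguments sg X [n] s : rename.

Definition basept (X : symseq) n k : X n k := deg (X n) k (bp X n).
Arguments basept X n k : clear implicits.

(* r is the block sum of s and t. *)
Definition is_block_sum n m l (s : 'S_n) (t : 'S_m) (r : 'S_l) : Prop :=
  (forall (i : 'I_n) (j : 'I_l), i = j :> nat -> r j = s i :> nat) /\
  (forall (i : 'I_m) (j : 'I_l), n + i = j :> nat -> r j = n + t i :> nat).

(* r moves the last of l = n + 1 letters to the front. *)
Definition is_shuffle n l (r : 'S_l) : Prop :=
  (forall j : 'I_l, j < n -> r j = j.+1 :> nat) /\
  (forall j : 'I_l, j = n :> nat -> r j = 0 :> nat).

(* A pairing X_n /\ Y_m -> Z_(n+m), indexed by all l with n + m = l in order to
   avoid transports in the associativity law. *)
Definition pairing (X Y Z : symseq) : Type :=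
  forall n m l, n + m = l -> forall k, X n k -> Y m k -> Z l k.

Definition is_pairing (X Y Z : symseq) (mu : pairing X Y Z) : Prop :=
  [/\ forall n m l (e : n + m = l) j k (f : hom j k) x y,
        mu n m l e j (act (X n) f x) (act (Y m) f y) = act (Z l) f (mu n m l e k x y),
      forall n m l (e : n + m = l) k y, mu n m l e k (basept X n k) y = basept Z l k,
      forall n m l (e : n + m = l) k x, mu n m l e k x (basept Y m k) = basept Z l k &
      forall n m l (e : n + m = l) (s : 'S_n) (t : 'S_m) (r : 'S_l),
        is_block_sum s t r -> forall k x y,
        mu n m l e k (sg X s k x) (sg Y t k y) = sg Z r k (mu n m l e k x y)].

(* The unit map S^1 -> R_1 is given by an edge [iota] which is a loop at the
   base point, S^1 being the quotient of the 1-simplex by its boundary. *)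
Record ring_spectrum : Type := RingSpectrum {
  rs :> symseq;
  mul : pairing rs rs rs;
  mulP : is_pairing mul;
  mulA : forall n m p nm mp l (e1 : n + m = nm) (e2 : nm + p = l)
    (e3 : m + p = mp) (e4 : n + mp = l) k x y z,
    mul e2 (mul e1 x y) z = mul (k := k) e4 x (mul e3 y z);
  one : rs 0 0;
  iota : rs 1 1;
  mul1 : forall n k (x : rs n k), mul (add0n n) (deg (rs 0) k one) x = x;
  mulr1 : forall n k (x : rs n k), mul (addn0 n) x (deg (rs 0) k one) = x;
  iota_src : src iota = bp rs 1;
  iota_tgt : tgt iota = bp rs 1;
  iota_central : forall n (r : 'S_n.+1), is_shuffle n r ->
    forall k (x : rs n k) (s : hom k 1),
    sg rs r k (mul (addn1 n) x (act (rs 1) s iota)) =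
    mul (add1n n) (act (rs 1) s iota) x }.

Record rmodule (R : ring_spectrum) : Type := RModule {
  md :> symseq;
  ract : pairing md R md;
  ractP : is_pairing ract;
  ractA : forall n m p nm mp l (e1 : n + m = nm) (e2 : nm + p = l)
    (e3 : m + p = mp) (e4 : n + mp = l) k x y z,
    ract e2 (ract e1 x y) z = ract (k := k) e4 x (mul e3 y z);
  ract1 : forall n k (x : md n k), ract (addn0 n) x (deg (R 0) k (one R)) = x }.

Definition regular_module (R : ring_spectrum) : rmodule R :=
  @RModule R R (@mul R) (mulP R) (@mulA R) (@mulr1 R).

Lemma deg_endpoint (X : sSet) (e : X 1) b k (x : X 0) :
  src e = x -> tgt e = x -> act X (hconst k (if b then ord_max else ord0 : 'I_2)) e = deg X k x.
Proof.
move=> h1 h2.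
have -> : hconst k (if b then ord_max else ord0 : 'I_2) =
    hcomp (hconst 0 (if b then ord_max else ord0 : 'I_2)) (hconst k ord0).
  exact: hom_eq.
rewrite act_comp /deg; congr (act X _ _).
by case: b.
Qed.

(* The adjoint M_n -> Omega M_(n+1) of the structure map M_n /\ S^1 -> M_(n+1),
   where Omega M_(n+1) is the space of loops at the base point. *)
Definition loops (X : symseq) n : sSet := map_space (bp X n) (bp X n).

Program Definition adjoint_structure (R : ring_spectrum) (M : rmodule R) n :
    smap (M n) (loops M n.+1) :=
  @SMap (M n) (loops M n.+1) (fun k x => exist _
    (@SMap (sprod (simplex k) (simplex 1)) (M n.+1) (fun j p =>
       ract (addn1 n) (act (M n) p.1 x) (act (R 1) p.2 (iota R))) _) _) _.
Next Obligation.
by have [nat_ _ _ _] := ractP M; rewrite -nat_ -!act_comp.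
Qed.
Next Obligation.
have [_ _ b_ _] := ractP M.
have E b : act (R 1) (hcomp (Delta1_end b) (hconst k ord0)) (iota R) = basept R 1 k.
  apply: etrans (deg_endpoint b k (iota_src R) (iota_tgt R)).
  by congr (act (R 1) _ _); apply: hom_eq.
by split; rewrite /= E b_.
Qed.
Next Obligation.
by apply: eq_exist; apply: smap_eq => j p /=; rewrite -act_comp.
Qed.

(* Fibrant objects of the stable model structure on symmetric spectra:
   Omega-spectra that are levelwise Kan complexes. *)
Definition stably_fibrant (R : ring_spectrum) (M : rmodule R) : Prop :=
  forall n, is_kan (M n) /\ is_equiv (adjoint_structure M n).

(* The simplicial set of R-linear maps from M to N. *)
Record linear_map (R : ring_spectrum) (M N : rmodule R) (k : nat) : Type := LinearMap {
  lmap :> forall n j, hom j k -> M n j -> N n j;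
  lmap_nat : forall n i j (f : hom i j) s x,
    lmap (hcomp s f) (act (M n) f x) = act (N n) f (lmap s x);
  lmap_base : forall n j s, lmap s (basept M n j) = basept N n j;
  lmap_sg : forall n j (t : 'S_n) (s : hom j k) x, lmap s (sg M t j x) = sg N t j (lmap s x);
  lmap_lin : forall n m l (e : n + m = l) j s x y,
    lmap s (ract (k := j) e x y) = ract e (lmap s x) y }.

Lemma linear_map_eq (R : ring_spectrum) (M N : rmodule R) k (f g : linear_map M N k) :
  (forall n j s x, f n j s x = g n j s x) -> f = g.
Proof.
case: f g => f f1 f2 f3 f4 [g g1 g2 g3 g4] /= e.
have E : f = g.
  apply: functional_extensionality_dep => n; apply: functional_extensionality_dep => j.
  by apply: funext => s; apply: funext.
by subst g; congr LinearMap; apply: Prop_irrelevance.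
Qed.

Program Definition linear_map_act (R : ring_spectrum) (M N : rmodule R) m k
    (f : hom m k) (g : linear_map M N k) : linear_map M N m :=
  @LinearMap R M N m (fun n j s x => g n j (hcomp f s) x) _ _ _ _.
Next Obligation. by rewrite -lmap_nat; congr (lmap g _ _); apply: hom_eq. Qed.
Next Obligation. exact: lmap_base. Qed.
Next Obligation. exact: lmap_sg. Qed.
Next Obligation. exact: lmap_lin. Qed.

Program Definition linear_maps (R : ring_spectrum) (M N : rmodule R) : sSet :=
  @SSet (linear_map M N) (@Simplicial (linear_map M N) (@linear_map_act R M N) _ _).
Next Obligation.
by apply: linear_map_eq => m j s y /=; congr (lmap x _ _); apply: hom_eq.
Qed.
Next Obligation.
by apply: linear_map_eq => i j s y /=; congr (lmap x _ _); apply: hom_eq.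
Qed.

Definition linear_at (R : ring_spectrum) (M N : rmodule R) (g : linear_maps M N 0)
  n j (x : M n j) : N n j := lmap g (hconst j ord0) x.

Program Definition linear_at_map (R : ring_spectrum) (M N : rmodule R)
    (g : linear_maps M N 0) n : smap (M n) (N n) :=
  @SMap (M n) (N n) (fun j x => linear_at g x) _.
Next Obligation.
by rewrite /linear_at -lmap_nat; congr (lmap g _ _); apply: hom_eq.
Qed.

(* Cofibrant objects: the left lifting property against the maps that are
   trivial Kan fibrations in each level. *)
Definition cofibrant (R : ring_spectrum) (M : rmodule R) : Prop :=
  forall (A B : rmodule R) (g : linear_maps A B 0),
    (forall n, trivial_kan_fibration (linear_at_map g n)) ->
    forall y : linear_maps M B 0, exists z : linear_maps M A 0,
      forall n j (x : M n j), linear_at g (linear_at z x) = linear_at y x.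

Record bifibrant_module (R : ring_spectrum) : Type := BifibrantModule {
  bm :> rmodule R;
  bm_fib : stably_fibrant bm;
  bm_cof : cofibrant bm }.

(* E_1-rings are modelled by symmetric ring spectra whose underlying symmetric
   spectrum is stably fibrant.  For such R the group pi_(-n) R is pi_0 (R_n). *)
Record connective_E1_ring : Type := ConnectiveE1Ring {
  er :> ring_spectrum;
  er_fib : stably_fibrant (regular_module er);
  er_conn : forall n (x : er n.+1 0), connected x (bp er n.+1) }.

(** * Simplicial categories and their homotopy coherent nerves *)

Record simplicial_cat : Type := SimplicialCat {
  ob :> Type;
  mor : ob -> ob -> sSet;
  mor_comp : forall A B C k, mor B C k -> mor A B k -> mor A C k;
  mor_comp_act : forall A B C j k (f : hom j k) (g : mor B C k) (h : mor A B k),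
    mor_comp (act (mor B C) f g) (act (mor A B) f h) = act (mor A C) f (mor_comp g h);
  idm : forall A, mor A A 0;
  comp1m : forall A B k (g : mor A B k), mor_comp (deg (mor B B) k (idm B)) g = g;
  compm1 : forall A B k (g : mor A B k), mor_comp g (deg (mor A A) k (idm A)) = g;
  compA : forall A B C D k (f : mor C D k) (g : mor B C k) (h : mor A B k),
    mor_comp f (mor_comp g h) = mor_comp (mor_comp f g) h }.

(* Simplicial functors to simplicial sets. *)
Record simplicial_functor (A : simplicial_cat) : Type := SimplicialFunctor {
  sfun :> A -> sSet;
  sact : forall a b k, mor a b k -> sfun a k -> sfun b k;
  sact_act : forall a b j k (f : hom j k) (g : mor a b k) (x : sfun a k),
    sact (act (mor a b) f g) (act (sfun a) f x) = act (sfun b) f (sact g x);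
  sact1 : forall a k (x : sfun a k), sact (deg (mor a a) k (idm a)) x = x;
  sactM : forall a b c k (g : mor b c k) (h : mor a b k) (x : sfun a k),
    sact (mor_comp g h) x = sact g (sact h x) }.

Arguments sact [A] U [a b k] g x : rename.

(* k-simplices of the nerve of the poset, ordered by reverse inclusion, of
   subsets of the interval [i, j] in {0, ..., m} that contain i and j.  There
   are none unless i <= j. *)
Definition chain m k (i j : 'I_m.+1) : Type :=
  {c : 'I_k.+1 -> {set 'I_m.+1} |
    (forall a b : 'I_k.+1, a <= b -> c b \subset c a) /\
    (forall a, [/\ i \in c a, j \in c a & forall v, v \in c a -> i <= v <= j])}.

(* The same for the subsets of {0, ..., j} that contain j. *)
Definition cone_chain m k (j : 'I_m.+1) : Type :=
  {c : 'I_k.+1 -> {set 'I_m.+1} |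
    (forall a b : 'I_k.+1, a <= b -> c b \subset c a) /\
    (forall a, j \in c a /\ forall v, v \in c a -> v <= j)}.

Program Definition chain_pre m k l (i j : 'I_m.+1) (f : hom l k)
    (c : chain k i j) : chain l i j := exist _ (fun a => sval c (f a)) _.
Next Obligation.
case: c => c [c1 c2] /=; split=> [a b ab|a]; last exact: c2.
by apply: c1; apply: (svalP f).
Qed.

Program Definition cone_pre m k l (j : 'I_m.+1) (f : hom l k)
    (c : cone_chain k j) : cone_chain l j := exist _ (fun a => sval c (f a)) _.
Next Obligation.
case: c => c [c1 c2] /=; split=> [a b ab|a]; last exact: c2.
by apply: c1; apply: (svalP f).
Qed.

Program Definition chain_img m n k (h : hom m n) (i j : 'I_m.+1)
    (c : chain k i j) : chain k (h i) (h j) :=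
  exist _ (fun a => happ h @: sval c a) _.
Next Obligation.
case: c => c [c1 c2] /=; split=> [a b ab|a]; first by apply: imsetS; apply: c1.
have [ci cj cv] := c2 a; split; [exact: imset_f|exact: imset_f|].
move=> v /imsetP[u /cv /andP[u1 u2] ->].
by apply/andP; split; apply: (svalP h).
Qed.

Program Definition cone_img m n k (h : hom m n) (j : 'I_m.+1)
    (c : cone_chain k j) : cone_chain k (h j) :=
  exist _ (fun a => happ h @: sval c a) _.
Next Obligation.
case: c => c [c1 c2] /=; split=> [a b ab|a]; first by apply: imsetS; apply: c1.
have [cj cv] := c2 a; split; first exact: imset_f.
by move=> v /imsetP[u /cv u1 ->]; apply: (svalP h).
Qed.

Program Definition chain_cup m k (i j l : 'I_m.+1)
    (c : chain k i j) (d : chain k j l) : chain k i l :=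
  exist _ (fun a => sval c a :|: sval d a) _.
Next Obligation.
case: c d => c [c1 c2] [d [d1 d2]] /=; split=> [a b ab|a].
  by apply: setUSS; [apply: c1|apply: d1].
have [ci cj cv] := c2 a; have [dj dl dv] := d2 a.
have /andP[ij _] := cv _ cj; have /andP[jl _] := dv _ dl.
split; rewrite ?inE ?ci ?dl ?orbT // => v; rewrite inE => /orP[/cv|/dv] /andP[h1 h2].
  by rewrite h1 (leq_trans h2).
by rewrite h2 (leq_trans ij h1).
Qed.

Program Definition cone_cup m k (i j : 'I_m.+1)
    (c : cone_chain k i) (d : chain k i j) : cone_chain k j :=
  exist _ (fun a => sval c a :|: sval d a) _.
Next Obligation.
case: c d => c [c1 c2] [d [d1 d2]] /=; split=> [a b ab|a].
  by apply: setUSS; [apply: c1|apply: d1].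
have [ci cv] := c2 a; have [di dj dv] := d2 a.
split; rewrite ?inE ?dj ?orbT // => v; rewrite inE => /orP[/cv h|/dv /andP[]//].
by apply: leq_trans h _; have /andP[] := dv _ dj.
Qed.

Lemma chain_eq m k (i j : 'I_m.+1) (c d : chain k i j) :
  (forall a, sval c a = sval d a) -> c = d.
Proof. by case: c d => c hc [d hd] /= e; apply: eq_exist; apply: funext. Qed.
Lemma cone_eq m k (j : 'I_m.+1) (c d : cone_chain k j) :
  (forall a, sval c a = sval d a) -> c = d.
Proof. by case: c d => c hc [d hd] /= e; apply: eq_exist; apply: funext. Qed.

(* An m-simplex of the homotopy coherent nerve of A: a simplicial functor to A
   from the simplicial category on {0, ..., m} whose mapping objects are the
   nerves of the posets above, with composition given by union. *)
Definition hc_law (A : simplicial_cat) m (o : 'I_m.+1 -> A)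
    (mp : forall i j k, chain k i j -> mor (o i) (o j) k) : Prop :=
  [/\ forall i j k l (f : hom l k) (c : chain k i j),
        mp i j l (chain_pre f c) = act (mor (o i) (o j)) f (mp i j k c),
      forall i k (c : chain k i i), mp i i k c = deg (mor (o i) (o i)) k (idm (o i)) &
      forall i j l k (c : chain k i j) (d : chain k j l),
        mp i l k (chain_cup c d) = mor_comp (mp j l k d) (mp i j k c)].

Record hc_simplex (A : simplicial_cat) (m : nat) : Type := HcSimplex {
  hob : 'I_m.+1 -> A;
  hmp : forall i j k, chain k i j -> mor (hob i) (hob j) k;
  hmpP : hc_law hmp }.

(* An m-simplex of the left fibration over the nerve of A classified by U: a
   simplex of the nerve with an extension of the resulting simplicial functor to
   simplicial sets to the cone {-1, 0, ..., m}, sending -1 to a point. *)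
Definition el_law (A : simplicial_cat) (U : simplicial_functor A) m
    (b : hc_simplex A m) (x : forall j k, cone_chain k j -> U (hob b j) k) : Prop :=
  (forall j k l (f : hom l k) (c : cone_chain k j),
     x j l (cone_pre f c) = act (U (hob b j)) f (x j k c)) /\
  (forall i j k (c : cone_chain k i) (d : chain k i j),
     x j k (cone_cup c d) = sact U (hmp b d) (x i k c)).

Record el_simplex (A : simplicial_cat) (U : simplicial_functor A) (m : nat) : Type :=
  ElSimplex {
    el_base : hc_simplex A m;
    el_fun : forall j k, cone_chain k j -> U (hob el_base j) k;
    el_funP : el_law el_fun }.

Lemma hc_simplex_eq (A : simplicial_cat) m (o : 'I_m.+1 -> A) mp mp' P P' :
  (forall i j k c, mp i j k c = mp' i j k c) ->
  @HcSimplex A m o mp P = @HcSimplex A m o mp' P'.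
Proof.
move=> e; have E : mp = mp'.
  apply: functional_extensionality_dep => i; apply: functional_extensionality_dep => j.
  by apply: functional_extensionality_dep => k; apply: funext.
by subst mp'; congr HcSimplex; apply: Prop_irrelevance.
Qed.

Lemma el_simplex_eq (A : simplicial_cat) (U : simplicial_functor A) m
    (o : 'I_m.+1 -> A) mp mp' P P' x x' Q Q' :
  (forall i j k c, mp i j k c = mp' i j k c) ->
  (forall j k c, x j k c = x' j k c) ->
  @ElSimplex A U m (@HcSimplex A m o mp P) x Q =
  @ElSimplex A U m (@HcSimplex A m o mp' P') x' Q'.
Proof.
move=> e e'; have E : mp = mp'.
  apply: functional_extensionality_dep => i; apply: functional_extensionality_dep => j.
  by apply: functional_extensionality_dep => k; apply: funext.
subst mp'; have E : x = x'.
  apply: functional_extensionality_dep => j.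
  by apply: functional_extensionality_dep => k; apply: funext.
have EP : P = P' by apply: Prop_irrelevance.
by subst x' P'; congr ElSimplex; apply: Prop_irrelevance.
Qed.

Program Definition hc_act (A : simplicial_cat) m n (h : hom m n)
    (s : hc_simplex A n) : hc_simplex A m :=
  @HcSimplex A m (fun i => hob s (h i)) (fun i j k c => hmp s (chain_img h c)) _.
Next Obligation.
have [p1 p2 p3] := hmpP s; split=> [i j k l f c|i k c|i j l k c d].
- by rewrite -p1; congr (hmp s _); apply: chain_eq.
- exact: p2.
- by rewrite -p3; congr (hmp s _); apply: chain_eq => a; apply: imsetU.
Qed.

Program Definition el_act (A : simplicial_cat) (U : simplicial_functor A) m n
    (h : hom m n) (s : el_simplex U n) : el_simplex U m :=
  @ElSimplex A U m (hc_act h (el_base s)) (fun j k c => el_fun s (cone_img h c)) _.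
Next Obligation.
have [p1 p2] := el_funP s; split=> [j k l f c|i j k c d].
- by rewrite -p1; congr (el_fun s _); apply: cone_eq.
- by rewrite -p2; congr (el_fun s _); apply: cone_eq => a; apply: imsetU.
Qed.

Lemma imset_hid n (S : {set 'I_n.+1}) : happ (hid n) @: S = S.
Proof. exact: imset_id. Qed.
Lemma imset_hcomp l m n (g : hom m n) (f : hom l m) (S : {set 'I_l.+1}) :
  happ (hcomp g f) @: S = happ g @: (happ f @: S).
Proof. exact: imset_comp. Qed.

Program Definition hc_nerve (A : simplicial_cat) : sSet :=
  @SSet (hc_simplex A) (@Simplicial (hc_simplex A) (@hc_act A) _ _).
Next Obligation.
case: x => o mp P; apply: hc_simplex_eq => i j k c /=.
by congr (mp _ _ _ _); apply: chain_eq => a; apply: imset_hid.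
Qed.
Next Obligation.
case: x => o mp P; apply: hc_simplex_eq => i j k c /=.
by congr (mp _ _ _ _); apply: chain_eq => a; apply: imset_hcomp.
Qed.

Program Definition elements (A : simplicial_cat) (U : simplicial_functor A) : sSet :=
  @SSet (el_simplex U) (@Simplicial (el_simplex U) (@el_act A U) _ _).
Next Obligation.
case: x => -[o mp P] x Q; apply: el_simplex_eq => [i j k c|j k c] /=.
  by congr (mp _ _ _ _); apply: chain_eq => a; apply: imset_hid.
by congr (x _ _ _); apply: cone_eq => a; apply: imset_hid.
Qed.
Next Obligation.
case: x => -[o mp P] x Q; apply: el_simplex_eq => [i j k c|j k c] /=.
  by congr (mp _ _ _ _); apply: chain_eq => a; apply: imset_hcomp.
by congr (x _ _ _); apply: cone_eq => a; apply: imset_hcomp.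
Qed.

Definition el_proj (A : simplicial_cat) (U : simplicial_functor A) :
    smap (elements U) (hc_nerve A) :=
  @SMap (elements U) (hc_nerve A) (fun _ x => el_base x) (fun _ _ _ _ => erefl).

(** * The infinity-category of R-modules *)

Program Definition linear_comp (R : ring_spectrum) (L M N : rmodule R) k
    (g : linear_map M N k) (f : linear_map L M k) : linear_map L N k :=
  @LinearMap R L N k (fun n j s x => g n j s (f n j s x)) _ _ _ _.
Next Obligation. by rewrite !lmap_nat. Qed.
Next Obligation. by rewrite !lmap_base. Qed.
Next Obligation. by rewrite !lmap_sg. Qed.
Next Obligation. by rewrite !lmap_lin. Qed.

Definition linear_id (R : ring_spectrum) (M : rmodule R) : linear_map M M 0 :=
  @LinearMap R M M 0 (fun _ _ _ x => x) (fun _ _ _ _ _ _ => erefl)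
    (fun _ _ _ => erefl) (fun _ _ _ _ _ => erefl) (fun _ _ _ _ _ _ _ _ => erefl).

Program Definition module_cat (R : ring_spectrum) : simplicial_cat :=
  @SimplicialCat (bifibrant_module R) (fun M N => linear_maps M N)
    (fun L M N k g f => linear_comp g f) _ (fun M => linear_id M) _ _ _.
Next Obligation. exact: linear_map_eq. Qed.
Next Obligation. exact: linear_map_eq. Qed.
Next Obligation. exact: linear_map_eq. Qed.
Next Obligation. exact: linear_map_eq. Qed.

(* The infinity-category underlying the stable simplicial model category of right
   R-modules: the homotopy coherent nerve of its bifibrant objects. *)
Definition RMod (R : ring_spectrum) : sSet := hc_nerve (module_cat R).

(* Omega^infty Sigma^n of an Omega-spectrum is its n-th level. *)
Program Definition Omega_Sigma (R : ring_spectrum) (n : nat) :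
    simplicial_functor (module_cat R) :=
  @SimplicialFunctor (module_cat R) (fun M => bm M n : sSet)
    (fun M N k g x => lmap g (hid k) x) _ _ _.
Next Obligation.
by rewrite -lmap_nat; congr (lmap g _ _); apply: hom_eq.
Qed.
Next Obligation. by []. Qed.
Next Obligation. by []. Qed.

(** * Natural systems and the categories D^n *)

Definition natural_system (R : ring_spectrum) (C : sSet) : Type := smap (Tw C) (RMod R).

Definition ns_value (R : ring_spectrum) (C : sSet) (D : natural_system R C)
  (phi : Tw C 0) : bifibrant_module R := hob (D 0 phi) ord0.

(* The left fibration over Tw(C) classified by Omega^infty Sigma^n D. *)
Definition total (R : ring_spectrum) (C : sSet) (D : natural_system R C) (n : nat) : sSet :=
  pullback D (el_proj (Omega_Sigma R n)).
Definition total_proj (R : ring_spectrum) (C : sSet) (D : natural_system R C) n :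
  smap (total D n) (Tw C) := pb_fst D (el_proj (Omega_Sigma R n)).

Definition value_space (R : ring_spectrum) (C : sSet) (D : natural_system R C)
  (n : nat) (phi : Tw C 0) : sSet := ns_value D phi n.

Definition value_zero (R : ring_spectrum) (C : sSet) (D : natural_system R C)
  (n : nat) (phi : Tw C 0) : value_space D n phi 0 := bp (ns_value D phi) n.

(* pi_(-n) of an Omega-spectrum. *)
Definition pi_neg (R : ring_spectrum) (M : bifibrant_module R) (n : nat) : Type :=
  pi0 (M n).
Definition pi_neg0 (R : ring_spectrum) (M : bifibrant_module R) (n : nat) : pi_neg M n :=
  component (bp M n).

(* The infinity-category D^n over C corresponding to the natural system D, given
   by its universal property in (Cat_infty)_{/C}: functors K -> D^n over C are
   sections of Omega^infty Sigma^n D over Tw(K),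
     map_{/C}(K, D^n) = lim_{Tw(K)} Omega^infty Sigma^n D.
   Thus an m-simplex consists of an m-simplex sigma of C and a lift to the total
   space of the composite of Tw(sigma) : Tw(Delta^m) -> Tw(C).  For K a point
   this gives Omega^infty Sigma^n D(id) as the fibres of the underlying groupoid,
   and for K = Delta^1 the mapping spaces
     map_{D^(n+1)}(0 Gamma, 0 Lambda)_phi = Omega^infty Sigma^n D(phi). *)
Lemma Dcat_closed (R : ring_spectrum) (C : sSet) (D : natural_system R C) n m k
    (h : hom m k) (c : C k) (s : smap (Tw (simplex k)) (total D n)) :
  (forall j (theta : hom j.*2.+1 k), total_proj D n j (s j theta) = act C theta c) ->
  forall j (theta : hom j.*2.+1 m),
    total_proj D n j (scomp s (Tw_map (simplex_map h)) j theta) =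
    act C theta (act C h c).
Proof. by move=> H j theta; rewrite -act_comp -H. Qed.

Definition Dsimplex (R : ring_spectrum) (C : sSet) (D : natural_system R C)
    (n m : nat) : Type :=
  {p : C m * smap (Tw (simplex m)) (total D n) |
    forall j (theta : hom j.*2.+1 m),
      total_proj D n j (p.2 j theta) = act C theta p.1}.

Definition Dact (R : ring_spectrum) (C : sSet) (D : natural_system R C) n m k
    (h : hom m k) (p : Dsimplex D n k) : Dsimplex D n m :=
  exist _ (act C h (sval p).1, scomp (sval p).2 (Tw_map (simplex_map h)))
    (Dcat_closed h (svalP p)).

Program Definition Dcat (R : ring_spectrum) (C : sSet) (D : natural_system R C)
    (n : nat) : sSet :=
  @SSet (Dsimplex D n) (@Simplicial (Dsimplex D n) (@Dact R C D n) _ _).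
Next Obligation.
case: x => -[c s] H; apply: eq_exist; congr (_, _); first exact: act_id.
by apply: smap_eq => j theta /=; congr (smap_fun s _ _); apply: hom_eq.
Qed.
Next Obligation.
case: x => -[c s] H; apply: eq_exist; congr (_, _); first exact: act_comp.
by apply: smap_eq => j theta /=; congr (smap_fun s _ _); apply: hom_eq.
Qed.

Definition Dproj (R : ring_spectrum) (C : sSet) (D : natural_system R C) n :
    smap (Dcat D n) C :=
  @SMap (Dcat D n) C (fun _ p => (sval p).1) (fun _ _ _ _ => erefl).

(* The zero section. *)
Program Definition zero_element (R : ring_spectrum) n m
    (b : hc_simplex (module_cat R) m) : el_simplex (Omega_Sigma R n) m :=
  @ElSimplex _ (Omega_Sigma R n) m b
    (fun j k c => basept (hob b j : bifibrant_module R) n k) _.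
Next Obligation.
split=> [j k l f c|i j k c d].
  by symmetry; exact: (@act_deg (bm (hob b j) n)).
by symmetry; exact: (lmap_base (hmp b d)).
Qed.

Lemma zero_element_act (R : ring_spectrum) n m k (f : hom m k)
    (b : hc_simplex (module_cat R) k) :
  zero_element n (hc_act f b) = el_act f (zero_element n b).
Proof. by case: b => o mp P; apply: el_simplex_eq. Qed.

Program Definition total_zero (R : ring_spectrum) (C : sSet)
    (D : natural_system R C) n : smap (Tw C) (total D n) :=
  @SMap (Tw C) (total D n) (fun m x => exist _ (x, zero_element n (D m x)) _) _.
Next Obligation. by []. Qed.
Next Obligation.
by apply: eq_exist; congr (_, _); rewrite smapE zero_element_act.
Qed.

Lemma Dzero_proof (R : ring_spectrum) (C : sSet) (D : natural_system R C) n m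
    (c : C m) (s : smap (Tw (simplex m)) (Tw C)) :
  (forall j (theta : hom j.*2.+1 m), s j theta = act C theta c :> C _) ->
  forall j (theta : hom j.*2.+1 m),
    total_proj D n j (scomp (total_zero D n) s j theta) = act C theta c.
Proof. by move=> H j theta; rewrite -H. Qed.

(* The map Delta^m -> C corresponding to a simplex. *)
Definition classify (C : sSet) m (c : C m) : smap (simplex m) C :=
  @SMap (simplex m) C (fun _ x => act C x c) (fun _ _ f x => act_comp x f c).

Program Definition Dzero (R : ring_spectrum) (C : sSet) (D : natural_system R C) n :
    smap C (Dcat D n) :=
  @SMap C (Dcat D n) (fun m c =>
    exist _ (c, scomp (total_zero D n) (Tw_map (classify c))) _) _.
Next Obligation. by []. Qed.
Next Obligation.
apply: eq_exist; congr (_, _); apply: smap_eq => j theta.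
rewrite [LHS]/= [RHS]/=; congr (smap_fun (total_zero D n) j _).
by rewrite -act_comp.
Qed.

(** * The spaces (Omega^infty Sigma^n D(id))_hAut and Omega^infty Sigma^n D(id) as
    parts of D^n *)

(* The homotopy orbits are the colimit over BAut(Lambda) of the functor
   Omega^infty Sigma^n D(id_(-)), that is, the total space of the left fibration
   it classifies.  The functor id : BAut(Lambda) -> Tw(C) is modelled by
   Tw(BAut(Lambda)) -> Tw(C), using the equivalence Tw_tgt from Tw(BAut(Lambda))
   to BAut(Lambda). *)
Definition homotopy_orbits (R : ring_spectrum) (C : sSet) (D : natural_system R C)
    (n : nat) (Lambda : C 0) : sSet :=
  pullback (total_proj D n) (Tw_map (BAut_incl Lambda)).

(* The part of the underlying groupoid of D^n that lies over BAut(Lambda). *)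
Definition Dcore (R : ring_spectrum) (C : sSet) (D : natural_system R C)
    (n : nat) (Lambda : C 0) : sSet := over (Dproj D n) Lambda.

Definition Dcore_proj (R : ring_spectrum) (C : sSet) (D : natural_system R C)
    (n : nat) (Lambda : C 0) : smap (Dcore D n Lambda) (BAut Lambda) :=
  over_map (f := Dproj D n) (f' := sid C) (h := Dproj D n) (fun _ => erefl) Lambda.

Definition Dcore_zero (R : ring_spectrum) (C : sSet) (D : natural_system R C)
    (n : nat) (Lambda : C 0) : smap (BAut Lambda) (Dcore D n Lambda) :=
  over_map (f := sid C) (f' := Dproj D n) (h := Dzero D n) (fun _ => erefl) Lambda.

(* Evaluation of sections over twisted arrow categories.  As Tw_tgt is an
   equivalence on the Kan complex Dcore, this determines, up to homotopy, the
   identification of Dcore with the homotopy orbits. *)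
Program Definition Dcore_eval (R : ring_spectrum) (C : sSet)
    (D : natural_system R C) (n : nat) (Lambda : C 0) :
    smap (Tw (Dcore D n Lambda)) (homotopy_orbits D n Lambda) :=
  @SMap (Tw (Dcore D n Lambda)) (homotopy_orbits D n Lambda) (fun m x =>
    exist _ ((sval (sval x)).2 m (hid m.*2.+1),
             Tw_map (Dcore_proj D n Lambda) m x) _) _.
Next Obligation.
by case: x => -[[c s] H] K; rewrite [LHS]H /= act_id.
Qed.
Next Obligation.
apply: eq_exist; congr (_, _); last exact: (smapE (Tw_map (Dcore_proj D n Lambda)) f x).
case: x => -[[c s] H] K /=; rewrite -smapE; congr (smap_fun s _ _).
exact: hom_eq.
Qed.

(* The simplex of the total space over the degenerate simplex on b given by
   a simplex y of the fibre over b. *)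
Definition min_fun m k (j : 'I_m.+1) (c : cone_chain k j) (a : 'I_k.+1) : 'I_m.+1 :=
  [arg min_(v < j in sval c a) v].

Lemma min_funP m k (j : 'I_m.+1) (c : cone_chain k j) (a : 'I_k.+1) :
  min_fun c a \in sval c a /\ forall v, v \in sval c a -> min_fun c a <= v.
Proof.
rewrite /min_fun; case: arg_minnP => [|i ic imin]; last by split.
by case: c => c [c1 c2] /=; case: (c2 a).
Qed.

Lemma min_fun_unique m k (j : 'I_m.+1) (c : cone_chain k j) (a : 'I_k.+1) w :
  w \in sval c a -> (forall v, v \in sval c a -> w <= v) -> min_fun c a = w.
Proof.
move=> h1 h2; have [h3 h4] := min_funP c a.
by apply: val_inj; apply/eqP; rewrite eqn_leq h4 // h2.
Qed.

Lemma min_mono m k (j : 'I_m.+1) (c : cone_chain k j) (a b : 'I_k.+1) :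
  a <= b -> min_fun c a <= min_fun c b.
Proof.
move=> ab; have [_ h] := min_funP c a; apply: h.
have [h _] := min_funP c b; case: c h => c [c1 c2] h.
exact: (subsetP (c1 _ _ ab)).
Qed.

Definition min_hom m k (j : 'I_m.+1) (c : cone_chain k j) : hom k m :=
  mk_hom (@min_mono m k j c).

Program Definition fibre_element (A : simplicial_cat) (U : simplicial_functor A)
    (b : hc_simplex A 0) m (y : U (hob b ord0) m) : el_simplex U m :=
  @ElSimplex A U m (hc_act (hconst m ord0) b)
    (fun j k c => act (U (hob b ord0)) (min_hom c) y) _.
Next Obligation.
split=> [j k l f c|i j k c d].
  by rewrite -act_comp; congr (act _ _ y); apply: hom_eq.
rewrite /=; have [_ p _] := hmpP b; rewrite (p ord0 k) sact1.
congr (act _ _ y); apply: hom_eq => a; apply: min_fun_unique => /=.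
  by rewrite inE (min_funP c a).1.
move=> v; rewrite inE => /orP[|vd]; first by move/(min_funP c a).2.
case: d vd => d [d1 d2] /= vd; have [ci _ dv] := d2 a.
have /andP[iv _] := dv _ vd; apply: leq_trans iv.
by apply: (min_funP c a).2; case: (c) => cc [c1 c2] /=; case: (c2 a).
Qed.

Lemma fibre_element_act (A : simplicial_cat) (U : simplicial_functor A)
    (b : hc_simplex A 0) m n (f : hom m n) (y : U (hob b ord0) n) :
  fibre_element (act (U (hob b ord0)) f y) = el_act f (fibre_element y).
Proof.
case: b y => o mp P y; apply: el_simplex_eq => [i j k c|j k c] /=.
  congr (mp _ _ _ _); apply: chain_eq => a /=; apply/setP => v.
  apply/imsetP/imsetP => -[w ws ->]; first by exists (f w); rewrite ?imset_f.
  by have /imsetP[u uc _] := ws; exists u.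
rewrite -act_comp; congr (act _ _ y); apply: hom_eq => a /=.
symmetry; apply: min_fun_unique => /=.
  by apply: imset_f; exact: (min_funP c a).1.
by move=> v /imsetP[u uc ->]; apply: (svalP f); exact: (min_funP c a).2.
Qed.

Program Definition total_fibre (R : ring_spectrum) (C : sSet)
    (D : natural_system R C) n (Lambda : C 0) m
    (y : value_space D n (tw_id Lambda) m) : total D n m :=
  exist _ (deg C m.*2.+1 Lambda,
           @fibre_element _ (Omega_Sigma R n) (D 0 (tw_id Lambda)) m y) _.
Next Obligation.
have e : deg C m.*2.+1 Lambda = act (Tw C) (hconst m ord0) (tw_id Lambda).
  by symmetry; exact: act_deg.
by rewrite [in LHS]e smapE.
Qed.

(* The canonical map from Omega^infty Sigma^n D(id_Lambda) to the fibre of D^n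
   over Lambda, which is an equivalence; a simplex y is sent to the section over
   Tw(Delta^m) pulled back from y along the target projection. *)
Program Definition fibre_section (R : ring_spectrum) (C : sSet)
    (D : natural_system R C) n (Lambda : C 0) m
    (y : value_space D n (tw_id Lambda) m) : Dcat D n m :=
  exist _ (deg C m Lambda,
    @SMap (Tw (simplex m)) (total D n) (fun j theta =>
      total_fibre (act (value_space D n (tw_id Lambda))
                     (Tw_tgt (simplex m) j theta) y)) _) _.
Next Obligation.
have e : Tw_tgt (simplex m) m0 (act (Tw (simplex m)) f x) =
  hcomp (Tw_tgt (simplex m) n0 x) f by exact: (smapE (Tw_tgt (simplex m)) f x).
transitivity (total_fibre (act (value_space D n (tw_id Lambda))
  (hcomp (Tw_tgt (simplex m) n0 x) f) y)); first by rewrite -e.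
rewrite act_comp.
apply: eq_exist; congr (_, _); last exact: fibre_element_act.
by symmetry; exact: act_deg.
Qed.
Next Obligation. by symmetry; exact: act_deg. Qed.

Program Definition constant_path (X : sSet) : smap X (path_space X) :=
  @SMap X (path_space X) (fun m x =>
    @SMap (sprod (simplex m) J) X (fun j p => act X p.1 x) _) _.
Next Obligation. by rewrite -act_comp. Qed.
Next Obligation. by apply: smap_eq => j p /=; rewrite -act_comp. Qed.

Definition hfibre (X Y : sSet) (f : smap X Y) (y : Y 0) : sSet :=
  hpullback f (at_vertex y).

Program Definition fibre_map (R : ring_spectrum) (C : sSet)
    (D : natural_system R C) n (Lambda : C 0) :
    smap (value_space D n (tw_id Lambda)) (hfibre (Dproj D n) Lambda) :=
  @SMap (value_space D n (tw_id Lambda)) (hfibre (Dproj D n) Lambda) (fun m y =>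
    exist _ ((fibre_section y, tt), constant_path C m (deg C m Lambda)) _) _.
Next Obligation. by rewrite /= !act_deg. Qed.
Next Obligation.
apply: eq_exist; congr (_, _); last first.
  by apply: smap_eq => j u /=; rewrite !act_deg.
congr (_, _); apply: eq_exist; congr (_, _); first by symmetry; exact: act_deg.
apply: smap_eq => j theta /=; congr total_fibre.
by rewrite -(act_comp (X := value_space D n (tw_id Lambda))); congr (act _ _ x); apply: hom_eq.
Qed.

(** * Linear extensions *)

(* A linear extension f : E -> B of p : B -> C by D.  The square has edges
   t = sq_top : E -> C, f, the zero section and k.  As D^2 is the final vertex of
   the square, the only further datum making it a square over C is the
   equivalence le_over of q k with p. *)
Record linear_extension (R : ring_spectrum) (C B E : sSet) (D : natural_system R C)
    (p : smap B C) (f : smap E B) : Type := LinearExtension {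
  le_k : smap B (Dcat D 2);
  le_over : smap B (path_space C);
  le_over_start : forall n b, path_start C n (le_over n b) = Dproj D 2 n (le_k n b);
  le_over_end : forall n b, path_end C n (le_over n b) = p n b;
  le_square : square E (Dzero D 2) le_k;
  le_left : forall n e, sq_left le_square n e = f n e;
  le_cartesian : cartesian le_square }.

(* k(X) as a point of the fibre of D^2 over p X. *)
Program Definition obstruction_point (R : ring_spectrum) (C B E : sSet)
    (D : natural_system R C) (p : smap B C) (f : smap E B)
    (L : linear_extension D p f) (X : B 0) : hfibre (Dproj D 2) (p 0 X) 0 :=
  exist _ ((le_k L 0 X, tt), le_over L 0 X) _.
Next Obligation.
have e1 := le_over_start L X; have e2 := le_over_end L X.
rewrite [RHS]/= in e1 e2 *; congr (_, _); first exact: esym e1.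
apply: etrans (esym e2); rewrite -[RHS]act_id /deg.
by congr (act C _ _); apply: hom_eq => i; rewrite !ord1.
Qed.

(* map_{D^(n)}(0 Lambda, 0 Lambda)_id *)
Definition zero_maps_over_id (R : ring_spectrum) (C : sSet)
    (D : natural_system R C) n (Lambda : C 0) : sSet :=
  hfibre (map_space_map (Dproj D n) (Dzero D n 0 Lambda) (Dzero D n 0 Lambda))
         (map_id Lambda).

(* Main.v *)
From mathcomp Require Import classical_sets.
From mathcomp Require Import all_boot fingroup perm boolp zify.
Require Import Defs.
From mathcomp Require Import ssreflect ssrfun ssrbool.

(* The part of D^n over the maximal Kan complex BAut(Lambda) of C is a Kan complex
   Z, fibred over BAut(Lambda) by a left fibration whose sections are those of the
   left fibration classified by D over Tw(BAut(Lambda)).  As the target projection of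
   Tw(BAut(Lambda)) is a trivial fibration, evaluating sections identifies Z with the
   homotopy orbits and the fibre of Z over Lambda with Omega^infty Sigma^n D(id).
   A simplex of the homotopy pullback defining E lies over BAut(X) precisely when all
   of its components are in these Kan complexes, because a path of equivalences
   cannot leave a maximal Kan subcomplex; hence Lifts0 is the pullback of Z along the
   zero section and k.  Lifts1 is its fibre over X, and dragging a path in Z along its
   projection to BAut(Lambda) moves it into the fibre over Lambda. *)

Set Implicit Arguments.
Unset Strict Implicit.
Unset Printing Implicit Defensive.
#[local] Obligation Tactic := intros; simpl.

Arguments act X [m n] f x : simpl never.
Arguments deg X k x : clear implicits.

(** * Partial simplicial maps *)

(** Equivalences are defined by maps out of [J], while fibrancy is given by horns. The bridge is
    [ELP], lifting against pushout products with all monomorphisms, which passes formally through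
    composites, pullbacks, powers and path objects. Combinatorics enters in three places. That the
    core of a quasi-category is Kan rests on Joyal's special outer horns. That [el_proj] is a left
    fibration reduces to one extension problem over a cube of subsets. The target projection of
    [Tw], and the identification of a fibre of [elements] with a value of the functor, both become
    restriction maps between spaces of maps out of cosimplicial simplicial sets, settled by a single
    Reedy induction. As D^n is given by sections over [Tw], a lifting problem against it is
    transposed to one for the left fibration of elements, over [Tw] of the source. Data prescribed
    on a subobject is a relation, [pmap], and not a map out of a [subsset], so that data on a union
    of subobjects is a disjunction and needs no transport along membership proofs. *)

Definition pmap (B X : sSet) : Type := forall n, B n -> X n -> Prop.

Section Pmaps.
Variables B X : sSet.
Implicit Types R S : pmap B X.

Definition is_pmap R : Prop :=
  (forall n b x x', R n b x -> R n b x' -> x = x') /\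
  (forall m n (f : hom m n) b x, R n b x -> R m (act B f b) (act X f x)).

Definition dom R n (b : B n) : Prop := exists x, R n b x.

Definition extends R (w : smap B X) : Prop := forall n b x, R n b x -> w n b = x.

Definition pover (Y : sSet) (p : smap X Y) (v : smap B Y) R : Prop :=
  forall n b x, R n b x -> p n x = v n b.

Definition empty_pmap : pmap B X := fun _ _ _ => False.
Lemma empty_is_pmap : is_pmap empty_pmap.
Proof. by split. Qed.

Definition punion R S : pmap B X := fun n b x => R n b x \/ S n b x.
Lemma punion_is_pmap R S : is_pmap R -> is_pmap S ->
  (forall n b x y, R n b x -> S n b y -> x = y) -> is_pmap (punion R S).
Proof.
move=> [R1 R2] [S1 S2] H; split=> [n b x x'|m n f b x].
  by case=> h1 [] h2; [apply: R1 h1 h2|apply: H h1 h2|symmetry; apply: H h2 h1|apply: S1 h1 h2].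
by case=> h; [left; apply: R2|right; apply: S2].
Qed.

Definition on (P : forall n, B n -> Prop) (g : smap B X) : pmap B X :=
  fun n b x => P n b /\ x = g n b.
Lemma on_is_pmap P (g : smap B X) : subclosed P -> is_pmap (on P g).
Proof.
move=> HP; split=> [n b x x' [_ ->] [_ ->] //|m n f b x [Pb ->]].
by split; [apply: HP|rewrite smapE].
Qed.

Lemma dom_act R m n (f : hom m n) b : is_pmap R -> dom R b -> dom R (act B f b).
Proof. by move=> [_ R2] [x Rx]; exists (act X f x); apply: R2. Qed.

Lemma total_pmap R : is_pmap R -> (forall n b, @dom R n b) ->
  exists w : smap B X, forall n b, R n b (w n b).
Proof.
move=> [R1 R2] T.
pose w n b := projT1 (cid (T n b)).
have wP n b : R n b (w n b) by rewrite /w; case: cid.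
have wN m n (f : hom m n) b : w m (act B f b) = act X f (w n b).
  by apply: R1 (wP _ _) _; apply: R2.
by exists (SMap wN).
Qed.

End Pmaps.

(** * Extension of partial maps along cells *)

Definition hsurj m n (f : hom m n) : Prop := forall j, exists i, f i = j.

Lemma hcompA k l m n (h : hom m n) (g : hom l m) (f : hom k l) :
  hcomp h (hcomp g f) = hcomp (hcomp h g) f.
Proof. exact: hom_eq. Qed.
Lemma hcomp1 m n (f : hom m n) : hcomp f (hid m) = f.
Proof. exact: hom_eq. Qed.
Lemma hcomp1l m n (f : hom m n) : hcomp (hid n) f = f.
Proof. exact: hom_eq. Qed.

Lemma lift_mono n (j : 'I_n.+2) (a b : 'I_n.+1) : a <= b -> lift j a <= lift j b.
Proof. by rewrite /= leq_bump2. Qed.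
Definition delta n (j : 'I_n.+2) : hom n n.+1 := mk_hom (@lift_mono n j).

Lemma delta_factor m n (j : 'I_n.+2) (f : hom m n.+1) :
  (forall i, f i <> j) -> exists g : hom m n, f = hcomp (delta j) g.
Proof.
move=> H.
have E i : {k | f i = lift j k}.
  case: (unliftP j (f i)) => [k ->|/H //]; by exists k.
pose g i := sval (E i).
have gP i : f i = lift j (g i) by rewrite /g; case: (E i).
have gm (a b : 'I_m.+1) : a <= b -> g a <= g b.
  by move=> ab; have := svalP f _ _ ab; rewrite -!/(happ f _) !gP /= leq_bump2.
by exists (mk_hom gm); apply: hom_eq => i; rewrite gP.
Qed.

Lemma hnsurj m n (f : hom m n) : ~ hsurj f -> exists j, forall i, f i <> j.
Proof.
by move=> H; apply: contrapT => H'; apply: H => j; apply: contrapT => Hj; apply: H';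
  exists j => i e; apply: Hj; exists i.
Qed.

(** The freedom to let the section pass through a given i is what separates two surjections in
    [cell_ext]. *)
Lemma hsection m n (f : hom m n) (i : 'I_m.+1) : hsurj f ->
  exists d : hom n m, hcomp f d = hid n /\ d (f i) = i.
Proof.
move=> H.
have E j : {k | f k = j /\ (j = f i -> k = i)}.
  apply: cid; case: (pselect (j = f i)) => [->|ne]; first by exists i.
  by have [k e] := H j; exists k; split.
pose d j := sval (E j).
have dP j : f (d j) = j /\ (j = f i -> d j = i) by rewrite /d; case: (E j).
have dm (a b : 'I_n.+1) : a <= b -> d a <= d b.
  move=> ab; rewrite leqNgt; apply/negP => dba.
  have := svalP f _ _ (ltnW dba); rewrite -!/(happ f _) (dP a).1 (dP b).1 => ba.
  have e : a = b by apply/val_inj/eqP; rewrite /= eqn_leq ab ba.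
  by rewrite e ltnn in dba.
exists (mk_hom dm); split; first by apply: hom_eq => j; exact: (dP j).1.
exact: (dP (f i)).2.
Qed.

(** Surjectivity forces injectivity by counting, so f is strictly increasing; [lb] then climbs from
    0 and [ub] descends from n. *)
Lemma mono_endo_id n (f : hom n n) : hsurj f -> f = hid n.
Proof.
move=> H.
have inj : injective f.
  have cod : codom f =i 'I_n.+1.
    by move=> j; rewrite inE; apply/codomP; have [i <-] := H j; exists i.
  have /image_injP inj : #|codom f| == #|'I_n.+1| by apply/eqP/eq_card.
  by move=> x y; apply: inj.
have lb (k : nat) : forall i : 'I_n.+1, i = k :> nat -> k <= f i.
  elim: k => [|k IH] i e //.
  have hk : k < n.+1 by rewrite ltnW // -e.
  have h := IH (Ordinal hk) erefl.
  have h2 : f (Ordinal hk) <= f i by apply: (svalP f); rewrite /= e.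
  have h3 : f (Ordinal hk) != f i :> nat.
    by apply/eqP => /val_inj/inj/(congr1 val) /=; rewrite e; lia.
  by rewrite (leq_ltn_trans h) // ltn_neqAle h3.
have ub (k : nat) : forall i : 'I_n.+1, n - i = k -> f i <= i.
  elim: k => [|k IH] i e; first by have := ltn_ord (f i); lia.
  have hk : i.+1 < n.+1 by lia.
  have h : f (Ordinal hk) <= i.+1 by apply: IH => /=; lia.
  have h2 : f i <= f (Ordinal hk) by apply: (svalP f) => /=.
  have h3 : f i != f (Ordinal hk) :> nat.
    by apply/eqP => /val_inj/inj/(congr1 val) /=; lia.
  by rewrite -ltnS (leq_trans _ h) // ltn_neqAle h3.
apply: hom_eq => i; apply/val_inj/eqP; rewrite eqn_leq.
by rewrite (ub _ i erefl) (lb _ i erefl).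
Qed.

Definition rlp_faces (X Y : sSet) (p : smap X Y) n (P : 'I_n.+1 -> Prop) : Prop :=
  forall (u : smap (faces P) X) (v : smap (simplex n) Y),
    (forall m x, p m (u m x) = v m (sval x)) ->
    exists w : smap (simplex n) X,
      (forall m x, w m (sval x) = u m x) /\ (forall m x, p m (w m x) = v m x).

Lemma faces_comp n (P : 'I_n.+1 -> Prop) k m (f : simplex n m) (h : hom k m) :
  (exists2 j, P j & forall i, happ f i <> j) ->
  exists2 j, P j & forall i, happ (hcomp f h) i <> j.
Proof. by case=> j Pj Hj; exists j => // i; apply: Hj. Qed.

(** The pushout of the union of faces P along the simplex b, without forming it. Hypothesis [D] says
    that R already covers exactly those faces of b; hypothesis [I] says that b identifies two
    operators only where R is defined, so that the filler w descends to the image of b. *)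
Lemma attach (B X Y : sSet) (p : smap X Y) (v : smap B Y) (R : pmap B X)
    N (P : 'I_N.+1 -> Prop) (b : B N) :
  is_pmap R -> pover p v R -> rlp_faces p P ->
  (forall m (f : hom m N), dom R (act B f b) <-> exists2 j, P j & forall i, f i <> j) ->
  (forall m (f g : hom m N), act B f b = act B g b -> f <> g -> dom R (act B f b)) ->
  exists R' : pmap B X, [/\ is_pmap R', pover p v R',
    forall n c x, R n c x -> R' n c x &
    forall n c, dom R' c <-> dom R c \/ exists f : hom n N, c = act B f b].
Proof.
move=> RP Rv rlp D I.
pose u0 m (f : faces P m) : X m := projT1 (cid ((D m (sval f)).2 (svalP f))).
have uP m f : R m (act B (sval f) b) (u0 m f) by rewrite /u0; case: cid.
have uN m n (h : hom m n) f : u0 m (act (faces P) h f) = act X h (u0 n f).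
  by apply: (RP.1 _ _ _ _ (uP _ _)) => /=; rewrite act_comp; apply: RP.2.
pose u : smap (faces P) X := SMap uN.
have [m x|w [w1 w2]] := rlp u (scomp v (classify b)).
  by rewrite /=; apply: Rv (uP m x).
have wR m (f : hom m N) x : R m (act B f b) x -> w m f = x.
  move=> Rx; have Df : dom R (act B f b) by exists x.
  have := w1 m (exist _ f ((D m f).1 Df)) => /= ->.
  by apply: RP.1 (uP m (exist _ f ((D m f).1 Df))) Rx.
exists (fun n c x => R n c x \/ exists f : hom n N, c = act B f b /\ x = w n f); split.
- split=> [n c x x'|m n h c x].
  + case=> [Rx|[f [ef ->]]] [Rx'|[g [eg ->]]].
    * exact: RP.1 Rx Rx'.
    * by symmetry; apply: wR; rewrite -eg.
    * by apply: wR; rewrite -ef.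
    * case: (pselect (f = g)) => [-> //|ne].
      have [y Ry] := I _ f g (etrans (esym ef) eg) ne.
      by rewrite (wR _ _ _ Ry) (wR _ g y) // -eg ef.
  + case=> [Rx|[f [-> ->]]]; first by left; apply: RP.2.
    by right; exists (hcomp f h); rewrite act_comp -smapE.
- by move=> n c x [/Rv //|[f [-> ->]]]; rewrite w2.
- by move=> n c x; left.
- move=> n c; split=> [[x [Rx|[f [-> _]]]]|[[x Rx]|[f ->]]].
  + by left; exists x.
  + by right; exists f.
  + by exists x; left.
  + by exists (w n f); right; exists f.
Qed.

Definition psub (B X : sSet) (R S : pmap B X) : Prop := forall n b x, R n b x -> S n b x.

(** Zorn's lemma for inclusion. The order is taken on the members of C above R, a nonempty
    collection, so that C has to be closed under unions of nonempty chains only. *)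
Lemma pmap_zorn (B X : sSet) (C : pmap B X -> Prop) (R : pmap B X) : C R ->
  (forall F : pmap B X -> Prop, (exists S, F S) -> (forall S, F S -> C S) ->
    (forall S S', F S -> F S' -> psub S S' \/ psub S' S) ->
    C (fun n b x => exists2 S, F S & S n b x)) ->
  exists S, [/\ C S, psub R S & forall S', C S' -> psub S S' -> psub S' S].
Proof.
move=> CR CU.
pose T := {S : pmap B X | C S /\ psub R S}.
pose le (S S' : T) : bool := `[< psub (sval S) (sval S') >].
have T0 : T by exists R; split.
have [||A tot|S Smax] := @ZL_preorder T T0 le.
- by move=> t; apply/asboolP.
- by move=> r s t /asboolP h1 /asboolP h2; apply/asboolP => n b x /h1/h2.
- case: (pselect (exists a, A a)) => [[a Aa]|nA]; last first.
    by exists T0 => s As; case: nA; exists s.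
  pose F S := exists2 s : T, A s & sval s = S.
  have HU : C (fun n b x => exists2 S, F S & S n b x) /\
      psub R (fun n b x => exists2 S, F S & S n b x).
    split.
      apply: CU => [|S [s _ <-]|S S' [s As <-] [s' As' <-]].
      + by exists (sval a), a.
      + by case: (svalP s).
      + by case: (tot _ _ As As') => /asboolP; [left|right].
    move=> n b x Rx; exists (sval a); first by exists a.
    by case: (svalP a) => _; apply.
  exists (exist (fun S => C S /\ psub R S) _ HU) => s As; apply/asboolP => n b x sx /=.
  by exists (sval s) => //; exists s.
case: S Smax => S [CS RS] Smax; exists S; split=> // S' CS' SS'.
have RS' : psub R S' by move=> n b x /RS/SS'.
have lSS' : le (exist _ S (conj CS RS)) (exist (fun S => C S /\ psub R S) S' (conj CS' RS')).
  by apply/asboolP.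
by have /asboolP := Smax _ lSS'.
Qed.

Lemma union_is_pmap (B X : sSet) (F : pmap B X -> Prop) : (forall S, F S -> is_pmap S) ->
  (forall S S', F S -> F S' -> psub S S' \/ psub S' S) ->
  is_pmap (fun n b x => exists2 S, F S & S n b x).
Proof.
move=> FP tot; split=> [n b x x' [S FS Sx] [S' FS' Sx']|m n f b x [S FS Sx]].
  by case: (tot _ _ FS FS') => h; [apply: (FP _ FS').1 (h _ _ _ Sx) Sx'|apply: (FP _ FS).1 Sx (h _ _ _ Sx')].
by exists S => //; apply: (FP _ FS).2.
Qed.

(* The simplex of least dimension outside a maximal partial lift attaches along
   its boundary (Eilenberg-Zilber). *)
Lemma cell_ext (B X Y : sSet) (p : smap X Y) (v : smap B Y) (R : pmap B X) :
  (forall n (c : B n), (forall m (c' : B m) (f : hom n m), m < n -> c <> act B f c') ->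
    rlp_faces p (fun _ : 'I_n.+1 => True)) ->
  is_pmap R -> pover p v R ->
  exists w : smap B X, extends R w /\ (forall n b, p n (w n b) = v n b).
Proof.
move=> tp RP Rv.
have [//|F _ FC tot|S [[SP Sv] RS Smax]] := pmap_zorn (C := fun S => is_pmap S /\ pover p v S) (R := R).
  split; first by apply: union_is_pmap => // S /FC[].
  by move=> n b x [S /FC[_ +]]; apply.
suff tot n b : @dom _ _ S n b.
  have [w wS] := total_pmap SP tot.
  exists w; split=> [n b x /RS|n b]; last exact: Sv (wS n b).
  exact: SP.1 (wS n b).
apply: contrapT => nb.
have [N [c nc cmin]] : exists N, exists2 c : B N, ~ dom S c &
    forall m (c' : B m), m < N -> dom S c'.
  apply: contrapT => H.
  have all0 k : forall m (c' : B m), m < k -> dom S c'.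
    elim: k => [//|k IH] m c' mk.
    apply: contrapT => h; apply: H; exists m, c' => // l d lm.
    by apply: IH; apply: leq_trans lm _.
  exact: nb (all0 n.+1 n b (ltnSn n)).
have ns m (f : hom m N) j : (forall i, f i <> j) -> dom S (act B f c).
  case: N c nc cmin f j => [|N] c nc cmin f j H.
    by case: (H ord0); rewrite [f _]ord1 [j]ord1.
  have [g ->] := delta_factor H.
  by rewrite act_comp; apply: dom_act => //; apply: cmin.
have [|m f|m f g e ne|R' [R'P R'v RR' D']] :=
    attach (P := fun=> True) (b := c) SP Sv.
- apply: (tp N c) => M c' f MN ec; apply: nc; rewrite ec.
  by apply: dom_act => //; apply: cmin.
- split=> [Df|[j _]]; last exact: ns.
  have [|j Hj] := @hnsurj m N f; last by exists j.
  move=> sf; have [d [fd _]] := hsection ord0 sf.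
  by apply: nc; rewrite -[c]act_id -fd act_comp; apply: dom_act.
- have [sf|/hnsurj[j]] := lem (hsurj f); last exact: ns.
  have [sg|/hnsurj[j]] := lem (hsurj g); last by rewrite e; exact: ns.
  (* For a section d of f through i, the operator g d fixes c, because act d (act g c) = act d (act
     f c) = c. Either g d is onto, hence the identity, and g i = f i; or it misses a vertex, and
     then c would already lie in the domain. *)
  case: ne; apply: hom_eq => i.
  have [d [fd dfi]] := hsection i sf.
  have [sgd|/hnsurj[j]] := lem (hsurj (hcomp g d)).
    by have /(congr1 (fun h => happ h (f i))) := mono_endo_id sgd; rewrite /= dfi.
  by move/ns; rewrite act_comp -e -act_comp fd act_id => /nc.
apply: nc; have [x R'x] : dom R' c by apply/D'; right; exists (hid N); rewrite act_id.
by exists x; apply: Smax R'x.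
Qed.

Lemma tfib_ext (B X Y : sSet) (p : smap X Y) (v : smap B Y) (R : pmap B X) :
  trivial_kan_fibration p -> is_pmap R -> pover p v R ->
  exists w : smap B X, extends R w /\ (forall n b, p n (w n b) = v n b).
Proof. by move=> tp; apply: cell_ext => n c _; exact: (tp n). Qed.

(** * Lifting extension properties *)

Lemma act_sprod (X Y : sSet) m n (f : hom m n) (q : sprod X Y n) :
  act (sprod X Y) f q = (act X f q.1, act Y f q.2).
Proof. by []. Qed.
Lemma act_simplex k m n (f : hom m n) (q : hom n k) : act (simplex k) f q = hcomp q f.
Proof. by []. Qed.
Lemma act_mapsp (K X : sSet) m n (f : hom m n) (g : mapsp K X n) k (h : hom k m) t :
  act (mapsp K X) f g k (h, t) = g k (hcomp f h, t).
Proof. by []. Qed.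
Lemma act_sub (X : sSet) P (HP : @subclosed X P) m n (f : hom m n) (x : subsset HP n) :
  sval (act (subsset HP) f x) = act X f (sval x).
Proof. by []. Qed.

Lemma sub_eq (X : sSet) P (HP : @subclosed X P) n (x y : subsset HP n) :
  sval x = sval y -> x = y.
Proof. by case: x y => x hx [y hy] /= e; apply: eq_exist. Qed.

Program Definition curry (B K X : sSet) (w : smap (sprod B K) X) : smap B (mapsp K X) :=
  @SMap B (mapsp K X) (fun n b =>
    @SMap (sprod (simplex n) K) X (fun j q => w j (act B q.1 b, q.2)) _) _.
Next Obligation. by rewrite -[RHS]smapE act_sprod /= -act_comp. Qed.
Next Obligation. by apply: smap_eq => j [g t] /=; rewrite -act_comp. Qed.

Program Definition uncurry (B K X : sSet) (g : smap B (mapsp K X)) : smap (sprod B K) X :=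
  @SMap (sprod B K) X (fun n q => g n q.1 n (hid n, q.2)) _.
Next Obligation.
by rewrite smapE act_mapsp -[RHS]smapE act_sprod act_simplex hcomp1 hcomp1l.
Qed.

Lemma uncurryE (B K X : sSet) (g : smap B (mapsp K X)) n b j (f : hom j n) t :
  g n b j (f, t) = uncurry g j (act B f b, t).
Proof. by rewrite /= smapE act_mapsp hcomp1. Qed.

Program Definition mapsp_pre (L K X : sSet) (i : smap L K) : smap (mapsp K X) (mapsp L X) :=
  @SMap (mapsp K X) (mapsp L X) (fun n g =>
    @SMap (sprod (simplex n) L) X (fun j q => g j (q.1, i j q.2)) _) _.
Next Obligation. by rewrite -[RHS]smapE act_sprod /= smapE. Qed.
Next Obligation. exact: smap_eq. Qed.

(* X^K -> X^L x_(Y^L) Y^K *)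
Program Definition pexp (X Y L K : sSet) (p : smap X Y) (i : smap L K) :
    smap (mapsp K X) (pullback (mapsp_post L p) (mapsp_pre Y i)) :=
  @SMap (mapsp K X) (pullback (mapsp_post L p) (mapsp_pre Y i))
    (fun n g => exist _ (mapsp_pre X i n g, mapsp_post K p n g) _) _.
Next Obligation. exact: smap_eq. Qed.
Next Obligation. by apply: eq_exist; congr (_, _); apply: smap_eq. Qed.

Lemma pexpE (X Y L K : sSet) (p : smap X Y) (i : smap L K) n (g : mapsp K X n)
    (z : pullback (mapsp_post L p) (mapsp_pre Y i) n) : pexp p i n g = z ->
  (forall j f t, g j (f, i j t) = (sval z).1 j (f, t)) /\
  (forall j q, p j (g j q) = (sval z).2 j q).
Proof. by move=> <-. Qed.

Lemma pexp_pb (X Y L K : sSet) (p : smap X Y) (i : smap L K) n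
    (z : pullback (mapsp_post L p) (mapsp_pre Y i) n) j f t :
  p j ((sval z).1 j (f, t)) = (sval z).2 j (f, i j t).
Proof.
case: z => -[a b] /= e.
exact: (congr1 (fun g : smap (sprod (simplex n) L) Y => g j (f, t)) e).
Qed.

(* Lifting against the pushout products of L -> K with the monomorphisms
   A -> B; the partial map R is defined on A x K and on B x L. *)
Definition ELP (K : sSet) (L : forall n, K n -> Prop) (X Y : sSet) (p : smap X Y) : Prop :=
  forall (B : sSet) (A : forall n, B n -> Prop) (v : smap (sprod B K) Y)
    (R : pmap (sprod B K) X),
    subclosed A -> is_pmap R -> pover p v R ->
    (forall n (q : sprod B K n), dom R q <-> A n q.1 \/ L n q.2) ->
    exists w : smap (sprod B K) X, extends R w /\ (forall n b, p n (w n b) = v n b).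

(** Transposition: lifting the boundary of the n-simplex against [pexp] is lifting ∂Δ^n x K ∪ Δ^n x
    L against p. In the proof [R1] carries the data on the first part and [R2] on the second. *)
Lemma pexp_tfib (K : sSet) L (HL : @subclosed K L) (X Y : sSet) (p : smap X Y) :
  (forall n (v : smap (sprod (simplex n) K) Y) (R : pmap (sprod (simplex n) K) X),
    is_pmap R -> pover p v R ->
    (forall m (q : sprod (simplex n) K m), dom R q <->
      (exists2 j, True & forall i, happ q.1 i <> j) \/ L m q.2) ->
    exists w : smap (sprod (simplex n) K) X, extends R w /\ (forall n b, p n (w n b) = v n b)) ->
  trivial_kan_fibration (pexp p (incl HL)).
Proof.
move=> E n u v uv.
pose R1 : pmap (sprod (simplex n) K) X := fun m q x =>
  exists h : exists2 j, True & forall i, happ q.1 i <> j,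
    x = u m (exist _ q.1 h) m (hid m, q.2).
pose R2 : pmap (sprod (simplex n) K) X := fun m q x =>
  exists h : L m q.2, x = (sval (v n (hid n))).1 m (q.1, exist _ q.2 h).
pose R := punion R1 R2.
have vE m (f : hom m n) : v m f = act _ f (v n (hid n)).
  by rewrite -smapE; congr (v m _); apply: hom_eq.
have uvE m (f : boundary n m) j t (h : L j t) g :
    (sval (v n (hid n))).1 j (hcomp (sval f) g, exist _ t h) =
    u m f j (g, t).
  have -> : u m f j (g, t) = _ := (pexpE (uv m f)).1 j g (exist _ t h).
  by rewrite (vE _ (sval f)).
have agree m q x y : R1 m q x -> R2 m q y -> x = y.
  case: q => f t [/= h ->] [l ->]; rewrite -(uvE m (exist _ f h)) /=.
  by rewrite hcomp1.
have RP : is_pmap R.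
  apply: punion_is_pmap agree; split.
  - by move=> m [f t] x x' [h ->] [h' ->]; congr (u m (exist _ _ _) m _).
  - move=> m k g [f t] x [/= h ->].
    have h' := @faces_comp n _ _ _ f g h; exists h'.
    have -> : exist _ (hcomp f g) h' = act (boundary n) g (exist _ f h) by apply: eq_exist.
    rewrite smapE /= -smapE; congr (smap_fun (u k _) _ (_, _)); exact: hom_eq.
  - by move=> m [f t] x x' [h ->] [h' ->]; congr (_ m (_, exist _ _ _)).
  - move=> m k g [f t] x [/= h ->]; exists (HL _ _ g _ h).
    by rewrite -smapE; congr (_ m (_, _)); apply: eq_exist.
pose v2 : smap (sprod (simplex n) K) Y := (sval (v n (hid n))).2.
have Rv : pover p v2 R.
  move=> m [f t] x [[/= h ->]|[/= h ->]].
    by rewrite ((pexpE (uv m (exist _ f h))).2 m (hid m, t)) (vE _ f) /= hcomp1.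
  exact: (pexp_pb (v n (hid n)) f (exist _ t h)).
have [m [f t]|w [wR wv]] := E _ v2 R RP Rv.
- split=> [[x [[h _]|[l _]]]|[h|l]]; [by left|by right| |].
    by exists (u m (exist _ f h) m (hid m, t)); left; exists h.
  by exists ((sval (v n (hid n))).1 m (f, exist _ t l)); right; exists l.
exists (curry w); split=> m f.
- apply: smap_eq => j [g t] /=.
  have h := @faces_comp n _ _ _ (sval f) g (svalP f).
  have e : (act (simplex n) g (sval f), t) = (hcomp (sval f) g, t) by [].
  rewrite e; have -> := wR _ (hcomp (sval f) g, t) (u j (exist _ _ h) j (hid j, t)); last first.
    by left; exists h.
  have -> : exist _ (hcomp (sval f) g) h = act (boundary n) g f by case: f h {e} => f h h' ; apply: eq_exist.
  by rewrite smapE /=; congr (smap_fun (u m f) _ (_, _)); apply: hom_eq.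
- rewrite (vE _ f); apply: eq_exist.
  rewrite [RHS]surjective_pairing; congr (_, _); apply: smap_eq => j [g t] /=; last by rewrite wv.
  by apply: wR; right; case: t => t h; exists h.
Qed.

(** The reverse transposition, now for an arbitrary pair of A in B, because a trivial fibration
    lifts against every partial map. Together with [pexp_tfib], an [ELP] has to be verified only for
    boundary inclusions of simplices. *)
Lemma tfib_ELP (K : sSet) L (HL : @subclosed K L) (X Y : sSet) (p : smap X Y) :
  trivial_kan_fibration (pexp p (incl HL)) -> ELP L p.
Proof.
move=> tp B A v R HA RP Rv Rd.
pose r n q (h : @dom _ _ R n q) : X n := projT1 (cid h).
have rP n q (h : @dom _ _ R n q) : R n q (r n q h) by rewrite /r; case: cid.
have RL n (b : B n) t : L n t -> dom R ((b, t) : sprod B K n).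
  by move=> Lt; apply/Rd; right.
have RA n (b : B n) (Ab : A n b) j (q : sprod (simplex n) K j) :
    dom R ((act B q.1 b, q.2) : sprod B K j).
  by apply/Rd; left; apply: HA.
have uP n (b : B n) m k (f : hom m k) (q : sprod (simplex n) (subsset HL) k) :
  r m (act B (act (sprod (simplex n) (subsset HL)) f q).1 b,
       sval (act (sprod (simplex n) (subsset HL)) f q).2) (RL _ _ _ (svalP _)) =
  act X f (r k (act B q.1 b, sval q.2) (RL _ _ _ (svalP _))).
  apply: RP.1 (rP _ _ _) _; rewrite /= act_comp; exact: (RP.2 _ _ f (act B q.1 b, sval q.2) _ (rP k _ _)).
pose v1 n (b : B n) : mapsp (subsset HL) X n := SMap (uP n b).
have vP n b : mapsp_post (subsset HL) p n (v1 n b) =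
    mapsp_pre Y (incl HL) n (curry v n b).
  by apply: smap_eq => j q /=; apply: Rv (rP _ _ _).
pose v' n (b : B n) : pullback (mapsp_post (subsset HL) p) (mapsp_pre Y (incl HL)) n :=
  exist _ (v1 n b, curry v n b) (vP n b).
have vE m n (f : hom m n) b : v' m (act B f b) = act _ f (v' n b).
  apply: eq_exist; congr (_, _); last exact: (smapE (curry v)).
  apply: smap_eq => j [g t]; apply: (RP.1 _ _ _ _ (rP _ _ _)).
  rewrite act_mapsp /= -act_comp; exact: rP.
pose R' : pmap B (mapsp K X) := fun n b g =>
  forall j (f : hom j n) t, R j (act B f b, t) (g j (f, t)).
have [|n b g Rg|w [wR wv]] := tfib_ext (v := SMap vE) (R := R') tp.
- split=> [n b g g' h h'|m n f b g h j f' t].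
    by apply: smap_eq => j [f t]; apply: RP.1 (h _ _ _) (h' _ _ _).
  by rewrite act_mapsp -act_comp; apply: h.
- apply: eq_exist; congr (_, _); apply: smap_eq => j [f t] /=; last exact: Rv (Rg _ _ _).
  by apply: RP.1 (Rg _ _ _) _; apply: rP.
exists (uncurry w); split=> [n [b t] x Rx|n [b t]] /=.
- have /Rd /= [Ab|Lt] : dom R ((b, t) : sprod B K n) by exists x.
    have gP m k (f : hom m k) (q : sprod (simplex n) K k) :
        r m _ (RA n b Ab m (act (sprod (simplex n) K) f q)) = act X f (r k _ (RA n b Ab k q)).
      by apply: RP.1 (rP _ _ _) _; rewrite /= act_comp; exact: (RP.2 _ _ f (act B q.1 b, q.2) _ (rP k _ _)).
    have -> : w n b = SMap gP by apply: wR => j f t'; apply: rP.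
    by apply: RP.1 (rP _ _ _) _; rewrite /= act_id.
  have -> : w n b n (hid n, t) = _ := (pexpE (wv n b)).1 n (hid n) (exist _ t Lt).
  by apply: RP.1 (rP _ _ _) _; rewrite /= act_id.
- by rewrite (pexpE (wv n b)).2 /= act_id.
Qed.

Definition sfst (X Y : sSet) : smap (sprod X Y) X :=
  @SMap (sprod X Y) X (fun _ q => q.1) (fun _ _ _ _ => erefl).
Definition ssnd (X Y : sSet) : smap (sprod X Y) Y :=
  @SMap (sprod X Y) Y (fun _ q => q.2) (fun _ _ _ _ => erefl).
Definition to_point (X : sSet) : smap X point := @SMap X point (fun _ _ => tt) (fun _ _ _ _ => erefl).

Definition pre_pmap (C B X : sSet) (P : forall n, C n -> Prop) (g : smap C B)
  (R : pmap B X) : pmap C X := fun n c x => P n c /\ R n (g n c) x.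
Lemma pre_is_pmap (C B X : sSet) P (g : smap C B) (R : pmap B X) :
  subclosed P -> is_pmap R -> is_pmap (pre_pmap P g R).
Proof.
move=> HP [R1 R2]; split=> [n b x x' [_ h] [_ h']|m n f b x [Pb h]]; first exact: R1 h h'.
by split; [apply: HP|rewrite smapE; apply: R2].
Qed.

(** * Left and right fibrations as lifting properties *)

Definition atv (K : sSet) (k0 : K 0) n (t : K n) : Prop := t = deg K n k0.
Lemma atv_closed (K : sSet) (k0 : K 0) : subclosed (atv k0).
Proof. by move=> m n f x ->; rewrite /atv act_deg. Qed.

(** Pushout products with the inclusion of the vertex 0 of the interval detect left fibrations, with
    the vertex 1 right fibrations; both together give Kan fibrations. [FJ] only asks that paths
    parametrised by [J] lift, which is all that the homotopy calculus below uses. *)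
Definition LF (X Y : sSet) (p : smap X Y) := ELP (@atv (simplex 1) (Delta1_end false)) p.
Definition RF (X Y : sSet) (p : smap X Y) := ELP (@atv (simplex 1) (Delta1_end true)) p.
Definition FJ (X Y : sSet) (p : smap X Y) := ELP (@atv J (J_end false)) p.

(** The map h deforms K into L along K1: it is the identity at e, lands in L over L1, and preserves
    L throughout. Hence A x K ∪ B x L -> B x K is a retract of its own pushout product with L1 ->
    K1, against which p lifts. *)
Lemma ELP_retract (K K1 : sSet) L L1 (h : smap (sprod K K1) K) (e : K1 0)
    (X Y : sSet) (p : smap X Y) :
  @subclosed K L -> @subclosed K1 L1 ->
  (forall n s, h n (s, deg K1 n e) = s) ->
  (forall n s t, L n s \/ L1 n t -> L n (h n (s, t))) ->
  ELP L1 p -> ELP L p.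
Proof.
move=> HL HL1 he hL E B A v R HA RP Rv Rd.
pose g : smap (sprod (sprod B K) K1) (sprod B K) :=
  pair_map (scomp (sfst _ _) (sfst _ _)) (scomp h (pair_map (scomp (ssnd _ _) (sfst _ _)) (ssnd _ _))).
pose P n (q : sprod (sprod B K) K1 n) := (A n q.1.1 \/ L n q.1.2) \/ L1 n q.2.
have HP : subclosed P.
  by move=> m n f q [[?|?]|?]; [left;left; apply: HA|left;right; apply: HL|right; apply: HL1].
have [||n b x [_ /Rv]//|n q|w [wR wv]] :=
    E _ (fun n (q : sprod B K n) => A n q.1 \/ L n q.2) (scomp v g) (pre_pmap P g R).
- by move=> m n f q [?|?]; [left; apply: HA|right; apply: HL].
- exact: pre_is_pmap.
- split=> [[x [[h1|h1] h2]]|h1]; [by left|by right|].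
  have [x Rx] : dom R (g n q); last by exists x.
  by apply/Rd; case: h1 => [[?|?]|?]; [left|right; apply: hL; left|right; apply: hL; right].
exists (scomp w (pair_map (sid _) (@SMap (sprod B K) K1 (fun n _ => deg K1 n e)
   (fun _ _ f _ => esym (act_deg f e))))).
split=> [n [b s] x Rx|n [b s]]; last by rewrite /= wv /= he.
rewrite /=; apply: wR; split; last by rewrite /= he.
by left; apply/(Rd _ (b, s)); exists x.
Qed.

Definition Jmin (b : bool) : smap (sprod J (simplex 1)) J :=
  @SMap (sprod J (simplex 1)) J (fun n q i => q.1 i && ((happ q.2 i == ord_max) == b))
    (fun _ _ _ _ => erefl).

(** [Jmin true] is the identity at the end 1 of the interval and collapses J to the vertex [false]
    at the end 0. *)
Lemma LF_FJ (X Y : sSet) (p : smap X Y) : LF p -> FJ p.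
Proof.
apply: (@ELP_retract _ _ _ _ (Jmin true) (Delta1_end true)); try exact: atv_closed.
- by move=> n s; apply: funext => i /=; rewrite andbT.
- by move=> n s t [->|->]; apply: funext => i //=; rewrite andbF.
Qed.
Lemma FJ_true (X Y : sSet) (p : smap X Y) : FJ p -> ELP (@atv J (J_end true)) p.
Proof.
apply: (@ELP_retract _ _ _ _ (@SMap (sprod J J) J (fun n q i => q.1 i || ~~ q.2 i)
   (fun _ _ _ _ => erefl)) (J_end true)); try exact: atv_closed.
- by move=> n s; apply: funext => i /=; rewrite orbF.
- by move=> n s t [->|->]; apply: funext => i //=; rewrite orbT.
Qed.

Definition D1J : smap (simplex 1) J :=
  @SMap (simplex 1) J (fun n t i => happ t i == ord_max) (fun _ _ _ _ => erefl).
Lemma D1J_inj n (t t' : simplex 1 n) : D1J n t = D1J n t' -> t = t'.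
Proof.
move=> e; apply: hom_eq => i; have := congr1 (fun s : J n => s i) e => /=.
by case: (happ t i) (happ t' i) => -[|[|[]]] // h [[|[|[]]]] // h' _; apply: val_inj.
Qed.
Definition inD1 n (s : J n) : Prop := exists t, D1J n t = s.
Lemma inD1_closed : subclosed inD1.
Proof. by move=> m n f s [t <-]; exists (act (simplex 1) f t); rewrite smapE. Qed.
Lemma inD1_false n : inD1 (deg J n (J_end false)).
Proof. by exists (deg (simplex 1) n (Delta1_end false)). Qed.

Lemma J_endsE n : deg J n (J_end false) <> deg J n (J_end true).
Proof. by move/(congr1 (fun s : J n => s ord0)). Qed.

Definition pushD1 (B X : sSet) (R : pmap (sprod B (simplex 1)) X) : pmap (sprod B J) X :=
  fun n q x => exists t, D1J n t = q.2 /\ R n (q.1, t) x.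
Lemma pushD1_is_pmap (B X : sSet) (R : pmap (sprod B (simplex 1)) X) :
  is_pmap R -> is_pmap (pushD1 R).
Proof.
move=> [R1 R2]; split=> [n q x x' [t [e h]] [t' [e' h']]|m n f q x [t [e h]]].
  by rewrite -e in e'; move: h'; rewrite (D1J_inj e'); apply: R1.
by exists (act (simplex 1) f t); rewrite smapE e; split => //; apply: R2 h.
Qed.

(* ℓ is a lift that ignores the data on B x D1; the two agree up to a homotopy
   relative to A x D1 and to B x {0}, which is extended to B x J. *)
Lemma LF_D1J (X Y : sSet) (p : smap X Y) : LF p -> ELP inD1 p.
Proof.
move=> lf B A v R HA RP Rv Rd.
have fj := LF_FJ lf.
pose cF := deg J ^~ (J_end false); pose cT := deg J ^~ (J_end true).
have Df n (b : B n) : dom R ((b, cF n) : sprod B J n).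
  by apply/Rd; right; apply: inD1_false.
pose P1 n (q : sprod B J n) := A n q.1 \/ q.2 = cF n.
have HP1 : subclosed P1.
  by move=> m n f q [?|h]; [left; apply: HA|right; apply: (atv_closed f h)].
have [|n b x [_ /Rv]//|n [b t]|l [lR lv]] :=
    fj _ A v (pre_pmap P1 (sid _) R) HA.
- exact: pre_is_pmap.
- split=> [[x []] //|h]; have [x Rx] : dom R ((b, t) : sprod B J n); last by exists x.
  by apply/Rd; case: h => [?|->]; [left|right; apply: inD1_false].
have lR' n b t x : P1 n (b, t) -> R n (b, t) x -> l n (b, t) = x.
  by move=> h1 h2; apply: lR.
(* In (B x J) x Δ^1 the factor J is the time of the homotopy and Δ^1 the place: M will be l at time
   [jF], R at time [jT], and stationary over A and at the place 0. *)
pose g2 : smap (sprod (sprod B J) (simplex 1)) (sprod B J) :=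
  pair_map (scomp (sfst _ _) (sfst _ _)) (scomp D1J (ssnd _ _)).
pose A2 n (q : sprod B J n) := A n q.1 \/ (q.2 = cF n \/ q.2 = cT n).
have HA2 : subclosed A2.
  move=> m n f q [?|[h|h]]; first by left; apply: HA.
    by right; left; apply: (atv_closed f h).
  by right; right; apply: (atv_closed f h).
pose PR n (q : sprod (sprod B J) (simplex 1) n) := A n q.1.1 \/ q.1.2 = cT n.
pose Pl n (q : sprod (sprod B J) (simplex 1) n) := atv (Delta1_end false) q.2 \/ q.1.2 = cF n.
have HPR : subclosed PR.
  by move=> m n f q [?|h]; [left; apply: HA|right; apply: (atv_closed f h)].
have HPl : subclosed Pl.
  by move=> m n f q [h|h]; [left; apply: (atv_closed f h)|right; apply: (atv_closed f h)].
have D1F n : D1J n (deg (simplex 1) n (Delta1_end false)) = cF n by [].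
have [|n q x [[_ /Rv ->]//|[_ ->]]|n q|M [MR Mv]] :=
    lf _ A2 (scomp v g2) (punion (pre_pmap PR g2 R) (on Pl (scomp l g2))) HA2.
- apply: punion_is_pmap; [exact: pre_is_pmap|exact: on_is_pmap|].
  move=> n [[b s] t] x y [/= h Rx] [/= h' ->]; symmetry; apply: (lR' _ _ _ _ _ Rx).
  case: h' => /= h'; [by right; rewrite /= h'|left=> /=].
  by case: h => // /= e; move: h'; rewrite e => /esym/J_endsE.
- by rewrite /= lv.
- split=> [[x [[[h|h] _]|[[h|h] _]]]|].
  + by left; left.
  + by left; right; right.
  + by right.
  + by left; right; left.
  + case=> [[h|[h|h]]|h].
    * have [x Rx] : dom R (g2 n q) by apply/Rd; left.
      by exists x; left; split=> //; left.
    * by exists (l n (g2 n q)); right; split=> //; right.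
    * have [x Rx] : dom R (g2 n q) by apply/Rd; right; exists q.2.
      by exists x; left; split=> //; right.
    * by exists (l n (g2 n q)); right; split=> //; left.
pose P3 n (q : sprod (sprod B J) J n) := A n q.1.1.
have HP3 : subclosed P3 by move=> m n f q; apply: HA.
pose Q3 n (q : sprod (sprod B J) J n) := q.2 = cF n.
have HQ3 : subclosed Q3 by move=> m n f q h; apply: (atv_closed f h).
pose R3 : pmap (sprod (sprod B J) J) X :=
  fun n q x => exists t, D1J n t = q.1.2 /\ x = M n ((q.1.1, q.2), t).
have R3P : is_pmap R3.
  split=> [n q x x' [t [e ->]] [t' [e' ->]]|m n f q x [t [e ->]]].
    by rewrite -e in e'; rewrite (D1J_inj e').
  by exists (act (simplex 1) f t); rewrite smapE e; split => //; rewrite -smapE.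
(* Now [q.1.2] is the place, in all of J, and [q.2] is the time. The lift is W at time [jT]. *)
have [|||n q|W [WR Wv]] := fj _ (fun n (q : sprod B J n) => A n q.1 \/ inD1 q.2)
   (scomp v (sfst _ _)) (punion (on Q3 (scomp l (sfst _ _))) (punion (pre_pmap P3 (sfst _ _) R) R3)).
- by move=> m n f q [?|?]; [left; apply: HA|right; apply: inD1_closed].
- apply: punion_is_pmap; first exact: on_is_pmap.
    apply: punion_is_pmap => //; first exact: pre_is_pmap.
    move=> n [[b t] s] x y [/= Ab Rx] [t' [/= e ->]]; symmetry; apply: MR; left.
    by split; [left|rewrite /= e].
  move=> n [[b t] s] x y [/= e ->] [[/= Ab Rx]|[t' [/= e' ->]]].
    by apply: (lR' _ _ _ _ _ Rx); left.
  by symmetry; rewrite -e'; apply: MR; right; split=> //; right.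
- move=> n [[b t] s] x [[/= _ ->]|[[/= _ /Rv]//|[t' [/= e ->]]]]; first by rewrite lv.
  by rewrite Mv /= e.
- split.
    case=> x [[h _]|[[h _]|[t [h _]]]]; [by right|by left;left|by left;right;exists t].
  case=> [[h|[t h]]|h].
  + have [x Rx] : dom R q.1 by apply/Rd; left.
    by exists x; right; left.
  + by exists (M n ((q.1.1, q.2), t)); right; right; exists t.
  + by exists (l n q.1); left.
exists (scomp W (pair_map (sid _) (@SMap (sprod B J) J (fun n _ => cT n)
   (fun _ _ f _ => esym (act_deg f (J_end true)))))).
split=> [n [b t] x Rx|n q]; last by rewrite /= Wv.
have /Rd [Ab|[t' e]] : dom R ((b, t) : sprod B J n) by exists x.
  by apply: WR; right; left.
apply: WR; right; right; exists t'; split=> //=.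
symmetry; apply: MR; left; split; first by right.
by change (R n (b, D1J n t') x); rewrite e.
Qed.

(* A left fibration over a Kan complex is a Kan fibration: homotopies in the
   base extend from D1 to J, whose two ends are interchangeable. *)
Lemma LF_RF (X Y : sSet) (p : smap X Y) : LF p -> LF (to_point Y) -> RF p.
Proof.
move=> lf lY B A v R HA RP Rv Rd.
pose no := fun n (b : B n) => False.
have [||//|n [b t]|v' [v'R _]] := LF_D1J lY (A := no) (v := to_point _)
    (R := pushD1 (on (fun _ _ => True) v)).
- by [].
- by apply/pushD1_is_pmap/on_is_pmap.
- split=> [[x [t' [e _]]]|[//|[t' e]]]; first by right; exists t'.
  by exists (v n (b, t')); exists t'.
have v'E n b t : v' n (b, D1J n t) = v n (b, t) by apply: v'R; exists t.
pose Ai := subsset HA.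
pose gA : smap (sprod Ai (simplex 1)) (sprod B (simplex 1)) :=
  pair_map (scomp (incl HA) (sfst _ _)) (ssnd _ _).
have [||n q x [t [e [_ /Rv h]]]|n [b t]|RA [RAR RAv]] :=
  LF_D1J lf (A := fun n (b : Ai n) => False)
    (v := scomp v' (pair_map (scomp (incl HA) (sfst _ _)) (ssnd _ _)))
    (R := pushD1 (pre_pmap (fun _ _ => True) gA R)).
- by [].
- by apply/pushD1_is_pmap/pre_is_pmap.
- by rewrite /= -e v'E h.
- split=> [[x [t' [e _]]]|[//|[t' e]]]; first by right; exists t'.
  have [x Rx] : dom R ((sval b, t') : sprod B _ n) by apply/Rd; left; apply: (svalP b).
  by exists x; exists t'.
pose R2 : pmap (sprod B J) X := fun n q x => exists h : A n q.1, x = RA n (exist _ q.1 h, q.2).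
have R2P : is_pmap R2.
  split=> [n q x x' [h ->] [h' ->]|m n f q x [h ->]]; first by congr (RA n (exist _ _ _, _)).
  by exists (HA _ _ f _ h); rewrite -smapE; congr (RA m (_, _)); apply: eq_exist.
pose cT := deg J ^~ (J_end true).
pose R1 := pre_pmap (fun n (q : sprod B J n) => q.2 = cT n) (sid _) (pushD1 R).
have [|n q x|n q|w [wR wv]] := FJ_true (LF_FJ lf) (A := A) (v := v') (R := punion R1 R2) HA.
- apply: punion_is_pmap => //.
    by apply: pre_is_pmap; [move=> m n f q h; apply: (atv_closed f h)|apply: pushD1_is_pmap].
  move=> n q x y [/= e [t [e' Rx]]] [h ->]; symmetry; apply: RAR; by exists t.
- case=> [[/= e [t [e' /Rv ->]]]|[h ->]]; last by rewrite RAv /= -surjective_pairing.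
  by rewrite -v'E e'; case: (q).
- split=> [[x [[/= e _]|[h _]]]|[h|h]]; [by right|by left| |].
    by exists (RA n (exist _ q.1 h, q.2)); right; exists h.
  have [x Rx] : dom R ((q.1, deg (simplex 1) n (Delta1_end true)) : sprod B _ n).
    by apply/Rd; right.
  exists x; left; split=> //=; exists (deg (simplex 1) n (Delta1_end true)).
  by split=> //; rewrite h; apply: funext.
exists (scomp w (pair_map (sfst _ _) (scomp D1J (ssnd _ _)))); split=> [n [b t] x Rx|n [b t]] /=.
  have /Rd [Ab|e] : dom R ((b, t) : sprod B _ n) by exists x.
    by apply: wR; right; exists Ab; symmetry; apply: RAR; exists t.
  apply: wR; left; split; last by exists t.
  by apply: funext => i; rewrite /= (e : t = _).
by rewrite wv v'E.
Qed.

(** * From left horns to the left lifting property *)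

Definition left_horns (X Y : sSet) (p : smap X Y) : Prop :=
  forall n (k : 'I_n.+1), k < n -> rlp_faces p (fun j => j <> k).

Section Prism.
Variable n : nat.

Lemma prism_fst_mono k (i j : 'I_n.+2) : i <= j ->
  (inord (minn n (i - (k < i))) : 'I_n.+1) <= (inord (minn n (j - (k < j))) : 'I_n.+1).
Proof.
move=> ij; have hi := ltn_ord i; have hj := ltn_ord j.
by rewrite !inordK; lia.
Qed.
Lemma prism_snd_mono k (i j : 'I_n.+2) : i <= j ->
  (inord (k < i) : 'I_2) <= (inord (k < j) : 'I_2).
Proof. by move=> ij; rewrite !inordK; lia. Qed.

(** For k <= n this is the degeneracy that takes the value k twice. The truncation at n makes it a
    monotone map for every k. It also serves as the general degeneracy operator further on. *)
Definition pfst k : hom n.+1 n := mk_hom (@prism_fst_mono k).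
Definition psnd k : hom n.+1 1 := mk_hom (@prism_snd_mono k).

(* The simplex (0,0) ... (k,0) (k,1) ... (n,1) of the prism. *)
Definition prism k : sprod (simplex n) (simplex 1) n.+1 := (pfst k, psnd k).

Lemma pfstE k (i : 'I_n.+2) : k <= n -> pfst k i = i - (k < i) :> nat.
Proof. by move=> kn; have hi := ltn_ord i; rewrite /= inordK; lia. Qed.
Lemma psndE k (i : 'I_n.+2) : psnd k i = (k < i) :> nat.
Proof. by rewrite /= inordK; lia. Qed.

Definition in_prism k m (f : hom m n) (t : hom m 1) : Prop :=
  forall i, (t i = 0 :> nat -> f i <= k) /\ (t i = 1 :> nat -> k <= f i).

Lemma in_prismP k m (f : hom m n) (t : hom m 1) : k <= n ->
  in_prism k f t <-> exists h : hom m n.+1, f = hcomp (pfst k) h /\ t = hcomp (psnd k) h.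
Proof.
move=> kn; split=> [H|[h [-> ->]] i]; last first.
  have e1 := pfstE (h i) kn; have e2 := psndE k (h i).
  by rewrite e1 e2; lia.
have hm (a b : 'I_m.+1) : a <= b ->
    (inord (f a + t a) : 'I_n.+2) <= (inord (f b + t b) : 'I_n.+2).
  move=> ab; have h1 : f a <= f b := svalP f _ _ ab; have h2 : t a <= t b := svalP t _ _ ab.
  have h3 := ltn_ord (f a); have h4 := ltn_ord (t a).
  have h5 := ltn_ord (f b); have h6 := ltn_ord (t b).
  by rewrite !inordK; lia.
have hmE i : mk_hom hm i = f i + t i :> nat.
  by have h3 := ltn_ord (f i); have h4 := ltn_ord (t i); rewrite /= inordK; lia.
exists (mk_hom hm); split; apply: hom_eq => i; apply: ord_inj.
all: have h3 := ltn_ord (f i); have h4 := ltn_ord (t i); have h5 := H i.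
  by apply: etrans (esym (pfstE (mk_hom hm i) kn)); rewrite hmE; lia.
by apply: etrans (esym (psndE k (mk_hom hm i))); rewrite hmE; lia.
Qed.

Lemma prism_inj k m (f g : hom m n.+1) : k <= n ->
  hcomp (pfst k) f = hcomp (pfst k) g -> hcomp (psnd k) f = hcomp (psnd k) g -> f = g.
Proof.
move=> kn e1 e2; apply: hom_eq => i; apply: ord_inj.
have {}e1 : pfst k (f i) = pfst k (g i) :> nat := congr1 (fun h : hom m n => h i : nat) e1.
have {}e2 : psnd k (f i) = psnd k (g i) :> nat := congr1 (fun h : hom m 1 => h i : nat) e2.
by rewrite !pfstE // !psndE in e1 e2; lia.
Qed.

End Prism.

(** The top simplices of the prism are attached in the order k = n, ..., 0. The facet k+1 of
    [prism n k] belongs to the prism attached just before, or to Δ^n x {0} if k = n; the facets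
    other than k and k+1 lie over the boundary. Only the facet k is new, so each attachment fills a
    left horn of dimension n+1. *)
Lemma left_horns_LF (X Y : sSet) (p : smap X Y) : left_horns p -> LF p.
Proof.
move=> H; apply/(tfib_ELP (HL := @atv_closed _ _))/pexp_tfib => n v R0 R0P R0v R0d.
have key m : m <= n.+1 -> exists R : pmap (sprod (simplex n) (simplex 1)) X,
    [/\ is_pmap R, pover p v R, forall n q x, R0 n q x -> R n q x &
      forall l q, @dom _ _ R l q <->
        dom R0 q \/ exists k, [/\ n.+1 - m <= k, k <= n & in_prism k q.1 q.2]].
  elim: m => [|m IH] hm.
    by exists R0; split=> // l q; split=> [?|[//|[k [h1 h2 _]]]]; [left|lia].
  have [R [RP Rv R0R Rd]] := IH (ltnW hm).
  pose k := n - m; have kn : k <= n by rewrite /k; lia.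
  have kn2 : k < n.+2 by lia.
  have [|l h|l f g e ne|R' [R'P R'v RR' R'd]] :=
    attach (P := fun j => j <> Ordinal kn2) (b := prism n k) RP Rv.
  - by apply: H => /=; lia.
  - have E1 i := pfstE (h i) kn; have E2 i := psndE k (h i).
    rewrite act_sprod.
    rewrite Rd R0d; split.
    + have fin : (forall i, h i <> k.+1 :> nat) ->
        exists2 j, j <> Ordinal kn2 & forall i, h i <> j.
        move=> hk; have kn3 : k.+1 < n.+2 by lia.
        exists (Ordinal kn3); first by move/(congr1 val) => /=; lia.
        by move=> i /(congr1 val) /= e; exact: hk e.
      case=> [[[j _ Hj]|e]|[k' [h1 h2 h3]]].
      * have {}Hj i : pfst n k (h i) <> j :> nat by move=> e; apply: (Hj i); apply: ord_inj.
        have hj := ltn_ord j.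
        have [jk|jk|jk] := ltngtP j k.
        - exists (inord j); first by move/(congr1 val); rewrite /= inordK; lia.
          move=> i /(congr1 val); rewrite /= inordK => [e|]; last by lia.
          by apply: (Hj i); rewrite E1 e; lia.
        - exists (inord j.+1); first by move/(congr1 val); rewrite /= inordK; lia.
          move=> i /(congr1 val); rewrite /= inordK => [e|]; last by lia.
          by apply: (Hj i); rewrite E1 e; lia.
        - by apply: fin => i e; apply: (Hj i); rewrite E1 e; lia.
      * apply: fin => i ei.
        have e' : psnd n k (h i) = 0 :> nat := congr1 (fun t : hom l 1 => t i : nat) e.
        by rewrite E2 ei ltnS leqnn in e'.
      * apply: fin => i ei.
        have : (psnd n k (h i) = 0 :> nat -> pfst n k (h i) <= k') /\
               (psnd n k (h i) = 1 :> nat -> k' <= pfst n k (h i)) := h3 i.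
        by rewrite E1 E2 ei; lia.
    + case=> j jk hj.
      have jk' : j <> k :> nat by move=> e; apply: jk; apply: ord_inj.
      have hj' i : h i <> j :> nat by move=> e; apply: (hj i); apply: ord_inj.
      have hjn := ltn_ord j.
      have [jk2|jk2|jk2] := ltngtP j k.+1.
      * left; left; exists (inord j) => // i e; apply: (hj' i).
        have : pfst n k (h i) = (inord j : 'I_n.+1) :> nat := congr1 val e.
        by rewrite E1 inordK; lia.
      * left; left; exists (inord j.-1) => // i e; apply: (hj' i).
        have : pfst n k (h i) = (inord j.-1 : 'I_n.+1) :> nat := congr1 val e.
        by rewrite E1 inordK; lia.
      * case: (ltnP k n) => kn3.
          right; exists k.+1; split; [rewrite /k; lia|lia|move=> i].
          change ((psnd n k (h i) = 0 :> nat -> pfst n k (h i) <= k.+1) /\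
               (psnd n k (h i) = 1 :> nat -> k.+1 <= pfst n k (h i))).
          by have := hj' i; rewrite E1 E2; lia.
        left; right; apply: hom_eq => i; apply: ord_inj.
        apply: etrans (E2 i) _; have := hj' i; have := ltn_ord (h i).
        by rewrite /=; lia.
  - by case: ne; exact: (prism_inj kn (congr1 fst e) (congr1 snd e)).
  exists R'; split=> // [l q x /R0R/RR' //|l [f t]].
  rewrite R'd Rd; split=> [[[?|[k' [h1 h2 h3]]]|h]|[h|[k' [h1 h2 h3]]]].
  - by left.
  - by right; exists k'; split=> //; lia.
  - right; exists k; split=> //.
    by apply/in_prismP => //; case: h => h [-> ->]; exists h.
  - by left; left.
  - case: (ltnP k k') => h4; first by left; right; exists k'; split=> //; rewrite /k in h4; lia.
    have ek : k' = k by rewrite /k in h4 *; lia.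
    right; have /(in_prismP _ _ kn) [h [-> ->]] : in_prism k f t by rewrite -ek.
    by exists h.
have [R [RP Rv R0R Rd]] := key n.+1 (leqnn _).
have tot l (f : hom l n) (t : hom l 1) : dom R ((f, t) : sprod (simplex n) (simplex 1) l).
  apply/Rd; right.
  (* A simplex (f, t) lies in the prism number f i, where i is the last index with t i = 0; if t is
     constantly 1, prism 0 will do. *)
  have [[i0 hi0]|all1] := pselect (exists i, t i = 0 :> nat); last first.
    exists 0; split=> // [|i]; first by lia.
    by split=> // h; case: all1; exists i.
  have [i /eqP hi imax] := @arg_maxnP _ i0 (fun i => t i == 0 :> nat) (fun i => i)
    (introT eqP hi0).
  exists (f i); split; [lia|by have := ltn_ord (f i)|move=> j; split=> hj].
    by apply: (svalP f); apply: imax; apply/eqP.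
  apply: (svalP f); rewrite leqNgt; apply/negP => ji.
  have : t j <= t i := svalP t _ _ (ltnW ji).
  by have {}hj : t j = 1 :> nat := hj; rewrite hj hi.
have [l [f t]|w wR] := total_pmap RP; first exact: tot.
exists w; split=> [l q x Rx|l q]; last exact: Rv (wR l q).
exact: RP.1 (wR l q) (R0R _ _ _ Rx).
Qed.

Section SimplexRetract.
Variables (n : nat) (k : 'I_n.+1).

Lemma hmax_mono m (f : hom m n) (t : hom m 1) (i j : 'I_m.+1) : i <= j ->
  (if t i == ord0 then f i else inord (maxn (f i) k)) <=
  (if t j == ord0 then f j else inord (maxn (f j) k)).
Proof.
move=> ij; have h1 : f i <= f j := svalP f _ _ ij; have h2 : t i <= t j := svalP t _ _ ij.
have hi := ltn_ord (f i); have hj := ltn_ord (f j); have hk := ltn_ord k.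
case: eqP => [ei|ni]; case: eqP => [ej|ej]; rewrite ?inordK; try lia.
by case: ni; apply: ord_inj; rewrite ej /= in h2 *; lia.
Qed.
(** A deformation of the n-simplex into the face on the vertices k, ..., n, meant for the target
    half of Δ^(2m+1). *)
Program Definition hmax : smap (sprod (simplex n) (simplex 1)) (simplex n) :=
  @SMap (sprod (simplex n) (simplex 1)) (simplex n)
    (fun m q => mk_hom (@hmax_mono m q.1 q.2)) _.
Next Obligation. exact: hom_eq. Qed.

End SimplexRetract.

(** Pushout products are associative: a problem for A in B against [pexp] is one against p for A x
    K' ∪ B x L' in B x K'. The maps [sw] and [ws] exchange the factors K and K'. *)
Lemma ELP_exp (K K' : sSet) L L' (HL' : @subclosed K' L') (X Y : sSet) (p : smap X Y) :
  @subclosed K L -> ELP L p -> ELP L (pexp p (incl HL')).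
Proof.
move=> HL E B A v R HA RP Rv Rd.
pose v1 : smap (sprod B K) (mapsp (subsset HL') X) := scomp (pb_fst _ _) v.
pose v2 : smap (sprod B K) (mapsp K' Y) := scomp (pb_snd _ _) v.
pose sw : smap (sprod (sprod B K') K) (sprod (sprod B K) K') :=
  @SMap (sprod (sprod B K') K) (sprod (sprod B K) K')
    (fun n q => ((q.1.1, q.2), q.1.2)) (fun _ _ _ _ => erefl).
pose ws : smap (sprod (sprod B K) K') (sprod (sprod B K') K) :=
  @SMap (sprod (sprod B K) K') (sprod (sprod B K') K)
    (fun n q => ((q.1.1, q.2), q.1.2)) (fun _ _ _ _ => erefl).
pose R1 : pmap (sprod (sprod B K') K) X := fun n q x =>
  exists g, R n (q.1.1, q.2) g /\ x = g n (hid n, q.1.2).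
pose R2 : pmap (sprod (sprod B K') K) X := fun n q x =>
  exists h : L' n q.1.2, x = uncurry v1 n ((q.1.1, q.2), exist _ q.1.2 h).
have R1P : is_pmap R1.
  split=> [n q x x' [g [Rg ->]] [g' [Rg' ->]]|m n f q x [g [Rg ->]]].
    by rewrite (RP.1 _ _ _ _ Rg Rg').
  exists (act _ f g); split; first exact: (RP.2 _ _ f (q.1.1, q.2) _ Rg).
  by rewrite act_mapsp -smapE act_sprod act_simplex hcomp1 hcomp1l.
have R2P : is_pmap R2.
  split=> [n q x x' [h ->] [h' ->]|m n f q x [h ->]].
    by congr (uncurry v1 n (_, exist _ _ _)).
  exists (HL' _ _ f _ h); rewrite -smapE; congr (uncurry v1 m (_, _)); exact: eq_exist.
have HA' : @subclosed (sprod B K') (fun n q => A n q.1 \/ L' n q.2).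
  by move=> m n f q [h|h]; [left; exact: HA|right; exact: (HL' m n f q.2 h)].
have [||n q|w [wR wv]] := E _ _ (scomp (uncurry v2) sw) (punion R1 R2) HA'.
- apply: punion_is_pmap => // n q x y [g [Rg ->]] [h ->].
  exact: ((pexpE (Rv _ _ _ Rg)).1 n (hid n) (exist _ q.1.2 h)).
- move=> n q x [[g [Rg ->]]|[h ->]].
    exact: ((pexpE (Rv _ _ _ Rg)).2 n (hid n, q.1.2)).
  exact: (pexp_pb (v n (q.1.1, q.2)) (hid n) (exist _ q.1.2 h)).
- split=> [[x [[g [Rg _]]|[h _]]]|].
  + have /Rd [/= h|/= h] : dom R ((q.1.1, q.2) : sprod B K n) by exists g.
      by left; left.
    by right.
  + by left; right.
  + case=> [[h|h]|h].
    * have [g Rg] : dom R ((q.1.1, q.2) : sprod B K n) by apply/Rd; left.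
      by exists (g n (hid n, q.1.2)); left; exists g.
    * by exists (uncurry v1 n ((q.1.1, q.2), exist _ q.1.2 h)); right; exists h.
    * have [g Rg] : dom R ((q.1.1, q.2) : sprod B K n) by apply/Rd; right.
      by exists (g n (hid n, q.1.2)); left; exists g.
exists (curry (scomp w ws)); split=> [n [b t] g Rg|n [b t]].
  apply: smap_eq => j [f t'] /=; apply: wR; left.
  exists (act _ f g); split; first exact: (RP.2 _ _ f (b, t) _ Rg).
  by rewrite act_mapsp hcomp1.
apply: sub_eq; rewrite [RHS]surjective_pairing.
congr (_, _); apply: smap_eq => j [f t'] /=; last first.
  by rewrite wv /=; rewrite (smapE v f (b, t)) /= hcomp1.
apply: wR; right; case: t' => t' h; exists h => /=.
by rewrite (smapE v f (b, t)) /= hcomp1.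
Qed.

(** * Homotopies and equivalences *)

Notation jF n := (deg J n (J_end false)).
Notation jT n := (deg J n (J_end true)).

Definition img_pmap (B X Y : sSet) (p : smap X Y) (R : pmap B X) : pmap B Y :=
  fun n b y => exists x, R n b x /\ y = p n x.
Lemma img_is_pmap (B X Y : sSet) (p : smap X Y) (R : pmap B X) :
  is_pmap R -> is_pmap (img_pmap p R).
Proof.
move=> RP; split=> [n b y y' [x [h ->]] [x' [h' ->]]|m n f b y [x [h ->]]].
  by rewrite (RP.1 _ _ _ _ h h').
by exists (act X f x); rewrite smapE; split=> //; apply: RP.2.
Qed.

Lemma ELP_comp (K : sSet) L (X Y Z : sSet) (p : smap X Y) (q : smap Y Z) :
  @ELP K L _ _ p -> ELP L q -> ELP L (scomp q p).
Proof.
move=> Ep Eq B A v R HA RP Rv Rd.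
have [|n b y [x [/Rv h ->]]|n b|wY [wYR wYv]] := Eq B A v (img_pmap p R) HA.
- exact: img_is_pmap.
- exact: h.
- rewrite -Rd; split=> [[y [x [h _]]]|[x h]]; first by exists x.
  by exists (p n x), x.
have [n b x h|w [wR wv]] := Ep B A wY R HA RP _ Rd.
  by symmetry; apply: wYR; exists x.
by exists w; split=> // n b; rewrite /= wv wYv.
Qed.

Lemma ELP_pb_snd (K : sSet) L (X Y Z : sSet) (p : smap X Z) (f : smap Y Z) :
  @ELP K L _ _ p -> ELP L (pb_snd p f).
Proof.
move=> Ep B A v R HA RP Rv Rd.
have [|n b y [x [/Rv h ->]]|n b|w [wR wv]] :=
  Ep B A (scomp f v) (img_pmap (pb_fst p f) R) HA.
- exact: img_is_pmap.
- by rewrite /= -h; exact: (svalP x).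
- rewrite -Rd; split=> [[y [x [h _]]]|[x h]]; first by exists x.
  by exists (pb_fst p f n x), x.
exists (sub_lift (@pullback_closed _ _ _ p f) (f := pair_map w v) wv).
split=> // n b x Rx; apply: sub_eq; rewrite /= [RHS]surjective_pairing; congr (_, _).
  by apply: wR; exists x.
by rewrite -(Rv _ _ _ Rx).
Qed.

Lemma ELP_pb_fst (K : sSet) L (X Y Z : sSet) (p : smap X Z) (f : smap Y Z) :
  @ELP K L _ _ p -> ELP L (pb_fst f p).
Proof.
move=> Ep B A v R HA RP Rv Rd.
have [|n b y [x [/Rv h ->]]|n b|w [wR wv]] :=
  Ep B A (scomp f v) (img_pmap (pb_snd f p) R) HA.
- exact: img_is_pmap.
- by rewrite /= -h; exact: esym (svalP x).
- rewrite -Rd; split=> [[y [x [h _]]]|[x h]]; first by exists x.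
  by exists (pb_snd f p n x), x.
exists (sub_lift (@pullback_closed _ _ _ f p) (f := pair_map v w) (fun n x => esym (wv n x))).
split=> // n b x Rx; apply: sub_eq; rewrite /= [RHS]surjective_pairing; congr (_, _).
  by rewrite -(Rv _ _ _ Rx).
by apply: wR; exists x.
Qed.

Definition TF (X Y : sSet) (p : smap X Y) : Prop :=
  forall (B : sSet) (v : smap B Y) (R : pmap B X), is_pmap R -> pover p v R ->
  exists w : smap B X, extends R w /\ (forall n b, p n (w n b) = v n b).

Lemma TFP (X Y : sSet) (p : smap X Y) : trivial_kan_fibration p <-> TF p.
Proof.
split=> [h B v R|h n u v uv]; first exact: tfib_ext.
pose R : pmap (simplex n) X := fun m f x =>
  exists h : exists2 j, True & forall i, happ f i <> j, x = u m (exist _ f h).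
have [|m f x [l ->]|w [wR wv]] := h _ v R.
- split=> [m f x x' [l ->] [l' ->]|m k g f x [l ->]]; first by congr (u m (exist _ _ _)).
  exists (@faces_closed n _ _ _ g _ l); rewrite -smapE; congr (u m _); exact: sub_eq.
- by rewrite uv.
exists w; split=> // m [f l]; by apply: wR; exists l.
Qed.

(** Homotopies are parametrised by J, so lifting against J alone suffices to compose them; this is
    the notion of fibrant object for the calculus of equivalences and homotopy pullbacks. *)
Notation isfib X := (FJ (to_point X)).

Lemma isfib_total (X Y : sSet) (p : smap X Y) : FJ p -> isfib Y -> isfib X.
Proof. by move=> h1 h2; have := ELP_comp h1 h2; congr ELP; apply: smap_eq. Qed.

Lemma homotopicP (X Y : sSet) (f g : smap X Y) : homotopic f g <->
  exists H : smap (sprod X J) Y,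
    (forall n x, H n (x, jF n) = f n x) /\ (forall n x, H n (x, jT n) = g n x).
Proof.
split=> [[h [h0 h1]]|[H [h0 h1]]].
  by exists (uncurry h); split=> n x; [apply: h0|apply: h1].
by exists (curry H); split=> n x; rewrite /= act_id; [apply: h0|apply: h1].
Qed.

Lemma homotopic_refl (X Y : sSet) (f : smap X Y) : homotopic f f.
Proof. by apply/homotopicP; exists (scomp f (sfst _ _)). Qed.

Definition Jneg : smap J J := @SMap J J (fun n s i => ~~ s i) (fun _ _ _ _ => erefl).
Definition revJ (X : sSet) : smap (sprod X J) (sprod X J) :=
  pair_map (sfst _ _) (scomp Jneg (ssnd _ _)).

Lemma homotopic_sym (X Y : sSet) (f g : smap X Y) : homotopic f g -> homotopic g f.
Proof.
move/homotopicP=> [H [h0 h1]]; apply/homotopicP; exists (scomp H (revJ X)).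
by split=> n x; [apply: h1|apply: h0].
Qed.

Lemma homotopic_post (X Y Z : sSet) (k : smap Y Z) (f g : smap X Y) :
  homotopic f g -> homotopic (scomp k f) (scomp k g).
Proof.
move/homotopicP=> [H [h0 h1]]; apply/homotopicP; exists (scomp k H).
by split=> n x; rewrite /= ?h0 ?h1.
Qed.

Lemma homotopic_pre (X Y Z : sSet) (k : smap X Y) (f g : smap Y Z) :
  homotopic f g -> homotopic (scomp f k) (scomp g k).
Proof.
move/homotopicP=> [H [h0 h1]]; apply/homotopicP.
exists (scomp H (pair_map (scomp k (sfst _ _)) (ssnd _ _))).
by split=> n x; rewrite /= ?h0 ?h1.
Qed.

Lemma homotopic_eq (X Y : sSet) (f g : smap X Y) : (forall n x, f n x = g n x) -> homotopic f g.
Proof. by move/smap_eq ->; apply: homotopic_refl. Qed.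

(** An open box in J x J: the bottom [h0] and the two sides [s0], [s1] are prescribed, and the
    fourth side of the filler is a composite of homotopies lying over a chosen path in the base.
    [FJ] applies with A the two ends of the first J. *)
Lemma square_lift (B X Y : sSet) (p : smap X Y) (v : smap (sprod (sprod B J) J) Y)
    (h0 s0 s1 : smap (sprod B J) X) : FJ p ->
  (forall n b, s0 n (b, jF n) = h0 n (b, jF n)) ->
  (forall n b, s1 n (b, jF n) = h0 n (b, jT n)) ->
  (forall n b s, p n (h0 n (b, s)) = v n ((b, s), jF n)) ->
  (forall n b t, p n (s0 n (b, t)) = v n ((b, jF n), t)) ->
  (forall n b t, p n (s1 n (b, t)) = v n ((b, jT n), t)) ->
  exists w : smap (sprod (sprod B J) J) X,
  [/\ forall n b s, w n ((b, s), jF n) = h0 n (b, s),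
      forall n b t, w n ((b, jF n), t) = s0 n (b, t),
      forall n b t, w n ((b, jT n), t) = s1 n (b, t) &
      forall n q, p n (w n q) = v n q].
Proof.
move=> fj e0 e1 p0 ps0 ps1.
pose P0 n (q : sprod (sprod B J) J n) := q.2 = jF n.
pose PF n (q : sprod (sprod B J) J n) := q.1.2 = jF n.
pose PT n (q : sprod (sprod B J) J n) := q.1.2 = jT n.
have C0 : subclosed P0 by move=> m n f q h; apply: (atv_closed f h).
have CF : subclosed PF by move=> m n f q h; apply: (atv_closed f h).
have CT : subclosed PT by move=> m n f q h; apply: (atv_closed f h).
pose g : smap (sprod (sprod B J) J) (sprod B J) :=
  pair_map (scomp (sfst _ _) (sfst _ _)) (ssnd _ _).
have [||n [[b s] t] x|n q|w [wR wv]] := fj _ (fun n (q : sprod B J n) => q.2 = jF n \/ q.2 = jT n) v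
   (punion (on P0 (scomp h0 (sfst _ _))) (punion (on PF (scomp s0 g)) (on PT (scomp s1 g)))).
- by move=> m n f q [h|h]; [left|right]; apply: (atv_closed f h).
- apply: punion_is_pmap; first exact: on_is_pmap.
    apply: punion_is_pmap; try exact: on_is_pmap.
    by move=> n q x y [h _] [h' _]; move: h'; rewrite /PT h => /J_endsE.
  move=> n [[b s] t] x y [/= h ->] [] [/= h' ->] /=.
    by rewrite (h : t = _) (h' : s = _) e0.
  by rewrite (h : t = _) (h' : s = _) e1.
- case=> [[/= h ->]|[[/= h ->]|[/= h ->]]].
  + by rewrite /= p0 (h : t = _).
  + by rewrite /= ps0 (h : s = _).
  + by rewrite /= ps1 (h : s = _).
- split=> [[x [[h _]|[[h _]|[h _]]]]|[[h|h]|h]].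
  + by right.
  + by left; left.
  + by left; right.
  + by exists (s0 n (g n q)); right; left.
  + by exists (s1 n (g n q)); right; right.
  + by exists (h0 n q.1); left.
exists w; split=> // n b s; apply: wR.
- by left; split.
- by right; left; split.
- by right; right; split.
Qed.

Definition cstJ (X : sSet) (b : bool) : smap X (sprod X J) :=
  pair_map (sid _) (@SMap X J (fun n _ => deg J n (J_end b)) (fun _ _ f _ => esym (act_deg f (J_end b)))).

Lemma homotopic_trans (X Y : sSet) (f g h : smap X Y) : isfib Y ->
  homotopic f g -> homotopic g h -> homotopic f h.
Proof.
move=> fY /homotopic_sym/homotopicP [H1 [a0 a1]] /homotopicP [H2 [b0 b1]].
have [|||||w [w1 w2 w3 _]] := @square_lift X Y _ _ (to_point _) H2 H1 (scomp h (sfst _ _)) fY.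
1,2: by move=> n b; rewrite /= ?a0 ?b0 ?b1.
1-3: by [].
apply/homotopicP; exists (scomp w (cstJ _ true)); split=> n x /=; first by rewrite w2 a1.
by rewrite w3.
Qed.

Lemma tfib_homotopic (A X Y : sSet) (p : smap X Y) (f g : smap A X) :
  trivial_kan_fibration p -> (forall n x, p n (f n x) = p n (g n x)) ->
  exists H : smap (sprod A J) X, [/\ forall n x, H n (x, jF n) = f n x,
    forall n x, H n (x, jT n) = g n x & forall n q, p n (H n q) = p n (f n q.1)].
Proof.
move=> /TFP tp e.
pose PF n (q : sprod A J n) := q.2 = jF n.
pose PT n (q : sprod A J n) := q.2 = jT n.
have [||w [wR wv]] := tp _ (scomp p (scomp f (sfst _ _)))
   (punion (on PF (scomp f (sfst _ _))) (on PT (scomp g (sfst _ _)))).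
- apply: punion_is_pmap; try (apply: on_is_pmap; move=> m n h q h'; exact: (atv_closed h h')).
  by move=> n q x y [h _] [h' _]; move: h'; rewrite /PT h => /J_endsE.
- by move=> n q x [[_ ->]|[_ ->]] //=; rewrite e.
by exists w; split=> // n x; apply: wR; [left|right]; split.
Qed.

Lemma tfib_section (X Y : sSet) (p : smap X Y) : trivial_kan_fibration p ->
  exists s : smap Y X, forall n y, p n (s n y) = y.
Proof.
move=> /TFP tp; have [||w [_ wv]] := tp _ (sid _) (@empty_pmap Y X); try by [].
by exists w.
Qed.

Lemma tfib_is_equiv (X Y : sSet) (p : smap X Y) : trivial_kan_fibration p -> is_equiv p.
Proof.
move=> tp; have [s ps] := tfib_section tp.
exists s; split; last exact: homotopic_eq.
have [|H [H0 H1 _]] := tfib_homotopic (f := scomp s p) (g := sid _) tp.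
  by move=> n x; rewrite /= ps.
by apply/homotopicP; exists H.
Qed.

Lemma scompA (X Y Z W : sSet) (h : smap Z W) (g : smap Y Z) (f : smap X Y) :
  scomp h (scomp g f) = scomp (scomp h g) f.
Proof. exact: smap_eq. Qed.
Lemma scomp1 (X Y : sSet) (f : smap X Y) : scomp f (sid X) = f.
Proof. exact: smap_eq. Qed.
Lemma scomp1l (X Y : sSet) (f : smap X Y) : scomp (sid Y) f = f.
Proof. exact: smap_eq. Qed.

Lemma equiv_comp (X Y Z : sSet) (f : smap X Y) (g : smap Y Z) : isfib X -> isfib Z ->
  is_equiv f -> is_equiv g -> is_equiv (scomp g f).
Proof.
move=> fX fZ [f' [a b]] [g' [c d]]; exists (scomp f' g'); split.
  apply: homotopic_trans a => //; have := homotopic_pre f (homotopic_post f' c).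
  by rewrite scomp1 !scompA.
apply: homotopic_trans d => //; have := homotopic_pre g' (homotopic_post g b).
by rewrite scomp1 !scompA.
Qed.

Lemma equiv_homotopic (X Y : sSet) (f g : smap X Y) : isfib X -> isfib Y ->
  homotopic f g -> is_equiv f -> is_equiv g.
Proof.
move=> fX fY /homotopic_sym h [f' [a b]]; exists f'; split.
  by apply: homotopic_trans a => //; apply: homotopic_post.
by apply: homotopic_trans b => //; apply: homotopic_pre.
Qed.

Lemma equiv_cancel_l (X Y Z : sSet) (f : smap X Y) (g : smap Y Z) : isfib Y ->
  is_equiv (scomp g f) -> is_equiv g -> is_equiv f.
Proof.
move=> fY [k [a b]] [g' [c d]]; exists (scomp k g); split; first by rewrite -scompA.
have h1 := homotopic_pre (scomp f (scomp k g)) c.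
have h2 := homotopic_pre g (homotopic_post g' b).
rewrite scomp1l in h1; rewrite scomp1 in h2.
apply: (homotopic_trans fY (homotopic_sym h1)).
by apply: (homotopic_trans fY _ c); move: h2; rewrite !scompA.
Qed.

Lemma equiv_cancel_r (X Y Z : sSet) (f : smap X Y) (g : smap Y Z) : isfib Y ->
  is_equiv (scomp g f) -> is_equiv f -> is_equiv g.
Proof.
move=> fY [k [a b]] [f' [c d]]; exists (scomp f k); split; last by rewrite scompA.
have h1 := homotopic_post (scomp (scomp f k) g) d.
have h2 := homotopic_pre f' (homotopic_post f a).
rewrite !scomp1 in h1 h2.
apply: (homotopic_trans fY (homotopic_sym h1)).
by apply: (homotopic_trans fY _ d); move: h2; rewrite !scompA.
Qed.

(* A section of p is homotopic to the inverse, and the homotopy can be made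
   fibrewise; a lift up to fibrewise homotopy is then corrected. *)
Lemma fib_equiv_tfib (N Z : sSet) (p : smap N Z) : FJ p -> isfib N -> is_equiv p ->
  trivial_kan_fibration p.
Proof.
move=> fj fN [g [/homotopic_sym a /homotopicP [bh [b0 b1]]]].
have [||n q x [h ->]|n q|L [LR Lv]] := fj Z (fun _ _ => False) bh
    (on (fun n (q : sprod Z J n) => q.2 = jF n) (scomp g (sfst _ _))).
- by [].
- by apply: on_is_pmap => m n f q h; apply: (atv_closed f h).
- by case: q h => z t /= ->; rewrite b0.
- by split=> [[x [h _]]|[//|h]]; [right|exists (g n q.1)].
pose s := scomp L (cstJ _ true).
have ps n z : p n (s n z) = z by rewrite /= Lv b1.
have gs : homotopic g s.
  by apply/homotopicP; exists L; split=> // n x; apply: LR.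
have /homotopicP [H [H0 H1]] : homotopic (sid N) (scomp s p).
  by apply: homotopic_trans a _ => //; apply: homotopic_pre.
(* Over ((b, s), t) the base point is p (H (b, t reversed)), whatever s is. The box has constant
   bottom s p and as sides H and s p H, both reversed, so its side at t = [jT] is a homotopy from
   the identity to s p over constant paths. *)
have [|||||G [_ G2 G3 Gv]] := @square_lift N N Z p (scomp (scomp p H)
   (scomp (revJ N) (pair_map (scomp (sfst _ _) (sfst _ _)) (ssnd _ _))))
   (scomp (scomp s p) (sfst _ _)) (scomp H (revJ N)) (scomp (scomp (scomp s p) H) (revJ N)) fj.
- by move=> n z; exact: H1.
- by move=> n z; rewrite /= [H n _]H1 /= ps.
- by move=> n z t; rewrite /= [H n _]H1 /= ps.
- by [].
- by move=> n z t; rewrite /= ps.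
apply/TFP => B v R RP Rv.
(* This homotopy run backwards joins s p x' to x' over a constant path. Starting from the lift s v
   on all of B, it is extended from the domain of R, and its end is a lift that extends R. *)
pose R2 : pmap (sprod B J) N := fun n q x =>
  exists x', R n q.1 x' /\ x = G n ((x', Jneg n q.2), jT n).
have R2P : is_pmap R2.
  split=> [n q x x' [y [h ->]] [y' [h' ->]]|m n f q x [y [h ->]]].
    by rewrite (RP.1 _ _ _ _ h h').
  by exists (act N f y); split; [apply: RP.2|rewrite -smapE].
pose PF n (q : sprod B J n) := q.2 = jF n.
have GF n x : G n ((x, jF n), jT n) = x by rewrite G2; exact: H0.
have GT n x : G n ((x, jT n), jT n) = s n (p n x) by rewrite G3 /= [H n _]H0.
have [||n q x|n q|w [wR wv]] := fj B (fun n b => dom R b) (scomp v (sfst _ _))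
    (punion (on PF (scomp (scomp s v) (sfst _ _))) R2).
- by move=> m n f b h; apply: dom_act.
- apply: punion_is_pmap => //; first by apply: on_is_pmap => m n f q h; apply: (atv_closed f h).
  move=> n q x y [/= h ->] [x' [Rx' ->]].
  by rewrite (h : q.2 = _) [Jneg _ _](_ : _ = jT n) // GT (Rv _ _ _ Rx').
- case=> [[/= h ->]|[x' [Rx' ->]]]; first by rewrite -[RHS]ps.
  by rewrite Gv /= [H n _]H0 /=; apply: Rv.
- split=> [[x [[h _]|[x' [h _]]]]|[[x h]|h]].
  + by right.
  + by left; exists x'.
  + by exists (G n ((x, Jneg n q.2), jT n)); right; exists x.
  + by exists (s n (v n q.1)); left.
exists (scomp w (cstJ _ true)); split=> [n b x Rx|n b]; last by rewrite /= wv.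
by apply: wR; right; exists x; split=> //; rewrite -[LHS]GF.
Qed.

(** * Homotopy pullbacks *)

Lemma ELPo (K : sSet) L (X : sSet) :
  (forall (B : sSet) (A : forall n, B n -> Prop) (R : pmap (sprod B K) X),
    subclosed A -> is_pmap R ->
    (forall n (q : sprod B K n), dom R q <-> A n q.1 \/ L n q.2) ->
    exists w : smap (sprod B K) X, extends R w) -> ELP L (to_point X).
Proof.
by move=> H B A v R HA RP _ Rd; have [w wR] := H B A R HA RP Rd; exists w; split=> // n q; case: (v n q).
Qed.

Lemma ELPoE (K : sSet) L (X : sSet) : @ELP K L _ _ (to_point X) ->
  forall (B : sSet) (A : forall n, B n -> Prop) (R : pmap (sprod B K) X),
    subclosed A -> is_pmap R ->
    (forall n (q : sprod B K n), dom R q <-> A n q.1 \/ L n q.2) ->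
    exists w : smap (sprod B K) X, extends R w.
Proof. by move=> H B A R HA RP Rd; have [//|w [wR _]] := H B A (to_point _) R HA RP _ Rd; exists w. Qed.

Lemma dom_img (B X Y : sSet) (p : smap X Y) (R : pmap B X) n (b : B n) :
  dom (img_pmap p R) b <-> dom R b.
Proof. by split=> [[y [x [h _]]]|[x h]]; [exists x|exists (p n x), x]. Qed.

Lemma ELP_retract_obj (K : sSet) L (X X' : sSet) (s : smap X X') (r : smap X' X) :
  (forall n x, r n (s n x) = x) -> @ELP K L _ _ (to_point X') -> ELP L (to_point X).
Proof.
move=> rs E; apply: ELPo => B A R HA RP Rd.
have [||w wR] := ELPoE E HA (R := img_pmap s R).
- exact: img_is_pmap.
- by move=> n q; rewrite dom_img.
by exists (scomp r w) => n q x Rx; rewrite -[RHS]rs; congr (r n _); apply: wR; exists x.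
Qed.

Lemma iso_equiv (X Y : sSet) (f : smap X Y) (g : smap Y X) :
  (forall n x, g n (f n x) = x) -> (forall n y, f n (g n y) = y) -> is_equiv f.
Proof. by move=> gf fg; exists g; split; apply: homotopic_eq. Qed.

Lemma ELP_sprod (K : sSet) L (X Y : sSet) : @ELP K L _ _ (to_point X) ->
  @ELP K L _ _ (to_point Y) -> ELP L (to_point (sprod X Y)).
Proof.
move=> EX EY; apply: ELPo => B A R HA RP Rd.
have [||w1 w1R] := ELPoE EX HA (R := img_pmap (sfst _ _) R).
- exact: img_is_pmap.
- by move=> n q; rewrite dom_img.
have [||w2 w2R] := ELPoE EY HA (R := img_pmap (ssnd _ _) R).
- exact: img_is_pmap.
- by move=> n q; rewrite dom_img.
exists (pair_map w1 w2) => n q [x y] h /=.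
by congr (_, _); [apply: w1R|apply: w2R]; exists (x, y).
Qed.

Lemma ELP_ssnd (K : sSet) L (X Y : sSet) : @ELP K L _ _ (to_point X) -> ELP L (ssnd X Y).
Proof.
move=> EX B A v R HA RP Rv Rd.
have [||w1 w1R] := ELPoE EX HA (R := img_pmap (sfst _ _) R).
- exact: img_is_pmap.
- by move=> n q; rewrite dom_img.
exists (pair_map w1 v); split=> // n q [x y] h /=.
by congr (_, _); [apply: w1R; exists (x, y)|rewrite -(Rv _ _ _ h)].
Qed.

Definition ppair (D : sSet) := pair_map (path_start D) (path_end D).

(** Adding the two ends of J to A turns a problem for B x K against the path fibration into one for
    (B x J) x K against D. *)
Lemma ELP_ppair (K : sSet) L (D : sSet) :
  @subclosed K L -> ELP L (to_point D) -> ELP L (ppair D).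
Proof.
move=> HL E B A v R HA RP Rv Rd.
pose P b n (q : sprod (sprod B J) K n) := q.1.2 = deg J n (J_end b).
have HP b : subclosed (P b) by move=> m n f q h; apply: (atv_closed f h).
pose g : smap (sprod (sprod B J) K) (sprod B K) :=
  pair_map (scomp (sfst _ _) (sfst _ _)) (ssnd _ _).
pose R1 : pmap (sprod (sprod B J) K) D := fun n q x =>
  exists y, R n (g n q) y /\ x = y n (hid n, q.1.2).
have R1P : is_pmap R1.
  split=> [n q x x' [y [Ry ->]] [y' [Ry' ->]]|m n f q x [y [Ry ->]]].
    by rewrite (RP.1 _ _ _ _ Ry Ry').
  exists (act _ f y); split; first exact: (RP.2 _ _ f _ _ Ry).
  by rewrite act_mapsp -smapE act_sprod act_simplex hcomp1 hcomp1l.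
have [|||w wR] := ELPoE E (B := sprod B J) (A := fun n q => A n q.1 \/ (q.2 = jF n \/ q.2 = jT n))
  (R := punion R1 (punion (on (P false) (scomp (sfst _ _) (scomp v g)))
                          (on (P true) (scomp (ssnd _ _) (scomp v g))))).
- move=> m n f q [h|[h|h]]; first by left; apply: HA.
    by right; left; apply: (atv_closed f h).
  by right; right; apply: (atv_closed f h).
- apply: punion_is_pmap => //.
    apply: punion_is_pmap; try exact: on_is_pmap.
    by move=> n q x y [h _] [h' _]; move: h'; rewrite /P h => /J_endsE.
  move=> n q x y [z [/Rv Rz ->]] [] [h ->] /=.
    by rewrite (h : q.1.2 = _) -Rz.
  by rewrite (h : q.1.2 = _) -Rz.
- move=> n q; split.
    case=> x [[z [h _]]|[[h _]|[h _]]].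
    + have /Rd [/= h'|/= h'] : dom R (g n q) by exists z.
        by left; left.
      by right.
    + by left; right; left.
    + by left; right; right.
  case=> [[h|[h|h]]|h].
  + have [z Rz] : dom R (g n q) by apply/Rd; left.
    by exists (z n (hid n, q.1.2)); left; exists z.
  + by exists (v n (g n q)).1; right; left.
  + by exists (v n (g n q)).2; right; right.
  + have [z Rz] : dom R (g n q) by apply/Rd; right.
    by exists (z n (hid n, q.1.2)); left; exists z.
pose sw : smap (sprod (sprod B K) J) (sprod (sprod B J) K) :=
  @SMap (sprod (sprod B K) J) (sprod (sprod B J) K)
    (fun n q => ((q.1.1, q.2), q.1.2)) (fun _ _ _ _ => erefl).
exists (curry (scomp w sw)); split=> [n [b t] z Rz|n [b t]].
  apply: smap_eq => j [f s] /=; apply: wR; left.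
  exists (act _ f z); split; first exact: (RP.2 _ _ f (b, t) _ Rz).
  by rewrite act_mapsp hcomp1.
rewrite /= !act_id [RHS]surjective_pairing.
by congr (_, _); apply: wR; right; [left|right].
Qed.

Section HPullback.
Variables (A B D : sSet) (a : smap A D) (b : smap B D).

Lemma hpb_ends n (z : hpullback a b n) :
  path_start D n (hpb_path a b n z) = a n (hpb_fst a b n z) /\
  path_end D n (hpb_path a b n z) = b n (hpb_snd a b n z).
Proof. by case: z => -[[x y] g] /= []. Qed.

Lemma hpb_eq n (z z' : hpullback a b n) : hpb_fst a b n z = hpb_fst a b n z' ->
  hpb_snd a b n z = hpb_snd a b n z' -> hpb_path a b n z = hpb_path a b n z' -> z = z'.
Proof.
case: z z' => -[[x y] g] h [[[x' y'] g'] h'] /= e1 e2 e3.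
by apply: eq_exist; rewrite e1 e2 e3.
Qed.

Program Definition hpb_mk (X : sSet) (al : smap X A) (be : smap X B) (G : smap (sprod X J) D)
    (e0 : forall n x, G n (x, jF n) = a n (al n x))
    (e1 : forall n x, G n (x, jT n) = b n (be n x)) : smap X (hpullback a b) :=
  @SMap X (hpullback a b) (fun n x => exist _ ((al n x, be n x), curry G n x) _) _.
Next Obligation. by rewrite /= act_id e0 e1. Qed.
Next Obligation. by apply: hpb_eq; rewrite /= ?smapE //; apply: (smapE (curry G)). Qed.

Definition hpG (X : sSet) (z : smap X (hpullback a b)) : smap (sprod X J) D :=
  uncurry (scomp (hpb_path a b) z).
Lemma hpG0 (X : sSet) (z : smap X (hpullback a b)) n x : hpG z n (x, jF n) = a n (hpb_fst a b n (z n x)).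
Proof. by have [<- _] := hpb_ends (z n x). Qed.
Lemma hpG1 (X : sSet) (z : smap X (hpullback a b)) n x : hpG z n (x, jT n) = b n (hpb_snd a b n (z n x)).
Proof. by have [_ <-] := hpb_ends (z n x). Qed.

Lemma curryK (X K Z : sSet) (g : smap X (mapsp K Z)) : curry (uncurry g) = g.
Proof.
by apply: smap_eq => n x; apply: smap_eq => j [h t]; exact: esym (uncurryE g x h t).
Qed.

Lemma hpb_mapeq (X : sSet) (z z' : smap X (hpullback a b)) :
  (forall n x, hpb_fst a b n (z n x) = hpb_fst a b n (z' n x)) ->
  (forall n x, hpb_snd a b n (z n x) = hpb_snd a b n (z' n x)) ->
  (forall n q, hpG z n q = hpG z' n q) -> forall n x, z n x = z' n x.
Proof.
move=> e1 e2 e3 n x; apply: hpb_eq => //.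
have : curry (hpG z) = curry (hpG z') by congr curry; apply: smap_eq.
by rewrite !curryK => /(congr1 (fun g : smap X (path_space D) => g n x)).
Qed.

Lemma hpG_mk (X : sSet) (al : smap X A) (be : smap X B) (G : smap (sprod X J) D) e0 e1 n q :
  hpG (@hpb_mk X al be G e0 e1) n q = G n q.
Proof. by case: q => x t; rewrite /= act_id. Qed.

Lemma ELP_hpb_pair (K : sSet) L : @subclosed K L -> ELP L (to_point D) ->
  ELP L (pb_fst (prod_map a b) (ppair D)).
Proof. by move=> HL E; apply/ELP_pb_fst/ELP_ppair. Qed.

Lemma ELP_hpb (K : sSet) L : @subclosed K L -> ELP L (to_point A) -> ELP L (to_point B) ->
  ELP L (to_point D) -> ELP L (to_point (hpullback a b)).
Proof.
move=> HL EA EB ED; have := ELP_comp (ELP_hpb_pair HL ED) (ELP_sprod EA EB).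
by congr ELP; apply: smap_eq.
Qed.

Lemma ELP_hpb_snd (K : sSet) L : @subclosed K L -> ELP L (to_point A) ->
  ELP L (to_point D) -> ELP L (hpb_snd a b).
Proof.
move=> HL EA ED; have := ELP_comp (ELP_hpb_pair HL ED) (ELP_ssnd (Y := B) EA).
by congr ELP; apply: smap_eq.
Qed.

End HPullback.

Lemma isfib_hpb (A B D : sSet) (a : smap A D) (b : smap B D) :
  isfib A -> isfib B -> isfib D -> isfib (hpullback a b).
Proof. by apply: ELP_hpb; apply: atv_closed. Qed.

(** * Homotopy invariance of homotopy pullbacks *)

Program Definition hpb_map (A B D D' : sSet) (a : smap A D) (b : smap B D) (a' : smap A D')
    (b' : smap B D') (w : smap D D') (ea : forall n x, a' n x = w n (a n x))
    (eb : forall n x, b' n x = w n (b n x)) : smap (hpullback a b) (hpullback a' b') :=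
  hpb_mk (al := hpb_fst a b) (be := hpb_snd a b) (G := scomp w (hpG (sid _))) _ _.
Next Obligation. by have [e _] := hpb_ends x; rewrite ea -e. Qed.
Next Obligation. by have [_ e] := hpb_ends x; rewrite eb -e. Qed.

Lemma hpG_map (X A B D D' : sSet) (a : smap A D) (b : smap B D) (a' : smap A D')
    (b' : smap B D') (w : smap D D') ea eb (z : smap X (hpullback a b)) n q :
  hpG (scomp (@hpb_map A B D D' a b a' b' w ea eb) z) n q = w n (hpG z n q).
Proof. by rewrite /= hcomp1. Qed.

Lemma hpG_map1 (A B D D' : sSet) (a : smap A D) (b : smap B D) (a' : smap A D')
    (b' : smap B D') (w : smap D D') ea eb n q :
  hpG (@hpb_map A B D D' a b a' b' w ea eb) n q = w n (hpG (sid _) n q).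
Proof. by rewrite /= hcomp1. Qed.

(** Only the path has to be lifted through w, relative to its two ends, which the unchanged
    components in A and B prescribe. *)
Lemma hpb_map_tfib (A B D D' : sSet) (a : smap A D) (b : smap B D) (a' : smap A D')
    (b' : smap B D') (w : smap D D') ea eb :
  trivial_kan_fibration w -> trivial_kan_fibration (@hpb_map A B D D' a b a' b' w ea eb).
Proof.
move=> /TFP tw; apply/TFP => X v R RP Rv.
pose P e n (q : sprod X J n) := q.2 = deg J n (J_end e).
have HP e : subclosed (P e) by move=> m n f q h; apply: (atv_closed f h).
pose R1 : pmap (sprod X J) D := fun n q x =>
  exists z, R n q.1 z /\ x = hpb_path a b n z n (hid n, q.2).
have R1P : is_pmap R1.
  split=> [n q x x' [z [h ->]] [z' [h' ->]]|m n f q x [z [h ->]]].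
    by rewrite (RP.1 _ _ _ _ h h').
  exists (act _ f z); split; first exact: RP.2.
  by rewrite smapE act_mapsp -smapE act_sprod act_simplex hcomp1 hcomp1l.
have [||G [GR Gv]] := tw _ (hpG v) (punion R1 (punion
   (on (P false) (scomp (scomp a (scomp (hpb_fst _ _) v)) (sfst _ _)))
   (on (P true) (scomp (scomp b (scomp (hpb_snd _ _) v)) (sfst _ _))))).
- apply: punion_is_pmap => //.
    apply: punion_is_pmap; try exact: on_is_pmap.
    by move=> n q x y [h _] [h' _]; move: h'; rewrite /P h => /J_endsE.
  move=> n q x y [z [/Rv e ->]] [] [h ->]; rewrite /= -e (h : q.2 = _).
    exact: (hpb_ends z).1.
  exact: (hpb_ends z).2.
- move=> n q x [[z [/Rv e ->]]|[[h ->]|[h ->]]].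
  + by rewrite /= -e /= hcomp1.
  + by rewrite [q]surjective_pairing (h : q.2 = _) hpG0 /= ea.
  + by rewrite [q]surjective_pairing (h : q.2 = _) hpG1 /= eb.
have [w' [w1 w2 w3]] : exists w' : smap X (hpullback a b),
    [/\ forall n x, hpb_fst a b n (w' n x) = hpb_fst _ _ n (v n x),
        forall n x, hpb_snd a b n (w' n x) = hpb_snd _ _ n (v n x) &
        forall n q, hpG w' n q = G n q].
  have e0 n x : G n (x, jF n) = a n (scomp (hpb_fst _ _) v n x).
    by apply: GR; right; left; split.
  have e1 n x : G n (x, jT n) = b n (scomp (hpb_snd _ _) v n x).
    by apply: GR; right; right; split.
  by exists (hpb_mk e0 e1); split=> // n q; apply: hpG_mk.
exists w'; split=> [n x z Rz|].
  have ez := Rv _ _ _ Rz.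
  apply: hpb_eq; rewrite ?w1 ?w2 -?ez //.
  apply: smap_eq => j [h t].
  have -> : hpb_path a b n (w' n x) j (h, t) = hpG w' j (act X h x, t).
    by rewrite /hpG -uncurryE.
  rewrite w3; apply: GR; left; exists (act _ h z); split; first exact: RP.2.
  by rewrite smapE act_mapsp hcomp1.
apply: (hpb_mapeq (z := scomp (hpb_map ea eb) w')) => n x.
- exact: w1.
- exact: w2.
- by rewrite -Gv -w3 hpG_map.
Qed.

Lemma sid_equiv (X : sSet) : is_equiv (sid X).
Proof. by apply: (iso_equiv (g := sid X)). Qed.

Lemma equiv_ext (X Y : sSet) (f g : smap X Y) : (forall n x, f n x = g n x) -> is_equiv f -> is_equiv g.
Proof. by move/smap_eq->. Qed.

Lemma section_equiv (X Y : sSet) (i : smap X Y) (q : smap Y X) : isfib Y ->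
  (forall n x, q n (i n x) = x) -> is_equiv q -> is_equiv i.
Proof.
move=> fY qi eq; apply: (equiv_cancel_l (g := q)) => //.
by apply: equiv_ext (sid_equiv X) => n x; rewrite /= qi.
Qed.

Lemma equiv_inv (X Y : sSet) (f : smap X Y) : is_equiv f -> exists g : smap Y X, is_equiv g.
Proof. by case=> g [h1 h2]; exists g, f. Qed.

(** Ken Brown's factorization through the mapping path space N. It reduces statements about an
    equivalence of fibrant objects to trivial fibrations and to sections of trivial fibrations. *)
Lemma brown (D D' : sSet) (w : smap D D') : isfib D -> isfib D' -> is_equiv w ->
  exists (N : sSet) (i : smap D N) (q : smap N D) (r : smap N D'),
  [/\ isfib N, trivial_kan_fibration q, trivial_kan_fibration r,
      forall n x, q n (i n x) = x & forall n x, r n (i n x) = w n x].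
Proof.
move=> fD fD' ew.
pose N := hpullback w (sid D').
have fN : isfib N by apply: isfib_hpb.
pose i : smap D N := hpb_mk (a := w) (b := sid D') (al := sid D) (be := w)
  (G := scomp w (sfst _ _)) (fun _ _ => erefl) (fun _ _ => erefl).
pose q := hpb_fst w (sid D'); pose r := hpb_snd w (sid D').
have tq : trivial_kan_fibration q.
  apply/TFP => X v R RP Rv.
  pose R1 : pmap (sprod X J) D' := fun n z x =>
    exists y, R n z.1 y /\ x = hpb_path _ _ n y n (hid n, z.2).
  have R1P : is_pmap R1.
    split=> [n z x x' [y [h ->]] [y' [h' ->]]|m n f z x [y [h ->]]].
      by rewrite (RP.1 _ _ _ _ h h').
    exists (act _ f y); split; first exact: RP.2.
    by rewrite smapE act_mapsp -smapE act_sprod act_simplex hcomp1 hcomp1l.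
  have [|||G GR] := ELPoE fD' (A := fun n (x : X n) => dom R x)
      (R := punion (on (fun n (z : sprod X J n) => z.2 = jF n) (scomp w (scomp v (sfst _ _)))) R1).
  - by move=> m n f x; apply: dom_act.
  - apply: punion_is_pmap => //.
      by apply: on_is_pmap => m n f z h; apply: (atv_closed f h).
    move=> n z x y [h ->] [y' [Ry' ->]]; rewrite (h : z.2 = _) /= -(Rv _ _ _ Ry').
    exact: esym (hpb_ends y').1.
  - move=> n z; split.
      by case=> x [[h _]|[y [h _]]]; [right|left; exists y].
    case=> [[y h]|h]; first by exists (hpb_path _ _ n y n (hid n, z.2)); right; exists y.
    by exists (w n (v n z.1)); left.
  have e0 n x : G n (x, jF n) = w n (v n x) by apply: GR; left; split.
  exists (hpb_mk (a := w) (b := sid D') (al := v) (be := scomp G (cstJ _ true)) (G := G)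
    e0 (fun _ _ => erefl)); split=> // n x z Rz.
  have GE j (h : hom j n) t : G j (act X h x, t) = hpb_path _ _ n z j (h, t).
    apply: GR; right; exists (act _ h z); split; first exact: RP.2.
    by rewrite smapE act_mapsp hcomp1.
  apply: hpb_eq.
  - by rewrite /= -(Rv _ _ _ Rz).
  - by rewrite /= -[x]act_id GE; exact: (hpb_ends z).2.
  - by apply: smap_eq => j [h t] /=; rewrite GE.
have eq := tfib_is_equiv tq.
have ei : is_equiv i by apply: (section_equiv (q := q)).
exists N, i, q, r; split=> //; apply: fib_equiv_tfib => //.
  by apply: ELP_hpb_snd => //; apply: atv_closed.
exact: (equiv_cancel_r (f := i)).
Qed.

Lemma hpb_map_equiv (A B D D' : sSet) (a : smap A D) (b : smap B D) (a' : smap A D')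
    (b' : smap B D') (w : smap D D') ea eb :
  isfib A -> isfib B -> isfib D -> isfib D' -> is_equiv w ->
  is_equiv (@hpb_map A B D D' a b a' b' w ea eb).
Proof.
move=> fA fB fD fD' /(brown fD fD') [N [i [q [r [fN tq tr qi ri]]]]].
have ea1 n x : a' n x = r n (scomp i a n x) by rewrite ea /= ri.
have eb1 n x : b' n x = r n (scomp i b n x) by rewrite eb /= ri.
pose hi : smap (hpullback a b) (hpullback (scomp i a) (scomp i b)) :=
  hpb_map (a := a) (b := b) (a' := scomp i a) (b' := scomp i b) (w := i)
    (fun _ _ => erefl) (fun _ _ => erefl).
have ea2 n x : a n x = q n (scomp i a n x) by rewrite /= qi.
have eb2 n x : b n x = q n (scomp i b n x) by rewrite /= qi.
pose hq : smap (hpullback (scomp i a) (scomp i b)) (hpullback a b) := hpb_map ea2 eb2.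
have ehi : is_equiv hi.
  apply: (section_equiv (q := hq)); last exact/tfib_is_equiv/hpb_map_tfib.
    exact: isfib_hpb.
  apply: (hpb_mapeq (z := scomp hq hi) (z' := sid _)) => // n z.
  by rewrite hpG_map hpG_map1 qi.
have : is_equiv (scomp (hpb_map ea1 eb1) hi).
  apply: equiv_comp => //; try exact: isfib_hpb.
  exact/tfib_is_equiv/hpb_map_tfib.
apply: equiv_ext; apply: (hpb_mapeq (z := scomp (hpb_map ea1 eb1) hi)) => // n z.
by rewrite hpG_map !hpG_map1 ri.
Qed.

Definition hpb_pre (A B B' D : sSet) (a : smap A D) (b' : smap B' D) (b : smap B D)
    (phi : smap B' B) (e : forall n x, b n (phi n x) = b' n x) :
    smap (hpullback a b') (hpullback a b) :=
  hpb_mk (a := a) (b := b) (al := hpb_fst a b') (be := scomp phi (hpb_snd a b')) (G := hpG (sid _))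
    (hpG0 (sid _)) (fun n x => etrans (hpG1 (sid _) x) (esym (e n _))).

Lemma hpG_pre (X A B B' D : sSet) (a : smap A D) (b' : smap B' D) (b : smap B D)
    (phi : smap B' B) e (z : smap X (hpullback a b')) n q :
  hpG (scomp (@hpb_pre A B B' D a b' b phi e) z) n q = hpG z n q.
Proof. by rewrite /= hcomp1. Qed.

Lemma hpb_pre_tfib (A B B' D : sSet) (a : smap A D) (b' : smap B' D) (b : smap B D)
    (phi : smap B' B) e :
  trivial_kan_fibration phi -> trivial_kan_fibration (@hpb_pre A B B' D a b' b phi e).
Proof.
move=> /TFP tp; apply/TFP => X v R RP Rv.
have [||be [beR bev]] := tp _ (scomp (hpb_snd _ _) v) (img_pmap (hpb_snd _ _) R).
- exact: img_is_pmap.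
- by move=> n x y [z [/Rv h ->]]; rewrite /= -h.
have e1 n x : hpG v n (x, jT n) = b' n (be n x) by rewrite hpG1 -e bev.
pose w : smap X (hpullback a b') := hpb_mk (al := scomp (hpb_fst _ _) v) (@hpG0 _ _ _ _ _ _ v) e1.
exists w; split=> [n x z Rz|].
  have ez := Rv _ _ _ Rz; apply: hpb_eq.
  - by rewrite /= -ez.
  - by apply: beR; exists z.
  - apply: smap_eq => j [h t] /=; rewrite smapE act_mapsp hcomp1 -ez /=.
    by rewrite hcomp1.
apply: (hpb_mapeq (z := scomp (hpb_pre a e) w)) => n x; [by []|exact: bev|].
by rewrite hpG_pre hpG_mk.
Qed.

(** Pulling a fibration back along a strong deformation retract gives an equivalence: the homotopy
    from the identity to i q is lifted along [hpb_snd]. It is relative to the image of i, so the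
    lifted retraction is a strict one. *)
Lemma hpb_pre_section (A B B' D : sSet) (a : smap A D) (b' : smap B' D) (b : smap B D)
    (i : smap B' B) (q : smap B B') e :
  isfib A -> isfib D -> trivial_kan_fibration q -> (forall n x, q n (i n x) = x) ->
  is_equiv (@hpb_pre A B B' D a b' b i e).
Proof.
move=> fA fD /TFP tq qi.
pose P c n (z : sprod B J n) := z.2 = deg J n (J_end c).
have HP c : subclosed (P c) by move=> m n f z h; apply: (atv_closed f h).
pose im n (x : B n) := exists y, x = i n y.
have im_act : subclosed im by move=> m n f x [y ->]; exists (act B' f y); rewrite smapE.
(* a homotopy from the identity to iq relative to the image of i *)
have [||k [kR kq]] := tq _ (scomp q (sfst B J)) (punion (on (P false) (sfst _ _))
    (punion (on (P true) (scomp (scomp i q) (sfst _ _)))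
            (on (fun n (z : sprod B J n) => im n z.1) (sfst _ _)))).
- apply: punion_is_pmap; first exact: on_is_pmap.
    apply: punion_is_pmap; try (exact: on_is_pmap); first by apply: on_is_pmap => m n f z; apply: im_act.
    by move=> n z x y [_ ->] [[y' e'] ->]; rewrite /= e' qi.
  move=> n z x y [h ->] [] [h' ->] //.
  by move: h'; rewrite /P h => /J_endsE.
- by move=> n z x [[_ ->]|[[_ ->]|[_ ->]]] //=; rewrite qi.
have k0 n x : k n (x, jF n) = x by apply: kR; left.
have k1 n x : k n (x, jT n) = i n (q n x) by apply: kR; right; left.
have ki n y t : k n (i n y, t) = i n y by apply: kR; right; right; split=> //; exists y.
pose X := hpullback a b; pose sn := hpb_snd a b.
have fs : FJ sn by apply: ELP_hpb_snd => //; apply: atv_closed.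
have HA : @subclosed X (fun n x => im n (sn n x)).
  by move=> m n f x; rewrite smapE; apply: im_act.
have [||n z|w [wR wv]] := fs X _ (scomp k (pair_map (scomp sn (sfst _ _)) (ssnd _ _)))
    (on (fun n (z : sprod X J n) => im n (sn n z.1) \/ z.2 = jF n) (sfst _ _)) HA.
- apply: on_is_pmap => m n f z [h|h]; first by left; apply: HA.
  by right; apply: (atv_closed f h).
- move=> n z x [h ->]; change (sn n z.1 = k n (sn n z.1, z.2)).
  by case: h => [[y h]|h]; [rewrite h ki|rewrite (h : z.2 = _) k0].
- split=> [[x [[h|h] _]]|h]; [by left|by right|].
  by exists z.1; split.
have w0 n x : w n (x, jF n) = x by apply: wR; split=> //; right.
have wi n x t : im n (sn n x) -> w n (x, t) = x by move=> h; apply: wR; split=> //; left.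
pose r := scomp w (cstJ _ true).
have r1 n x : hpG r n (x, jT n) = b' n (q n (sn n x)).
  by rewrite hpG1 -e -k1; congr (b n _); exact: wv.
pose r' : smap X (hpullback a b') :=
  hpb_mk (al := scomp (hpb_fst _ _) r) (be := scomp q sn) (@hpG0 _ _ _ _ _ _ r) r1.
have r'G n z : hpG r' n z = hpG r n z by rewrite hpG_mk.
have ir n x : hpb_pre a e n (r' n x) = r n x.
  apply: (hpb_mapeq (z := scomp (hpb_pre a e) r')) => {}n {}x //.
    by rewrite /= -k1; symmetry; exact: wv.
  by rewrite hpG_pre r'G.
exists r'; split; last first.
  apply/homotopic_sym/homotopicP; exists w; split=> n x; first exact: w0.
  exact: esym (ir n x).
apply: homotopic_eq => n x /=.
have im_x : im n (sn n (hpb_pre a e n x)) by exists (hpb_snd _ _ n x).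
apply: (hpb_mapeq (z := scomp r' (hpb_pre a e)) (z' := sid _)) => {im_x}{}n {}x.
- have im_x : im n (sn n (hpb_pre a e n x)) by exists (hpb_snd _ _ n x).
  exact: (congr1 (fun z => hpb_fst a b n z) (wi n _ (jT n) im_x)).
- exact: qi.
- case: x => x t.
  have im_x : im n (sn n (hpb_pre a e n x)) by exists (hpb_snd _ _ n x).
  have -> : hpG (scomp r' (hpb_pre a e)) n (x, t) = hpG r n (hpb_pre a e n x, t).
    by rewrite -r'G.
  have -> : hpG r n (hpb_pre a e n x, t) = hpG (sid _) n (hpb_pre a e n x, t).
    by rewrite /hpG /= (wi n _ (jT n) im_x).
  by rewrite /= hcomp1.
Qed.

Lemma hpb_pre_equiv (A B B' D : sSet) (a : smap A D) (b' : smap B' D) (b : smap B D)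
    (phi : smap B' B) e : isfib A -> isfib B -> isfib B' -> isfib D ->
  is_equiv phi -> is_equiv (@hpb_pre A B B' D a b' b phi e).
Proof.
move=> fA fB fB' fD /(brown fB' fB) [N [i [q [r [fN tq tr qi ri]]]]].
pose bN := scomp b r.
have ei n x : bN n (i n x) = b' n x by rewrite /= ri.
have er n x : b n (r n x) = bN n x by [].
have : is_equiv (scomp (hpb_pre a er) (hpb_pre a ei)).
  apply: equiv_comp; try exact: isfib_hpb.
    exact: (@hpb_pre_section _ _ _ _ a _ _ _ q).
  exact/tfib_is_equiv/hpb_pre_tfib.
apply: equiv_ext; apply: (hpb_mapeq (z := scomp (hpb_pre a er) (hpb_pre a ei))) => n x //.
  exact: ri.
by rewrite hpG_pre /= !hcomp1.
Qed.

(* A partial map into J extends vertex by vertex. *)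
Lemma sfst_tfib (B : sSet) : trivial_kan_fibration (sfst B J).
Proof.
apply/TFP => X v R RP Rv.
pose c (x : X 0) : bool :=
  if pselect (exists z, R 0 x z) is left h then (projT1 (cid h)).2 ord0 else false.
have wN m n (f : hom m n) (x : X n) :
    (fun i => c (vertex i (act X f x))) = act J f (fun i => c (vertex i x)).
  apply: funext => i; rewrite /vertex -act_comp; congr (c (act X _ x)); exact: hom_eq.
pose w : smap X J := @SMap X J (fun n x i => c (vertex i x)) wN.
exists (pair_map v w); split=> // n x [y s] Rx /=.
rewrite -(Rv _ _ _ Rx); congr (_, _); apply: funext => i.
rewrite /= /c; case: pselect => [h|[]].
  have h2 := RP.2 _ _ (hconst 0 i) _ _ Rx.
  case: (cid h) => z Rz /=.
  by rewrite (RP.1 _ _ _ _ Rz h2).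
by exists (act (sprod B J) (hconst 0 i) (y, s)); apply: RP.2.
Qed.

Lemma cstJ_equiv (B : sSet) c : isfib (sprod B J) -> is_equiv (cstJ B c).
Proof.
move=> fB; apply: (section_equiv (q := sfst B J)) => //.
exact/tfib_is_equiv/sfst_tfib.
Qed.

Lemma isfib_J : isfib J.
Proof.
apply: ELPo => B A R HA RP Rd.
have /TFP tp := @sfst_tfib point.
have [||w [wR _]] := tp _ (to_point _) (fun n q z => R n q z.2).
- split=> [n q [x s] [x' s'] h h'|m n f q x h]; last exact: RP.2.
  by have /= -> := RP.1 _ _ _ _ h h'; case: x x' {h h'} => -[].
- by move=> n q [[] s].
exists (scomp (ssnd _ _) w) => n q s h /=.
by rewrite (wR n q (tt, s)).
Qed.

(** Both sides map by equivalences into the homotopy pullback along the homotopy B x J -> D, through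
    the two ends of J. *)
Lemma hpb_homotopic (A B D : sSet) (a : smap A D) (b b' : smap B D) :
  isfib A -> isfib B -> isfib D -> homotopic b b' ->
  exists e : smap (hpullback a b) (hpullback a b'), is_equiv e.
Proof.
move=> fA fB fD /homotopicP [H [H0 H1]].
have fBJ : isfib (sprod B J) by apply: ELP_sprod => //; apply: isfib_J.
have e0 n x : H n (cstJ B false n x) = b n x := H0 n x.
have e1 n x : H n (cstJ B true n x) = b' n x := H1 n x.
have q0 : is_equiv (hpb_pre a e0) by apply: hpb_pre_equiv => //; apply: cstJ_equiv.
have q1 : is_equiv (hpb_pre a e1) by apply: hpb_pre_equiv => //; apply: cstJ_equiv.
have [g eg] := equiv_inv q1.
by exists (scomp g (hpb_pre a e0)); apply: equiv_comp => //; apply: isfib_hpb.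
Qed.

Definition Jor : smap (sprod J J) J :=
  @SMap (sprod J J) J (fun n q i => q.1 i || q.2 i) (fun _ _ _ _ => erefl).
Lemma JorF n (s : J n) : Jor n (s, jF n) = s.
Proof. by apply: funext => i; apply: orbF. Qed.
Lemma JorT n (s : J n) : Jor n (s, jT n) = jT n.
Proof. by apply: funext => i; apply: orbT. Qed.
Lemma JFor n (s : J n) : Jor n (jF n, s) = s.
Proof. exact: funext. Qed.
Lemma JTor n (s : J n) : Jor n (jT n, s) = jT n.
Proof. exact: funext. Qed.

Lemma point_eq n (u v : point n) : u = v.
Proof. by case: u; case: v. Qed.

(** * Strict and homotopy fibres *)

Definition fibre (X Y : sSet) (p : smap X Y) (y : Y 0) : sSet := pullback p (at_vertex y).

Definition fibre_in (X Y : sSet) (p : smap X Y) (y : Y 0) : smap (fibre p y) (hfibre p y) :=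
  hpb_mk (a := p) (b := at_vertex y) (al := pb_fst _ _) (be := to_point _)
    (G := scomp p (scomp (pb_fst _ _) (sfst _ _)))
    (fun _ _ => erefl) (fun n (z : fibre p y n) => svalP z : p n (sval z).1 = at_vertex y n (sval z).2).

(* The homotopy follows the path in Y and drags the point of X along. *)
Lemma fibre_in_equiv (X Y : sSet) (p : smap X Y) (y : Y 0) : FJ p -> is_equiv (fibre_in p y).
Proof.
move=> fp; pose Z := hfibre p y; pose g := hpG (sid Z).
pose PF n (q : sprod Z J n) := q.2 = jF n.
have [||n q x [h ->]|n q|w [wR wv]] := fp Z (fun _ _ => False) g
    (on PF (scomp (hpb_fst _ _) (sfst _ _))).
- by [].
- by apply: on_is_pmap => m n f q h; apply: (atv_closed f h).
- by rewrite [q]surjective_pairing (h : q.2 = _) hpG0.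
- by split=> [[x [h _]]|[//|h]]; [right|exists (hpb_fst _ _ n q.1)].
have w0 n z : w n (z, jF n) = hpb_fst _ _ n z by apply: wR; split.
have w1 n z : p n (w n (z, jT n)) = at_vertex y n tt.
  by rewrite wv /g hpG1; case: (hpb_snd _ _ _ _).
pose r : smap Z (fibre p y) :=
  sub_lift (@pullback_closed _ _ _ p (at_vertex y))
    (f := pair_map (scomp w (cstJ _ true)) (to_point _)) w1.
exists r; split.
  have wi n x t : p n (w n (fibre_in p y n x, t)) = at_vertex y n tt.
    rewrite wv /g; have -> : hpG (sid Z) n (fibre_in p y n x, t) = hpG (fibre_in p y) n (x, t) by [].
    by rewrite hpG_mk; exact: (svalP x).
  pose H : smap (sprod (fibre p y) J) (fibre p y) :=
    sub_lift (@pullback_closed _ _ _ p (at_vertex y))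
      (f := pair_map (scomp w (pair_map (scomp (fibre_in p y) (sfst _ _)) (ssnd _ _))) (to_point _))
      (fun n q => wi n q.1 q.2).
  apply/homotopic_sym/homotopicP; exists H; split=> n x; apply: sub_eq => //=.
  by rewrite w0; case: x => -[x []].
have G0 n (q : sprod Z J n) : g n (q.1, Jor n (jF n, q.2)) = p n (w n q).
  by rewrite JFor wv -surjective_pairing.
have G1 n (q : sprod Z J n) : g n (q.1, Jor n (jT n, q.2)) = at_vertex y n tt.
  by rewrite JTor /g hpG1; case: (hpb_snd _ _ _ _).
pose G : smap (sprod (sprod Z J) J) Y := scomp g (pair_map (scomp (sfst _ _) (sfst _ _))
   (scomp Jor (pair_map (ssnd _ _) (scomp (ssnd _ _) (sfst _ _))))).
pose H : smap (sprod Z J) Z := hpb_mk (a := p) (b := at_vertex y) (al := w) (be := to_point _) (G := G) G0 G1.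
apply/homotopic_sym/homotopicP; exists H; split=> n z.
- apply: (hpb_mapeq (z := scomp H (cstJ _ false)) (z' := sid Z)) => {}n {}z.
  + exact: w0.
  + exact: point_eq.
  + case: z => z s; have -> : hpG (scomp H (cstJ Z false)) n (z, s) = hpG H n ((z, jF n), s) by [].
    by rewrite hpG_mk; congr (g n (z, _)); apply: JorF.
- apply: (hpb_mapeq (z := scomp H (cstJ _ true)) (z' := scomp (fibre_in p y) r)) => {}n {}z //.
  case: z => z s; have -> : hpG (scomp H (cstJ Z true)) n (z, s) = hpG H n ((z, jT n), s) by [].
  have -> : hpG (scomp (fibre_in p y) r) n (z, s) = hpG (fibre_in p y) n (r n z, s) by [].
  rewrite !hpG_mk; transitivity (g n (z, jT n)); last by symmetry; exact: wv.
  by congr (g n (z, _)); apply: JorT.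
Qed.

(** * Equivalences in a quasi-category *)

Definition d (X : sSet) (i : nat) n (x : X n.+1) : X n := act X (delta (inord i)) x.
Arguments d [X] i [n] x.

Lemma d_smap (X Y : sSet) (f : smap X Y) i n (x : X n.+1) : d i (f _ x) = f _ (d i x).
Proof. by rewrite /d smapE. Qed.

Lemma deltaV n (j : 'I_n.+2) (i : 'I_n.+1) : delta j i = i + (j <= i) :> nat.
Proof. by rewrite /= /bump addnC. Qed.

Lemma delta_inj m n (j : 'I_n.+2) (f g : hom m n) : hcomp (delta j) f = hcomp (delta j) g -> f = g.
Proof.
move=> e; apply: hom_eq => i.
by have /lift_inj := congr1 (fun h : hom m n.+1 => happ h i) e.
Qed.

Lemma delta_delta n (u v : nat) : u < v -> v < n.+3 ->
  hcomp (delta (inord v : 'I_n.+3)) (delta (inord u : 'I_n.+2)) =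
  hcomp (delta (inord u)) (delta (inord v.-1)).
Proof.
move=> uv vn; apply: hom_eq => i; apply: ord_inj; have hi := ltn_ord i.
change (delta (inord v : 'I_n.+3) (delta (inord u : 'I_n.+2) i) =
        delta (inord u : 'I_n.+3) (delta (inord v.-1 : 'I_n.+2) i) :> nat).
by rewrite !deltaV !inordK; lia.
Qed.

Lemma dd (X : sSet) n (u v : nat) (x : X n.+2) : u < v -> v < n.+3 ->
  d u (d v x) = d v.-1 (d u x).
Proof. by move=> uv vn; rewrite /d -!act_comp delta_delta. Qed.

Section Facets.
Variables (X : sSet) (n : nat) (P : 'I_n.+2 -> Prop) (y : 'I_n.+2 -> X n).

Definition facets_compat : Prop := forall u v, P u -> P v -> forall m (f g : hom m n),
  hcomp (delta u) f = hcomp (delta v) g -> act X f (y u) = act X g (y v).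

Definition facets_pmap : pmap (simplex n.+1) X := fun m f x =>
  exists u g, [/\ P u, f = hcomp (delta u) g & x = act X g (y u)].

Lemma facets_is_pmap : facets_compat -> is_pmap facets_pmap.
Proof.
move=> H; split=> [m f x x' [u [g [Pu -> ->]]] [v [h [Pv e ->]]]|m k g f x [u [h [Pu -> ->]]]].
  exact: H e.
by exists u, (hcomp h g); split; rewrite ?act_comp // act_simplex hcompA.
Qed.

Lemma facets_dom m (f : hom m n.+1) : @dom _ _ facets_pmap m f <-> exists2 j, P j & forall i, f i <> j.
Proof.
split=> [[x [u [g [Pu -> _]]]]|[j Pj /delta_factor [g ->]]].
  by exists u => // i /=; apply/eqP; rewrite eq_sym neq_lift.
by exists (act X g (y j)), j, g.
Qed.

End Facets.

(** The cosimplicial identity as a pullback square: two facets of a simplex meet in a face of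
    codimension two. Hence the simplicial identities alone make a family of facets compatible. *)
Lemma delta_pair m n (u v : nat) (f g : hom m n.+1) : u < v -> v < n.+3 ->
  hcomp (delta (inord u : 'I_n.+3)) f = hcomp (delta (inord v : 'I_n.+3)) g ->
  exists h, f = hcomp (delta (inord v.-1)) h /\ g = hcomp (delta (inord u)) h.
Proof.
move=> uv vn e.
have [h ef] : exists h, f = hcomp (delta (inord v.-1)) h.
  apply: delta_factor => i fi.
  have : delta (inord u : 'I_n.+3) (f i) = delta (inord v : 'I_n.+3) (g i) :> nat :=
    congr1 (fun h : hom m n.+2 => happ h i : nat) e.
  by rewrite !deltaV fi !inordK; lia.
exists h; split=> //; apply: (@delta_inj _ _ (inord v)).
by rewrite -e ef !hcompA (delta_delta uv vn).
Qed.

Lemma facets_compatP (X : sSet) n (P : 'I_n.+3 -> Prop) (y : 'I_n.+3 -> X n.+1) :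
  (forall u v : 'I_n.+3, P u -> P v -> u < v -> d u (y v) = d v.-1 (y u)) -> facets_compat P y.
Proof.
move=> H u v Pu Pv m f g.
wlog uv : u v Pu Pv f g / u <= v.
  move=> W e; case: (leqP u v) => h; first exact: W.
  by symmetry; apply: W => //; apply: ltnW.
move=> e; have [uv'|uv'|/ord_inj uv'] := ltngtP u v; last 2 first.
- by rewrite ltnNge uv in uv'.
- by subst v; rewrite (delta_inj e).
have := @delta_pair _ _ u v f g uv' (ltn_ord v); rewrite !inord_val => /(_ e) [h [-> ->]].
by have := H u v Pu Pv uv'; rewrite !act_comp /d => ->.
Qed.

Lemma horn_ext (X : sSet) n (k : 'I_n.+1) (R : pmap (simplex n) X) : fills_horn X k -> is_pmap R ->
  (forall m (f : hom m n), @dom _ _ R m f <-> exists2 j, j <> k & forall i, f i <> j) ->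
  exists z : X n, forall m f x, R m f x -> act X f z = x.
Proof.
move=> F RP Rd.
pose h0 m (f : horn k m) : X m := projT1 (cid ((Rd m (sval f)).2 (svalP f))).
have hP m f : R m (sval f) (h0 m f) by rewrite /h0; case: cid.
have hN m l (g : hom m l) f : h0 m (act (horn k) g f) = act X g (h0 l f).
  by apply: (RP.1 _ _ _ _ (hP _ _)); apply: (RP.2 _ _ g _ _ (hP _ _)).
have [g gE] := F (SMap hN).
exists (g n (hid n)) => m f x Rx.
have hf : exists2 j, j <> k & forall i, happ f i <> j by apply/Rd; exists x.
rewrite -smapE act_simplex hcomp1l (gE m (exist _ f hf)).
exact: (RP.1 _ _ _ _ (hP _ (exist _ f hf)) Rx).
Qed.

Lemma facets_fill (X : sSet) n (k : 'I_n.+2) (y : 'I_n.+2 -> X n) : fills_horn X k ->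
  facets_compat (fun u => u <> k) y -> exists z : X n.+1, forall u, u <> k -> act X (delta u) z = y u.
Proof.
move=> F H; have [||z zE] := horn_ext F (R := facets_pmap (fun u => u <> k) y).
- exact: facets_is_pmap.
- by move=> m f; apply: facets_dom.
by exists z => u uk; apply: zE; exists u, (hid n); rewrite hcomp1 act_id.
Qed.

(* c is a composite of a and b. *)
Definition M (X : sSet) (a b c : X 1) : Prop :=
  exists s : X 2, [/\ d 2 s = a, d 0 s = b & d 1 s = c].
Definition one (X : sSet) (x : X 0) : X 1 := deg X 1 x.

(** The inner horns of the 3-simplex as rules on its edges a = 01, b = 12, c = 23, dd = 02, e = 13,
    f = 03: [R1] yields the face 1 and [R2] the face 2. As rules they apply to quasi-categories and
    also to the slices below, of which only the three-dimensional inner horns are filled. *)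
Definition R1 (X : sSet) : Prop := forall a b c dd e f : X 1,
  M a b dd -> M b c e -> M a e f -> M dd c f.
Definition R2 (X : sSet) : Prop := forall a b c dd e f : X 1,
  M a b dd -> M b c e -> M dd c f -> M a e f.

Lemma srcE (X : sSet) (e : X 1) : src e = d 1 e.
Proof. by rewrite /src /vertex /d; congr (act X _ e); apply: hom_eq => i; apply: ord_inj; rewrite ord1 /= /bump inordK. Qed.
Lemma tgtE (X : sSet) (e : X 1) : tgt e = d 0 e.
Proof. by rewrite /tgt /vertex /d; congr (act X _ e); apply: hom_eq => i; apply: ord_inj; rewrite ord1 /= /bump inordK. Qed.

Lemma e01E : e01 = delta (inord 2).
Proof.
apply: hom_eq => i; apply: ord_inj; rewrite /= /edge_hom /bump inordK //.
by case: i => -[|[|//]] hi /=; rewrite /v2 inordK.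
Qed.
Lemma e02E : e02 = delta (inord 1).
Proof.
apply: hom_eq => i; apply: ord_inj; rewrite /= /edge_hom /bump inordK //.
by case: i => -[|[|//]] hi /=; rewrite /v2 inordK.
Qed.
Lemma e12E : e12 = delta (inord 0).
Proof.
apply: hom_eq => i; apply: ord_inj; rewrite /= /edge_hom /bump inordK //.
by case: i => -[|[|//]] hi /=; rewrite /v2 inordK.
Qed.

Lemma M_src (X : sSet) (a b c : X 1) : M a b c -> src a = src c.
Proof. by case=> s [<- _ <-]; rewrite !srcE dd. Qed.
Lemma M_mid (X : sSet) (a b c : X 1) : M a b c -> tgt a = src b.
Proof. by case=> s [<- <- _]; rewrite srcE tgtE dd. Qed.
Lemma M_tgt (X : sSet) (a b c : X 1) : M a b c -> tgt b = tgt c.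
Proof. by case=> s [_ <- <-]; rewrite !tgtE (@dd _ _ 0 1). Qed.

Lemma d_deg (X : sSet) i n (x : X 0) : d i (deg X n.+1 x) = deg X n x.
Proof. exact: act_deg. Qed.
Lemma src_one (X : sSet) (x : X 0) : src (one x) = x.
Proof. by rewrite srcE d_deg /deg -[RHS]act_id; congr (act X _ x); apply: hom_eq => i; rewrite !ord1. Qed.
Lemma tgt_one (X : sSet) (x : X 0) : tgt (one x) = x.
Proof. by rewrite tgtE d_deg /deg -[RHS]act_id; congr (act X _ x); apply: hom_eq => i; rewrite !ord1. Qed.

Lemma d_pfst (X : sSet) n (k i : nat) (x : X n) : k <= n -> (i == k) || (i == k.+1) ->
  d i (act X (pfst n k) x) = x.
Proof.
move=> kn ik; rewrite /d -act_comp -[RHS]act_id; congr (act X _ x); apply: hom_eq => j.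
apply: ord_inj; change (pfst n k (delta (inord i : 'I_n.+2) j) = j :> nat).
by rewrite pfstE // deltaV inordK; have := ltn_ord j; lia.
Qed.

Lemma M_one_l (X : sSet) (a : X 1) : M (one (src a)) a a.
Proof.
exists (act X (pfst 1 0) a); split; [|exact: d_pfst|exact: d_pfst].
rewrite /d /one /deg /src /vertex -!act_comp; congr (act X _ a); apply: hom_eq => i.
apply: ord_inj; change (pfst 1 0 (delta (inord 2 : 'I_3) i) = 0 :> nat).
by rewrite pfstE // deltaV inordK //; have := ltn_ord i; lia.
Qed.
Lemma M_one_r (X : sSet) (a : X 1) : M a (one (tgt a)) a.
Proof.
exists (act X (pfst 1 1) a); split; [exact: d_pfst| |exact: d_pfst].
rewrite /d /one /deg /tgt /vertex -!act_comp; congr (act X _ a); apply: hom_eq => i.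
apply: ord_inj; change (pfst 1 1 (delta (inord 0 : 'I_3) i) = 1 :> nat).
by rewrite pfstE // deltaV inordK //; have := ltn_ord i; lia.
Qed.

Lemma is_equivalenceP (X : sSet) (e : X 1) : is_equivalence e <->
  (exists g, M e g (one (src e))) /\ (exists g, M g e (one (tgt e))).
Proof.
rewrite /is_equivalence e01E e02E e12E; split.
  move=> [[s [h1 h2]] [t [h3 h4]]]; split; first by exists (d 0 s), s.
  by exists (d 2 t), t.
by move=> [[g [s [h1 h2 h3]]] [g' [t [h4 h5 h6]]]]; split; [exists s|exists t].
Qed.

Lemma one_equivalence (X : sSet) (x : X 0) : is_equivalence (one x).
Proof.
apply/is_equivalenceP; split; exists (one x).
  by have := M_one_l (one x); rewrite src_one.
by have := M_one_l (one x); rewrite src_one tgt_one.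
Qed.

Section Rules.
Variable X : sSet.
Hypotheses (r1 : R1 X) (r2 : R2 X).

(* The left inverse is homotopic to the right inverse. *)
Lemma two_sided (e : X 1) : is_equivalence e ->
  exists g, M e g (one (src e)) /\ M g e (one (tgt e)).
Proof.
move=> /is_equivalenceP [[g h] [g' h']]; exists g'; split=> //.
have h1 : M (one (tgt e)) g g'.
  apply: (r1 h' h); have := M_one_r g'.
  by rewrite (M_mid h').
by apply: (r2 (M_one_r e) h1).
Qed.

Lemma inverse_equivalence (e g : X 1) : M e g (one (src e)) -> M g e (one (tgt e)) ->
  is_equivalence g.
Proof.
move=> h1 h2; apply/is_equivalenceP; split; exists e.
  by rewrite (_ : src g = tgt e) // (M_mid h1).
by rewrite (_ : tgt g = src e) // -(M_mid h2).
Qed.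

Hypothesis cX : forall a b : X 1, tgt a = src b -> exists c, M a b c.

Lemma eq_comp (a b c : X 1) : M a b c -> is_equivalence a -> is_equivalence b -> is_equivalence c.
Proof.
move=> h /two_sided [g [g1 g2]] /two_sided [k [k1 k2]].
have kg : tgt k = src g.
  by rewrite (M_mid k2) -(M_mid h) (M_mid g1).
(* The candidate inverse of c: the inverse k of b followed by the inverse g of a. *)
have [l hl] := cX kg.
have bl : M b l g.
  apply: (r2 k1 hl); rewrite -(M_mid h) (M_mid g1); exact: M_one_l.
apply/is_equivalenceP; split; exists l.
  by rewrite -(M_src h); apply: (r1 h bl).
have gc : M g c b.
  apply: (r2 g2 h); rewrite (M_mid h); exact: M_one_l.
by rewrite -(M_tgt h); apply: (r1 hl gc).
Qed.

Lemma eq_right (a b c : X 1) : M a b c -> is_equivalence a -> is_equivalence c -> is_equivalence b.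
Proof.
move=> h ea ec; have [g [g1 g2]] := two_sided ea.
have gc : M g c b by apply: (r2 g2 h); rewrite (M_mid h); exact: M_one_l.
exact: eq_comp gc (inverse_equivalence g1 g2) ec.
Qed.

Lemma eq_left (a b c : X 1) : M a b c -> is_equivalence b -> is_equivalence c -> is_equivalence a.
Proof.
move=> h eb ec; have [g [g1 g2]] := two_sided eb.
have cg : M c g a by apply: (r1 h g1); rewrite -(M_mid h); exact: M_one_r.
exact: eq_comp cg ec (inverse_equivalence g1 g2).
Qed.

End Rules.

Lemma neq_inord n (i k : nat) : i < n.+1 -> k < n.+1 -> i <> k -> (inord i : 'I_n.+1) <> inord k.
Proof. by move=> hi hk ne /(congr1 val); rewrite /= !inordK. Qed.

Definition has_fill3 (X : sSet) : Prop := forall (k : nat) (s : nat -> X 2), 0 < k < 3 ->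
  (forall u v, u < v -> v < 4 -> u <> k -> v <> k -> d u (s v) = d v.-1 (s u)) ->
  exists z : X 3, forall u, u < 4 -> u <> k -> d u z = s u.

Lemma fill3_R1 (X : sSet) : has_fill3 X -> R1 X.
Proof.
move=> fill3 a b c p e f [s3 [a1 a2 a3]] [s0 [b1 b2 b3]] [s2 [c1 c2 c3]].
have [//||z zE] := fill3 1 (fun u => nth s0 [:: s0; s0; s2; s3] u).
  move=> [|[|[|[|u]]]] [|[|[|[|v]]]] //= _ _ h1 h2; by rewrite ?a1 ?a2 ?b1 ?b3 ?c1 ?c2.
exists (d 1 z); split.
- by rewrite -(@dd _ _ 1 3) // zE //= a3.
- by rewrite dd // zE //= b2.
- by rewrite -(@dd _ _ 1 2) // zE //= c3.
Qed.

Lemma fill3_R2 (X : sSet) : has_fill3 X -> R2 X.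
Proof.
move=> fill3 a b c p e f [s3 [a1 a2 a3]] [s0 [b1 b2 b3]] [s1 [c1 c2 c3]].
have [//||z zE] := fill3 2 (fun u => nth s0 [:: s0; s1; s0; s3] u).
  move=> [|[|[|[|u]]]] [|[|[|[|v]]]] //= _ _ h1 h2; by rewrite ?a2 ?a3 ?b1 ?b2 ?c1 ?c2.
exists (d 2 z); split.
- by rewrite -(@dd _ _ 2 3) // zE //= a1.
- by rewrite dd // zE //= b3.
- by rewrite dd // zE //= c3.
Qed.

Section QuasiRules.
Variable X : sSet.
Hypothesis qX : is_quasicategory X.

Lemma quasi_comp (a b : X 1) : tgt a = src b -> exists c, M a b c.
Proof.
move=> e.
have F : fills_horn X (inord 1 : 'I_3) by apply: qX; rewrite inordK.
have [|z zE] := facets_fill (y := fun u : 'I_3 => if u == 0 :> nat then b else a) F.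
- apply: facets_compatP => u v hu hv uv.
  have hu1 : u <> 1 :> nat by move=> h; apply: hu; apply: ord_inj; rewrite inordK.
  have hv1 : v <> 1 :> nat by move=> h; apply: hv; apply: ord_inj; rewrite inordK.
  have -> : (u : nat) = 0 by have := ltn_ord v; lia.
  have -> : (v : nat) = 2 by have := ltn_ord v; lia.
  by rewrite /= -srcE -tgtE.
exists (d 1 z), z; split=> //; rewrite /d zE ?inordK //; exact: neq_inord.
Qed.

Lemma fill3 : has_fill3 X.
Proof.
move=> k s hk H.
have F : fills_horn X (inord k : 'I_4) by apply: qX; rewrite inordK; lia.
have [|z zE] := facets_fill (y := fun u : 'I_4 => s u) F.
- apply: facets_compatP => u v hu hv uv; apply: H => //.
    by move=> h; apply: hu; apply: ord_inj; rewrite inordK; lia.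
  by move=> h; apply: hv; apply: ord_inj; rewrite inordK; lia.
exists z => u hu uk; rewrite /d zE ?inordK //; apply: neq_inord => //; lia.
Qed.

Lemma quasi_R1 : R1 X. Proof. exact: fill3_R1 fill3. Qed.
Lemma quasi_R2 : R2 X. Proof. exact: fill3_R2 fill3. Qed.

Lemma q_comp (a b c : X 1) : M a b c -> is_equivalence a -> is_equivalence b -> is_equivalence c.
Proof. exact: (eq_comp quasi_R1 quasi_R2 quasi_comp). Qed.
Lemma q_right (a b c : X 1) : M a b c -> is_equivalence a -> is_equivalence c -> is_equivalence b.
Proof. exact: (eq_right quasi_R1 quasi_R2 quasi_comp). Qed.
Lemma q_left (a b c : X 1) : M a b c -> is_equivalence b -> is_equivalence c -> is_equivalence a.
Proof. exact: (eq_left quasi_R1 quasi_R2 quasi_comp). Qed.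

End QuasiRules.

(** * Joins of simplices and special outer horns *)

Section Join.
Variables (a m i k : nat) (al : hom a m) (f : hom i k).

(** Δ^(m+1+k) is read as the join of Δ^m with Δ^k: the vertices up to m form the head, the others
    the tail, and [jn] is the join of the operators al and f. *)
Definition jn_fun (x : 'I_(a.+1 + i).+1) : 'I_(m.+1 + k).+1 :=
  inord (if x <= a then (al (inord x) : nat) else m.+1 + f (inord (x - a.+1))).

Lemma jn_funE (x : 'I_(a.+1 + i).+1) : jn_fun x = (if x <= a then (al (inord x) : nat) else m.+1 + f (inord (x - a.+1))) :> nat.
Proof.
rewrite /jn_fun inordK //; case: ifP => _.
  by have := ltn_ord (al (inord x)); lia.
by have := ltn_ord (f (inord (x - a.+1))); lia.
Qed.

Lemma jn_mono (x y : 'I_(a.+1 + i).+1) : x <= y -> jn_fun x <= jn_fun y.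
Proof.
move=> xy; rewrite !jn_funE; have hx := ltn_ord x; have hy := ltn_ord y.
case: ifP => h1; case: ifP => h2; try lia.
- by apply: (svalP al); rewrite !inordK; lia.
- by have := ltn_ord (al (inord x)); lia.
- by rewrite leq_add2l; apply: (svalP f); rewrite !inordK; lia.
Qed.

Definition jn : hom (a.+1 + i) (m.+1 + k) := mk_hom jn_mono.

Lemma jnL (x : 'I_(a.+1 + i).+1) : x <= a -> jn x = al (inord x) :> nat.
Proof. by move=> h; rewrite [LHS]jn_funE h. Qed.
Lemma jnR (x : 'I_(a.+1 + i).+1) : a < x -> jn x = m.+1 + f (inord (x - a.+1)) :> nat.
Proof. by move=> h; rewrite [LHS]jn_funE leqNgt h. Qed.
End Join.

Definition inl_fun m k (x : 'I_m.+1) : 'I_(m.+1 + k).+1 := inord x.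
Lemma inl_funE m k x : @inl_fun m k x = x :> nat.
Proof. by rewrite inordK //; have := ltn_ord x; lia. Qed.
Lemma inl_mono m k (x y : 'I_m.+1) : x <= y -> @inl_fun m k x <= @inl_fun m k y.
Proof. by rewrite !inl_funE. Qed.
Definition inl m k : hom m (m.+1 + k) := mk_hom (@inl_mono m k).
Lemma inlE m k x : inl m k x = x :> nat.
Proof. exact: inl_funE. Qed.

Lemma jn_comp a b m i j k (al : hom b m) (be : hom a b) (f : hom j k) (g : hom i j) :
  hcomp (jn al f) (jn be g) = jn (hcomp al be) (hcomp f g).
Proof.
apply: hom_eq => x; apply: ord_inj; have hx := ltn_ord x.
change (jn al f (jn be g x) = jn (hcomp al be) (hcomp f g) x :> nat).
case: (leqP x a) => h.
  have e := jnL be g h; have hb := ltn_ord (be (inord x)).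
  have h' : jn be g x <= b by rewrite e; lia.
  rewrite (jnL al f h') (jnL (hcomp al be) (hcomp f g) h).
  by have -> : inord (jn be g x) = be (inord x) by rewrite e inord_val.
have e := jnR be g h; have hb := ltn_ord (g (inord (x - a.+1))).
have h' : b < jn be g x by rewrite e; lia.
rewrite (jnR al f h') (jnR (hcomp al be) (hcomp f g) h).
have -> // : inord (jn be g x - b.+1) = g (inord (x - a.+1)).
by rewrite e (_ : _ + _ - _ = g (inord (x - a.+1))) ?inord_val //; lia.
Qed.

Lemma jn_id m k : jn (hid m) (hid k) = hid _.
Proof.
apply: hom_eq => x; apply: ord_inj; have hx := ltn_ord x.
change (jn (hid m) (hid k) x = x :> nat); case: (leqP x m) => h.
  by rewrite jnL //= inordK.
by rewrite jnR //= inordK; lia.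
Qed.

Lemma jn_inl a m i k (al : hom a m) (f : hom i k) :
  hcomp (jn al f) (inl a i) = hcomp (inl m k) al.
Proof.
apply: hom_eq => x; apply: ord_inj; have hx := ltn_ord x.
change (jn al f (inl a i x) = inl m k (al x) :> nat).
by rewrite jnL inlE // inlE inord_val.
Qed.

Lemma jn_delta m k u : u < m.+2 ->
  jn (delta (inord u : 'I_m.+2)) (hid k) = delta (inord u : 'I_(m.+1 + k).+2).
Proof.
move=> hu; apply: hom_eq => x; apply: ord_inj; have hx := ltn_ord x.
change (jn (delta (inord u : 'I_m.+2)) (hid k) x = delta (inord u : 'I_(m.+1 + k).+2) x :> nat).
rewrite [RHS]deltaV inordK; last by lia.
case: (leqP x m) => h; first by rewrite jnL // deltaV !inordK; lia.
by rewrite jnR //= inordK; lia.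
Qed.

Lemma inl_factor b m k (f : hom b (m.+1 + k)) : (forall x, f x <= m) -> exists g, f = hcomp (inl m k) g.
Proof.
move=> H.
have gm (x y : 'I_b.+1) : x <= y -> (inord (f x) : 'I_m.+1) <= (inord (f y) : 'I_m.+1).
  by move=> xy; have := svalP f _ _ xy; rewrite !inordK ?ltnS.
exists (mk_hom gm); apply: hom_eq => x; apply: ord_inj.
change (f x = inl m k (mk_hom gm x) :> nat).
by rewrite inlE /= inordK // ltnS.
Qed.

Lemma inj_hom_leq t k (io : hom t k) (x y : 'I_t.+1) : injective io -> io x <= io y -> x <= y.
Proof.
move=> inj h; rewrite leqNgt; apply/negP => yx.
have h2 : io y <= io x := svalP io _ _ (ltnW yx).
have e : io x = io y by apply: ord_inj; lia.
by rewrite (inj _ _ e) ltnn in yx.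
Qed.

Lemma jn_factor b m t k (io : hom t k) (f : hom b (m.+1 + k)) : injective io ->
  (forall x, m < f x -> exists y, f x = m.+1 + io y :> nat) ->
  exists h, f = hcomp (jn (hid m) io) h.
Proof.
move=> inj H.
have E x : {y : 'I_t.+1 | m < f x -> f x = m.+1 + io y :> nat}.
  apply: cid; case: (ltnP m (f x)) => h; first by have [y hy] := H x h; exists y.
  by exists ord0.
pose g x := sval (E x).
have gP x : m < f x -> f x = m.+1 + io (g x) :> nat by rewrite /g; case: (E x).
pose h x : 'I_(m.+1 + t).+1 := inord (if f x <= m then (f x : nat) else m.+1 + g x).
have hE x : h x = (if f x <= m then (f x : nat) else m.+1 + g x) :> nat.
  by rewrite /h inordK //; case: ifP => hf; [lia|have := ltn_ord (g x); lia].
have hm (x y : 'I_b.+1) : x <= y -> h x <= h y.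
  move=> xy; have fxy : f x <= f y := svalP f _ _ xy; rewrite !hE.
  case: ifP => h1; case: ifP => h2; try lia.
  rewrite leq_add2l; apply: (inj_hom_leq inj).
  have := gP x; have := gP y; lia.
exists (mk_hom hm); apply: hom_eq => x; apply: ord_inj.
change (f x = jn (hid m) io (mk_hom hm x) :> nat).
have hhE : mk_hom hm x = (if f x <= m then (f x : nat) else m.+1 + g x) :> nat := hE x.
case: (leqP (f x) m) => hf; rewrite ?hf in hhE.
  by rewrite jnL hhE //= inordK.
rewrite leqNgt hf /= in hhE.
rewrite jnR hhE; last by lia.
by rewrite (gP _ hf) (_ : _ + _ - _ = g x) ?inord_val //; lia.
Qed.

(** If io x = io y with x < y, then by monotonicity io already agrees at x and x+1, so it factors
    through the degeneracy repeating x; the section skips x+1. *)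
Lemma noninj_factor t k (io : hom t k) : ~ injective io ->
  exists t' (e : hom t' t) (pi : hom t t'), t' < t /\ io = hcomp (hcomp io e) pi.
Proof.
move=> ni.
have [x [y [xy e]]] : exists x y : 'I_t.+1, x < y /\ io x = io y.
  apply: contrapT => H; apply: ni => x y e.
  have [xy|xy|/ord_inj //] := ltngtP x y; case: H.
    by exists x, y.
  by exists y, x.
case: t io x y {ni} xy e => [|t] io x y xy e.
  by have := ltn_ord y; lia.
exists t, (delta (inord x.+1)), (pfst t x); split=> //.
have hy := ltn_ord y.
rewrite -hcompA; apply: hom_eq => z.
change (io z = io (delta (inord x.+1 : 'I_t.+2) (pfst t x z))).
have hz := ltn_ord z.
have E : delta (inord x.+1 : 'I_t.+2) (pfst t x z) = (if z == x.+1 :> nat then x : nat else z) :> nat.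
  by rewrite deltaV inordK ?pfstE; try lia; case: eqP; lia.
case: eqP E => [ez|_] E; last by congr (io _); apply: ord_inj.
have -> : delta (inord x.+1 : 'I_t.+2) (pfst t x z) = x by apply: ord_inj.
apply: ord_inj; apply/eqP; rewrite eqn_leq.
have h1 : io x <= io z by apply: (svalP io); lia.
have h2 : io z <= io y by apply: (svalP io); lia.
by rewrite h1 e h2.
Qed.

Lemma tail_factor m k b (f : hom b (m.+1 + k)) (s : 'I_(m.+1 + k).+1) :
  m < s -> (forall x, f x <> s) -> (forall x, f x <= m) \/
  exists t (io : hom t k) s0 h,
    [/\ t < k, injective io, forall x, io x <> s0 & f = hcomp (jn (hid m) io) h].
Proof.
move=> ms Hs; have hs := ltn_ord s.
have ne x : f x <> s :> nat by move=> e; apply: (Hs x); apply: ord_inj.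
case: k f s ms hs Hs ne => [|k] f s ms hs Hs ne.
  by left=> x; have := ltn_ord (f x); have := ne x; lia.
right.
have sE : (inord (s - m.+1) : 'I_k.+2) = s - m.+1 :> nat by rewrite inordK; lia.
have inj : injective (delta (inord (s - m.+1) : 'I_k.+2)) by move=> x y /lift_inj.
have [x mx|h ->] := jn_factor (f := f) inj.
  have hx := ltn_ord (f x); have nx := ne x.
  case: (ltnP (f x) s) => fs.
    exists (inord (f x - m.+1)); rewrite deltaV sE inordK; lia.
  by exists (inord (f x - m.+1).-1); rewrite deltaV sE inordK; lia.
exists k, (delta (inord (s - m.+1))), (inord (s - m.+1)), h; split=> // x /=.
by apply/eqP; rewrite eq_sym neq_lift.
Qed.

Section JoinExtension.
Variables (X : sSet) (m k j : nat).
Hypotheses (qX : is_quasicategory X) (j0 : 0 < j) (jm : j <= m).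

Definition tmiss b (f : hom b (m.+1 + k)) : Prop := exists2 s : 'I_(m.+1 + k).+1, m < s & forall x, f x <> s.
Definition hmiss b (f : hom b (m.+1 + k)) : Prop :=
  exists2 u : 'I_(m.+1 + k).+1, u <= m /\ u <> j :> nat & forall x, f x <> u.

(** For j = m the horn is outer in Δ^m but inner in the join, as the tail contributes at least one
    vertex after j. *)
Lemma inner_rlp t : rlp_faces (to_point X) (fun s : 'I_(m.+1 + t).+1 => s <> inord j).
Proof.
move=> u v uv.
have F : fills_horn X (inord j : 'I_(m.+1 + t).+1) by apply: qX; rewrite inordK; lia.
have [g gE] := F u; exists g; split=> // a f; by case: (v a f).
Qed.

(* The partial map is extended along the joins of the m-simplex with the faces
   of the boundary of the k-simplex, each of which attaches along an inner horn. *)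
Lemma join_ext (R : pmap (simplex (m.+1 + k)) X) : is_pmap R ->
  (forall b (f : hom b (m.+1 + k)), @dom _ _ R b f <->
     (hmiss f /\ tmiss f) \/ (forall x, f x <= m)) ->
  exists R', [/\ is_pmap R', psub R R' & forall b (f : hom b (m.+1 + k)), tmiss f -> @dom _ _ R' b f].
Proof.
move=> RP Rd.
pose allt t b (h : hom b (m.+1 + t)) := forall s : 'I_(m.+1 + t).+1, m < s -> exists x, h x = s.
(* The third clause lets S grow in blocks: if it contains a simplex outside R with full tail over a
   face io, it contains the whole join of Δ^m with that face. A block that is not yet present
   therefore meets the domain exactly in its horn at j. *)
pose C (S : pmap (simplex (m.+1 + k)) X) := [/\ is_pmap S,
  forall b (f : hom b (m.+1 + k)), @dom _ _ S b f -> tmiss f &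
  forall t (io : hom t k) b (h : hom b (m.+1 + t)), allt t b h ->
    @dom _ _ S b (hcomp (jn (hid m) io) h) -> ~ @dom _ _ R b (hcomp (jn (hid m) io) h) ->
    forall b' (h' : hom b' (m.+1 + t)), @dom _ _ S b' (hcomp (jn (hid m) io) h')].
have tfree b (f : hom b (m.+1 + k)) : (forall x, f x <= m) -> tmiss f.
  move=> H; exists (inord m.+1); first by rewrite inordK; lia.
  by move=> x /(congr1 val) /=; rewrite inordK; have := H x; lia.
have [|F _ FC tot|S [[SP St Sc] RS Smax]] := pmap_zorn (C := C) (R := R).
- by split=> // b f /Rd [[]//|]; apply: tfree.
- split.
  + by apply: union_is_pmap => // S /FC[].
  + by move=> b f [x [S /FC[_ h _] Sx]]; apply: h; exists x.
  + move=> t io b h ha [x [S FS Sx]] nR b' h'.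
    have [_ _ Sc] := FC _ FS.
    have [y Sy] := Sc t io b h ha (ex_intro _ x Sx) nR b' h'.
    by exists y, S.
exists S; split=> //.
suff key t (io : hom t k) s0 : (forall x, io x <> s0) ->
    forall b (h : hom b (m.+1 + t)), @dom _ _ S b (hcomp (jn (hid m) io) h).
  move=> b f [s ms Hs].
  have [tf|[t [io [s0 [h [_ _ hs0 ->]]]]]] := tail_factor ms Hs; last exact: key hs0 _ _.
  by have [x Rx] : @dom _ _ R b f; [apply/Rd; right|exists x; apply: RS].
elim/ltn_ind: t => t IH in io s0 *; move=> io_s0.
case: (pselect (injective io)) => inj; last first.
  have [t' [e' [pi [tt' e]]]] := noninj_factor inj.
  move=> b h; have -> : hcomp (jn (hid m) io) h =
      hcomp (jn (hid m) (hcomp io e')) (hcomp (jn (hid m) pi) h).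
    by rewrite hcompA jn_comp -e hcomp1.
  by apply: (IH t' tt' (hcomp io e') s0) => x; apply: io_s0.
move=> b1 h1; apply: contrapT => nS.
pose b0 : hom (m.+1 + t) (m.+1 + k) := jn (hid m) io.
have b0L (x : 'I_(m.+1 + t).+1) : x <= m -> b0 x = x :> nat by move=> hx; rewrite /b0 jnL //= inordK.
have b0R (x : 'I_(m.+1 + t).+1) : m < x -> b0 x = m.+1 + io (inord (x - m.+1)) :> nat by move=> hx; rewrite /b0 jnR.
have b0_s0 (x : 'I_(m.+1 + t).+1) : b0 x <> m.+1 + s0 :> nat.
  case: (leqP x m) => hx; first by rewrite b0L //; lia.
  rewrite b0R // => /addnI e; exact: io_s0 (ord_inj e).
have tm b (g : hom b (m.+1 + t)) : tmiss (hcomp b0 g).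
  have hs := ltn_ord s0.
  exists (inord (m.+1 + s0)); first by rewrite inordK; lia.
  by move=> x /(congr1 val) /=; rewrite inordK; [exact: b0_s0|lia].
have b0inj : injective b0.
  move=> x y e; apply: ord_inj; have {}e : b0 x = b0 y :> nat by rewrite e.
  have hx := ltn_ord x; have hy := ltn_ord y.
  case: (leqP x m) (leqP y m) => hxm [hym|hym].
  - by rewrite !b0L // in e.
  - by rewrite b0L ?b0R // in e; lia.
  - by rewrite b0R ?b0L // in e; lia.
  - rewrite !b0R // in e; move/addnI/ord_inj/inj/(congr1 val): e => /=.
    by rewrite !inordK; lia.
have tl_tfree t' b (g : hom b (m.+1 + t')) (io' : hom t' k) :
    (forall x, jn (hid m) io' (g x) <= m) -> forall x, g x <= m.
  by move=> H x; have := H x; case: (leqP (g x) m) => // h; rewrite jnR //; lia.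
have Sv : pover (to_point X) (to_point (simplex (m.+1 + k))) S by [].
have [b f|b f g e ne|R' [R'P _ SR' D']] := @attach (simplex (m.+1 + k)) X point (to_point X)
    (to_point _) S (m.+1 + t) (fun s => s <> inord j) b0 SP Sv (@inner_rlp t).
- split=> [Df|[s sj Hs]].
    apply: contrapT => nf.
    have hf s : s <> inord j -> exists x, f x = s.
      by move=> sj; apply: contrapT => H; apply: nf; exists s => // x e; apply: H; exists x.
    have af : allt t b f.
      move=> s ms; apply: hf => /(congr1 val) /=; rewrite inordK; lia.
    apply: nS; apply: (Sc t io b f af Df) => /Rd [[[u [um uj] hu] _]|tf].
      have [|x ex] := hf (inord u).
        by move=> /(congr1 val) /=; rewrite !inordK; lia.
      apply: (hu x); apply: ord_inj; change (b0 (f x) = u :> nat).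
      have fu : f x = u :> nat by rewrite ex inordK //; lia.
      by rewrite b0L fu.
    have [|x ex] := af (inord m.+1); first by rewrite inordK; lia.
    have := tl_tfree _ _ _ _ tf x; rewrite ex inordK; lia.
  case: (leqP s m) => hs.
    have [x Rx] : @dom _ _ R b (hcomp b0 f); last by exists x; apply: RS.
    apply/Rd; left; split; last exact: tm.
    have hk := ltn_ord s; exists (inord s); first by rewrite inordK; [split=> // e; apply: sj; apply: ord_inj; rewrite inordK; lia|lia].
    move=> x /(congr1 val) /=; rewrite inordK; last by lia.
    change (b0 (f x) = s :> nat -> False) => e; apply: (Hs x); apply: ord_inj.
    case: (leqP (f x) m) => hf; first by rewrite b0L in e.
    by rewrite b0R in e => //; lia.
  have [tf|[t' [io' [s1 [h [tt' _ _ eh]]]]]] := tail_factor hs Hs.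
    have [x Rx] : @dom _ _ R b (hcomp b0 f); last by exists x; apply: RS.
    by apply/Rd; right=> x; change (b0 (f x) <= m); rewrite b0L.
  change (@dom _ _ S b (hcomp b0 f)); rewrite eh /b0 hcompA jn_comp hcomp1.
  by apply: (IH t' tt' _ s0) => x; apply: io_s0.
- case: ne; apply: hom_eq => x; apply: b0inj.
  exact: (congr1 (fun h : hom b (m.+1 + k) => happ h x) e).
apply: nS; have [x R'x] : @dom _ _ R' b1 (hcomp b0 h1) by apply/D'; right; exists h1.
exists x; apply: (Smax R') R'x => //; split=> //.
- by move=> b f /D' [/St //|[g ->]]; apply: tm.
move=> t1 io1 b h ah /D' [Sh nR|[g eg] _] b' h'.
  by have [y Sy] := Sc _ _ _ _ ah Sh nR b' h'; exists y; apply: SR'.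
suff [g' ->] : exists g', hcomp (jn (hid m) io1) h' = hcomp b0 g' by apply/D'; right; exists g'.
apply: jn_factor => // z.
change (m < jn (hid m) io1 (h' z) -> exists y, jn (hid m) io1 (h' z) = m.+1 + io y :> nat).
case: (leqP (h' z) m) => hz.
  by rewrite jnL //= inordK //; lia.
rewrite jnR // => _; set w := inord _ : 'I_t1.+1.
have hw := ltn_ord w.
have [|x' ex'] := ah (inord (m.+1 + w)); first by rewrite inordK; lia.
have e : jn (hid m) io1 (h x') = b0 (g x') :> nat := congr1 (fun q : hom b (m.+1 + k) => happ q x' : nat) eg.
have hx' : h x' = m.+1 + w :> nat by rewrite ex' inordK //; lia.
rewrite jnR hx' in e; last by lia.
have {}e : m.+1 + io1 w = b0 (g x') :> nat.
  by rewrite -e; congr (_ + nat_of_ord (io1 _)); apply: ord_inj; rewrite inordK; lia.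
rewrite e; exists (inord (g x' - m.+1)).
case: (leqP (g x') m) => hg; last by rewrite b0R.
by rewrite b0L // in e; lia.
Qed.
End JoinExtension.

(** * Slices over the boundary of a simplex *)

Section Slice.
Variables (X : sSet) (k : nat).

Definition tails m := faces (fun s : 'I_(m.+1 + k).+1 => m < s).

Lemma tmiss_jn a m i (al : hom a m) (g : hom i (a.+1 + k)) :
  @tmiss a k i g -> @tmiss m k i (hcomp (jn al (hid k)) g).
Proof.
move=> [s ms hs]; have h := ltn_ord s.
exists (inord (m.+1 + (s - a.+1))); first by rewrite inordK; lia.
move=> x /(congr1 val) /=; rewrite inordK; last by lia.
change (jn al (hid k) (g x) = m.+1 + (s - a.+1) :> nat -> False).
have hg := ltn_ord (g x).
case: (leqP (g x) a) => gx; first by rewrite jnL //; have := ltn_ord (al (inord (g x))); lia.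
rewrite jnR //= inordK; last by lia.
by move=> e; apply: (hs x); apply: ord_inj; change (g x = s :> nat); lia.
Qed.

Definition tmap a m (al : hom a m) : smap (tails a) (tails m) :=
  @sub_lift (tails a) (simplex (m.+1 + k)) _ (@faces_closed _ (fun s => m < s))
    (scomp (simplex_map (jn al (hid k))) (incl (@faces_closed _ (fun s => a < s))))
    (fun i g => tmiss_jn al (svalP g)).

(* An m-simplex is a map to X from the join of the m-simplex with the boundary
   of the k-simplex. *)
Program Definition slice : sSet :=
  @SSet (fun m => smap (tails m) X)
    (@Simplicial (fun m => smap (tails m) X) (fun a m al y => scomp y (tmap al)) _ _).
Next Obligation.
apply: smap_eq => i g /=; congr (smap_fun x _ _).
by apply: sub_eq; rewrite /= jn_id hcomp1l.
Qed.
Next Obligation.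
apply: smap_eq => i h /=; congr (smap_fun x _ _).
by apply: sub_eq; rewrite /= hcompA jn_comp hcomp1.
Qed.

Lemma slice_act a m (al : hom a m) (y : slice m) b (g : hom b (a.+1 + k)) (tg : @tmiss a k b g) tg' :
  act slice al y b (exist _ g tg) = y b (exist _ (hcomp (jn al (hid k)) g) tg').
Proof. by congr (smap_fun y _ _); apply: eq_exist. Qed.

Lemma slice_fun m (y : slice m) b (g g' : hom b (m.+1 + k)) tg tg' : g = g' ->
  y b (exist _ g tg) = y b (exist _ g' tg').
Proof. by move=> e; congr (smap_fun y _ _); apply: eq_exist. Qed.

Lemma inl_tmiss m b (g : hom b m) : @tmiss m k b (hcomp (inl m k) g).
Proof.
exists (inord m.+1); first by rewrite inordK; lia.
move=> x /(congr1 val) /=; rewrite !inordK; have := ltn_ord (g x); lia.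
Qed.

Program Definition pslice : smap slice X :=
  @SMap slice X (fun m y => y m (exist _ (inl m k) _)) _.
Next Obligation. by have := inl_tmiss (hid m); rewrite hcomp1. Qed.
Next Obligation.
rewrite -smapE /=; congr (smap_fun x _ _); apply: eq_exist; exact: jn_inl.
Qed.

Lemma psliceE m (y : slice m) b (g : hom b m) tg :
  y b (exist _ (hcomp (inl m k) g) tg) = act X g (pslice m y).
Proof. by rewrite [pslice m y]/= -smapE; congr (smap_fun y _ _); apply: eq_exist. Qed.

Lemma tfree_inl_delta m b u (g : hom b (m.+1 + k)) (g' : hom b m.+1) : u < m.+2 ->
  hcomp (jn (delta (inord u : 'I_m.+2)) (hid k)) g = hcomp (inl m.+1 k) g' ->
  exists g1, g = hcomp (inl m k) g1 /\ hcomp (delta (inord u)) g1 = g'.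
Proof.
move=> hu e.
have [x|g1 eg] := @inl_factor b m k g.
  have {}e : jn (delta (inord u : 'I_m.+2)) (hid k) (g x) = inl m.+1 k (g' x) :> nat :=
    congr1 (fun q : hom b (m.+2 + k) => happ q x : nat) e.
  rewrite inlE in e; case: (leqP (g x) m) => // gx; rewrite jnR // in e.
  by have := ltn_ord (g' x); lia.
exists g1; split=> //; rewrite eg hcompA jn_inl in e.
apply: hom_eq => x; apply: ord_inj.
have := congr1 (fun q : hom b (m.+2 + k) => happ q x : nat) e.
rewrite -hcompA.
change (inl m.+1 k (delta (inord u) (g1 x)) = inl m.+1 k (g' x) :> nat -> delta (inord u) (g1 x) = g' x :> nat).
by rewrite !inlE.
Qed.

Hypothesis qX : is_quasicategory X.

(** Transposed, this is the extension problem of [join_ext]. The last horn j = m+2 is included, so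
    from dimension 2 on [pslice] behaves like a right fibration; that horn is what makes it reflect
    invertibility. *)
Lemma slice_lift m j (y : nat -> slice m.+1) (v : X m.+2) : 0 < j < m.+3 ->
  (forall u w, u < w -> w < m.+3 -> u <> j -> w <> j -> d u (y w) = d w.-1 (y u)) ->
  (forall u, u < m.+3 -> u <> j -> d u v = pslice _ (y u)) ->
  exists z : slice m.+2, (forall u, u < m.+3 -> u <> j -> d u z = y u) /\ pslice _ z = v.
Proof.
move=> /andP[j0 jm] yc yv.
pose jd u : hom (m.+2 + k) (m.+3 + k) := jn (delta (inord u : 'I_m.+3)) (hid k).
pose R : pmap (simplex (m.+3 + k)) X := fun b f x =>
  (exists u g (tg : @tmiss m.+1 k b g), [/\ u < m.+3, u <> j,
     f = hcomp (jd u) g & x = y u b (exist _ g tg)]) \/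
  (exists g : hom b m.+2, f = hcomp (inl m.+2 k) g /\ x = act X g v).
have jdE u : u < m.+3 -> jd u = delta (inord u : 'I_(m.+3 + k).+1) by apply: jn_delta.
have yy u w b (g h : hom b (m.+2 + k)) tg th : u < m.+3 -> w < m.+3 -> u <> j -> w <> j ->
    hcomp (jd u) g = hcomp (jd w) h -> y u b (exist _ g tg) = y w b (exist _ h th).
  wlog uw : u w g h tg th / u <= w.
    move=> W hu hw uj wj e; case: (leqP u w) => uw; first exact: W.
    by symmetry; apply: W => //; lia.
  move=> hu hw uj wj; rewrite !jdE // => e.
  have [uw'|uw'|uw'] := ltngtP u w; [|by lia|].
    have hw' : w < (m + k).+4 by lia.
    have [q [eg eh]] := @delta_pair b (m + k).+1 u w g h uw' hw' e.
    have hw1 : w.-1 < m.+2 by lia.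
    have hu1 : u < m.+2 by lia.
    have {}eg : g = hcomp (jn (delta (inord w.-1 : 'I_m.+2)) (hid k)) q by rewrite jn_delta.
    have {}eh : h = hcomp (jn (delta (inord u : 'I_m.+2)) (hid k)) q by rewrite jn_delta.
    have tq : @tmiss m k b q.
      have [s ms hs] := th; have := ltn_ord s.
      exists (inord s.-1); first by rewrite inordK; lia.
      move=> x /(congr1 val) /=; rewrite inordK; last by lia.
      move=> ex; apply: (hs x); apply: ord_inj; rewrite eh.
      change (jn (delta (inord u : 'I_m.+2)) (hid k) (q x) = s :> nat).
      have hi : (inord u : 'I_(m.+1 + k).+2) = u :> nat by rewrite inordK //; lia.
      by rewrite jn_delta // deltaV ex hi; lia.
    have := congr1 (fun z : slice m => z b (exist _ q tq)) (yc u w uw' hw uj wj).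
    rewrite /d /= => E; subst g h.
    by refine (etrans (slice_fun _ _ _ erefl) (etrans (esym E) (slice_fun _ _ _ erefl))).
  by subst w; apply: slice_fun; apply: delta_inj e.
have yi u b (g : hom b (m.+2 + k)) tg (g' : hom b m.+2) : u < m.+3 -> u <> j ->
    hcomp (jd u) g = hcomp (inl m.+2 k) g' -> y u b (exist _ g tg) = act X g' v.
  move=> hu uj /(tfree_inl_delta hu) [g1 [eg <-]].
  by rewrite act_comp; have := yv u hu uj; rewrite /d => ->; subst g; rewrite psliceE.
have RP : is_pmap R.
  split=> [b f x x'|a b h f x].
    case=> [[u [g [tg [hu uj -> ->]]]]|[g [-> ->]]] [[w [g' [tg' [hw wj e ->]]]]|[g' [e ->]]].
    - exact: yy e.
    - exact: yi e.
    - by symmetry; exact: yi (esym e).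
    - congr (act X _ v); apply: hom_eq => z; apply: ord_inj.
      have := congr1 (fun q : hom b (m.+3 + k) => happ q z : nat) e.
      change (inl m.+2 k (g z) = inl m.+2 k (g' z) :> nat -> g z = g' z :> nat).
      by rewrite !inlE.
  case=> [[u [g [tg [hu uj -> ->]]]]|[g [-> ->]]].
    left; exists u, (hcomp g h), (faces_comp h tg); split=> //; first exact: hom_eq.
    by rewrite -smapE; congr (smap_fun (y u) _ _); apply: eq_exist.
  by right; exists (hcomp g h); split; [exact: hom_eq|rewrite act_comp].
have [||R' [R'P RR' Rt]] := @join_ext X m.+2 k j qX j0 _ R RP.
- by lia.
- move=> b f; split.
    case=> x [[u [g [tg [hu uj -> _]]]]|[g [-> _]]].
      left; split; last exact: tmiss_jn.
      exists (inord u); first by rewrite inordK; [lia|lia].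
      move=> z; rewrite jdE //=; apply/eqP; by rewrite eq_sym neq_lift.
    right=> z; change (inl m.+2 k (g z) <= m.+2); rewrite inlE; have := ltn_ord (g z); lia.
  case=> [[[u [hu uj] mu] [s ms hs]]|tf].
    have [g eg] := @delta_factor b (m.+2 + k) u f mu.
    have hs1 := ltn_ord s.
    have tg : @tmiss m.+1 k b g.
      exists (inord s.-1); first by rewrite inordK; lia.
      move=> x /(congr1 val) /=; rewrite inordK; last by lia.
      move=> ex; apply: (hs x); apply: ord_inj; rewrite eg.
      have e2 : u <= s.-1 by lia.
      by apply: etrans (deltaV _ _) _; rewrite ex; change (s.-1 + (u <= s.-1) = s); rewrite e2; lia.
    exists (y u b (exist _ g tg)); left; exists u, g, tg; split=> //.
    by rewrite jdE ?inord_val.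
  by have [g eg] := inl_factor tf; exists (act X g v); right; exists g.
pose z0 b (f : tails m.+2 b) : X b := projT1 (cid (Rt b (sval f) (svalP f))).
have zP b f : R' b (sval f) (z0 b f) by rewrite /z0; case: cid.
have zN a b (h : hom a b) f : z0 a (act (tails m.+2) h f) = act X h (z0 b f).
  by apply: (R'P.1 _ _ _ _ (zP _ _)); apply: (R'P.2 _ _ h _ _ (zP _ _)).
exists (SMap zN : slice m.+2); split.
- move=> u hu uj; apply: smap_eq => b [g tg].
  apply: (R'P.1 _ _ _ _ (zP _ _)); apply: RR'; left.
  by exists u, g, tg.
- apply: (R'P.1 _ _ _ _ (zP _ _)); apply: RR'; right.
  by exists (hid _); rewrite hcomp1 act_id.
Qed.

Lemma slice_fill3 : has_fill3 slice.
Proof.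
move=> j s hj H.
have [|v vE] := fill3 qX (s := fun u => pslice _ (s u)) hj.
  by move=> u w uw hw uj wj; rewrite !d_smap H.
have [||z [zE _]] := @slice_lift 1 j s v _ H; [by lia|by []|].
by exists z.
Qed.

(** The horn j = 2 lifts an edge that composes to an identity when put before a given one ([L]).
    Applied to e it gives g', applied to g' it gives e''; then e'' is homotopic to e, and so g' also
    inverts e from the other side. *)
Lemma slice_conservative (e : slice 1) : is_equivalence (pslice 1 e) ->
  exists g, M e g (one (src e)).
Proof.
have sE (f : slice 1) : pslice 1 (one (src f)) = one (src (pslice 1 f)) /\
    pslice 1 (one (tgt f)) = one (tgt (pslice 1 f)).
  by rewrite /one /src /tgt /vertex !smap_deg !smapE.
have L (g : slice 1) (h : X 1) : M h (pslice 1 g) (one (tgt (pslice 1 g))) ->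
    exists h', pslice 1 h' = h /\ M h' g (one (tgt g)).
  case=> v [v2 v0 v1].
  have [|||z [zE zv]] := @slice_lift 0 2 (fun u => if u == 0 then g else one (tgt g)) v.
  - by [].
  - by move=> [|[|u]] [|[|[|w]]] //= _ _ _ _; rewrite -!tgtE tgt_one.
  - by move=> [|[|[|u]]] // _ _; exact: etrans v1 (esym (sE g).2).
  exists (d 2 z); split; first by rewrite -d_smap zv.
  by exists z; split; [|exact: (zE 0)|exact: (zE 1)].
move=> /(two_sided (quasi_R1 qX) (quasi_R2 qX)) [g [g1 g2]].
have [g' [eg h1]] := L _ _ g2.
have ts : tgt g' = src e := M_mid h1.
have [|e'' [_ h2]] := L g' (pslice 1 e).
  have -> : tgt (pslice 1 g') = src (pslice 1 e).
    by rewrite /tgt /src /vertex -!smapE; congr (pslice 0 _).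
  by rewrite eg.
have h3 : M e'' (one (tgt e)) e.
  apply: (fill3_R2 slice_fill3 h2 h1); rewrite ts; exact: M_one_l.
exists g'; apply: (fill3_R1 slice_fill3 h3 (e := g')); last by rewrite -ts.
have <- : src g' = tgt e by rewrite (M_src h1) src_one.
exact: M_one_l.
Qed.

End Slice.

Lemma tmiss_delta m k u b (g : hom b (m.+1 + k)) : u < m.+2 ->
  @tmiss m.+1 k b (hcomp (jn (delta (inord u : 'I_m.+2)) (hid k)) g) -> @tmiss m k b g.
Proof.
move=> hu [s ms hs]; have hl := ltn_ord s.
exists (inord s.-1); first by rewrite inordK; lia.
move=> x /(congr1 val) /=; rewrite inordK; last by lia.
move=> ex; apply: (hs x); apply: ord_inj.
change (jn (delta (inord u : 'I_m.+2)) (hid k) (g x) = s :> nat).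
by rewrite jnR ex /= ?inordK; lia.
Qed.

(** The simplex e is the join of Δ^(m+1) with the boundary of Δ^k. Together with full joins over the
    facets other than j it forms a horn of Δ^(m+2+k), inner because j <= m+1. *)
Lemma slice_fill (X : sSet) (qX : is_quasicategory X) k m j (e : slice X k m.+1)
    (t : nat -> X (m.+1 + k)) : 0 < j < m.+2 ->
  (forall u b g (tg : @tmiss m k b g), u < m.+2 -> u <> j -> act X g (t u) = d u e b (exist _ g tg)) ->
  (forall u v b (f g : hom b (m.+1 + k)), u < v -> v < m.+2 -> u <> j -> v <> j ->
    hcomp (jn (delta (inord u : 'I_m.+2)) (hid k)) f = hcomp (jn (delta (inord v : 'I_m.+2)) (hid k)) g ->
    act X f (t u) = act X g (t v)) ->
  exists W : X (m.+2 + k),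
    (forall u, u < m.+2 -> u <> j -> act X (jn (delta (inord u : 'I_m.+2)) (hid k)) W = t u) /\
    (forall b f (tf : @tmiss m.+1 k b f), act X f W = e b (exist _ f tf)).
Proof.
move=> /andP[j0 jm] Ht Hc.
pose jd u : hom (m.+1 + k) (m.+2 + k) := jn (delta (inord u : 'I_m.+2)) (hid k).
have jdE u : u < m.+2 -> jd u = delta (inord u : 'I_(m.+2 + k).+1) by apply: jn_delta.
pose R : pmap (simplex (m.+2 + k)) X := fun b f x =>
  (exists u (g : hom b (m.+1 + k)), [/\ u < m.+2, u <> j, f = hcomp (jd u) g & x = act X g (t u)]) \/
  (exists tf : @tmiss m.+1 k b f, x = e b (exist _ f tf)).
have tt u w b (g h : hom b (m.+1 + k)) : u < m.+2 -> w < m.+2 -> u <> j -> w <> j ->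
    hcomp (jd u) g = hcomp (jd w) h -> act X g (t u) = act X h (t w).
  move=> hu hw uj wj E; have [uw|uw|uw] := ltngtP u w; first exact: (Hc _ _ _ _ _ uw).
    by symmetry; apply: (Hc _ _ _ _ _ uw).
  by subst w; rewrite !jdE // in E; rewrite (delta_inj E).
have te u b (g : hom b (m.+1 + k)) tf : u < m.+2 -> u <> j ->
    act X g (t u) = e b (exist _ (hcomp (jd u) g) tf).
  by move=> hu uj; rewrite (Ht u b g (tmiss_delta hu tf)) //; exact: slice_act.
have RP : is_pmap R.
  split=> [b f x x'|a b h f x].
    case=> [[u [g [hu uj -> ->]]]|[tf ->]] [[w [g' [hw wj E ->]]]|[tf' ->]].
    - exact: tt E.
    - exact: te.
    - by subst f; symmetry; apply: te.
    - exact: slice_fun.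
  case=> [[u [g [hu uj -> ->]]]|[tf ->]].
    by left; exists u, (hcomp g h); split; rewrite ?act_comp //; apply: hom_eq.
  by right; exists (faces_comp h tf); rewrite -smapE; congr (smap_fun e _ _); apply: eq_exist.
have F : fills_horn X (inord j : 'I_(m.+2 + k).+1) by apply: qX; rewrite inordK; lia.
have [b f|W WR] := horn_ext F RP.
  split.
    case=> x [[u [g [hu uj -> _]]]|[[s ms hs] _]].
      exists (inord u); first by apply: neq_inord => //; lia.
      by move=> z; rewrite jdE //=; apply/eqP; rewrite eq_sym neq_lift.
    by exists s => // E; move: ms; rewrite E inordK; lia.
  case=> s sj hs; case: (ltnP m.+1 s) => ms.
    have tf : @tmiss m.+1 k b f by exists s.
    by exists (e b (exist _ f tf)); right; exists tf.
  have [g eg] := @delta_factor b (m.+1 + k) s f hs.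
  exists (act X g (t s)); left; exists s, g; split=> //.
    by move=> E; apply: sj; rewrite -E inord_val.
  by rewrite jdE ?inord_val.
exists W; split=> [u hu uj|b f tf].
  by apply: WR; left; exists u, (hid _); rewrite hcomp1 act_id.
by apply: WR; right; exists tf.
Qed.

Lemma jn_degen (X : sSet) k (j : 'I_2) (x : X (1 + k)) :
  act X (jn (delta j) (hid k)) (act X (jn (hconst 1 (ord0 : 'I_1)) (hid k)) x) = x.
Proof.
rewrite -act_comp jn_comp -[RHS]act_id; congr (act X _ x).
rewrite hcomp1 -jn_id; have -> // : hcomp (hconst 1 ord0) (delta j) = hid 0.
by apply: hom_eq => i; apply: ord_inj; rewrite [i]ord1.
Qed.

(* Joyal's special outer horns.  Seen from its first edge, which is invertible
   in the slice over the boundary of the last k + 1 vertices, the filler is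
   obtained from inner horns only. *)
Lemma special_horn (X : sSet) (qX : is_quasicategory X) k (R : pmap (simplex k.+2) X) eps :
  is_pmap R -> (forall m (f : hom m k.+2), @dom _ _ R m f <-> exists2 j, j <> ord0 & forall i, f i <> j) ->
  R 1 (inl 1 k) eps -> is_equivalence eps ->
  exists z : X k.+2, forall m f x, R m f x -> act X f z = x.
Proof.
move=> RP Rd Re eq_eps.
have td b (f : hom b k.+2) : @tmiss 1 k b f -> @dom _ _ R b f.
  by move=> [s ms hs]; apply/Rd; exists s => // E; move: ms; rewrite E.
pose e0 b (f : tails k 1 b) : X b := projT1 (cid (td b (sval f) (svalP f))).
have eP b f : R b (sval f) (e0 b f) by rewrite /e0; case: cid.
have eN a b (h : hom a b) f : e0 a (act (tails k 1) h f) = act X h (e0 b f).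
  by apply: (RP.1 _ _ _ _ (eP _ _)); apply: (RP.2 _ _ h _ _ (eP _ _)).
pose e : slice X k 1 := SMap eN.
have [|g [s [s2 s0 s1]]] := slice_conservative qX (e := e).
  rewrite (_ : pslice X k 1 e = eps) //.
  rewrite -[LHS]act_id -(psliceE e (inl_tmiss k (hid 1))).
  by apply: (RP.1 _ _ _ _ (eP _ _)); rewrite /= hcomp1.
pose jd m u : hom (m.+1 + k) (m.+2 + k) := jn (delta (inord u : 'I_m.+2)) (hid k).
have [x0 Rx0] : @dom _ _ R (1 + k) (jd 0 1).
  apply/Rd; exists (inord 1); first by move=> /(congr1 val) /=; rewrite inordK.
  by move=> z; rewrite /jd jn_delta //=; apply/eqP; rewrite eq_sym neq_lift.
have Hx b (q : hom b (1 + k)) (tq : @tmiss 0 k b q) : act X q x0 = src e b (exist _ q tq).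
  rewrite srcE; symmetry; apply: (RP.1 _ _ _ _ (eP _ _)).
  exact: (RP.2 _ _ q _ _ Rx0).
have tg : d 0 g = src e.
  by rewrite -tgtE -[RHS]tgt_one; apply: M_tgt; exists s.
(* The facet x0 opposite to the vertex 1 is the join of the vertex 0 with Δ^k. Here it is spread
   along g, which ends at that vertex. *)
have [|||w [w0 wg]] := @slice_fill X qX k 0 1 g (fun=> x0).
- by [].
- by move=> [|[|u]] b q tq // _ _; rewrite tg Hx.
- by move=> [|u] [|[|v]].
(* The sides of s are e, g and an identity. Over g stands w, over the identity a degeneracy of x0,
   and the remaining join, over e, is the filler sought. *)
have [|||W [W0 Ws]] := @slice_fill X qX k 1 2 s
   (fun u => if u == 0 then w else act X (jn (hconst 1 ord0) (hid k)) x0).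
- by [].
- move=> [|[|[|u]]] b q tq // _ _.
    by rewrite s0; apply: wg.
  transitivity (act X q (act X (jn (hconst 1 ord0) (hid k)) x0)); first by [].
  rewrite s1 -act_comp (Hx _ _ (tmiss_jn _ tq)).
  by symmetry; exact: (@slice_act X k 1 0 (hconst 1 ord0) (src e) b q tq (tmiss_jn _ tq)).
- move=> [|[|u]] [|[|[|v]]] // b f q _ _ _ _; rewrite !jn_delta // => E.
  have [h [-> ->]] := @delta_pair b k.+1 0 1 f q isT isT E.
  have jd0 : delta (inord 0 : 'I_(1 + k).+2) = jd 0 0 by rewrite /jd jn_delta.
  rewrite /= !act_comp [delta _]jd0 (w0 0) //; congr (act X h _).
  by symmetry; exact: (@jn_degen X k).
exists (act X (jd 1 2) W) => m f x Rx.
have [j j0 hj] : exists2 j, j <> ord0 & forall i, happ f i <> j by apply/Rd; exists x.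
case: (leqP j 1) => j1; last first.
  have tf : @tmiss 1 k m f by exists j.
  rewrite -act_comp (Ws _ _ (tmiss_jn _ tf)).
  have := congr1 (fun z : slice X k 1 => z m (exist _ f tf)) s2; rewrite /d (slice_act _ _ (tmiss_jn _ tf)) => ->.
  exact: (RP.1 _ _ _ _ (eP m (exist _ f tf)) Rx).
have [q eq] := @delta_factor m (1 + k) j f hj.
have {}j1 : j = inord 1.
  apply: ord_inj; rewrite inordK //.
  have : j <> 0 :> nat by move=> h; apply: j0; apply: ord_inj.
  by lia.
have {}eq : f = hcomp (jd 0 1) q by rewrite eq /jd jn_delta // j1.
have -> : x = act X q x0 by apply: (RP.1 _ _ _ _ Rx); rewrite eq; apply: (RP.2 _ _ q _ _ Rx0).
rewrite eq act_comp; congr (act X q _).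
have E : hcomp (jd 1 2) (jd 0 1) = hcomp (jd 1 1) (jd 0 1).
  by rewrite /jd !jn_comp (@delta_delta 0 1 2).
rewrite -act_comp E act_comp (W0 1) //; exact: (@jn_degen X k).
Qed.

(** * Underlying groupoids *)

Notation over := Defs.over.

Lemma quasi_horn (X : sSet) (qX : is_quasicategory X) n (k : 'I_n.+3) (R : pmap (simplex n.+2) X) :
  is_pmap R -> k < n.+2 ->
  (forall m (f : hom m n.+2), @dom _ _ R m f <-> exists2 j, j <> k & forall i, f i <> j) ->
  (forall f x, R 1 f x -> is_equivalence x) ->
  exists z : X n.+2, forall m f x, R m f x -> act X f z = x.
Proof.
move=> RP kn Rd Re; case: (posnP k) => k0; last first.
  by apply: (horn_ext (k := k)) => //; apply: qX; rewrite k0 kn.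
have {}k0 : k = ord0 by apply: ord_inj.
have [eps Reps] : @dom _ _ R 1 (inl 1 n).
  apply/Rd; exists (inord 2); first by rewrite k0 => /(congr1 val) /=; rewrite inordK.
  by move=> i /(congr1 val) /=; rewrite !inordK //; have := ltn_ord i; lia.
apply: (special_horn qX RP _ Reps (Re _ _ Reps)) => m f.
by rewrite -k0; apply: Rd.
Qed.

(** An edge and k together occupy at most three vertices. Hence the edge misses a further vertex,
    unless the simplex is a triangle and the edge is its facet opposite to k. *)
Lemma horn_edge n (k : 'I_n.+3) (e : hom 1 n.+2) :
  (exists2 j, j <> k & forall i, e i <> j) \/ n = 0 /\ forall i, e i = delta k (inord i) :> nat.
Proof.
case: (pselect (exists2 j, j <> k & forall i, e i <> j)) => [|H]; [by left|right].
have hit (j : nat) : j < n.+3 -> j = k \/ j = e ord0 \/ j = e ord_max.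
  move=> hj; apply: contrapT => hn; apply: H; exists (inord j).
    by move=> /(congr1 val) /=; rewrite inordK // => E; apply: hn; left.
  move=> i /(congr1 val) /=; rewrite inordK // => E; apply: hn; right.
  by case: i E => -[|[|//]] hi <-; [left|right]; congr (nat_of_ord (e _)); apply: ord_inj.
have n0 : n = 0.
  case: n k e {H} hit => // n k e hit.
  have := hit 0 isT; have := hit 1 isT; have := hit 2 isT; have := hit 3 isT; lia.
split=> // i; subst n.
have h0 := hit 0 isT; have h1 := hit 1 isT; have h2 := hit 2 isT.
have h3 : e ord0 <= e ord_max by apply: (svalP e).
have h4 := ltn_ord (e ord_max); have h5 := ltn_ord k.
rewrite deltaV inordK //; case: i => -[|[|//]] hi.
  by rewrite (_ : Ordinal hi = ord0) /=; [lia|apply: ord_inj].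
by rewrite (_ : Ordinal hi = ord_max) /=; [lia|apply: ord_inj].
Qed.

(** Left horns are enough: [left_horns_LF] turns them into [LF], and [LF_RF] then gives lifting at
    the other end of the interval. *)
Lemma over_left_horns (X Y : sSet) (f : smap X Y) (y : Y 0) :
  is_quasicategory X -> left_horns (to_point (over f y)).
Proof.
move=> qX n k kn u v _.
suff [z zE] : exists z : over f y n, forall m x, act (over f y) (sval x) z = u m x.
  by exists (classify z); split=> // m x; case: (v m x).
case: n k kn u v => [|[|n]] k kn u _.
- by have := ltn_ord k; lia.
- have k0 : k = ord0 by apply: ord_inj => /=; case: (nat_of_ord k) kn.
  have h0 : exists2 j, j <> k & forall i, happ (hconst 0 (ord0 : 'I_2)) i <> j.
    by exists ord_max => //; rewrite k0.
  exists (deg (over f y) 1 (u 0 (exist _ (hconst 0 ord0) h0))) => m x.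
  rewrite act_deg /deg -smapE; congr (smap_fun u _ _); apply: sub_eq.
  apply: hom_eq => i; case: x => x [j jk hj] /=.
  have := hj i; case: (x i) => -[|[|//]] hi; first by move=> _; apply: ord_inj.
  case; apply: ord_inj => /=.
  have : j <> 0 :> nat by move=> E; apply: jk; apply: ord_inj; rewrite k0.
  by have := ltn_ord j; lia.
pose R : pmap (simplex n.+2) X := fun m g x => exists h, x = sval (u m (exist _ g h)).
have Rv m g x (p : R m g x) : exists q : over f y m, sval q = x.
  by case: p => h ->; exists (u m (exist _ g h)).
have RP : is_pmap R.
  split=> [m g x x' [h ->] [h' ->]|l m q g x [h ->]].
    by congr (sval (u m _)); apply: eq_exist.
  exists (faces_comp q h); rewrite -act_sub -smapE; congr (sval (u l _)); exact: eq_exist.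
have Rd m (g : hom m n.+2) : @dom _ _ R m g <-> exists2 j, j <> k & forall i, g i <> j.
  by split=> [[x [h _]]//|h]; exists (sval (u m (exist _ g h))), h.
have Re g x : R 1 g x -> is_equivalence x.
  move/Rv => [q <-]; have [h _] := svalP q.
  by have := h (hid 1); rewrite act_id.
have [z zE] := quasi_horn qX RP kn Rd Re.
have Hz : (forall e : hom 1 n.+2, is_equivalence (act X e z)) /\
          (forall i, equivalent (f 0 (vertex i z)) y).
  split=> [e|i].
    case: (horn_edge k e) => [/Rd [x Rx]|[n0 ek]]; first by rewrite (zE _ _ _ Rx); apply: Re Rx.
    subst n; have {ek}-> : e = delta k by apply: hom_eq => i; apply: ord_inj; rewrite ek inord_val.
    have dz (i : 'I_3) : i <> k -> is_equivalence (d i z).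
      move=> ik; rewrite /d inord_val.
      have [x Rx] : @dom _ _ R 1 (delta i).
        by apply/Rd; exists i => // q; apply/eqP; rewrite eq_sym neq_lift.
      by rewrite (zE _ _ _ Rx); apply: Re Rx.
    have Mz : M (d 2 z) (d 0 z) (d 1 z) by exists z.
    have ne (i : nat) : i < 3 -> i <> k -> is_equivalence (d i z).
      move=> hi ik; have := dz (inord i); rewrite inordK //; apply=> E.
      by apply: ik; rewrite -E inordK.
    (* In a triangle the edge opposite to k is new. It is an equivalence by two out of three: by
       cancellation for k = 0, by composition for k = 1. *)
    have [k0|k1] : k = 0 :> nat \/ k = 1 :> nat by lia.
      have kE : k = inord 0 by apply: ord_inj; rewrite k0 inordK.
      rewrite [in delta k]kE; apply: (q_right qX Mz (ne 2 _ _) (ne 1 _ _)); rewrite ?k0 //.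
    have kE : k = inord 1 by apply: ord_inj; rewrite k1 inordK.
    rewrite [in delta k]kE; apply: (q_comp qX Mz (ne 2 _ _) (ne 0 _ _)); rewrite ?k1 //.
  have [x Rx] : @dom _ _ R 0 (hconst 0 i).
    apply/Rd; have [j [hj jk ji]] : exists j, [/\ j < 3, j <> k :> nat & j <> i :> nat].
      apply: contrapT => H.
      have H' j : j < 3 -> j = k \/ j = i :> nat.
        by move=> hj; apply: contrapT => h; apply: H; exists j; split=> // E; apply: h; [left|right].
      have := H' 0 isT; have := H' 1 isT; have := H' 2 isT; lia.
    have jn : (inord j : 'I_n.+3) = j :> nat by rewrite inordK //; lia.
    exists (inord j); first by move=> E; apply: jk; rewrite -E.
    by move=> q E; apply: ji; rewrite -jn -E.
  rewrite /vertex (zE _ _ _ Rx); have [q qx] := Rv _ _ _ Rx; have [_ h] := svalP q.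
  have := h ord0; rewrite qx /vertex (_ : hconst 0 ord0 = hid 0) ?act_id //.
  by apply: hom_eq => a; rewrite !ord1.
exists (exist _ z Hz) => m x; apply: sub_eq; apply: zE.
by case: x => x hx; exists hx.
Qed.

Lemma over_LF (X Y : sSet) (f : smap X Y) (y : Y 0) :
  is_quasicategory X -> LF (to_point (over f y)).
Proof. by move=> qX; apply: left_horns_LF; apply: over_left_horns. Qed.

(** * Edges of J *)

Lemma J_edge (j : J 1) : is_equivalence j.
Proof.
apply/is_equivalenceP.
have E (a b : bool) : @M J (fun i : 'I_2 => if i == ord0 then a else b)
    (fun i : 'I_2 => if i == ord0 then b else a) (fun _ => a).
  exists (fun i : 'I_3 => if i == 1 :> nat then b else a).
  by split; apply: funext => i; rewrite /d /act /= /bump inordK //; case: i => -[|[|//]].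
pose j' : J 1 := fun i => if i == ord0 then j ord_max else j ord0.
have ej : j = fun i => if i == ord0 then j ord0 else j ord_max.
  by apply: funext => i; case: i => -[|[|//]] hi /=; congr (j _); apply: ord_inj.
have os : one (src j) = fun _ => j ord0 by [].
have ot : one (tgt j) = fun _ => j ord_max by [].
by split; exists j'; rewrite ?os ?ot {1}ej; apply: E.
Qed.

Lemma J_equivalence (X : sSet) (h : smap J X) (j : J 1) : is_equivalence (h 1 j).
Proof. by apply: smap_is_equivalence; apply: J_edge. Qed.

Lemma edge_J (X : sSet) (e : X 1) : LF (to_point X) ->
  exists h : smap J X, forall n t, h n (D1J n t) = act X t e.
Proof.
move=> lX.
pose R : pmap (sprod point J) X := fun n q x => exists t, D1J n t = q.2 /\ x = act X t e.
have [|||n q|w [wR _]] := LF_D1J lX (A := fun _ _ => False) (R := R) (v := to_point _).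
- by [].
- split=> [n q x x' [t [et ->]] [t' [et' ->]]|m n f q x [t [et ->]]].
    by rewrite -et in et'; rewrite (D1J_inj et').
  by exists (act (simplex 1) f t); rewrite smapE et -act_comp.
- by [].
- split=> [[x [t [h _]]]|[//|[t h]]]; first by right; exists t.
  by exists (act X t e), t.
exists (scomp w (pair_map (to_point J) (sid J))) => n t.
by rewrite /=; apply: wR; exists t.
Qed.

Lemma LF_edge (X : sSet) (e : X 1) : LF (to_point X) -> is_equivalence e.
Proof.
move=> /(edge_J e) [h hE].
by have := J_equivalence h (D1J 1 (hid 1)); rewrite hE act_id.
Qed.

(** The naturality square of the path: its diagonal [dg] is the start followed by an edge from J,
    and also an edge from J followed by the end. Edges from J are equivalences, so two out of three
    applies. *)
Lemma path_equivalence (C : sSet) (qC : is_quasicategory C) (g : path_space C 1) :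
  is_equivalence (path_end C 1 g) <-> is_equivalence (path_start C 1 g).
Proof.
have gJ (i : 'I_2) (j : J 1) : is_equivalence (g 1 (hconst 1 i, j)).
  have gP m n (f : hom m n) (j0 : J n) :
      g m (hconst m i, act J f j0) = act C f (g n (hconst n i, j0)).
    by rewrite -smapE; congr (g m (_, _)); apply: hom_eq.
  exact: (J_equivalence (SMap gP) j).
pose dg := g 1 (hid 1, fun i => i != ord0).
have M1 : M (path_start C 1 g) (g 1 (hconst 1 ord_max, fun i => i != ord0)) dg.
  exists (g 2 (pfst 1 1, fun i : 'I_3 => i == 2 :> nat)).
  split; rewrite d_smap; congr (g 1 (_, _)).
  - by apply: hom_eq => i; apply: ord_inj; change (pfst 1 1 (delta (inord 2 : 'I_3) i) = i :> nat);
      rewrite pfstE // deltaV inordK //; have := ltn_ord i; lia.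
  - by apply: funext => i; rewrite /deg /act /= /bump ?inordK //; case: i => -[|[|//]].
  - by apply: hom_eq => i; apply: ord_inj; change (pfst 1 1 (delta (inord 0 : 'I_3) i) = 1 :> nat);
      rewrite pfstE // deltaV inordK //; have := ltn_ord i; lia.
  - by apply: funext => i; rewrite /deg /act /= /bump ?inordK //; case: i => -[|[|//]].
  - by apply: hom_eq => i; apply: ord_inj; change (pfst 1 1 (delta (inord 1 : 'I_3) i) = i :> nat);
      rewrite pfstE // deltaV inordK //; have := ltn_ord i; lia.
  - by apply: funext => i; rewrite /deg /act /= /bump ?inordK //; case: i => -[|[|//]].
have M2 : M (g 1 (hconst 1 ord0, fun i => i != ord0)) (path_end C 1 g) dg.
  exists (g 2 (pfst 1 0, fun i : 'I_3 => i != 0 :> nat)).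
  split; rewrite d_smap; congr (g 1 (_, _)).
  - by apply: hom_eq => i; apply: ord_inj; change (pfst 1 0 (delta (inord 2 : 'I_3) i) = 0 :> nat);
      rewrite pfstE // deltaV inordK //; have := ltn_ord i; lia.
  - by apply: funext => i; rewrite /deg /act /= /bump ?inordK //; case: i => -[|[|//]].
  - by apply: hom_eq => i; apply: ord_inj; change (pfst 1 0 (delta (inord 0 : 'I_3) i) = i :> nat);
      rewrite pfstE // deltaV inordK //; have := ltn_ord i; lia.
  - by apply: funext => i; rewrite /deg /act /= /bump ?inordK //; case: i => -[|[|//]].
  - by apply: hom_eq => i; apply: ord_inj; change (pfst 1 0 (delta (inord 1 : 'I_3) i) = i :> nat);
      rewrite pfstE // deltaV inordK //; have := ltn_ord i; lia.
  - by apply: funext => i; rewrite /deg /act /= /bump ?inordK //; case: i => -[|[|//]].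
split=> H.
  by apply: (q_left qC M1 (gJ _ _)); apply: (q_comp qC M2 (gJ _ _)).
by apply: (q_right qC M2 (gJ _ _)); apply: (q_comp qC M1 H (gJ _ _)).
Qed.

(** * The left fibration of elements *)

Section Retraction.
Variables (n : nat) (S : {set 'I_n.+1}).

(** A monotone retraction of [n] onto S: x goes to the least element of S above it, and to the
    greatest element of S if there is none. The clauses are what monotonicity needs in either
    case. *)
Lemma ret_ex (x : 'I_n.+1) : exists y, (exists j, j \in S) ->
  [/\ y \in S, forall s, s \in S -> x <= s -> y <= s,
      forall s, s \in S -> x <= s -> x <= y &
      (forall s, s \in S -> s < x) -> forall s, s \in S -> s <= y].
Proof.
case: (pselect (exists2 s, s \in S & x <= s)) => [[s0 s0S xs0]|H].
  have h0 : (s0 \in S) && (x <= s0) by rewrite s0S.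
  case: (@arg_minnP _ s0 (fun s => (s \in S) && (x <= s)) (fun s : 'I_n.+1 => nat_of_ord s) h0)
    => y /andP[yS xy] ymin.
  exists y => _; split=> // [s sS xs|H]; first by apply: ymin; rewrite sS.
  by have := H _ s0S; rewrite ltnNge xs0.
case: (pselect (exists j, j \in S)) => [[j jS]|h]; last by exists x.
case: (@arg_maxnP _ j (fun s => s \in S) (fun s : 'I_n.+1 => nat_of_ord s) jS) => y yS ymax.
exists y => _; split=> // s sS xs; by case: H; exists s.
Qed.

Definition ret_fun (x : 'I_n.+1) : 'I_n.+1 :=
  if pselect (exists j, j \in S) then sval (cid (ret_ex x)) else x.

Lemma ret_mono (x y : 'I_n.+1) : x <= y -> ret_fun x <= ret_fun y.
Proof.
rewrite /ret_fun; case: pselect => [nS|//] xy.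
case: cid => a /= /(_ nS) [a1 a2 a3 a4]; case: cid => b /= /(_ nS) [b1 b2 b3 b4].
case: (pselect (exists2 s, s \in S & y <= s)) => [[s sS ys]|H].
  by apply: a2 => //; apply: leq_trans xy (b3 s sS ys).
apply: b4 => // s sS; rewrite ltnNge; apply/negP => ys; by apply: H; exists s.
Qed.

Definition ret : hom n n := mk_hom ret_mono.

Lemma ret_id s : s \in S -> ret s = s.
Proof.
move=> sS; rewrite /= /ret_fun; case: pselect => [nS|[]]; last by exists s.
case: cid => a /= /(_ nS) [a1 a2 a3 _]; apply: ord_inj; apply/eqP.
by rewrite eqn_leq (a2 s) // (a3 s).
Qed.

Lemma ret_in s x : s \in S -> ret x \in S.
Proof.
move=> sS; rewrite /= /ret_fun; case: pselect => [nS|[]]; last by exists s.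
by case: cid => a /= /(_ nS) [].
Qed.

Lemma ret_img (T : {set 'I_n.+1}) : T \subset S -> happ ret @: T = T.
Proof.
move=> /subsetP TS; apply/setP => v; apply/imsetP/idP => [[w wT ->]|vT].
  by rewrite ret_id // TS.
by exists v => //; rewrite ret_id // TS.
Qed.
End Retraction.

Lemma ret_comp n (S T : {set 'I_n.+1}) t : T \subset S -> t \in T ->
  hcomp (ret S) (ret T) = ret T.
Proof.
by move=> /subsetP TS tT; apply: hom_eq => x; apply: ret_id; apply/TS/ret_in/tT.
Qed.

(** * Gluing families over cubes of subsets *)

Section Fib.
Variables (A : simplicial_cat) (U : simplicial_functor A).

(** The equation h is an argument, so that families over equal bases take values in the same
    simplicial sets and can be compared. *)
Definition fib n (e : el_simplex U n) (s : hc_simplex A n) (h : el_base e = s) :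
    forall j k, cone_chain k j -> U (hob s j) k :=
  match h in _ = s0 return forall j k, cone_chain k j -> U (hob s0 j) k with
  | erefl => @el_fun _ _ _ e end.

Lemma fib_law n (e : el_simplex U n) s (h : el_base e = s) : el_law (fib h).
Proof. by case: s / h; exact: el_funP. Qed.

Lemma fib_eq n (e e' : el_simplex U n) s (h : el_base e = s) (h' : el_base e' = s) j k
  (c : cone_chain k j) : e = e' -> fib h c = fib h' c.
Proof. by move=> E; subst e'; rewrite (Prop_irrelevance h h'). Qed.

Lemma fib_act m n (g : hom m n) (e : el_simplex U n) s (h : el_base e = s)
    (h' : el_base (el_act g e) = hc_act g s) j k (c : cone_chain k j) :
  fib h' c = fib h (cone_img g c).
Proof. by subst s; rewrite (Prop_irrelevance h' erefl). Qed.

Lemma fib_inj n (e e' : el_simplex U n) s (h : el_base e = s) (h' : el_base e' = s) :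
  (forall j k (c : cone_chain k j), fib h c = fib h' c) -> e = e'.
Proof.
subst s; case: e e' h' => b x P [b' x' P'] /= h' E; subst b'.
have {}E : x = x'.
  apply: functional_extensionality_dep => j; apply: functional_extensionality_dep => k.
  by apply: funext => c; exact: E.
by subst x'; congr ElSimplex; apply: Prop_irrelevance.
Qed.

Lemma fib_mp n o mp mp' Q Q' (e : el_simplex U n) (h : el_base e = @HcSimplex A n o mp Q)
    (h' : el_base e = @HcSimplex A n o mp' Q') j k (c : cone_chain k j) :
  (forall i j k c, mp i j k c = mp' i j k c) -> fib h c = fib h' c.
Proof.
move=> E; have {}E : mp = mp'.
  apply: functional_extensionality_dep => i; apply: functional_extensionality_dep => i'.
  by apply: functional_extensionality_dep => l; apply: funext.
subst mp'; have EQ : Q = Q' by apply: Prop_irrelevance.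
by subst Q'; rewrite (Prop_irrelevance h h').
Qed.

Lemma fib_hc l m n (g : hom l m) (f : hom m n) (b : hc_simplex A n) (e : el_simplex U l)
    (h : el_base e = hc_act (hcomp f g) b) (h' : el_base e = hc_act g (hc_act f b))
    j k (c : cone_chain k j) : fib h c = fib h' c.
Proof.
case: b h h' => o mp Q h h'; apply: fib_mp => i i' q x /=.
by congr (mp _ _ _ _); apply: chain_eq => a; apply: imset_hcomp.
Qed.

Program Definition cone n (j : 'I_n.+1) : sSet :=
  @SSet (fun k => cone_chain k j) (@Simplicial (fun k => cone_chain k j)
    (fun _ _ f c => cone_pre f c) _ _).
Next Obligation. exact: cone_eq. Qed.
Next Obligation. exact: cone_eq. Qed.

Lemma cone_sub n (j : 'I_n.+1) k (c : cone_chain k j) (a b : 'I_k.+1) : a <= b -> sval c b \subset sval c a.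
Proof. by case: c => c [c1 c2]; apply: c1. Qed.
Lemma cone_sub0 n (j : 'I_n.+1) k (c : cone_chain k j) a : sval c a \subset sval c ord0.
Proof. exact: cone_sub. Qed.
Lemma cone_top n (j : 'I_n.+1) k (c : cone_chain k j) a : j \in sval c a.
Proof. by case: c => c [c1 c2] /=; case: (c2 a). Qed.
Lemma cone_le n (j : 'I_n.+1) k (c : cone_chain k j) a v : v \in sval c a -> v <= j.
Proof. by case: c => c [c1 c2] /=; case: (c2 a) => _; apply. Qed.
Lemma chain_sub n (i j : 'I_n.+1) k (c : chain k i j) (a b : 'I_k.+1) : a <= b -> sval c b \subset sval c a.
Proof. by case: c => c [c1 c2]; apply: c1. Qed.
Lemma chain_sub0 n (i j : 'I_n.+1) k (c : chain k i j) a : sval c a \subset sval c ord0.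
Proof. exact: chain_sub. Qed.
Lemma chain_in n (i j : 'I_n.+1) k (c : chain k i j) a : (i \in sval c a) /\ (j \in sval c a).
Proof. by case: c => c [c1 c2] /=; case: (c2 a). Qed.
Lemma chain_le n (i j : 'I_n.+1) k (c : chain k i j) a v : v \in sval c a -> i <= v <= j.
Proof. by case: c => c [c1 c2] /=; case: (c2 a) => _ _; apply. Qed.

Lemma cone_cupE n (i j : 'I_n.+1) k (c : cone_chain k i) (d : chain k i j) a :
  sval (cone_cup c d) a = sval c a :|: sval d a.
Proof. by []. Qed.

Section Glue.
Variables (n : nat) (P : 'I_n.+1 -> Prop) (b : hc_simplex A n) (u : smap (faces P) (elements U)).
Hypotheses (hu : forall m f, el_base (u m f) = hc_act (sval f) b) (Pmax : P ord_max).

Definition cst i j (e : i = j) k : U (hob b i) k -> U (hob b j) k :=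
  match e in _ = j0 return U (hob b i) k -> U (hob b j0) k with erefl => fun y => y end.

Lemma cst_act i j (e : i = j) k l (g : hom l k) y : cst e (act _ g y) = act _ g (cst e y).
Proof. by case: j / e. Qed.

Lemma cst_sact i' i (ei : i' = i) j' j (ej : j' = j) k (d' : chain k i' j') (d : chain k i j) y :
  (forall a, sval d' a = sval d a) ->
  cst ej (sact U (hmp b d') y) = sact U (hmp b d) (cst ei y).
Proof. by subst i j => E /=; congr (sact U (hmp b _) _); apply: chain_eq. Qed.

Definition X m (f : faces P m) j k (c : cone_chain k j) : U (hob b (happ (sval f) j)) k :=
  fib (hu f) c.

Lemma X_act l m (g : hom l m) (f : faces P m) j k (c : cone_chain k j) :
  X (act (faces P) g f) c = X f (cone_img g c).
Proof.
have e1 : u l (act (faces P) g f) = el_act g (u m f) by exact: smapE.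
have h1 : el_base (el_act g (u m f)) = hc_act (hcomp (sval f) g) b by rewrite -e1 hu.
have h2 : el_base (el_act g (u m f)) = hc_act g (hc_act (sval f) b) by rewrite /= hu.
refine (etrans (@fib_eq _ _ _ (hc_act (hcomp (sval f) g) b) (hu (act (faces P) g f)) h1 j k c e1) _).
by rewrite (fib_hc h1 h2); exact: (@fib_act _ _ g _ _ (hu f) h2 _ _ c).
Qed.

Lemma X_nat m (f : faces P m) j k l (g : hom l k) (c : cone_chain k j) :
  X f (cone_pre g c) = act _ g (X f c).
Proof. exact: (fib_law (hu f)).1. Qed.

Lemma X_cup m (f : faces P m) i j k (c : cone_chain k i) (d : chain k i j) :
  X f (cone_cup c d) = sact U (hmp b (chain_img (sval f) d)) (X f c).
Proof. exact: (fib_law (hu f)).2. Qed.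

Lemma X_cst m (f : faces P m) j1 j2 k (c1 : cone_chain k j1) (c2 : cone_chain k j2) i
    (e1 : happ (sval f) j1 = i) (e2 : happ (sval f) j2 = i) : j1 = j2 ->
  (forall a, sval c1 a = sval c2 a) -> cst e1 (X f c1) = cst e2 (X f c2).
Proof.
by move=> E; subst j2 => H; rewrite (Prop_irrelevance e1 e2) (cone_eq H).
Qed.

Lemma X_face m (f f' : faces P m) j k (c : cone_chain k j) i
    (e : happ (sval f) j = i) (e' : happ (sval f') j = i) : f = f' ->
  cst e (X f c) = cst e' (X f' c).
Proof. by move=> E; subst f'; rewrite (Prop_irrelevance e e'). Qed.

Definition miss k (j : 'I_n.+1) (c : cone_chain k j) := exists2 i, P i & i \notin sval c ord0.

Lemma miss_face k (j : 'I_n.+1) (c : cone_chain k j) : miss c ->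
  exists2 i, P i & forall x, happ (ret (sval c ord0)) x <> i.
Proof.
move=> [i Pi ic]; exists i => // x E; case/negP: ic; rewrite -E.
exact: ret_in (cone_top c ord0).
Qed.

(** A chain that misses a vertex of P comes from a face in P, where u prescribes the value. Instead
    of choosing such a vertex, u is evaluated at the retraction onto the largest set of the chain,
    which fixes all its sets; this canonical choice is what makes [G] natural ([G_ret]). *)
Definition G j k (c : cone_chain k j) (h : miss c) : U (hob b j) k :=
  cst (ret_id (cone_top c ord0)) (X (exist _ (ret (sval c ord0)) (miss_face h)) c).

Lemma G_ret (S : {set 'I_n.+1}) hS j k (c : cone_chain k j) (h : miss c) (e : ret S j = j) :
  sval c ord0 \subset S -> cst e (X (exist _ (ret S) hS) c) = G h.
Proof.
move=> cS; set T := sval c ord0 in cS *.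
have jT : j \in T := cone_top c ord0.
have E : exist _ (ret T) (miss_face h) = act (faces P) (ret T) (exist _ (ret S) hS).
  by apply: eq_exist; exact: esym (ret_comp cS jT).
have e' : happ (ret S) (ret T j) = j by rewrite (ret_id jT) (ret_id (subsetP cS _ jT)).
symmetry; refine (etrans (@X_face _ (exist _ (ret T) (miss_face h)) (act (faces P) (ret T) (exist _ (ret S) hS)) j k c j (ret_id (cone_top c ord0)) e' E) _).
refine (etrans (congr1 (cst e' (k := k)) (X_act (ret T) (exist _ (ret S) hS) c)) _).
apply: X_cst; first by rewrite (ret_id jT).
by move=> a /=; rewrite ret_img // cone_sub0.
Qed.

Lemma G_act k l (g : hom l k) j (c : cone_chain k j) (h : miss c) (h' : miss (cone_pre g c)) :
  G h' = act _ g (G h).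
Proof.
rewrite -(G_ret (miss_face h) h' (ret_id (cone_top c ord0))) //.
  by rewrite /G -cst_act X_nat.
exact: (cone_sub0 c (g ord0)).
Qed.

Lemma G_cup i j k (c : cone_chain k i) (d : chain k i j) (h : miss (cone_cup c d)) (hc : miss c) :
  G h = sact U (hmp b d) (G hc).
Proof.
set S := sval (cone_cup c d) ord0.
have iS : i \in S by rewrite /S cone_cupE finset.inE cone_top.
rewrite -(G_ret (miss_face h) hc (ret_id iS)) ?subsetUl //.
have dS a : sval d a \subset S by apply: subset_trans (chain_sub0 d a) (subsetUr _ _).
rewrite -(cst_sact (ret_id iS) (ret_id (cone_top (cone_cup c d) ord0)) (d' := chain_img (ret S) d)); last first.
  by move=> a /=; rewrite ret_img.
by rewrite /G X_cup.
Qed.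

Lemma miss_lt (i : 'I_n.+1) (j : nat) k (c : cone_chain k i) : i < j -> j < n.+1 -> miss c.
Proof.
move=> ij jn; exists ord_max => //; apply/negP => /cone_le /=; lia.
Qed.

(** Chains ending at j < n miss [ord_max], which is in P, so their values are known. Over [ord_max]
    the value is forced on chains that miss a vertex of P, and on chains all of whose sets contain
    some i < n, which decompose at i. Gluing thus reduces to the single extension problem [EXT]. *)
Definition box k (c : cone (ord_max : 'I_n.+1) k) : Prop :=
  miss c \/ exists2 i : 'I_n.+1, i < n & forall a, i \in sval c a.

Hypothesis EXT : forall K : pmap (cone (ord_max : 'I_n.+1)) (U (hob b ord_max)), is_pmap K ->
  (forall k c, @dom _ _ K k c <-> box c) -> exists w : smap (cone ord_max) (U (hob b ord_max)), extends K w.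

Lemma cup_inj (i j : 'I_n.+1) k (c c' : cone_chain k i) (d d' : chain k i j) :
  cone_cup c d = cone_cup c' d' -> c = c' /\ d = d'.
Proof.
move=> E.
have H a v : (v \in sval c a) || (v \in sval d a) = (v \in sval c' a) || (v \in sval d' a).
  by have := congr1 (fun q : cone_chain k j => v \in sval q a) E; rewrite !cone_cupE !finset.inE.
split.
  apply: cone_eq => a; apply/setP => v; have := H a v.
  case: (leqP v i) => vi; last first.
    have nc (q : cone_chain k i) : v \in sval q a = false by apply/negP => /cone_le h; lia.
    by rewrite !nc.
  have [->|ne] := eqVneq v i; first by rewrite !cone_top.
  have nd (q : chain k i j) : v \in sval q a = false.
    apply/negP => /chain_le /andP[h _]; case/eqP: ne; apply: ord_inj; lia.
  by rewrite !nd !orbF.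
apply: chain_eq => a; apply/setP => v; have := H a v.
case: (leqP i v) => vi; last first.
  have nd (q : chain k i j) : v \in sval q a = false.
    by apply/negP => /chain_le /andP[h _]; lia.
  by rewrite !nd.
have [->|ne] := eqVneq v i; first by rewrite !(chain_in _ a).1.
have nd (q : cone_chain k i) : v \in sval q a = false.
  apply/negP => /cone_le h; case/eqP: ne; apply: ord_inj; lia.
by rewrite !nd.
Qed.

Lemma low_ex (i j : 'I_n.+1) k (c : cone_chain k j) : i <= j -> (forall a, i \in sval c a) ->
  exists (c' : cone_chain k i) (d : chain k i j), c = cone_cup c' d.
Proof.
move=> ij ic.
have P1 : (forall x y : 'I_k.+1, x <= y -> [set v in sval c y | v <= i] \subset [set v in sval c x | v <= i]) /\
   (forall x, i \in [set v in sval c x | v <= i] /\ forall v, v \in [set v in sval c x | v <= i] -> v <= i).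
  split=> [x y xy|x]; last by split=> [|v]; rewrite finset.inE ?ic ?leqnn // => /andP[].
  apply/subsetP => v; rewrite !finset.inE => /andP[h ->]; rewrite andbT.
  exact: (subsetP (cone_sub c xy)).
have P2 : (forall x y : 'I_k.+1, x <= y -> [set v in sval c y | i <= v] \subset [set v in sval c x | i <= v]) /\
   (forall x, [/\ i \in [set v in sval c x | i <= v], j \in [set v in sval c x | i <= v]
      & forall v, v \in [set v in sval c x | i <= v] -> i <= v <= j]).
  split=> [x y xy|x].
    apply/subsetP => v; rewrite !finset.inE => /andP[h ->]; rewrite andbT.
    exact: (subsetP (cone_sub c xy)).
  split=> [||v]; rewrite !finset.inE ?ic ?leqnn ?cone_top //.
  by move=> /andP[/cone_le -> ->].
exists (exist _ (fun x => [set v in sval c x | v <= i]) P1).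
exists (exist _ (fun x => [set v in sval c x | i <= v]) P2).
apply: cone_eq => a; apply/setP => v; rewrite /= !finset.inE -andb_orr.
by case: (leqP v i) => [//|/ltnW ->]; rewrite andbT.
Qed.

Lemma el_max : exists w : smap (cone ord_max) (U (hob b ord_max)),
  (forall k (c : cone_chain k ord_max) (h : miss c), w k c = G h) /\
  (forall i k (c : cone_chain k i) (d : chain k i ord_max) (hc : miss c), i < n ->
     w k (cone_cup c d) = sact U (hmp b d) (G hc)).
Proof.
pose K : pmap (cone (ord_max : 'I_n.+1)) (U (hob b ord_max)) := fun k c y =>
  (exists h : miss c, y = G h) \/
  (exists i (c' : cone_chain k i) (d : chain k i ord_max) (hc : miss c'),
     [/\ i < n, c = cone_cup c' d & y = sact U (hmp b d) (G hc)]).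
have Girr k j (c : cone_chain k j) (h h' : miss c) : G h = G h' by rewrite (Prop_irrelevance h h').
have cc k i1 i2 (c1 : cone_chain k i1) d1 (h1 : miss c1) (c2 : cone_chain k i2) d2 (h2 : miss c2) :
    i1 <= i2 -> i1 < n -> i2 < n -> cone_cup c1 d1 = cone_cup c2 d2 :> cone_chain k ord_max ->
    sact U (hmp b d1) (G h1) = sact U (hmp b d2) (G h2).
  move=> i12 i1n i2n E.
  have [E12|ne] := eqVneq i1 i2.
    by subst i2; have [Ec Ed] := cup_inj E; subst c2 d2; rewrite (Girr _ _ _ h1 h2).
  have lt12 : i1 < i2 by rewrite ltn_neqAle i12 andbT; apply/eqP => /ord_inj/eqP; rewrite (negPf ne).
  (* If the cuts are at i1 < i2, the first part c2 contains i1 and decomposes further, so both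
     values agree by functoriality of b. *)
  have i1c2 a : i1 \in sval c2 a.
    have := congr1 (fun q : cone_chain k ord_max => i1 \in sval q a) E.
    rewrite !cone_cupE !finset.inE cone_top /= => /esym/orP[//|/chain_le /andP[]]; lia.
  have [c1' [e Ec2]] := low_ex i12 i1c2.
  have E2 : cone_cup c1 d1 = cone_cup c1' (chain_cup e d2).
    by rewrite E Ec2; apply: cone_eq => a /=; rewrite setUA.
  have [Ec Ed] := cup_inj E2; subst c1'.
  rewrite Ed; subst c2; rewrite (G_cup h2 h1).
  by have [_ _ ->] := hmpP b; rewrite sactM.
have KP : is_pmap K.
  split=> [k c y y'|l k g c y].
    case=> [[h ->]|[i [c1 [d1 [h1 [i1 -> ->]]]]]] [[h' ->]|[i' [c2 [d2 [h2 [i2 E ->]]]]]] //.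
    - by subst c; apply: G_cup.
    - by symmetry; apply: G_cup.
    - case: (leqP i i') => ii; first exact: cc E.
      by symmetry; apply: cc (esym E) => //; apply: ltnW.
  case=> [[h ->]|[i [c1 [d1 [h1 [i1 -> ->]]]]]].
    have h' : miss (cone_pre g c).
      case: h => i Pi ic; exists i => //; apply: contra ic; exact: (subsetP (cone_sub0 c _)).
    by left; exists h'; rewrite (G_act h h').
  have h' : miss (cone_pre g c1) by apply: (@miss_lt i n).
  right; exists i, (cone_pre g c1), (chain_pre g d1), h'; split=> //; first exact: cone_eq.
  by have [-> _ _] := hmpP b; rewrite (G_act h1 h') sact_act.
have [|w wK] := EXT KP.
  move=> k c; split.
    case=> y [[h _]|[i [c1 [d1 [h1 [i1 -> _]]]]]]; first by left.
    by right; exists i => // a; rewrite cone_cupE finset.inE cone_top.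
  case=> [h|[i iN ic]]; first by exists (G h); left; exists h.
  have [c' [d E]] := low_ex (ltnW iN : i <= (ord_max : 'I_n.+1)) ic.
  have hc : miss c' by apply: (@miss_lt i n).
  by exists (sact U (hmp b d) (G hc)); right; exists i, c', d, hc.
exists w; split=> [k c h|i k c d hc iN]; first by apply: wK; left; exists h.
by apply: wK; right; exists i, c, d, hc.
Qed.

Lemma el_at j : exists w : smap (cone j) (U (hob b j)),
  (forall k (c : cone_chain k j) (h : miss c), w k c = G h) /\
  (forall i k (c : cone_chain k i) (d : chain k i j) (hc : miss c), i < j ->
     w k (cone_cup c d) = sact U (hmp b d) (G hc)).
Proof.
have [E|ne] := eqVneq j ord_max; first by subst j; exact: el_max.
have jn : j < n.
  by rewrite ltn_neqAle -ltnS ltn_ord andbT; apply: contra ne => /eqP E; apply/eqP/ord_inj.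
have h0 k (c : cone_chain k j) : miss c by apply: (@miss_lt j n).
exists (@SMap (cone j) (U (hob b j)) (fun k c => G (h0 k c)) (fun l k g c => G_act (h0 _ _) (h0 _ _))).
split=> [k c h|i k c d hc ij] /=; first by rewrite (Prop_irrelevance h (h0 k c)).
exact: G_cup.
Qed.

Lemma el_glue : exists z : el_simplex U n, el_base z = b /\
  forall m f, act (elements U) (sval f) z = u m f.
Proof.
pose w j := sval (cid (el_at j)).
have w1 j k (c : cone_chain k j) (h : miss c) : w j k c = G h.
  by rewrite /w; case: cid => q /= [].
have w2 i j k (c : cone_chain k i) (d : chain k i j) (hc : miss c) : i < j ->
     w j k (cone_cup c d) = sact U (hmp b d) (G hc).
  by rewrite /w; case: cid => q /= [_ +]; apply.
have L : @el_law A U n b (fun j k c => w j k c).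
  split=> [j k l g c|i j k c d]; first exact: (smapE (w j) g c).
  have /andP[ij _] := chain_le (chain_in d ord0).2.
  have [E|ne] := eqVneq i j.
    subst j; have [_ -> _] := hmpP b; rewrite sact1; congr (smap_fun (w i) _ _).
    apply: cone_eq => a /=; apply/setUidPl/subsetP => v /chain_le h.
    by have -> : v = i by [apply: ord_inj; lia]; exact: cone_top.
  have lt : i < j by rewrite ltn_neqAle ij andbT; apply: contra ne => /eqP E; apply/eqP/ord_inj.
  have hc : miss c by apply: (@miss_lt i j).
  by rewrite (w2 _ _ _ _ _ hc lt) (w1 _ _ _ hc).
exists (ElSimplex L); split=> // m f.
suff H j k (c : cone_chain k j) : fib (erefl : el_base (el_act (sval f) (ElSimplex L)) = hc_act (sval f) b) c = fib (hu f) c.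
  exact: (fib_inj H).
change (w (happ (sval f) j) k (cone_img (sval f) c) = X f c).
have h : miss (cone_img (sval f) c).
  have [i Pi fi] := svalP f; exists i => //=; apply/negP => /imsetP[x _ E]; exact: (fi x).
rewrite (w1 _ _ _ h); set r := ret (sval c ord0).
have rj : r j = j by apply/ret_id/cone_top.
have e1 : happ (sval f) (r j) = happ (sval f) j by rewrite rj.
rewrite -[X f c]/(cst erefl (X f c)) (X_cst (c2 := cone_img r c) erefl e1 (esym rj)); last first.
  by move=> a /=; rewrite ret_img // cone_sub.
rewrite -X_act /G; set S := sval (cone_img (sval f) c) ord0.
have fS x : happ (sval f) (r x) \in S by apply: imset_f; apply: ret_in (cone_top c ord0).
have e2 : happ (ret S) (happ (hcomp (sval f) r) j) = happ (sval f) j.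
  exact: (etrans (ret_id (fS j)) e1).
refine (etrans (@X_cst _ (exist _ (ret S) (miss_face h)) _ _ _ _ (cone_img (hcomp (sval f) r) c) _
  (ret_id (cone_top (cone_img (sval f) c) ord0)) e2 _ _) _).
- exact: esym e1.
- move=> a; change (happ (sval f) @: sval c a = happ (hcomp (sval f) r) @: sval c a).
  by rewrite imset_hcomp ret_img // cone_sub0.
refine (etrans (congr1 (cst e2 (k := k)) (esym (X_act (hcomp (sval f) r) (exist _ (ret S) (miss_face h)) c))) _).
apply: X_face; apply: (@sub_eq _ _ (@faces_closed n P)); apply: hom_eq => x.
exact: ret_id (fS x).
Qed.
End Glue.

Hypothesis UL : forall a, LF (to_point (U a)).

Lemma el_left_horns : left_horns (el_proj U).
Proof.
move=> n k kn u v uv.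
have hu m f : el_base (u m f) = hc_act (sval f) (v n (hid n)).
  have := uv m f; rewrite /= => ->; rewrite -[RHS](smapE v (sval f)) act_simplex hcomp1l.
  by [].
have kmax : ord_max <> k by move=> E; rewrite -E ltnn in kn.
have [K KP Kd|z [zb zE]] := el_glue hu kmax; last first.
  exists (@classify (elements U) n z); split=> [m x|m x]; first exact: zE.
  change (hc_act x (el_base z) = v m x); rewrite zb.
  by apply: etrans (esym (smapE v x (hid n))) _; rewrite act_simplex hcomp1l.
pose N : 'I_n.+1 := ord_max.
(* The set k is added to as long as t is 0. At t = 0 every chain decomposes at k < n and lies in the
   box; at t = 1 it is unchanged; a chain missing i <> k still misses i. So the box extends by
   lifting at the vertex 0 of the interval. *)
pose ad (t : 'I_2) (s : {set 'I_n.+1}) := if t == ord0 then k |: s else s.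
have kP l (c : cone_chain l N) (t : hom l 1) :
  (forall x y : 'I_l.+1, x <= y -> ad (t y) (sval c y) \subset ad (t x) (sval c x)) /\
  (forall x, N \in ad (t x) (sval c x) /\ forall w, w \in ad (t x) (sval c x) -> w <= N).
  split=> [x y xy|x]; last first.
    split; first by rewrite /ad; case: ifP => _; rewrite ?finset.inE cone_top ?orbT.
    by move=> w _; rewrite -ltnS ltn_ord.
  have h := cone_sub c xy; have ht : t x <= t y := svalP t _ _ xy.
  rewrite /ad; case: (eqVneq (t y) ord0) => ty.
    by rewrite ty leqn0 in ht; rewrite (_ : t x == ord0) ?setUS //; apply/eqP/ord_inj/eqP.
  by case: ifP => _ //; apply: subset_trans h (subsetUr _ _).
pose kk0 l (q : sprod (cone N) (simplex 1) l) : cone N l := exist _ _ (kP l q.1 q.2).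
have kkN l l' (g : hom l l') q : kk0 l (act _ g q) = act (cone N) g (kk0 l' q) by apply: cone_eq.
pose kk : smap (sprod (cone N) (simplex 1)) (cone N) := SMap kkN.
pose bx l (c : cone N l) := box (fun j => j <> k) c.
have bxP : subclosed bx.
  move=> l l' g c [[i ik ic]|[i iN ic]]; last by right; exists i => // a; exact: (ic (g a)).
  left; exists i => //; apply: contra ic; exact: (subsetP (cone_sub0 c _)).
pose PP l (q : sprod (cone N) (simplex 1) l) := bx l q.1 \/ atv (Delta1_end false) q.2.
have PPP : subclosed PP.
  by move=> l l' g q [h|h]; [left; apply: bxP|right; apply: (atv_closed g h)].
have [|||l q|w [wK _]] := @UL (hob (v n (hid n)) N) _ bx (to_point _) (pre_pmap PP kk K).
- exact: bxP.
- exact: pre_is_pmap.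
- by [].
- split=> [[y [h _]] //|h].
  have [y Ky] : dom K (kk l q); last by exists y.
  apply/Kd; case: h => [[[i ik ic]|[i iN ic]]|h].
  + left; exists i => //=; rewrite /ad; case: ifP => _ //.
    by rewrite !finset.inE negb_or ic andbT; apply/eqP.
  + by right; exists i => // x /=; rewrite /ad; case: ifP => _ //; rewrite finset.inE ic orbT.
  + right; exists k => // x; change (k \in ad (happ q.2 x) (sval q.1 x)); rewrite /ad.
    by have -> : happ q.2 x == ord0 by [rewrite (h : q.2 = _)]; rewrite finset.inE finset.in_set1 eqxx.
exists (scomp w (pair_map (sid _) (@SMap (cone N) (simplex 1) (fun l _ => deg (simplex 1) l (Delta1_end true))
   (fun _ _ g _ => esym (act_deg g _))))) => l c y Kc.
have E : kk l (c, deg (simplex 1) l (Delta1_end true)) = c by apply: cone_eq.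
have bc : bx l c by apply/Kd; exists y.
by apply: wK; split; [left|rewrite [pair_map _ _ _ _]/= E].
Qed.

Lemma el_LF : LF (el_proj U).
Proof. exact: left_horns_LF el_left_horns. Qed.

End Fib.

(** * Maps out of a cosimplicial simplicial set *)

Record cosimp := Cosimp {
  cs :> nat -> sSet;
  csm : forall l m, hom l m -> smap (cs l) (cs m);
  csm_id : forall m k (z : cs m k), csm (hid m) k z = z;
  csm_comp : forall l m n (f : hom m n) (g : hom l m) k (z : cs l k),
    csm (hcomp f g) k z = csm f k (csm g k z) }.
Arguments csm W [l m] f : rename.

Program Definition Hm (W : cosimp) (X : sSet) : sSet :=
  @SSet (fun m => smap (W m) X)
    (@Simplicial (fun m => smap (W m) X) (fun _ _ f g => scomp g (csm W f)) _ _).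
Next Obligation. by apply: smap_eq => k z /=; rewrite csm_id. Qed.
Next Obligation. by apply: smap_eq => k z /=; rewrite csm_comp. Qed.

Program Definition hm_post (W : cosimp) (X Y : sSet) (p : smap X Y) : smap (Hm W X) (Hm W Y) :=
  @SMap (Hm W X) (Hm W Y) (fun _ g => scomp p g) _.
Next Obligation. exact: smap_eq. Qed.

Section Sub.
Variables (W : cosimp) (L : forall m k, W m k -> Prop).
Hypotheses (HL : forall m, subclosed (@L m))
  (Lc : forall l m (f : hom l m) k z, L z -> L (csm W f k z)).

Program Definition csub : cosimp :=
  @Cosimp (fun m => subsset (@HL m))
    (fun l m f => @sub_lift (subsset (@HL l)) (W m) _ (@HL m) (scomp (csm W f) (incl (@HL l)))
       (fun k z => Lc f (svalP z))) _ _.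
Next Obligation. by case: z => z hz; apply: eq_exist; rewrite csm_id. Qed.
Next Obligation. by apply: eq_exist; rewrite csm_comp. Qed.

Program Definition hm_res (X : sSet) : smap (Hm W X) (Hm csub X) :=
  @SMap (Hm W X) (Hm csub X) (fun m g => scomp g (incl (@HL m))) _.
Next Obligation. exact: smap_eq. Qed.

Definition hm_tgt (X Y : sSet) (p : smap X Y) : sSet := pullback (hm_post csub p) (hm_res Y).

Lemma phiP (X Y : sSet) (p : smap X Y) m (g : Hm W X m) :
  hm_post csub p m (hm_res X m g) = hm_res Y m (hm_post W p m g).
Proof. exact: smap_eq. Qed.

Definition phi (X Y : sSet) (p : smap X Y) : smap (Hm W X) (hm_tgt p) :=
  @sub_lift (Hm W X) (sprod (Hm csub X) (Hm W Y)) _ (pullback_closed (f := hm_post csub p) (g := hm_res Y))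
    (pair_map (hm_res X) (hm_post W p)) (phiP p).

(** An operator on [m] onto the vertices that z involves. By [rho1] and [rho4], z comes from a
    proper face exactly when [rho z] misses a vertex, and it then presents z by a canonical face;
    this replaces a choice of face in the latching object. *)
Variable rho : forall m k, W m k -> hom m m.
Hypotheses (rho1 : forall m k (z : W m k), csm W (rho z) k z = z)
  (rho2 : forall l m (f : hom l m) k (z : W l k), hcomp (rho (csm W f k z)) (hcomp f (rho z)) = hcomp f (rho z))
  (rho3 : forall m k l (g : hom l k) (z : W m k), hcomp (rho z) (rho (act (W m) g z)) = rho (act (W m) g z))
  (rho4 : forall l m (f : hom l m) k (z : W l k) i, (forall x, f x <> i) -> forall x, rho (csm W f k z) x <> i).

Definition kanfib (X Y : sSet) (p : smap X Y) := LF p /\ RF p.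

Hypothesis HA : forall (X Y : sSet) (p : smap X Y), kanfib p -> forall m (R : pmap (W m) X) (v : smap (W m) Y),
  is_pmap R -> pover p v R -> (forall k (z : W m k), dom R z <-> L z) ->
  exists w : smap (W m) X, extends R w /\ (forall k z, p k (w k z) = v k z).

Definition dJ n (t : J n) : Prop := t = jF n \/ t = jT n.
Lemma dJ_closed : subclosed dJ.
Proof. by move=> m n f t [h|h]; [left|right]; apply: (atv_closed f h). Qed.

Lemma kanfib_pexp (X Y : sSet) (p : smap X Y) : kanfib p -> kanfib (pexp p (incl dJ_closed)).
Proof. by case=> h1 h2; split; apply: ELP_exp => //; apply: atv_closed. Qed.

Lemma dJ_act n k (g : hom k n) (t : J n) : dJ t -> act J g t ord0 = t ord0.
Proof. by case=> ->. Qed.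

Section Step.
Variables (X Y : sSet) (p : smap X Y) (m : nat).
Variables (u : smap (boundary m) (Hm W X)) (s : smap (csub m) X) (v : smap (W m) Y) (l : smap (W m) X).
Hypotheses (us : forall k f j (z : csub k j), u k f j (sval z) = s j (csm csub (sval f) j z))
  (uv : forall k f j (z : W k j), p j (u k f j z) = v j (csm W (sval f) j z))
  (ls : forall j (z : csub m j), l j (sval z) = s j z)
  (lv : forall j z, p j (l j z) = v j z).

Local Notation p' := (pexp p (incl dJ_closed)).

(** The prescribed ends of a homotopy over the boundary, from the restriction of l to the given data
    u. A simplex of the two-point set is constant, so it is read off at its first vertex. *)
Program Definition pw k (f : boundary m k) : smap (sprod (W k) (subsset dJ_closed)) X :=
  @SMap (sprod (W k) (subsset dJ_closed)) X (fun n q =>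
    if sval q.2 ord0 then u k f n q.1 else l n (csm W (sval f) n q.1)) _.
Next Obligation.
rewrite (dJ_act _ (svalP x.2)); case: (sval x.2 ord0); by rewrite !smapE.
Qed.

Lemma pwP k (f : boundary m k) n (z : W k n) :
  mapsp_post (subsset dJ_closed) p n (curry (pw f) n z) =
  mapsp_pre Y (incl dJ_closed) n (curry (scomp v (scomp (csm W (sval f)) (sfst (W k) J))) n z).
Proof. by apply: smap_eq => j [h t] /=; case: ifP => _; rewrite ?uv ?lv. Qed.

Definition v' k (f : boundary m k) : smap (W k) (pullback (mapsp_post (subsset dJ_closed) p) (mapsp_pre Y (incl dJ_closed))) :=
  @sub_lift (W k) (sprod (mapsp (subsset dJ_closed) X) (mapsp J Y)) _ (pullback_closed (f:=_) (g:=_))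
    (pair_map (curry (pw f)) (curry (scomp v (scomp (csm W (sval f)) (sfst (W k) J))))) (pwP f).

Definition s' k (f : boundary m k) : smap (csub k) (mapsp J X) :=
  curry (scomp s (scomp (csm csub (sval f)) (sfst (csub k) J))).

Lemma sv' k (f : boundary m k) : hm_post csub p' k (s' f) = hm_res _ k (v' f).
Proof.
apply: smap_eq => n z; apply: sub_eq; congr (_, _); apply: smap_eq => j [h t] /=.
  case: ifP => _.
    by rewrite -(us f (act (csub k) h z)).
  by rewrite -ls.
by rewrite -ls lv.
Qed.

Program Definition q' : smap (boundary m) (hm_tgt p') :=
  @SMap (boundary m) (hm_tgt p') (fun k f => exist _ (s' f, v' f) (sv' f)) _.
Next Obligation.
rewrite /hm_tgt; apply: eq_exist; congr (_, _); apply: smap_eq => j z.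
  apply: smap_eq => i [h t] /=; congr (s i _); apply: eq_exist.
  by rewrite csm_comp -smapE.
apply: eq_exist; congr (_, _); apply: smap_eq => i [h t] /=.
  case: (sval t ord0); first by rewrite (smapE u f x) /= (smapE (csm W f)).
  by rewrite act_simplex csm_comp (smapE (csm W f)).
by rewrite act_simplex csm_comp (smapE (csm W f)).
Qed.

Hypothesis IH : forall k, k < m -> rlp_faces (phi p') (fun _ : 'I_k.+1 => True).
Hypothesis fp : FJ p.

Lemma boundary_face k j (f : hom j m) (z : W j k) : (exists2 i, True & forall x, f x <> i) ->
  exists2 i, True & forall x, rho (csm W f k z) x <> i.
Proof. by case=> i _ fi; exists i => //; apply: rho4. Qed.

Lemma reedy_step : exists w : smap (W m) X, [/\ forall j (z : csub m j), w j (sval z) = s j z,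
  forall j z, p j (w j z) = v j z & forall k f j z, w j (csm W (sval f) j z) = u k f j z].
Proof.
have [|||h [_ hq]] := @cell_ext (boundary m) _ _ (phi p') q' (@empty_pmap _ _).
(* A simplex of the boundary of Δ^m of dimension at least m factors through a facet, hence is
   induced from a smaller simplex. Only dimensions below m remain, where the induction hypothesis
   holds. *)
- move=> n c nd; apply: IH; rewrite ltnNge; apply/negP => mn.
  case: m c nd mn => [|m'] c nd mn.
    by have [i _ ci] := svalP c; case: (ci ord0); rewrite [i]ord1; exact: ord1.
  have [i _ ci] := svalP c; have [g eg] := delta_factor ci.
  have di : exists2 j, True & forall x, delta i x <> j.
    by exists i => // x; apply/eqP; rewrite eq_sym neq_lift.
  apply: (nd m' (exist _ (delta i) di) g mn).
  by apply: (@sub_eq _ _ (@faces_closed _ _)).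
- exact: empty_is_pmap.
- by [].
have hE k (f : boundary m k) j z : [/\ L z -> forall t, h k f j z j (hid j, t) = l j (csm W (sval f) j z),
    h k f j z j (hid j, jF j) = l j (csm W (sval f) j z),
    h k f j z j (hid j, jT j) = u k f j z &
    forall t, p j (h k f j z j (hid j, t)) = v j (csm W (sval f) j z)].
  have E := hq k f; split.
  - move=> Lz t.
    have e1 := congr1 (fun q : hm_tgt p' k => (sval q).1 j (exist _ z Lz)) E.
    have := congr1 (fun q : mapsp J X j => q j (hid j, t)) e1.
    by rewrite /= => ->; rewrite -ls /= act_id.
  - have e1 := congr1 (fun q : hm_tgt p' k => (sval q).2 j z) E.
    have := (pexpE e1).1 j (hid j) (exist _ (jF j) (or_introl erefl)).
    by rewrite /= => ->; rewrite act_id.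
  - have e1 := congr1 (fun q : hm_tgt p' k => (sval q).2 j z) E.
    have := (pexpE e1).1 j (hid j) (exist _ (jT j) (or_intror erefl)).
    by rewrite /= => ->; rewrite act_id.
  - move=> t.
    have e1 := congr1 (fun q : hm_tgt p' k => (sval q).2 j z) E.
    have := (pexpE e1).2 j (hid j, t).
    by rewrite /= => ->; rewrite act_id.
have hN k (f : boundary m k) j z n (g : hom n j) t :
    h k f n (act (W k) g z) n (hid n, act J g t) = act X g (h k f j z j (hid j, t)).
  by rewrite smapE act_mapsp -[RHS]smapE act_sprod act_simplex /= hcomp1 hcomp1l.
have hf k i (f : boundary m k) (g : hom i k) j z t :
    h i (act (boundary m) g f) j z j (hid j, t) = h k f j (csm W g j z) j (hid j, t).
  by rewrite smapE.
pose D k (z : W m k) := exists2 i, True & forall x, happ (rho z) x <> i.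
have Dc n k (g : hom n k) (z : W m k) : D k z -> D n (act (W m) g z).
  case=> i _ hi; exists i => // y E; apply: (hi (rho (act (W m) g z) y)); rewrite -E.
  exact: (congr1 (fun q : hom m m => happ q y) (rho3 g z)).
pose bd k (z : W m k) (hz : D k z) : boundary m m := exist _ (rho z) hz.
(* The partial homotopy on W m: it is l at the start and constantly l on L; on a simplex coming from
   a face it is h, evaluated at the canonical face [rho z]. *)
pose R : pmap (sprod (W m) J) X := fun n q x =>
  (q.2 = jF n /\ x = l n q.1) \/ (L q.1 /\ x = l n q.1) \/
  (exists hz : D n q.1, x = h m (bd _ _ hz) n q.1 n (hid n, q.2)).
have RP : is_pmap R.
  have key n z t (hz : D n z) : (t = jF n \/ L z) -> h m (bd _ _ hz) n z n (hid n, t) = l n z.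
    have [a1 a2 _ _] := hE m (bd _ _ hz) n z; rewrite /= rho1 in a1 a2.
    by case=> [->|/a1].
  split=> [n [z t] x x'|n k g [z t] x].
    case=> [[/= e ->]|[[/= e ->]|[/= hz ->]]] [[/= e' ->]|[[/= e' ->]|[/= hz' ->]]] //.
    - by rewrite key //; left.
    - by rewrite key //; right.
    - by rewrite key //; left.
    - by rewrite key //; right.
    - by rewrite (Prop_irrelevance hz hz').
  case=> [[/= e ->]|[[/= e ->]|[/= hz ->]]].
  - by left; split; [rewrite /= e act_deg|rewrite smapE].
  - by right; left; split; [apply: HL|rewrite smapE].
  - right; right.
    have hz' := Dc _ _ g _ hz.
    exists hz' => /=; rewrite -hN.
    rewrite -{1}(rho1 (act (W m) g z)) -hf.
    congr (smap_fun (smap_fun (h m _) n _) n _).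
    by apply: (@sub_eq _ _ (@faces_closed _ _)); exact: (rho3 g z).
pose AA n (z : W m n) := L z \/ D n z.
have [|n [z t] x|n [z t]|w [wR wv]] := fp (A := AA) (v := scomp v (sfst _ _)) (R := R) _ RP.
- move=> n k g z [h'|h']; first by left; apply: HL.
  by right; apply: Dc.
- case=> [[_ ->]|[[_ ->]|[hz ->]]]; rewrite /= ?lv //.
  by have [_ _ _ ->] := hE m (bd _ _ hz) n z; rewrite /= rho1.
- split=> [[x [[e _]|[[e _]|[hz _]]]]|[[e|hz]|e]]; [by right|by left; left|by left; right| | |].
  + by exists (l n z); right; left.
  + by exists (h m (bd _ _ hz) n z n (hid n, t)); right; right; exists hz.
  + by exists (l n z); left.
exists (scomp w (cstJ _ true)); split=> [j z|j z|k f j z] /=.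
- by rewrite -ls; apply: wR; right; left; split=> //=; exact: svalP z.
- by rewrite wv.
have hz : D j (csm W (sval f) j z) by apply: boundary_face; exact: svalP f.
rewrite (wR _ _ (h m (bd _ _ hz) j (csm W (sval f) j z) j (hid j, jT j))); last by right; right; exists hz.
(* The face f and the canonical face present the same simplex; by [rho1] and [rho2] the homotopy h
   has the same value on both. *)
have [_ _ <- _] := hE k f j z.
transitivity (h m (bd _ _ hz) j (csm W (hcomp (sval f) (rho z)) j z) j (hid j, jT j)).
  by rewrite csm_comp rho1.
rewrite -hf; transitivity (h k (act (boundary m) (rho z) f) j z j (hid j, jT j)); last by rewrite hf rho1.
congr (smap_fun (smap_fun (h k _) j _) j _).
by apply: (@sub_eq _ _ (@faces_closed _ _)); exact: rho2.
Qed.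
End Step.

(* A lift that ignores the data on the boundary is corrected along a homotopy,
   which exists by induction applied to the Leibniz exponential with dJ -> J. *)
Lemma phi_tfib (X Y : sSet) (p : smap X Y) : kanfib p -> trivial_kan_fibration (phi p).
Proof.
move=> kp m; elim/ltn_ind: m X Y p kp => m IH X Y p kp u q uq.
pose s : smap (csub m) X := (sval (q m (hid m))).1.
pose v : smap (W m) Y := (sval (q m (hid m))).2.
have qE k (f : hom k m) : (forall j z, (sval (q k f)).1 j z = s j (csm csub f j z)) /\
    (forall j z, (sval (q k f)).2 j z = v j (csm W f j z)).
  have E : q k f = act _ f (q m (hid m)) by rewrite -smapE act_simplex hcomp1l.
  by split=> j z; rewrite E.
have sv k (z : W m k) (hz : L z) : p k (s k (exist _ z hz)) = v k z.
  exact: (congr1 (fun g : smap (csub m) Y => g k (exist _ z hz)) (svalP (q m (hid m)))).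
pose R : pmap (W m) X := fun k z x => exists hz : L z, x = s k (exist _ z hz).
have [||k z|l [lR lv]] := @HA _ _ _ kp m R v.
- split=> [k z x x' [h ->] [h' ->]|k n g z x [h ->]]; first by rewrite (Prop_irrelevance h h').
  exists (HL g h); rewrite -smapE; congr (smap_fun s _ _); exact: eq_exist.
- by move=> k z x [h ->]; exact: sv.
- by split=> [[x [h _]] //|h]; exists (s k (exist _ z h)), h.
have [|||||| w [ws wv wu]] := @reedy_step X Y p m u s v l.
- move=> k f j z; have := congr1 (fun x : hm_tgt p k => (sval x).1 j z) (uq k f).
  by rewrite /= => ->; rewrite (qE _ _).1.
- move=> k f j z; have := congr1 (fun x : hm_tgt p k => (sval x).2 j z) (uq k f).
  by rewrite /= => ->; rewrite (qE _ _).2.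
- by move=> j [z hz]; apply: lR; exists hz.
- exact: lv.
- by move=> k km; apply: (IH k km); apply: kanfib_pexp.
- by case: kp => /LF_FJ.
exists (@classify (Hm W X) m w); split=> k f.
  by apply: smap_eq => j z; exact: wu.
apply: sub_eq; rewrite [RHS]surjective_pairing; congr (_, _); apply: smap_eq => j z /=.
  by apply: etrans (ws j (csm csub f j z)) _; rewrite (qE k f).1.
exact: etrans (wv _ _) (esym ((qE k f).2 j z)).
Qed.

Lemma hm_res_tfib (X : sSet) : kanfib (to_point X) -> trivial_kan_fibration (hm_res X).
Proof.
move=> /phi_tfib tp n u v uv.
have vP k (z : simplex n k) : hm_post csub (to_point X) k (v k z) = hm_res point k (to_point _).
  exact: smap_eq.
have N k l (f : hom k l) (z : simplex n l) : (v k (act (simplex n) f z), to_point (W k)) =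
    act (sprod (Hm csub X) (Hm W point)) f (v l z, to_point (W l)).
  by rewrite smapE; congr (_, _); exact: smap_eq.
have [|w [wu wv]] := tp n u (@sub_lift (simplex n) (sprod (Hm csub X) (Hm W point)) _
   (pullback_closed (f := hm_post csub (to_point X)) (g := hm_res point))
   (@SMap (simplex n) (sprod (Hm csub X) (Hm W point)) (fun k z => (v k z, to_point _)) N) vP).
  move=> k z; apply: sub_eq; congr (_, _); first exact: uv.
  exact: smap_eq.
exists w; split=> // k z.
exact: (congr1 (fun x : hm_tgt (to_point X) k => (sval x).1) (wv k z)).
Qed.
End Sub.

Lemma point_LF : LF (to_point point).
Proof.
apply: ELPo => B A R HA RP Rd; exists (to_point _) => n b x _; exact: point_eq.
Qed.

Lemma kanfib_LF (X : sSet) : LF (to_point X) -> kanfib (to_point X).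
Proof. by move=> lX; split=> //; apply: LF_RF lX point_LF. Qed.

(* The retraction of [m] onto the support of a simplex of a cosimplicial
   simplicial set, for supports that behave like images. *)
Section Supports.
Variables (W : cosimp) (sup : forall m k, W m k -> {set 'I_m.+1}).
Hypotheses (sup0 : forall m k (z : W m k), exists s, s \in sup z)
  (sup1 : forall m k (z : W m k) (f : hom m m), (forall s, s \in sup z -> f s = s) -> csm W f k z = z)
  (sup2 : forall l m (f : hom l m) k (z : W l k), sup (csm W f k z) = happ f @: sup z)
  (sup3 : forall m k l (g : hom l k) (z : W m k), sup (act (W m) g z) \subset sup z).

Definition srho m k (z : W m k) : hom m m := ret (sup z).

Lemma srho1 m k (z : W m k) : csm W (srho z) k z = z.
Proof. by apply: sup1 => s; apply: ret_id. Qed.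

Lemma srho_in m k (z : W m k) x : srho z x \in sup z.
Proof. by have [s sz] := sup0 z; apply: ret_in sz. Qed.

Lemma srho2 l m (f : hom l m) k (z : W l k) :
  hcomp (srho (csm W f k z)) (hcomp f (srho z)) = hcomp f (srho z).
Proof.
by apply: hom_eq => x; apply: ret_id; rewrite sup2; apply: imset_f; apply: srho_in.
Qed.

Lemma srho3 m k l (g : hom l k) (z : W m k) :
  hcomp (srho z) (srho (act (W m) g z)) = srho (act (W m) g z).
Proof.
by apply: hom_eq => x; apply: ret_id; apply: (subsetP (sup3 g z)); apply: srho_in.
Qed.

Lemma srho4 l m (f : hom l m) k (z : W l k) i : (forall x, f x <> i) ->
  forall x, srho (csm W f k z) x <> i.
Proof.
move=> fi x; have := srho_in (csm W f k z) x; rewrite sup2 => /imsetP[y _ ->]; exact: fi.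
Qed.
End Supports.

(** * The target projection of the twisted arrow category *)

Program Definition twC : cosimp :=
  @Cosimp (fun m => simplex m.*2.+1) (fun l m f => simplex_map (tw_hom f)) _ _.
Next Obligation. by rewrite tw_hom_id hcomp1l. Qed.
Next Obligation. by rewrite tw_hom_comp hcompA. Qed.

(** The vertices of Δ^(2m+1) are m', ..., 0', 0, ..., m in this order, a primed vertex being a
    source; [fold] forgets the prime. *)
Definition fold m (i : 'I_m.*2.+2) : 'I_m.+1 := inord (if i <= m then m - i else i - m.+1).
Lemma foldE m (i : 'I_m.*2.+2) : fold i = (if i <= m then m - i else i - m.+1) :> nat.
Proof. by rewrite /fold inordK //; have := ltn_ord i; case: ifP; lia. Qed.

Lemma fold_tw l m (f : hom l m) i : fold (tw_hom f i) = f (fold i).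
Proof.
apply: ord_inj; rewrite foldE; have hi := ltn_ord i.
have -> : tw_hom f i = tw_fun f i :> nat by [].
rewrite tw_funE; case: (leqP i l) => il.
  have hf := ltn_ord (f (inord (l - i))).
  rewrite leq_subr subKn //; congr (nat_of_ord (f _)).
  by apply: ord_inj; rewrite foldE il inordK //; lia.
rewrite leqNgt ltn_addr //= addKn; congr (nat_of_ord (f _)).
by apply: ord_inj; rewrite foldE leqNgt il /= inordK //; lia.
Qed.

Definition twsup m k (z : hom k m.*2.+1) : {set 'I_m.+1} := [set fold (z x) | x : 'I_k.+1].

Definition twL m k (z : hom k m.*2.+1) : Prop := forall x, m < z x.

Lemma tw_res_tfib : exists HL Lc, forall X : sSet, LF (to_point X) ->
  trivial_kan_fibration (@hm_res twC twL HL Lc X).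
Proof.
have HL m : @subclosed (simplex m.*2.+1) (@twL m) by move=> i k g z h x; apply: h.
have Lc l m (f : hom l m) k (z : hom k l.*2.+1) : twL z -> twL (simplex_map (tw_hom f) k z).
  move=> h x; change (m < tw_fun f (happ z x)); have hx : l < happ z x := h x.
  by rewrite tw_funE; case: ifP => h1; lia.
exists HL, Lc => X lX.
pose sup m k (z : twC m k) : {set 'I_m.+1} := twsup z.
have s0 m k (z : twC m k) : exists s, s \in sup m k z by exists (fold (happ z ord0)); apply: imset_f.
have s1 m k (z : twC m k) (f : hom m m) : (forall s, s \in sup m k z -> f s = s) -> csm twC f k z = z.
  move=> H; apply: hom_eq => x; apply: ord_inj.
  change (tw_fun f (happ z x) = happ z x :> nat); rewrite tw_funE.
  have hz := ltn_ord (happ z x).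
  have hm : fold (happ z x) \in sup m k z by apply: imset_f.
  have := H _ hm.
  case: (leqP (happ z x) m) => h.
    have -> : fold (happ z x) = inord (m - happ z x) by rewrite /fold h.
    by move=> ->; rewrite inordK; lia.
  have -> : fold (happ z x) = inord (happ z x - m.+1) by rewrite /fold leqNgt h.
  by move=> ->; rewrite inordK; lia.
have s2 l m (f : hom l m) k (z : twC l k) : sup m k (csm twC f k z) = happ f @: sup l k z.
  rewrite -imset_comp; apply: eq_imset => x; exact: fold_tw.
have s3 m k l (g : hom l k) (z : twC m k) : sup m l (act (twC m) g z) \subset sup m k z.
  by apply/subsetP => v /imsetP[x _ ->]; apply: imset_f.
apply: (hm_res_tfib (rho := @srho twC sup)).
- by move=> m k z; apply: srho1.
- by move=> l m f k z; apply: srho2.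
- by move=> m k l g z; apply: srho3.
- by move=> l m f k z i; apply: srho4.
- move=> Y Z p [_ rp] m R v RP Rv Rd.
  have : @ELP (simplex m.*2.+1) (fun k z => @twL m k z) _ _ p.
    (* The deformation moves every vertex up into the target half as the interval goes from 0 to 1,
       so it is the right lifting property that is used. *)
    apply: (@ELP_retract (simplex m.*2.+1) _ _ _ (@hmax m.*2.+1 (inord m.+1)) (Delta1_end false)) rp.
    + exact: HL.
    + exact: atv_closed.
    + by move=> n s; apply: hom_eq => i /=.
    + move=> n s t h x /=.
      have mE : (inord m.+1 : 'I_m.*2.+2) = m.+1 :> nat by rewrite inordK //; lia.
      case: h => [h|h]; first by case: ifP => _; [exact: h|rewrite inordK mE; have := ltn_ord (happ s x); lia].
      rewrite (h : t = _) /= inordK mE; have := ltn_ord (happ s x); lia.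
  move=> E; have [|||n q|w [wR wv]] := E point (fun _ _ => False)
      (scomp v (ssnd _ _)) (fun n q x => R n q.2 x) _.
  + by [].
  + split=> [n q x x'|n k g q x]; [exact: RP.1|exact: RP.2].
  + by move=> n q x /Rv.
  + by split=> [/Rd h|[//|/Rd]] //; right.
  exists (scomp w (pair_map (to_point _) (sid _))); split=> [n z x Rx|n z] /=; first exact: wR.
  by rewrite wv.
- exact: kanfib_LF.
Qed.

(** By Yoneda [Hm twC X] is Tw X, and maps out of the target half are simplices of X. The operator
    [un] inverts [tgt_hom] on that half and translates the lifting problem. *)
Lemma Tw_tgt_tfib (X : sSet) : LF (to_point X) -> trivial_kan_fibration (Tw_tgt X).
Proof.
move=> lX; have [HL [Lc /(_ X lX) tp]] := tw_res_tfib; move=> n u v uv.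
have un_mono m (x y : 'I_m.*2.+2) : x <= y -> (inord (x - m.+1) : 'I_m.+1) <= (inord (y - m.+1) : 'I_m.+1).
  by have h1 := ltn_ord x; have h2 := ltn_ord y; rewrite !inordK; lia.
pose un m : hom m.*2.+1 m := mk_hom (@un_mono m).
have unE m x : un m x = x - m.+1 :> nat by have hx := ltn_ord x; rewrite inordK; lia.
have un_tw l m (f : hom l m) k (z : hom k l.*2.+1) : twL z ->
    hcomp (un m) (hcomp (tw_hom f) z) = hcomp f (hcomp (un l) z).
  move=> h; apply: hom_eq => x; apply: ord_inj.
  change (un m (tw_fun f (happ z x)) = f (un l (happ z x)) :> nat).
  by rewrite unE tw_funE leqNgt h /= addKn; congr (nat_of_ord (f _)).
have tgL m : @twL m m (tgt_hom m) by move=> x; change (m < tgt_fun x); rewrite tgt_funE; lia.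
have un_tgt m : hcomp (un m) (tgt_hom m) = hid m.
  apply: hom_eq => x; apply: ord_inj; change (un m (tgt_fun x) = x :> nat).
  by rewrite unE tgt_funE addKn.
have tgt_un m k (z : hom k m.*2.+1) : twL z -> hcomp (tgt_hom m) (hcomp (un m) z) = z.
  move=> h; apply: hom_eq => x; apply: ord_inj; change (tgt_fun (un m (happ z x)) = happ z x :> nat).
  by rewrite tgt_funE unE; have := h x; lia.
pose cu m (x : Tw X m) : Hm twC X m := @classify X m.*2.+1 x.
have cuN l m (f : hom l m) x : cu l (act (Tw X) f x) = act (Hm twC X) f (cu m x).
  by apply: smap_eq => k z /=; rewrite -act_comp.
pose U : smap (boundary n) (Hm twC X) := scomp (SMap cuN) u.
pose W := csub HL Lc.
have cvN m (x : X m) k l (f : hom k l) (z : W m l) :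
    act X (hcomp (un m) (sval (act (W m) f z))) x = act X f (act X (hcomp (un m) (sval z)) x).
  by rewrite -act_comp; congr (act X _ x); apply: hom_eq.
pose cv m (x : X m) : Hm W X m := SMap (cvN m x).
have cvM l m (f : hom l m) x : cv l (act X f x) = act (Hm W X) f (cv m x).
  by apply: smap_eq => k z; rewrite /= (un_tw _ _ _ _ _ (svalP z)) -act_comp.
have [|w [wu wv]] := tp n U (scomp (SMap cvM) v).
  move=> m f; apply: smap_eq => k z; rewrite /= -uv /= -act_comp.
  by rewrite tgt_un //; exact: svalP z.
have wN l m (f : hom l m) (x : simplex n m) :
    w l (act (simplex n) f x) l.*2.+1 (hid _) = act (Tw X) f (w m x m.*2.+1 (hid _)).
  by rewrite smapE -[RHS]smapE /= hcomp1 act_simplex hcomp1l.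
exists (@SMap (simplex n) (Tw X) (fun m x => w m x m.*2.+1 (hid _)) wN); split=> m x.
  by rewrite /= wu /= act_id.
have := congr1 (fun g : Hm W X m => g m (exist _ (tgt_hom m) (tgL m))) (wv m x).
rewrite /= un_tgt act_id => <-; rewrite -[LHS]smapE act_simplex hcomp1l //.
Qed.

(** * Families over cones as a mapping space *)

Definition smin m (S : {set 'I_m.+1}) : 'I_m.+1 := ret S ord0.
Lemma smin_in m (S : {set 'I_m.+1}) s : s \in S -> smin S \in S.
Proof. exact: ret_in. Qed.
Lemma smin_le m (S : {set 'I_m.+1}) s : s \in S -> smin S <= s.
Proof. by move=> sS; rewrite -[leqRHS](congr1 (@nat_of_ord _) (ret_id sS)); apply: (svalP (ret S)). Qed.
Lemma smin_unique m (S : {set 'I_m.+1}) w : w \in S -> (forall v, v \in S -> w <= v) -> smin S = w.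
Proof.
by move=> wS H; apply: ord_inj; apply/eqP; rewrite eqn_leq smin_le // H // (smin_in wS).
Qed.
Lemma smin1 m (w : 'I_m.+1) : smin [set w] = w.
Proof. by apply: smin_unique => [|v]; rewrite finset.in_set1 // => /eqP->. Qed.
Lemma smin_img m n (f : hom m n) (S : {set 'I_m.+1}) s : s \in S -> smin (happ f @: S) = f (smin S).
Proof.
move=> sS; apply: smin_unique; first by apply: imset_f; apply: smin_in sS.
by move=> v /imsetP[w wS ->]; apply: (svalP f); apply: smin_le.
Qed.

Definition below m (S : {set 'I_m.+1}) (mu : 'I_m.+1) : {set 'I_m.+1} := [set v in S | v <= mu].
Lemma belowE m (S : {set 'I_m.+1}) mu v : (v \in below S mu) = (v \in S) && (v <= mu).
Proof. by rewrite finset.inE. Qed.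
Lemma smin_below m (S : {set 'I_m.+1}) (mu s : 'I_m.+1) : s \in S -> smin S <= mu -> smin (below S mu) = smin S.
Proof.
move=> sS h; apply: smin_unique; first by rewrite belowE (smin_in sS).
by move=> v; rewrite belowE => /andP[/smin_le].
Qed.
Definition itv m (x y : 'I_m.+1) : {set 'I_m.+1} := [set v : 'I_m.+1 | x <= v <= y].
Lemma itvE m (x y v : 'I_m.+1) : (v \in itv x y) = (x <= v <= y).
Proof. by rewrite finset.inE. Qed.
Lemma smin_itv m (x y : 'I_m.+1) : x <= y -> smin (itv x y) = x.
Proof. by move=> h; apply: smin_unique => [|v]; rewrite itvE ?leqnn ?h // => /andP[]. Qed.

(* A chain of the poset in which [m] is glued in front of the nonempty subsets of
   [m] ordered by reverse inclusion, y being smaller than S if y <= min S; the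
   component t tells the two parts apart, and y is recorded as [set y].  Sets are
   truncated at the minimum of the last one, which accounts for the relations
   in the colimit of the cones over the vertices j of [m]. *)
Definition joinP m k (z : hom k 1 * ('I_k.+1 -> {set 'I_m.+1})) : Prop :=
  [/\ forall a, exists s, s \in z.2 a,
      forall a b : 'I_k.+1, a <= b -> smin (z.2 a) <= smin (z.2 b),
      forall a b : 'I_k.+1, a <= b -> z.1 a != ord0 -> z.2 b \subset z.2 a,
      forall a, z.1 a = ord0 -> z.2 a = [set smin (z.2 a)] &
      forall a v, v \in z.2 a -> v <= smin (z.2 ord_max)].

Definition jact m k l (g : hom l k) (z : hom k 1 * ('I_k.+1 -> {set 'I_m.+1})) :
    hom l 1 * ('I_l.+1 -> {set 'I_m.+1}) :=
  (hcomp z.1 g, fun a => below (z.2 (g a)) (smin (z.2 (g ord_max)))).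

Lemma leq_max n (a : 'I_n.+1) : a <= (ord_max : 'I_n.+1).
Proof. by rewrite -ltnS ltn_ord. Qed.

Lemma smin_jact m k l (g : hom l k) z a : @joinP m k z ->
  smin ((jact g z).2 a) = smin (z.2 (g a)).
Proof.
case=> z1 z2 _ _ _; have [s sz] := z1 (g a); apply: smin_below sz _.
by apply: z2; apply: (svalP g); apply: leq_max.
Qed.

Lemma jactP m k l (g : hom l k) z : @joinP m k z -> joinP (jact g z).
Proof.
move=> zP; have E a := smin_jact g a zP; have [z1 z2 z3 z4 z5] := zP.
split=> [a|a b ab|a b ab ta|a ta|a v].
- have [s sz] := z1 (g a); exists (smin (z.2 (g a))); rewrite belowE (smin_in sz) /=.
  by apply: z2; apply: (svalP g); apply: leq_max.
- by rewrite !E; apply: z2; apply: (svalP g).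
- apply/subsetP => v; rewrite !belowE => /andP[h ->]; rewrite andbT.
  by apply: (subsetP (z3 _ _ _ ta)) h; apply: (svalP g).
- rewrite E; apply/setP => v; rewrite belowE (z4 _ ta) smin1 finset.in_set1.
  by case: eqP => // ->; apply: z2; apply: (svalP g); apply: leq_max.
- by rewrite E belowE => /andP[].
Qed.

Lemma join_eq m k (z z' : {z | @joinP m k z}) : (forall a, (sval z).1 a = (sval z').1 a) ->
  (forall a, (sval z).2 a = (sval z').2 a) -> z = z'.
Proof.
case: z z' => -[t c] h [[t' c'] h'] /= e1 e2; apply: eq_exist; congr (_, _).
  exact: hom_eq.
exact: funext.
Qed.

Program Definition join m : sSet :=
  @SSet (fun k => {z | @joinP m k z}) (@Simplicial (fun k => {z | @joinP m k z})
    (fun _ _ g z => exist _ (jact g (sval z)) (jactP g (svalP z))) _ _).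
Next Obligation.
case: x => -[t c] h; have [_ _ _ _ z5] := h; apply: join_eq => //= a.
by apply/setP => v; rewrite belowE andb_idr // => /z5.
Qed.
Next Obligation.
case: x => z h; have [z1 z2 _ _ _] := h; apply: join_eq => //= a.
apply/setP => v; rewrite !belowE (smin_jact g _ h) -andbA; congr (_ && _); rewrite /=.
case: (leqP v (smin (z.2 (g (f ord_max))))) => vl; rewrite ?andbF //= andbT.
by symmetry; apply: leq_trans vl _; apply: z2; apply: (svalP g); apply: leq_max.
Qed.

Lemma cjoinP l m (f : hom l m) k z : @joinP l k z -> @joinP m k (z.1, fun a => happ f @: z.2 a).
Proof.
case=> z1 z2 z3 z4 z5.
have E a : smin (happ f @: z.2 a) = f (smin (z.2 a)) by have [s sz] := z1 a; apply: smin_img sz.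
split=> [a|a b ab|a b ab ta|a ta|a v] /=.
- by have [s sz] := z1 a; exists (f s); apply: imset_f.
- by rewrite !E; apply: (svalP f); apply: z2.
- by apply: imsetS; apply: z3.
- by rewrite E (z4 a ta) imset_set1 smin1.
- by rewrite E => /imsetP[w wz ->]; apply: (svalP f); apply: z5 wz.
Qed.

Program Definition cjoin l m (f : hom l m) : smap (join l) (join m) :=
  @SMap (join l) (join m) (fun k z => exist _ (_, _) (cjoinP f (svalP z))) _.
Next Obligation.
case: x => z h; have [z1 z2 z3 z4 z5] := h; apply: join_eq => //= a.
apply/setP => v; rewrite belowE; have [s sz] := z1 (f0 ord_max); rewrite (smin_img f sz).
apply/imsetP/andP => [[w]|[/imsetP[w wz ->] fw]].
  rewrite belowE => /andP[wz wm] ->; split; first exact: imset_f.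
  exact: (svalP f).
case: (leqP w (smin (z.2 (f0 ord_max)))) => wm; first by exists w; rewrite // belowE wz.
have amax : f0 a <= f0 ord_max by apply: (svalP f0); apply: leq_max.
case: (eqVneq (z.1 (f0 a)) ord0) => ta.
  have := z2 _ _ amax; rewrite (z4 _ ta) finset.in_set1 in wz; rewrite -(eqP wz); lia.
exists (smin (z.2 (f0 ord_max))).
  by rewrite belowE leqnn andbT; apply: (subsetP (z3 _ _ amax ta)); apply: smin_in sz.
by apply: ord_inj; apply/eqP; rewrite eqn_leq fw; apply: (svalP f); apply: ltnW.
Qed.

Program Definition joinC : cosimp := @Cosimp join cjoin _ _.
Next Obligation. by apply: join_eq => //= a; apply: imset_hid. Qed.
Next Obligation. by apply: join_eq => //= a; apply: (imset_hcomp f g). Qed.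

Definition jsup m k (z : joinC m k) : {set 'I_m.+1} := [set v | [exists a, v \in (sval z).2 a]].
Lemma jsupP m k (z : joinC m k) v : reflect (exists a, v \in (sval z).2 a) (v \in jsup z).
Proof. by rewrite finset.inE; apply: existsP. Qed.

(** [jL true] is the part formed by the subsets, [jL false] the simplex glued in front of it. *)
Definition jL (b : bool) m k (z : joinC m k) : Prop := forall a, ((sval z).1 a == ord0) = ~~ b.
Lemma jL_closed b m : subclosed (@jL b m).
Proof. by move=> k l g z h a; apply: (h (g a)). Qed.
Lemma jL_csm b l m (f : hom l m) k (z : joinC l k) : jL b z -> jL b (csm joinC f k z).
Proof. by []. Qed.

Definition tand k (t s : hom k 1) : 'I_k.+1 -> 'I_2 := fun a => if s a == ord0 then ord0 else t a.
Lemma tand_mono k (t s : hom k 1) (a b : 'I_k.+1) : a <= b -> tand t s a <= tand t s b.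
Proof.
move=> ab; rewrite /tand; case: eqP => // sa; case: eqP => [sb|_]; last exact: (svalP t).
by case: sa; apply: ord_inj; have := svalP s _ _ ab; rewrite -!/(happ s _) sb /=; lia.
Qed.
Definition tor k (t s : hom k 1) : 'I_k.+1 -> 'I_2 := fun a => if s a == ord0 then t a else ord_max.
Lemma tor_mono k (t s : hom k 1) (a b : 'I_k.+1) : a <= b -> tor t s a <= tor t s b.
Proof.
move=> ab; rewrite /tor; case: eqP => sa; case: eqP => sb //; [exact: (svalP t)|exact: leq_max|].
by case: sa; apply: ord_inj; have := svalP s _ _ ab; rewrite -!/(happ s _) sb /=; lia.
Qed.
Lemma t_up k (s : hom k 1) (a b : 'I_k.+1) : a <= b -> s a != ord0 -> s b != ord0.
Proof.
move=> ab; apply: contra => /eqP sb; apply/eqP/ord_inj.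
by have := svalP s _ _ ab; rewrite -!/(happ s _) sb /=; lia.
Qed.

(** Moves the join towards its front: where s is 0, a set is replaced by its minimum, the greatest
    vertex below it in the order of the join. *)
Definition c0 m k (z : hom k 1 * ('I_k.+1 -> {set 'I_m.+1})) (s : hom k 1) a :=
  if s a == ord0 then [set smin (z.2 a)] else z.2 a.
Lemma smin_c0 m k (z : hom k 1 * ('I_k.+1 -> {set 'I_m.+1})) s a : smin (c0 z s a) = smin (z.2 a).
Proof. by rewrite /c0; case: ifP => _ //; rewrite smin1. Qed.
Lemma j0P m k (z : hom k 1 * ('I_k.+1 -> {set 'I_m.+1})) (s : hom k 1) : joinP z ->
  joinP (mk_hom (@tand_mono k z.1 s), c0 z s).
Proof.
case=> z1 z2 z3 z4 z5; split=> [a|a b ab|a b ab ta|a ta|a v] /=; rewrite ?smin_c0.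
- rewrite /c0; case: ifP => _ //; exists (smin (z.2 a)); exact: finset.set11.
- exact: z2.
- have sa : s a != ord0 by move: ta; rewrite /= /tand; case: ifP.
  have tz : z.1 a != ord0 by move: ta; rewrite /= /tand; case: ifP.
  rewrite /c0 (negPf sa) (negPf (t_up ab sa)); exact: z3.
- rewrite /c0; case: ifP => sa //; apply: z4; by move: ta; rewrite /= /tand sa.
- rewrite /c0; case: ifP => _; last exact: z5.
  by rewrite finset.in_set1 => /eqP ->; have [w wz] := z1 a; apply: z5 (smin_in wz).
Qed.

(** Moves the join towards its part of subsets: where s is 1, a vertex y becomes the interval from y
    up to the truncation. This is the largest admissible set with minimum y, so it contains all
    later sets of the chain, as reverse inclusion requires. *)
Definition c1 m k (z : hom k 1 * ('I_k.+1 -> {set 'I_m.+1})) (s : hom k 1) a :=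
  if (z.1 a == ord0) && (s a != ord0) then itv (smin (z.2 a)) (smin (z.2 ord_max)) else z.2 a.
Lemma smin_c1 m k (z : hom k 1 * ('I_k.+1 -> {set 'I_m.+1})) s a : joinP z -> smin (c1 z s a) = smin (z.2 a).
Proof. by case=> _ z2 _ _ _; rewrite /c1; case: ifP => _ //; rewrite smin_itv // z2 ?leq_max. Qed.
Lemma j1P m k (z : hom k 1 * ('I_k.+1 -> {set 'I_m.+1})) (s : hom k 1) : joinP z ->
  joinP (mk_hom (@tor_mono k z.1 s), c1 z s).
Proof.
move=> zP; have [z1 z2 z3 z4 z5] := zP; split=> [a|a b ab|a b ab ta|a ta|a v] /=; rewrite ?smin_c1 //.
- rewrite /c1; case: ifP => _ //; exists (smin (z.2 a)).
  by rewrite itvE leqnn z2 // leq_max.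
- exact: z2.
- rewrite /c1; case: (eqVneq (z.1 a) ord0) => za /=; last first.
    by rewrite (negPf (t_up ab za)) /=; apply: z3.
  have sa : s a != ord0.
    by apply: contra ta => sa; rewrite /= /tor sa za.
  rewrite sa (t_up ab sa) andbT; apply/subsetP => v; rewrite itvE.
  case: ifP => _; first by rewrite itvE => /andP[h ->]; rewrite (leq_trans (z2 _ _ ab) h).
  by move=> vz; rewrite (z5 _ _ vz) (leq_trans (z2 _ _ ab)) // smin_le.
- move: ta; rewrite /= /tor /c1; case: eqP => // sa za; rewrite andbF; exact: z4.
- rewrite /c1; case: ifP => _; last exact: z5.
  by rewrite itvE => /andP[].
Qed.

Program Definition jh0 m : smap (sprod (joinC m) (simplex 1)) (joinC m) :=
  @SMap (sprod (joinC m) (simplex 1)) (joinC m) (fun k q => exist _ (_, _) (j0P q.2 (svalP q.1))) _.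
Next Obligation.
case: x => -[z h] s; apply: join_eq => //= a; have [z1 z2 z3 z4 z5] := h.
apply/setP => v; rewrite !smin_c0 belowE /c0 /= (smin_jact f a h) -/(happ s _).
case: ifP => _; last by rewrite belowE.
rewrite finset.in_set1; case: eqP => //= ->; symmetry; apply: z2; apply: (svalP f); exact: leq_max.
Qed.

Program Definition jh1 m : smap (sprod (joinC m) (simplex 1)) (joinC m) :=
  @SMap (sprod (joinC m) (simplex 1)) (joinC m) (fun k q => exist _ (_, _) (j1P q.2 (svalP q.1))) _.
Next Obligation.
case: x => -[z h] s; apply: join_eq => //= a; have [z1 z2 z3 z4 z5] := h.
apply/setP => v; rewrite !smin_c1 // belowE /c1 /= !(smin_jact f _ h) -/(happ s _) -/(happ z.1 _).
case: ifP => _; last by rewrite belowE.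
rewrite !itvE -andbA; congr (_ && _); case: (leqP v (smin (z.2 (f ord_max)))) => vl; rewrite ?andbF //= andbT.
by symmetry; apply: leq_trans vl _; apply: z2; apply: leq_max.
Qed.

Lemma join_res_tfib b (X : sSet) : LF (to_point X) ->
  trivial_kan_fibration (@hm_res joinC (jL b) (@jL_closed b) (@jL_csm b) X).
Proof.
move=> lX.
have s0 m k (z : joinC m k) : exists s, s \in jsup z.
  by have [z1 _ _ _ _] := svalP z; have [s sz] := z1 ord0; exists s; apply/jsupP; exists ord0.
have s1 m k (z : joinC m k) (f : hom m m) : (forall s, s \in jsup z -> f s = s) -> csm joinC f k z = z.
  move=> H; apply: join_eq => //= a; rewrite -[RHS]imset_id; apply: eq_in_imset => v vz.
  by apply: H; apply/jsupP; exists a.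
have s2 l m (f : hom l m) k (z : joinC l k) : jsup (csm joinC f k z) = happ f @: jsup z.
  apply/setP => v; apply/jsupP/imsetP => [[a /imsetP[w wz ->]]|[w /jsupP[a wz] ->]].
    by exists w => //; apply/jsupP; exists a.
  by exists a; apply: imset_f.
have s3 m k l (g : hom l k) (z : joinC m k) : jsup (act (joinC m) g z) \subset jsup z.
  apply/subsetP => v /jsupP[a /=]; rewrite belowE => /andP[vz _]; by apply/jsupP; exists (g a).
apply: (hm_res_tfib (rho := @srho joinC (@jsup))).
- by move=> m k z; apply: srho1.
- by move=> l m f k z; apply: srho2.
- by move=> m k l g z; apply: srho3.
- by move=> l m f k z i; apply: srho4.
- move=> Y Z p [lp rp] m R v RP Rv Rd.
  have E : @ELP (joinC m) (fun k z => @jL b m k z) _ _ p.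
    case: b R RP Rv Rd => R RP Rv Rd.
      apply: (@ELP_retract (joinC m) _ _ _ (@jh1 m) (Delta1_end false)) rp.
      + exact: jL_closed.
      + exact: atv_closed.
      + by move=> n s; apply: join_eq => a //=; rewrite /c1 /= andbF.
      + move=> n s t h a /=; rewrite /tor; case: h => [h|h].
          by case: ifP => // _; exact: h.
        by rewrite (h : t = _).
    apply: (@ELP_retract (joinC m) _ _ _ (@jh0 m) (Delta1_end true)) lp.
    + exact: jL_closed.
    + exact: atv_closed.
    + by move=> n s; apply: join_eq => a.
    + move=> n s t h a /=; rewrite /tand; case: h => [h|h].
        by case: ifP => // _; exact: h.
      by rewrite (h : t = _).
  have [|||n q|w [wR wv]] := E point (fun _ _ => False)
      (scomp v (ssnd _ _)) (fun n q x => R n q.2 x) _.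
  + by [].
  + split=> [n q x x'|n k g q x]; [exact: RP.1|exact: RP.2].
  + by move=> n q x /Rv.
  + by split=> [/Rd h|[//|/Rd]] //; right.
  exists (scomp w (pair_map (to_point _) (sid _))); split=> [n z x Rx|n z] /=; first exact: wR.
  by rewrite wv.
- exact: kanfib_LF.
Qed.

(** * Sections over twisted arrow categories *)

Lemma bij_inverse (X Y : sSet) (f : smap X Y) :
  (forall n (x x' : X n), f n x = f n x' -> x = x') -> (forall n (y : Y n), exists x, f n x = y) ->
  exists g : smap Y X, (forall n x, g n (f n x) = x) /\ (forall n y, f n (g n y) = y).
Proof.
move=> inj surj; pose g n (y : Y n) := sval (cid (surj n y)).
have gP n y : f n (g n y) = y by rewrite /g; case: cid.
have gN m n (h : hom m n) y : g m (act Y h y) = act X h (g n y).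
  by apply: inj; rewrite smapE !gP.
by exists (SMap gN); split=> // n x; apply: inj; rewrite /= gP.
Qed.

Lemma tfib_ELP_L (K : sSet) L (X Y : sSet) (p : smap X Y) : trivial_kan_fibration p -> @ELP K L _ _ p.
Proof. by move=> /TFP tp B A v R HA RP Rv _; exact: tp. Qed.

Definition fhom (A X Y : sSet) (p : smap X Y) (f g : smap A X) : Prop :=
  exists H : smap (sprod A J) X, [/\ forall n x, H n (x, jF n) = f n x,
    forall n x, H n (x, jT n) = g n x & forall n q, p n (H n q) = p n (f n q.1)].

Lemma fhom_homotopic (A X Y : sSet) (p : smap X Y) (f g : smap A X) : fhom p f g -> homotopic f g.
Proof. by case=> H [h0 h1 _]; apply/homotopicP; exists H. Qed.

Lemma fhom_trans (A X Y : sSet) (p : smap X Y) (f g h : smap A X) : FJ p ->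
  fhom p f g -> fhom p f h -> fhom p g h.
Proof.
move=> fp [H1 [a0 a1 a2]] [H2 [b0 b1 b2]].
have [n b|n b|n b s|n b t|n b t|S [S0 S1 S2 S3]] := @square_lift A X Y p
  (scomp (scomp p f) (scomp (sfst _ _) (sfst _ _))) (scomp f (sfst _ _)) H1 H2 fp.
- exact: a0.
- exact: b0.
- by [].
- by rewrite a2.
- by rewrite b2.
exists (scomp S (cstJ _ true)); split=> [n x|n x|n [x t]] /=; rewrite ?S1 ?S2 ?S3 //=.
by rewrite -(a1 n x) a2.
Qed.

(** As q is a trivial fibration, the homotopy p H, which is constant in Z, can be deformed over Z to
    a constant one relative to its ends; lifting this deformation through p makes H fibrewise over
    Y. *)
Lemma fhom_fib (A X Y Z : sSet) (p : smap X Y) (q : smap Y Z) (f g : smap A X) : FJ p ->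
  trivial_kan_fibration q -> fhom (scomp q p) f g -> (forall n x, p n (f n x) = p n (g n x)) ->
  fhom p f g.
Proof.
move=> fp /TFP tq [H [h0 h1 h2]] pfg.
pose P1 n (x : sprod (sprod A J) J n) := x.2 = jF n.
pose P2 n (x : sprod (sprod A J) J n) := x.1.2 = jF n \/ x.1.2 = jT n \/ x.2 = jT n.
have c1 : subclosed P1 by move=> m n k x h; apply: (atv_closed k h).
have c2 : subclosed P2.
  by move=> m n k x [h|[h|h]]; [left|right; left|right; right]; apply: (atv_closed k h).
pose f2 : smap (sprod (sprod A J) J) Y := scomp (scomp p f) (scomp (sfst _ _) (sfst _ _)).
have [|n x y|V [VR Vq]] := tq _ (scomp q f2)
    (punion (on P1 (scomp p (scomp H (sfst _ _)))) (on P2 f2)).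
- apply: punion_is_pmap; [exact: on_is_pmap|exact: on_is_pmap|].
  move=> n [[a s] t] x y [/= et ->] [/= es ->]; move: et es; rewrite /P1 /P2 /= => et [->|[->|es]].
  + by rewrite h0.
  + by rewrite h1 pfg.
  + by move: et; rewrite es => /esym/J_endsE.
- by case=> [[_ ->]|[_ ->]] //; exact: (h2 n x.1).
have [n b|n b|n b s|n b t|n b t|S [S0 S1 S2 S3]] := @square_lift A X Y p V H (scomp f (sfst _ _)) (scomp g (sfst _ _)) fp.
- by rewrite h0.
- by rewrite h1.
- by symmetry; apply: VR; left.
- by symmetry; apply: VR; right; split=> //; left.
- by rewrite /= -pfg; symmetry; apply: VR; right; split=> //; right; left.
exists (scomp S (cstJ _ true)); split=> [n x|n x|n [x t]] /=; rewrite ?S1 ?S2 ?S3 //=.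
by apply: VR; right; split=> //; right; right.
Qed.

Lemma ELP_total (K : sSet) L (X Y : sSet) (p : smap X Y) : @ELP K L _ _ p ->
  @ELP K L _ _ (to_point Y) -> ELP L (to_point X).
Proof.
by move=> h1 h2; have -> : to_point X = scomp (to_point Y) p; [exact: smap_eq|exact: ELP_comp].
Qed.

Lemma tgt_nat (X Y : sSet) (f : smap X Y) n (x : Tw X n) :
  Tw_tgt Y n (Tw_map f n x) = f n (Tw_tgt X n x).
Proof. by symmetry; exact: (smapE f (tgt_hom n) x). Qed.

Lemma Tw_LF (X : sSet) : LF (to_point X) -> LF (to_point (Tw X)).
Proof. by move=> lX; exact: (ELP_total (tfib_ELP_L (Tw_tgt_tfib lX)) lX). Qed.

Section TwSections.
(** The abstract situation: Z over K is the right adjoint of Tw applied to tau, so that maps B -> Z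
    over v correspond to maps Tw B -> HO over Tw v, with counit ev. It is used for Z the pullback of
    D^n to K and HO that of the left fibration of elements to Tw K. *)
Variables (K Z HO : sSet) (tau : smap HO (Tw K)) (pr : smap Z K) (ev : smap (Tw Z) HO).
Hypotheses (lK : LF (to_point K)) (lZ : LF (to_point Z)) (ltau : LF tau)
  (ev_over : forall n z, tau n (ev n z) = Tw_map pr n z)
  (univ : forall (B : sSet) (v : smap B K) (g : smap (Tw B) HO),
    (forall n x, tau n (g n x) = Tw_map v n x) -> exists l : smap B Z,
      (forall n b, pr n (l n b) = v n b) /\ (forall n x, ev n (Tw_map l n x) = g n x))
  (uniq : forall (B : sSet) (l l' : smap B Z), (forall n b, pr n (l n b) = pr n (l' n b)) ->
    (forall n x, ev n (Tw_map l n x) = ev n (Tw_map l' n x)) -> forall n b, l n b = l' n b).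

Lemma HO_LF : LF (to_point HO).
Proof. exact: (ELP_total ltau (Tw_LF lK)). Qed.

(* An inverse is obtained by transposing a map Tw HO -> HO which lies over
   Tw(tgt) and is homotopic to the target projection of HO; the two projections
   from Tw (Tw K) to Tw K are homotopic over K. *)
Lemma section_eval_equiv (sg : smap Z (Tw Z)) : (forall n z, Tw_tgt Z n (sg n z) = z) ->
  is_equiv (scomp ev sg) /\ homotopic (scomp (scomp ev sg) (Tw_tgt Z)) ev.
Proof.
move=> sgP; set w := scomp ev sg.
have tK := Tw_tgt_tfib lK; have tZ := Tw_tgt_tfib lZ; have tH := Tw_tgt_tfib HO_LF.
have ft : FJ tau := LF_FJ ltau.
have fp : FJ (scomp (Tw_tgt K) tau) by apply: ELP_comp => //; apply: tfib_ELP_L.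
have [H [H0 H1 H2]] := @tfib_homotopic (Tw (Tw K)) _ _ _ (Tw_tgt (Tw K)) (Tw_map (Tw_tgt K)) tK
  (fun n x => esym (tgt_nat (Tw_tgt K) x)).
pose vH : smap (sprod (Tw HO) J) (Tw K) := scomp H (pair_map (scomp (Tw_map tau) (sfst _ _)) (ssnd _ _)).
pose PF n (x : sprod (Tw HO) J n) := x.2 = jF n.
have [|||n q|M [MR Mt]] := ft (Tw HO) (fun _ _ => False) vH (on PF (scomp (Tw_tgt HO) (sfst _ _))).
- by [].
- by apply: on_is_pmap => m n k x h; apply: (atv_closed k h).
- by move=> n [x t] y [e ->]; rewrite /= (e : t = _) H0 -tgt_nat.
- split=> [[y [h _]]|[//|h]]; first by right.
  by exists (Tw_tgt HO n q.1).
have M0 n x : M n (x, jF n) = Tw_tgt HO n x by apply: MR.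
pose mu : smap (Tw HO) HO := scomp M (cstJ _ true).
have muP n x : tau n (mu n x) = Tw_map (scomp (Tw_tgt K) tau) n x by rewrite /= Mt /= H1.
have [nu [nu1 nu2]] := univ muP.
have [sH sHP] := tfib_section tH.
have evt n (y : Tw Z n) : Tw_tgt K n (tau n (ev n y)) = pr n (Tw_tgt Z n y).
  by rewrite ev_over tgt_nat.
have Mp n y t : Tw_tgt K n (tau n (M n (y, t))) = Tw_tgt K n (tau n (Tw_tgt HO n y)).
  by rewrite Mt; apply: etrans (H2 n (Tw_map tau n y, t)) _; rewrite tgt_nat.
have prw n z : Tw_tgt K n (tau n (w n z)) = pr n z by apply: etrans (evt n _) _; rewrite sgP.
have [S [S0 S1 S2]] := @tfib_homotopic (Tw Z) _ _ _ (scomp sg (Tw_tgt Z)) (sid _) tZ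
  (fun n x => sgP n (Tw_tgt Z n x)).
have evS : fhom (scomp (Tw_tgt K) tau) (scomp w (Tw_tgt Z)) ev.
  exists (scomp ev S); split=> [n x|n x|n q].
  - exact: (congr1 (ev n) (S0 n x)).
  - exact: (congr1 (ev n) (S1 n x)).
  - exact: etrans (evt _ _) (etrans (congr1 (pr n) (S2 n q)) (esym (evt _ _))).
have mM : fhom (scomp (Tw_tgt K) tau) (scomp w (Tw_tgt Z)) (scomp mu (Tw_map w)).
  exists (scomp M (pair_map (scomp (Tw_map w) (sfst _ _)) (ssnd _ _))); split=> [n x|n x|n q].
  - exact: etrans (M0 n _) (tgt_nat w x).
  - by [].
  - by apply: etrans (Mp _ _ _) _; rewrite tgt_nat.
split; last exact: fhom_homotopic evS.
exists nu; split.
- have fe n x : tau n (scomp mu (Tw_map w) n x) = tau n (ev n x).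
    by apply: etrans (muP n _) _; apply: etrans _ (esym (ev_over x)); exact: prw.
  have [G [G0 G1 G2]] := fhom_fib ft tK (fhom_trans fp mM evS) fe.
  (* Composition with the projection from Tw (Z x J) to Tw Z x J makes the homotopy G of maps Tw Z
     -> HO transposable; its transpose is a homotopy of maps Z -> Z. *)
  pose g : smap (Tw (sprod Z J)) HO :=
    scomp G (pair_map (Tw_map (sfst Z J)) (scomp (Tw_tgt J) (Tw_map (ssnd Z J)))).
  have gP n x : tau n (g n x) = Tw_map (scomp pr (sfst Z J)) n x.
    by apply: etrans (G2 n _) _; apply: etrans (fe n _) _; exact: ev_over.
  have [l [l1 l2]] := univ gP; apply/homotopicP; exists l; split.
  + apply: (@uniq _ (scomp l (cstJ _ false)) (scomp nu w)) => n z.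
      by apply: etrans (l1 n _) _; apply: esym; apply: etrans (nu1 n _) _; exact: prw.
    apply: etrans (l2 n (z, jF n.*2.+1)) _.
    by apply: etrans (G0 n z) _; symmetry; exact: nu2.
  + apply: (@uniq _ (scomp l (cstJ _ true)) (sid _)) => n z; first by rewrite [LHS]l1.
    by apply: etrans (l2 n (z, jT n.*2.+1)) _; exact: (G1 n z).
- have fH : isfib HO by apply/LF_FJ/HO_LF.
  have h1 : homotopic (scomp sg nu) (scomp (Tw_map nu) sH).
    have [n x|Q [Q0 Q1 _]] := @tfib_homotopic _ _ _ _ (scomp sg nu) (scomp (Tw_map nu) sH) tZ.
      by apply: etrans (sgP n _) _; symmetry; apply: etrans (tgt_nat nu _) _; rewrite sHP.
    by apply/homotopicP; exists Q.
  rewrite /w -scompA; apply: (homotopic_trans fH (homotopic_post ev h1)).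
  have h2 : homotopic (Tw_tgt HO) mu by apply/homotopicP; exists M.
  apply: (homotopic_trans (g := scomp mu sH)) => //; first by apply: homotopic_eq => n x; exact: nu2.
  apply: homotopic_sym; apply: (homotopic_trans (g := scomp (Tw_tgt HO) sH)) => //.
    by apply: homotopic_eq => n x; exact: esym (sHP n x).
  exact: homotopic_pre h2.
Qed.
End TwSections.

Lemma kan_LF (X : sSet) : is_kan X -> LF (to_point X).
Proof.
move=> kX; apply: left_horns_LF => n k kn u v _.
have n0 : 0 < n by case: n k kn {u v} => // k; lia.
have [g gE] := kX n k n0 u; exists g; split=> // m x; exact: point_eq.
Qed.

Lemma total_LF (R : ring_spectrum) (C : sSet) (D : natural_system R C) n : LF (total_proj D n).
Proof.
apply: ELP_pb_fst; apply: el_LF => M; apply: kan_LF; exact: (bm_fib M n).1.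
Qed.

(** * Pullbacks of D^n to Kan complexes *)

Definition tw0 j (s : hom j 1) : 'I_j.*2.+2 -> 'I_2 :=
  fun x => if x <= j then ord0 else s (inord (x - j.+1)).
Lemma tw0_mono j (s : hom j 1) (x y : 'I_j.*2.+2) : x <= y -> tw0 s x <= tw0 s y.
Proof.
move=> xy; rewrite /tw0; have hx := ltn_ord x; have hy := ltn_ord y.
case: ifP => h1; case: ifP => h2 //; first by lia.
by apply: (svalP s); rewrite !inordK; lia.
Qed.
(** A vertex s of the interval goes to the arrow from 0 to s, which makes this inverse to the target
    projection on [src0]. *)
Program Definition tw_iota : smap (simplex 1) (Tw (simplex 1)) :=
  @SMap (simplex 1) (Tw (simplex 1)) (fun j s => mk_hom (@tw0_mono j s)) _.
Next Obligation.
apply: hom_eq => x0; change (tw0 (hcomp x f) x0 = tw0 x (tw_fun f x0)); rewrite /tw0 tw_funE.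
have hx := ltn_ord x0; case: ifP => h1; first by rewrite leq_subr.
rewrite leqNgt ltn_addr //=; congr (happ x _); apply: ord_inj.
by rewrite inordK addKn //; have := ltn_ord (f (inord (x0 - m.+1))).
Qed.

Lemma tgt_iota j (s : simplex 1 j) : Tw_tgt (simplex 1) j (tw_iota j s) = s.
Proof.
apply: hom_eq => x; change (tw0 s (tgt_fun x) = happ s x); rewrite /tw0 tgt_funE.
rewrite leqNgt ltn_addr //=; congr (happ s _); apply: ord_inj; rewrite inordK addKn //; exact: ltn_ord.
Qed.

Definition src0 j (t : Tw (simplex 1) j) : Prop := forall x : 'I_j.*2.+2, x <= j -> happ t x = ord0.

Lemma src0_closed : @subclosed (Tw (simplex 1)) src0.
Proof.
move=> i j g t h x xi; apply: (h (tw_fun g x)); rewrite tw_funE xi; exact: leq_subr.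
Qed.

Lemma iota_tgt j (t : Tw (simplex 1) j) : src0 t -> tw_iota j (Tw_tgt (simplex 1) j t) = t.
Proof.
move=> h; apply: hom_eq => x; have hx := ltn_ord x.
change (tw0 (hcomp t (tgt_hom j)) x = happ t x); rewrite /tw0; case: ifP => xj; first by rewrite h.
change (happ t (tgt_fun (inord (x - j.+1))) = happ t x); congr (happ t _); apply: ord_inj.
by rewrite tgt_funE inordK; lia.
Qed.

(** Where s is 1 the source is lowered to 0. In the twisted arrow category the object x -> y maps to
    0 -> y, so this is a homotopy out of the identity, and it ends in [src0]. *)
Definition push0 j (t : hom j.*2.+1 1) (s : hom j 1) : 'I_j.*2.+2 -> 'I_2 :=
  fun x => if (x <= j) && (s (inord (j - x)) != ord0) then ord0 else t x.
Lemma push0_mono j (t : hom j.*2.+1 1) (s : hom j 1) (x y : 'I_j.*2.+2) : x <= y ->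
  push0 t s x <= push0 t s y.
Proof.
move=> xy; have h : t x <= t y := svalP t _ _ xy; rewrite /push0; case: ifP => // h1.
case: ifP => // /andP[yj sy]; case/negP: h1; rewrite (leq_trans xy yj) /=.
apply: t_up sy; rewrite !inordK; lia.
Qed.
Program Definition tw_push : smap (sprod (Tw (simplex 1)) (simplex 1)) (Tw (simplex 1)) :=
  @SMap (sprod (Tw (simplex 1)) (simplex 1)) (Tw (simplex 1)) (fun j q => mk_hom (@push0_mono j q.1 q.2)) _.
Next Obligation.
case: x => t s; apply: hom_eq => x; have hx := ltn_ord x.
change (push0 (hcomp t (tw_hom f)) (hcomp s f) x = push0 t s (tw_fun f x)); rewrite /push0 tw_funE.
case: (leqP x m) => xm /=.
  have hf := ltn_ord (f (inord (m - x))); rewrite leq_subr subKn /=; last by lia.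
  by rewrite inord_val.
by rewrite leqNgt ltn_addr.
Qed.

Lemma src0_ELP (X Y : sSet) (p : smap X Y) : RF p -> ELP src0 p.
Proof.
apply: (@ELP_retract (Tw (simplex 1)) _ _ _ tw_push (Delta1_end false)).
- exact: src0_closed.
- exact: atv_closed.
- by move=> n s; apply: hom_eq => x; change (push0 s (hconst n ord0) x = happ s x); rewrite /push0 andbF.
- move=> n s t h x xn; change (push0 s t x = ord0); rewrite /push0 xn /=.
  case: h => [h|h]; first by case: ifP => // _; exact: h.
  by rewrite (h : t = _).
Qed.

Section Pullback.
Variables (R : ring_spectrum) (C : sSet) (D : natural_system R C) (n : nat).
Variables (K : sSet) (v0 : smap K C).
Hypothesis lK : LF (to_point K).

Definition orbits := pullback (total_proj D n) (Tw_map v0).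
Definition orbits_proj : smap orbits (Tw K) := pb_snd _ _.
Definition secs := pullback (Dproj D n) v0.
Definition secs_proj : smap secs K := pb_snd _ _.

Lemma orbits_LF : LF orbits_proj.
Proof. by apply: ELP_pb_snd; exact: total_LF. Qed.

Lemma secs_evalP m (x : Tw secs m) :
  total_proj D n m ((sval (sval x).1).2 m (hid m.*2.+1)) = Tw_map v0 m (sval x).2.
Proof.
case: x => -[[[c s] H] k] /= e; rewrite [LHS]H act_id; exact: e.
Qed.

Program Definition secs_eval : smap (Tw secs) orbits :=
  @SMap (Tw secs) orbits (fun m x =>
    exist _ ((sval (sval x).1).2 m (hid m.*2.+1), (sval x).2) (secs_evalP x)) _.
Next Obligation.
apply: eq_exist; congr (_, _); case: x => -[[[c s] H] k] e /=; rewrite -smapE.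
by congr (smap_fun s _ _); exact: hom_eq.
Qed.

Lemma secs_ext m (z z' : secs m) : secs_proj m z = secs_proj m z' ->
  (forall j (th : hom j.*2.+1 m), secs_eval j (act secs th z) = secs_eval j (act secs th z')) -> z = z'.
Proof.
case: z z' => -[[[c s] H] k] e [[[[c' s'] H'] k'] e'] /= ek E; subst k'.
apply: eq_exist; congr (_, _); apply: eq_exist; congr (_, _).
  exact: etrans e (esym e').
apply: smap_eq => j th; have := congr1 (fun q : orbits j => (sval q).1) (E j th).
by rewrite /= /hcomp /=; rewrite -!/(hcomp th (hid _)) hcomp1.
Qed.

Lemma secs_univ (B : sSet) (v : smap B K) (g : smap (Tw B) orbits) :
  (forall j x, orbits_proj j (g j x) = Tw_map v j x) -> exists l : smap B secs,
    (forall j b, secs_proj j (l j b) = v j b) /\ (forall j x, secs_eval j (Tw_map l j x) = g j x).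
Proof.
move=> gv.
pose s0 m (b : B m) j (th : Tw (simplex m) j)   : Defs.total D n j := (sval (g j (act B th b))).1.
have sN m b i j (f : hom i j) (th : Tw (simplex m) j) :
    s0 m b i (act (Tw (simplex m)) f th) = act (Defs.total D n) f (s0 m b j th).
  rewrite /s0; have -> : act B (act (Tw (simplex m)) f th) b = act (Tw B) f (act B th b) by exact: act_comp.
  by rewrite smapE.
have sP m b j (th : hom j.*2.+1 m) : total_proj D n j (s0 m b j th) = act C th (v0 m (v m b)).
  rewrite /s0 (svalP (g j (act B th b))).
  have -> : (sval (g j (act B th b))).2 = Tw_map v j (act B th b) by exact: gv.
  by rewrite /= !smapE.
pose d0 m b : Dcat D n m := exist _ (v0 m (v m b), SMap (sN m b)) (sP m b).
pose l0 m b : secs m := exist (fun q : sprod (Dcat D n) K m => Dproj D n m q.1 = v0 m q.2) (d0 m b, v m b) erefl.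
have lN i m (f : hom i m) b : l0 i (act B f b) = act secs f (l0 m b).
  apply: eq_exist; congr (_, _); last exact: smapE.
  apply: eq_exist; congr (_, _); first by rewrite !smapE.
  by apply: smap_eq => j th; rewrite /= /s0 -act_comp.
exists (SMap lN); split=> // j x; apply: (@sub_eq _ _ (@pullback_closed _ _ _ _ _)).
rewrite /= /s0 act_id [RHS]surjective_pairing; congr (_, _); symmetry; exact: gv.
Qed.

(** Transposed along [secs_univ], the problem lives on Tw B x Tw Δ^1. On [src0], a copy of Δ^1, it
    is a left lifting problem and gives [w1]. From there to all of Tw Δ^1 a right lifting is
    required ([src0_ELP]), available because Tw K is Kan. *)
Lemma secs_LF : LF secs_proj.
Proof.
move=> B A v Q HA QP Qv Qd.
pose vT : smap (sprod (Tw B) (Tw (simplex 1))) (Tw K) :=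
  @SMap (sprod (Tw B) (Tw (simplex 1))) (Tw K) (fun j q => v j.*2.+1 q) (fun i j f q => smapE v (tw_hom f) q).
pose QT : pmap (sprod (Tw B) (Tw (simplex 1))) orbits := fun j q y =>
  exists x : secs j.*2.+1, Q j.*2.+1 q x /\ y = secs_eval j x.
have QTP : is_pmap QT.
  split=> [j q y y' [x [h ->]] [x' [h' ->]]|i j f q y [x [h ->]]]; first by rewrite (QP.1 _ _ _ _ h h').
  exists (act (Tw secs) f x); split; first exact: (QP.2 _ _ (tw_hom f) q x h).
  by rewrite -smapE.
pose c0 j : Tw (simplex 1) j := deg (simplex 1) j.*2.+1 (Delta1_end false).
have QTd j (q : sprod (Tw B) (Tw (simplex 1)) j) : dom QT q <-> A j.*2.+1 q.1 \/ q.2 = c0 j.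
  split=> [[y [x [h _]]]|h]; first by apply/(Qd j.*2.+1 q); exists x.
  have [x Qx] := (Qd j.*2.+1 q).2 h; by exists (secs_eval j x), x.
have QTv : pover orbits_proj vT QT by move=> j q y [x [/Qv h ->]]; exact: h.
pose A' j (b : Tw B j) := A j.*2.+1 b.
have HA' : subclosed A' by move=> i j f b h; apply: HA.
pose io : smap (sprod (Tw B) (simplex 1)) (sprod (Tw B) (Tw (simplex 1))) :=
  prod_map (sid _) tw_iota.
have io0 j : tw_iota j (deg (simplex 1) j (Delta1_end false)) = c0 j.
  by apply: hom_eq => x; change (tw0 (hconst j (ord0 : 'I_2)) x = ord0); rewrite /tw0; case: ifP.
have [|||j q|w1 [w1R w1v]] := @orbits_LF (Tw B) A' (scomp vT io) (pre_pmap (fun _ _ => True) io QT).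
- exact: HA'.
- by apply: pre_is_pmap.
- by move=> j q y [_ /QTv].
- split=> [[y [_ h]]|h].
    have /QTd [h'|h'] : dom QT (io j q) by exists y.
      by left.
    have h2 : tw_iota j q.2 = c0 j by exact: h'.
    right; change (q.2 = deg (simplex 1) j (Delta1_end false)).
    have e1 := tgt_iota q.2; rewrite h2 -io0 tgt_iota in e1; exact: esym e1.
  have [y Qy] : dom QT (io j q); last by exists y.
  by apply/QTd; case: h => [h|h]; [left|right; exact: etrans (congr1 (tw_iota j) (h : q.2 = _)) (io0 j)].
pose io' : smap (sprod (Tw B) (Tw (simplex 1))) (sprod (Tw B) (simplex 1)) :=
  prod_map (sid _) (Tw_tgt (simplex 1)).
pose P0 j (q : sprod (Tw B) (Tw (simplex 1)) j) := src0 q.2.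
have P0c : subclosed P0 by move=> i j f q h; apply: (src0_closed f h).
have ioK j q : P0 j q -> io j (io' j q) = q.
  by case: q => b t h; congr (_, _); exact: iota_tgt.
have rt : RF orbits_proj by apply: LF_RF orbits_LF (Tw_LF lK).
have [|||j q|w [wR wv]] := src0_ELP rt (B := Tw B) (A := A') (v := vT) (R := punion QT (on P0 (scomp w1 io'))).
- exact: HA'.
- apply: punion_is_pmap => //; first exact: on_is_pmap.
  move=> j q y y' h [h0 ->]; symmetry; apply: w1R; split=> //.
  by rewrite ioK.
- move=> j q y [/QTv //|[h ->]]; rewrite [scomp w1 io' j q]/(w1 j (io' j q)) w1v.
  exact: (congr1 (vT j) (ioK _ _ h)).
- split=> [[y [h|[h _]]]|[h|h]].
  + have /QTd [h'|h'] : dom QT q by exists y.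
      by left.
    by right; rewrite h'.
  + by right.
  + have [y Qy] : dom QT q by apply/QTd; left.
    by exists y; left.
  + by exists (w1 j (io' j q)); right.
pose g : smap (Tw (sprod B (simplex 1))) orbits :=
  @SMap (Tw (sprod B (simplex 1))) orbits (fun j q => w j q) (fun i j f q => smapE w f q).
have [l [l1 l2]] := @secs_univ _ v g (fun j q => wv j q).
exists l; split=> // m q x Qx; apply: secs_ext => [|j th].
  by rewrite l1 -(Qv _ _ _ Qx).
rewrite -smapE; apply: etrans (l2 j (act (sprod B (simplex 1)) th q)) _.
apply: wR; left; exists (act secs th x); split=> //.
exact: (QP.2 _ _ th q x Qx).
Qed.

Lemma secs_obj_LF : LF (to_point secs).
Proof. exact: (ELP_total secs_LF lK). Qed.

Lemma orbits_obj_LF : LF (to_point orbits).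
Proof. exact: (ELP_total orbits_LF (Tw_LF lK)). Qed.

Lemma secs_equiv (sg : smap secs (Tw secs)) : (forall m z, Tw_tgt secs m (sg m z) = z) ->
  is_equiv (scomp secs_eval sg) /\ homotopic (scomp (scomp secs_eval sg) (Tw_tgt secs)) secs_eval.
Proof.
apply: (section_eval_equiv (tau := orbits_proj) (pr := secs_proj)) => //.
- exact: secs_obj_LF.
- exact: orbits_LF.
- exact: secs_univ.
- move=> B l l' h1 h2 m b; apply: secs_ext => [|j th]; first exact: h1.
  by rewrite -!smapE; exact: (h2 j (act B th b)).
Qed.
End Pullback.

(** * The core of D^n over BAut(Lambda) *)

Section Core.
Variables (R : ring_spectrum) (C : sSet) (D : natural_system R C) (n : nat) (Lambda : C 0).
Hypothesis qC : is_quasicategory C.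
Local Notation K := (BAut Lambda).
Local Notation Z := (secs D n (BAut_incl Lambda)).

Lemma BAut_LF : LF (to_point K). Proof. exact: over_LF. Qed.

Definition core_in : smap (Dcore D n Lambda) Z :=
  @sub_lift (Dcore D n Lambda) (sprod (Dcat D n) K) _ (pullback_closed (f := Dproj D n) (g := BAut_incl Lambda))
    (pair_map (over_incl (Dproj D n) Lambda) (Dcore_proj D n Lambda)) (fun _ _ => erefl).

(** The pullback Z is a left fibration over a Kan complex, so each of its edges extends to J and is
    an equivalence; the vertex condition concerns only the projection to C. *)
Lemma core_outP m (z : Z m) : (forall e : hom 1 m, is_equivalence (act (Dcat D n) e (sval z).1)) /\
  (forall i, equivalent (Dproj D n 0 (vertex i (sval z).1)) Lambda).
Proof.
split=> [e|i].
  have h := LF_edge (act Z e z) (@secs_obj_LF _ _ D n _ (BAut_incl Lambda) BAut_LF).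
  exact: (smap_is_equivalence (pb_fst (Dproj D n) (BAut_incl Lambda)) h).
have [_ h] := svalP (sval z).2; move: (h i).
have e : Dproj D n m (sval z).1 = sval (sval z).2 by exact: (svalP z).
have -> : Dproj D n 0 (vertex i (sval z).1) = vertex i (sval (sval z).2) by
  apply: etrans (smapE (Dproj D n) _ _) _; rewrite e.
by [].
Qed.

Definition core_out : smap Z (Dcore D n Lambda) :=
  @sub_lift Z (Dcat D n) _ (@over_closed _ _ (Dproj D n) Lambda) (pb_fst _ _) core_outP.

Lemma core_inK m x : core_out m (core_in m x) = x.
Proof. exact: sub_eq. Qed.
Lemma core_outK m z : core_in m (core_out m z) = z.
Proof.
apply: (@sub_eq _ _ (@pullback_closed _ _ _ _ _)); rewrite /= [RHS]surjective_pairing; congr (_, _).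
by apply: (@sub_eq _ _ (@over_closed _ _ (sid C) Lambda)); exact: (svalP z).
Qed.

Lemma Dcore_LF : LF (to_point (Dcore D n Lambda)).
Proof. exact: (ELP_retract_obj core_inK (@secs_obj_LF _ _ D n _ (BAut_incl Lambda) BAut_LF)). Qed.

Lemma Dcore_proj_LF : LF (Dcore_proj D n Lambda).
Proof.
move=> B A v Q HA QP Qv Qd.
have [|||w [wR wv]] := @secs_LF R C D n _ (BAut_incl Lambda) BAut_LF B A v (img_pmap core_in Q) HA.
- exact: img_is_pmap.
- by move=> j q y [x [/Qv h ->]].
- by move=> j q; rewrite dom_img.
exists (scomp core_out w); split=> [j q x Qx|j q].
  have e : w j q = core_in j x by apply: wR; exists x.
  exact: etrans (congr1 (core_out j) e) (core_inK x).
by rewrite -(wv j q) -[in RHS](core_outK (w j q)).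
Qed.

Lemma Dcore_orbits : exists w : smap (Dcore D n Lambda) (homotopy_orbits D n Lambda),
  is_equiv w /\ homotopic (scomp w (Tw_tgt (Dcore D n Lambda))) (Dcore_eval D n Lambda).
Proof.
have [sg sgP] := tfib_section (Tw_tgt_tfib (@secs_obj_LF _ _ D n _ (BAut_incl Lambda) BAut_LF)).
have [e1 e2] := @secs_equiv _ _ D n _ (BAut_incl Lambda) BAut_LF _ sgP.
have fO : isfib (homotopy_orbits D n Lambda) by apply/LF_FJ/(@orbits_obj_LF _ _ D n _ (BAut_incl Lambda) BAut_LF).
exists (scomp (scomp (secs_eval D n (BAut_incl Lambda)) sg) core_in); split.
  apply: equiv_comp => //; first by apply/LF_FJ/Dcore_LF.
  exact: (iso_equiv core_inK core_outK).
have := homotopic_pre (Tw_map core_in) e2.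
move=> h; apply: (homotopic_trans fO _ (homotopic_trans fO h _)); apply: homotopic_eq => m x.
  by congr (smap_fun (scomp (secs_eval D n (BAut_incl Lambda)) sg) m _); symmetry; exact: tgt_nat.
by apply: (@sub_eq _ _ (@pullback_closed _ _ _ _ _)).
Qed.
End Core.

(** * The fibres of the left fibration of elements *)

Local Notation coneC b := (csub (@jL_closed b) (@jL_csm b)).

(* A simplex of a fibre amounts to a map out of the part of [join] formed by the
   subsets; the restrictions from the whole of [join] to this part and to the
   simplex glued in front of it are trivial fibrations, which compares the fibre
   with the value of the functor. *)
Section MinFamily.
Variable Y : sSet.

Lemma jmin_mono m k (q : joinC m k) (a b : 'I_k.+1) : a <= b -> smin ((sval q).2 a) <= smin ((sval q).2 b).
Proof. by have [_ z2 _ _ _] := svalP q; exact: z2. Qed.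
Definition jmin m k (q : joinC m k) : hom k m := mk_hom (@jmin_mono m k q).

Program Definition min_family : smap Y (Hm joinC Y) :=
  @SMap Y (Hm joinC Y) (fun m y => @SMap (joinC m) Y (fun k q => act Y (jmin q) y) _) _.
Next Obligation.
rewrite -act_comp; congr (act Y _ _); apply: hom_eq => a.
exact: (smin_jact f a (svalP x)).
Qed.
Next Obligation.
apply: smap_eq => k q; rewrite /= -act_comp; congr (act Y _ _); apply: hom_eq => a /=.
by have [z1 _ _ _ _] := svalP q; have [w wz] := z1 a; rewrite (smin_img f wz).
Qed.

Lemma vertsP m : @joinP m m (hconst m ord0, fun a => [set a]).
Proof.
split=> //= [a|a b ab|a _|a v]; rewrite ?smin1 //; first by exists a; exact: finset.set11.
by rewrite finset.in_set1 => /eqP->; exact: leq_max.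
Qed.
(** The universal simplex of the front part: evaluation at it is the Yoneda bijection between maps
    from the front part to Y and simplices of Y. *)
Definition verts m : coneC false m m := exist (@jL false m m) (exist _ _ (@vertsP m)) (fun _ => erefl).

Program Definition at_verts : smap (Hm (coneC false) Y) Y :=
  @SMap (Hm (coneC false) Y) Y (fun m g => g m (verts m)) _.
Next Obligation.
rewrite -smapE; congr (smap_fun x _ _); apply: eq_exist; apply: join_eq => a //=.
apply/setP => v; rewrite imset_set1 belowE smin1 finset.in_set1; case: eqP => //= ->.
by symmetry; apply: (svalP f); exact: leq_max.
Qed.

Lemma at_vertsK m y : at_verts m (hm_res (@jL_closed false) (@jL_csm false) Y m (min_family m y)) = y.
Proof. by rewrite -[RHS]act_id; congr (act Y _ _); apply: hom_eq => a; exact: smin1. Qed.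

Lemma verts_at m g : hm_res (@jL_closed false) (@jL_csm false) Y m (min_family m (at_verts m g)) = g.
Proof.
apply: smap_eq => k q; change (act Y (jmin (sval q)) (g m (verts m)) = g k q); rewrite -smapE.
congr (smap_fun g _ _); have h' := svalP q; have [_ z2 _ z4 _] := svalP (sval q).
apply: (@sub_eq _ _ (@jL_closed false m)); apply: join_eq => a /=.
  by apply/esym/eqP; rewrite (h' a).
rewrite (z4 a); last by apply/eqP; rewrite (h' a).
apply/setP => v; rewrite belowE !smin1 finset.in_set1; case: eqP => //= ->.
by apply: z2; exact: leq_max.
Qed.

Definition cone_family : smap Y (Hm (coneC true) Y) :=
  scomp (hm_res (@jL_closed true) (@jL_csm true) Y) min_family.

Hypothesis lY : LF (to_point Y).

Lemma cone_isfib : isfib (Hm (coneC true) Y) /\ is_equiv cone_family.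
Proof.
have fY := LF_FJ lY.
have t b : trivial_kan_fibration (hm_res (@jL_closed b) (@jL_csm b) Y) by exact: join_res_tfib.
have f0 : isfib (Hm (coneC false) Y).
  exact: (@ELP_retract_obj _ _ _ _ at_verts (scomp (hm_res (@jL_closed false) (@jL_csm false) Y) min_family) verts_at fY).
have f1 : isfib (Hm joinC Y) by apply: isfib_total (tfib_ELP_L (t false)) f0.
have [sg sgP] := tfib_section (t true).
have f2 : isfib (Hm (coneC true) Y) by exact: (ELP_retract_obj sgP f1).
split=> //; apply: equiv_comp => //; last exact: tfib_is_equiv.
apply: (equiv_cancel_l (g := hm_res (@jL_closed false) (@jL_csm false) Y)) => //.
  exact: (@iso_equiv _ _ (scomp (hm_res (@jL_closed false) (@jL_csm false) Y) min_family) at_verts at_vertsK verts_at).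
exact: tfib_is_equiv.
Qed.
End MinFamily.

Lemma fib_const (A : simplicial_cat) (U : simplicial_functor A) (b : hc_simplex A 0) l m (f : hom l m)
    (e : el_simplex U l) (h : el_base e = hc_act (hconst l ord0) b)
    (h' : el_base e = hc_act f (hc_act (hconst m ord0) b)) (j : 'I_l.+1) k (c : cone_chain k j) :
  fib h c = fib h' c.
Proof.
case: b h h' => o mp P h h'; apply: (@fib_mp A U l (fun _ => o ord0) _ _ _ _ _ h h') => i i' q x /=.
by congr (mp _ _ _ _); apply: chain_eq => a; rewrite /= -imset_comp.
Qed.

Section ElFibre.
Variables (A : simplicial_cat) (U : simplicial_functor A) (b0 : hc_simplex A 0).
Local Notation Y := (U (hob b0 ord0)).
Local Notation F := (fibre (el_proj U) b0).

Definition fib0 m (z : F m) j k (c : cone_chain k j) : Y k :=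
  @fib A U m (sval z).1 (hc_act (hconst m ord0) b0) (svalP z) j k c.

Lemma sact_const m j i k (d : chain k i j) (y : Y k) :
  sact U (hmp (hc_act (hconst m ord0) b0) d) y = y.
Proof. by have [_ p _] := hmpP b0; rewrite [hmp _ _]/= (p ord0 k) sact1. Qed.

(** Over a degenerate simplex of the nerve all composites act by the identity ([sact_const]), so a
    chain may be cut at any i contained in all its sets. This is the relation that the truncation in
    [join] builds in. *)
Lemma fib0_below m (z : F m) (i j : 'I_m.+1) k (c : cone_chain k j) (c' : cone_chain k i) :
  i <= j -> (forall a, i \in sval c a) -> (forall a, sval c' a = below (sval c a) i) ->
  fib0 z c = fib0 z c'.
Proof.
move=> ij ic E; have [c1 [d Ec]] := low_ex ij ic.
have -> : c' = c1.
  apply: cone_eq => a; apply/setP => v; rewrite E belowE Ec cone_cupE finset.inE.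
  apply/andP/idP => [[/orP[//|vd] vi]|vc]; last by rewrite vc (cone_le vc).
  have /andP[iv _] := chain_le vd; have -> : v = i by apply: ord_inj; lia.
  exact: cone_top.
rewrite Ec /fib0; have [_ e2] := fib_law (svalP z : el_base (sval z).1 = hc_act (hconst m ord0) b0).
by apply: etrans (e2 _ _ _ _ _) _; exact: sact_const.
Qed.

Lemma fib0_act l m (f : hom l m) (z : F m) j k (c : cone_chain k j) :
  fib0 (act F f z) c = fib0 z (cone_img f c).
Proof.
have h' : el_base (el_act f (sval z).1) = hc_act f (hc_act (hconst m ord0) b0).
  exact: (congr1 (hc_act f) (svalP z)).
apply: etrans _ (fib_act (svalP z : el_base (sval z).1 = hc_act (hconst m ord0) b0) h' c).
exact: (@fib_const A U b0 l m f _ (svalP (act F f z)) h' j k c).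
Qed.

Lemma cone_ofP m k (q : coneC true m k) :
  (forall a b : 'I_k.+1, a <= b -> (sval (sval q)).2 b \subset (sval (sval q)).2 a) /\
  (forall a, smin ((sval (sval q)).2 ord_max) \in (sval (sval q)).2 a /\
     forall v, v \in (sval (sval q)).2 a -> v <= smin ((sval (sval q)).2 ord_max)).
Proof.
have h := svalP q; have [z1 z2 z3 z4 z5] := svalP (sval q).
have z3' (a b : 'I_k.+1) : a <= b -> (sval (sval q)).2 b \subset (sval (sval q)).2 a by move=> ab; apply: z3; rewrite // (h a).
split=> // a; split; last exact: z5.
have [w wz] := z1 ord_max; exact: (subsetP (z3' _ _ (leq_max a))) (smin_in wz).
Qed.
Definition cone_of m k (q : coneC true m k) : cone_chain k (smin ((sval (sval q)).2 ord_max)) :=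
  exist _ (sval (sval q)).2 (cone_ofP q).

Lemma of_coneP m k (j : 'I_m.+1) (c : cone_chain k j) :
  joinP (hconst k (ord_max : 'I_2), fun a => below (sval c a) (smin (sval c ord_max))).
Proof.
have h a : smin (sval c ord_max) \in below (sval c a) (smin (sval c ord_max)).
  by rewrite belowE leqnn (subsetP (cone_sub c (leq_max a))) // (smin_in (cone_top c ord_max)).
split=> //= [a|a b ab|a b ab _|a v].
- by exists (smin (sval c ord_max)).
- have hs : below (sval c b) (smin (sval c ord_max)) \subset below (sval c a) (smin (sval c ord_max)).
    apply/subsetP => v; rewrite !belowE => /andP[vb ->]; rewrite andbT.
    exact: (subsetP (cone_sub c ab)).
  exact/smin_le/(subsetP hs)/(smin_in (h b)).
- apply/subsetP => v; rewrite !belowE => /andP[vb ->]; rewrite andbT.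
  exact: (subsetP (cone_sub c ab)).
- by rewrite (smin_below (cone_top c ord_max)) // belowE => /andP[].
Qed.
Definition of_cone m k (j : 'I_m.+1) (c : cone_chain k j) : coneC true m k :=
  exist (@jL true m k) (exist _ _ (of_coneP c)) (fun _ => erefl).

Lemma of_cone_eq m k (j : 'I_m.+1) (c : cone_chain k j) (q : coneC true m k) :
  (forall a, below (sval c a) (smin (sval c ord_max)) = (sval (sval q)).2 a) -> of_cone c = q.
Proof.
case: q => -[z h] h' E; apply: (@sub_eq _ _ (@jL_closed true m)); apply: join_eq => a; [|exact: E].
have : z.1 a != ord0 by rewrite (h' a).
case: (z.1 a) => -[|[|//]] // hh _; exact: ord_inj.
Qed.

Lemma of_coneK m k (q : coneC true m k) : of_cone (cone_of q) = q.
Proof.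
apply: of_cone_eq => a; apply/setP => v; rewrite belowE andb_idr //=.
by case: q => -[z [z1 z2 z3 z4 z5]] h; exact: z5.
Qed.

Lemma cone_ofK m (z : F m) k (j : 'I_m.+1) (c : cone_chain k j) : fib0 z c = fib0 z (cone_of (of_cone c)).
Proof.
have e : smin (below (sval c ord_max) (smin (sval c ord_max))) = smin (sval c ord_max).
  by apply: (smin_below (cone_top c ord_max)).
apply: fib0_below => [|a|a] /=; rewrite e //.
- exact/(cone_le (a := ord_max) (c := c))/(smin_in (cone_top c ord_max)).
- exact/(subsetP (cone_sub c (leq_max a)))/(smin_in (cone_top c ord_max)).
Qed.

Lemma fibre_familyN m (z : F m) k l (f : hom l k) (q : coneC true m k) :
  fib0 z (cone_of (act (coneC true m) f q)) = act Y f (fib0 z (cone_of q)).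
Proof.
have [e1 _] := fib_law (svalP z : el_base (sval z).1 = hc_act (hconst m ord0) b0).
apply: etrans _ (e1 _ _ _ f (cone_of q)); symmetry.
have qP := svalP (sval q); have E := smin_jact f ord_max qP; have [c1 c2] := cone_ofP q.
apply: (@fib0_below m z) => [|a|a] /=; rewrite E.
- by have [_ z2 _ _ _] := qP; apply: z2; exact: leq_max.
- apply: (subsetP (c1 _ _ _)) (smin_in (c2 (f ord_max)).1); apply: (svalP f); exact: leq_max.
- by [].
Qed.

Program Definition fibre_family : smap F (Hm (coneC true) Y) :=
  @SMap F (Hm (coneC true) Y) (fun m z =>
    @SMap (coneC true m) Y (fun k q => fib0 z (cone_of q)) (fun k l f q => @fibre_familyN m z l k f q)) _.
Next Obligation.
apply: smap_eq => k q; rewrite /= fib0_act.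
have [c1 c2] := cone_ofP q; have E := smin_img f (c2 ord_max).1.
apply: fib0_below => [|a|a] /=; rewrite E //.
- by apply: imset_f; exact: (c2 a).1.
- apply/setP => v; rewrite belowE andb_idr // => /imsetP[w wz ->].
  by apply: (svalP f); exact: (c2 a).2.
Qed.

Lemma fibre_family_inj m (z z' : F m) : fibre_family m z = fibre_family m z' -> z = z'.
Proof.
move=> E; apply: (@sub_eq _ _ (@pullback_closed _ _ _ _ _)); rewrite [LHS]surjective_pairing [RHS]surjective_pairing.
congr (_, _); last exact: point_eq.
apply: (@fib_inj A U m _ _ (hc_act (hconst m ord0) b0) (svalP z) (svalP z')) => j k c.
rewrite -!/(fib0 _ c) (cone_ofK z) (cone_ofK z').
exact: (congr1 (fun g : Hm (coneC true) Y m => g k (of_cone c)) E).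
Qed.

Lemma fibre_family_surj m (g : Hm (coneC true) Y m) : exists z, fibre_family m z = g.
Proof.
have P : @el_law A U m (hc_act (hconst m ord0) b0) (fun j k c => g k (of_cone c)).
  split=> [j k l f c|i j k c d].
    change (g l (of_cone (cone_pre f c)) = act Y f (g k (of_cone c))); rewrite -smapE.
    congr (smap_fun g _ _); apply: of_cone_eq => a /=; rewrite (smin_below (s := j)) //; last first.
    - by apply: smin_le; apply: (subsetP (cone_sub c (leq_max _))); exact: (smin_in (cone_top c ord_max)).
    - exact: cone_top.
    apply/setP => v; rewrite !belowE -andbA; congr (_ && _).
    case: (leqP v (smin (sval c (f ord_max)))) => vl; rewrite ?andbF //= andbT; symmetry.
    apply: leq_trans vl _; apply: smin_le; apply: (subsetP (cone_sub c (leq_max _))).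
    exact: (smin_in (cone_top c ord_max)).
  change (g k (of_cone (cone_cup c d)) = sact U (hmp (hc_act (hconst m ord0) b0) d) (g k (of_cone c))).
  rewrite sact_const; congr (smap_fun g _ _); apply: of_cone_eq => a /=.
  have E : smin (sval c ord_max :|: sval d ord_max) = smin (sval c ord_max).
    apply: smin_unique; first by rewrite finset.inE (smin_in (cone_top c ord_max)).
    move=> v; rewrite finset.inE => /orP[/smin_le //|/chain_le/andP[iv _]].
    by apply: leq_trans iv; apply: smin_le; exact: cone_top.
  rewrite E; apply/setP => v; rewrite !belowE finset.inE; case: (boolP (v \in sval c a)) => //= vc.
  apply/negP => /andP[/chain_le/andP[iv _] vs]; case/negP: vc.
  have si := smin_le (cone_top c ord_max); have -> : v = i.
    by apply/ord_inj/eqP; rewrite eqn_leq iv andbT; exact: leq_trans vs si.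
  exact: cone_top.
pose z0 : F m := exist
  (fun q : sprod (elements U) point m => el_proj U m q.1 = at_vertex (X := hc_nerve A) b0 m q.2)
  (@ElSimplex A U m (hc_act (hconst m ord0) b0) _ P, tt) erefl.
exists z0; apply: smap_eq => k q.
transitivity (fib (erefl (el_base (sval z0).1)) (cone_of q)); last exact: (congr1 (g k) (of_coneK q)).
change (fib0 z0 (cone_of q) = @fib A U m (sval z0).1 (hc_act (hconst m ord0) b0) erefl _ _ (cone_of q)).
by rewrite /fib0; have -> : svalP z0 = erefl by exact: Prop_irrelevance.
Qed.

Program Definition fibre_point : smap Y F :=
  @SMap Y F (fun m y => exist _ (@fibre_element A U b0 m y, tt) _) _.
Next Obligation. by []. Qed.
Next Obligation. by apply: eq_exist; congr (_, _); exact: fibre_element_act. Qed.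

Lemma fibre_point_equiv : LF (to_point Y) -> isfib F /\ is_equiv fibre_point.
Proof.
move=> /cone_isfib[f1 e1].
have [g [gf fg]] := bij_inverse fibre_family_inj fibre_family_surj.
have fF : isfib F by exact: (ELP_retract_obj gf f1).
split=> //; apply: (equiv_cancel_l (g := fibre_family)) => //; last exact: (iso_equiv gf fg).
apply: equiv_ext e1 => m y; apply: smap_eq => k q.
rewrite [RHS]/= /fib0; have -> : svalP (fibre_point m y) = erefl by exact: Prop_irrelevance.
congr (act Y _ _); apply: hom_eq => a; symmetry; apply: min_fun_unique => /=.
  by have [z1 _ _ _ _] := svalP (sval q); have [w wz] := z1 a; exact: smin_in wz.
by move=> v; exact: smin_le.
Qed.
End ElFibre.

Section FibreSections.
Variables (R : ring_spectrum) (C : sSet) (D : natural_system R C) (n : nat) (Lambda : C 0).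
Local Notation Y := (value_space D n (tw_id Lambda)).
Local Notation b0 := (D 0 (tw_id Lambda)).
Local Notation F := (secs D n (at_vertex Lambda)).
Local Notation O := (orbits D n (at_vertex Lambda)).
Local Notation Fel := (fibre (el_proj (Omega_Sigma R n)) b0).

Lemma value_LF : LF (to_point Y).
Proof. exact: (kan_LF (bm_fib (ns_value D (tw_id Lambda)) n).1). Qed.

Lemma orbits_elP m (x : O m) :
  el_proj (Omega_Sigma R n) m (sval (sval x).1).2 = at_vertex (X := RMod R) b0 m (sval x).2.
Proof.
have h1 : D m (sval (sval x).1).1 = el_base (sval (sval x).1).2 := svalP (sval x).1.
have h2 : (sval (sval x).1).1 = deg C m.*2.+1 Lambda := svalP x.
apply: etrans (esym h1) _; rewrite h2.
have -> : deg C m.*2.+1 Lambda = act (Tw C) (hconst m ord0) (tw_id Lambda) by symmetry; exact: act_deg.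
exact: smapE.
Qed.
Definition orbits_el : smap O Fel :=
  @sub_lift O (sprod (elements (Omega_Sigma R n)) point) _
    (pullback_closed (f := el_proj (Omega_Sigma R n)) (g := at_vertex (X := RMod R) b0))
    (pair_map (scomp (pb_snd _ _) (pb_fst _ _)) (to_point O)) orbits_elP.

Lemma orbits_el_inj m (x x' : O m) : orbits_el m x = orbits_el m x' -> x = x'.
Proof.
move=> /(congr1 (fun z : Fel m => (sval z).1)).
case: x x' => -[[[c e] h] u] h' [[[[c1 e1] h1] u1] h1'] /= E.
have Ec : c = c1 by exact: etrans h' (esym h1').
by subst c1 e1; apply: eq_exist; congr (_, _); [exact: eq_exist|exact: point_eq].
Qed.

Lemma orbits_el_surj m (z : Fel m) : exists x, orbits_el m x = z.
Proof.
case: z => -[e u] h.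
have P : D m (deg C m.*2.+1 Lambda) = el_proj (Omega_Sigma R n) m e.
  have -> : deg C m.*2.+1 Lambda = act (Tw C) (hconst m ord0) (tw_id Lambda) by symmetry; exact: act_deg.
  by apply: etrans (smapE D _ _) (esym h).
exists (exist (fun q : sprod (Defs.total D n) (Tw point) m =>
    total_proj D n m q.1 = Tw_map (at_vertex Lambda) m q.2)
  (exist (fun q : sprod (Tw C) (elements (Omega_Sigma R n)) m => D m q.1 = el_proj (Omega_Sigma R n) m q.2)
    (deg C m.*2.+1 Lambda, e) P, u) erefl).
apply: (@sub_eq _ _ (@pullback_closed _ _ _ _ _)); congr (_, _); exact: point_eq.
Qed.

Definition fibre_secs : smap Y F :=
  @sub_lift Y (sprod (Dcat D n) point) _ (pullback_closed (f := Dproj D n) (g := at_vertex Lambda))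
    (pair_map (scomp (scomp (sfst _ _) (pb_fst _ _)) (fibre_map D n Lambda)) (to_point Y)) (fun _ _ => erefl).

(** Over a point, evaluation identifies sections with [orbits], which is in bijection with the fibre
    of [elements]. Under it [fibre_secs] becomes homotopic to the equivalence [fibre_point], and
    evaluation can be cancelled. *)
Lemma fibre_secs_equiv : is_equiv fibre_secs.
Proof.
have lp := point_LF; have lF := @secs_obj_LF R C D n _ (at_vertex Lambda) lp.
have [sg sgP] := tfib_section (Tw_tgt_tfib lF).
have [sY sYP] := tfib_section (Tw_tgt_tfib value_LF).
have [e1 e2] := @secs_equiv R C D n _ (at_vertex Lambda) lp _ sgP.
have fO : isfib O by apply/LF_FJ/(@orbits_obj_LF _ _ D n _ (at_vertex Lambda) lp).
have [g [gf fg]] := bij_inverse orbits_el_inj orbits_el_surj.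
have [fE e3] := @fibre_point_equiv _ (Omega_Sigma R n) b0 value_LF.
set w := scomp _ sg in e1 e2.
have h : homotopic (scomp g (fibre_point (Omega_Sigma R n) b0)) (scomp w fibre_secs).
  have := homotopic_pre (scomp (Tw_map fibre_secs) sY) e2 => h; apply: homotopic_sym.
  apply: (homotopic_trans fO _ (homotopic_trans fO h _)); apply: homotopic_eq => m y.
    congr (smap_fun w m _); symmetry; apply: etrans (tgt_nat fibre_secs _) _.
    by congr (smap_fun fibre_secs m _); exact: sYP.
  rewrite -[LHS]gf; congr (smap_fun g m _).
  apply: (@sub_eq _ _ (@pullback_closed _ _ _ _ _)); congr (_, _).
  rewrite -[in RHS](sYP m y); set y' := sY m y.
  change (@fibre_element _ (Omega_Sigma R n) b0 m (act Y (hcomp (hid _) (tgt_hom m)) y') =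
    @fibre_element _ (Omega_Sigma R n) b0 m (act Y (tgt_hom m) y')).
  by rewrite (_ : hcomp _ _ = tgt_hom m) //; exact: hom_eq.
apply: (equiv_cancel_l (g := w)) => //; first exact: LF_FJ.
apply: (equiv_homotopic _ fO h); first by apply: LF_FJ value_LF.
apply: equiv_comp => //; first by apply: LF_FJ value_LF.
exact: (iso_equiv fg gf).
Qed.
End FibreSections.

(** * Subobjects of homotopy pullbacks *)

Definition mono_map (X Y : sSet) (i : smap X Y) : Prop := forall n x x', i n x = i n x' -> x = x'.

Lemma mono_lift (W X Y : sSet) (i : smap X Y) (z : smap W Y) : mono_map i ->
  (forall n w, exists x, i n x = z n w) -> exists z' : smap W X, forall n w, i n (z' n w) = z n w.
Proof.
move=> mi H; pose z0 n w := sval (cid (H n w)).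
have zP n w : i n (z0 n w) = z n w by rewrite /z0; case: cid.
have zN m n (h : hom m n) w : z0 m (act W h w) = act X h (z0 n w).
  by apply: mi; rewrite smapE !zP smapE.
by exists (SMap zN).
Qed.

Lemma incl_mono (X : sSet) P (HP : @subclosed X P) : mono_map (incl HP).
Proof. by move=> n x x' e; apply: (@sub_eq _ _ HP). Qed.

Lemma mapsp_mono (K X Y : sSet) (i : smap X Y) : mono_map i -> mono_map (mapsp_post K i).
Proof.
move=> mi n g g' e; apply: smap_eq => j q; apply: mi.
exact: (congr1 (fun h : mapsp K Y n => h j q) e).
Qed.

Lemma mapsp_lift (K X Y : sSet) (i : smap X Y) n (g : mapsp K Y n) : mono_map i ->
  (forall j q, exists x, i j x = g j q) -> exists g', mapsp_post K i n g' = g.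
Proof. by move=> mi /(mono_lift mi)[g' e]; exists g'; exact: smap_eq. Qed.

Section HpbSub.
Variables (A B D A' B' D' : sSet) (a : smap A D) (b : smap B D) (a' : smap A' D') (b' : smap B' D').
Variables (iA : smap A' A) (iB : smap B' B) (iD : smap D' D).
Hypotheses (ea : forall n x, a n (iA n x) = iD n (a' n x)) (eb : forall n x, b n (iB n x) = iD n (b' n x)).

Lemma hpb_subP n (z : hpullback a' b' n) :
  prod_map a b n (iA n (hpb_fst _ _ n z), iB n (hpb_snd _ _ n z)) =
  pair_map (path_start D) (path_end D) n (mapsp_post J iD n (hpb_path _ _ n z)).
Proof.
have [e1 e2] := hpb_ends z; rewrite [LHS]/= ea eb -e1 -e2.
by [].
Qed.

Definition hpb_sub : smap (hpullback a' b') (hpullback a b) :=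
  @sub_lift (hpullback a' b') (sprod (sprod A B) (path_space D)) _
    (pullback_closed (f := prod_map a b) (g := pair_map (path_start D) (path_end D)))
    (pair_map (pair_map (scomp iA (hpb_fst _ _)) (scomp iB (hpb_snd _ _)))
       (scomp (mapsp_post J iD) (hpb_path _ _))) hpb_subP.

Hypotheses (mA : mono_map iA) (mB : mono_map iB) (mD : mono_map iD).

Lemma hpb_sub_mono : mono_map hpb_sub.
Proof.
move=> n z z' e; apply: hpb_eq.
- by apply: mA; exact: (congr1 (hpb_fst a b n) e).
- by apply: mB; exact: (congr1 (hpb_snd a b n) e).
- by apply: (mapsp_mono mD); exact: (congr1 (hpb_path a b n) e).
Qed.

Lemma hpb_sub_surj n (z : hpullback a b n) : (exists x, iA n x = hpb_fst a b n z) ->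
  (exists y, iB n y = hpb_snd a b n z) ->
  (forall j q, exists u, iD j u = hpb_path a b n z j q) -> exists z', hpb_sub n z' = z.
Proof.
move=> [x ex] [y ey] /(mapsp_lift mD)[g eg]; have [e1 e2] := hpb_ends z.
have P : prod_map a' b' n (x, y) = pair_map (path_start D') (path_end D') n g.
  congr (_, _); apply: mD.
    by rewrite -ea ex -e1 -eg.
  by rewrite -eb ey -e2 -eg.
exists (exist (fun q : sprod (sprod A' B') (path_space D') n =>
  prod_map a' b' n q.1 = pair_map (path_start D') (path_end D') n q.2) ((x, y), g) P).
by apply: hpb_eq.
Qed.
End HpbSub.

(** * Paths in quasi-categories *)

Lemma equivalent_map (X Y : sSet) (f : smap X Y) (x y : X 0) : equivalent x y -> equivalent (f 0 x) (f 0 y).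
Proof.
case=> e [<- <- he]; exists (f 1 e); split; last exact: smap_is_equivalence.
- by rewrite /src /vertex smapE.
- by rewrite /tgt /vertex smapE.
Qed.

Lemma J_equivalent (X : sSet) (h : smap J X) (s t : J 0) : equivalent (h 0 s) (h 0 t).
Proof.
exists (h 1 (fun i : 'I_2 => if i == ord0 then s ord0 else t ord0)); split; last exact: J_equivalence.
- by rewrite /src /vertex -smapE; congr (h 0 _); apply: funext => i; rewrite ord1.
- by rewrite /tgt /vertex -smapE; congr (h 0 _); apply: funext => i; rewrite ord1.
Qed.

Definition ov (X Y : sSet) (f : smap X Y) (y : Y 0) n (x : X n) : Prop :=
  (forall e : hom 1 n, is_equivalence (act X e x)) /\ (forall i, equivalent (f 0 (vertex i x)) y).

Lemma ov_map (X X' Y : sSet) (f : smap X Y) (f' : smap X' Y) (h : smap X X') (y : Y 0) n (x : X n) :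
  (forall x, f' 0 (h 0 x) = f 0 x) -> ov f y x -> ov f' y (h n x).
Proof. by move=> H hx; exact: (svalP (over_map (f := f) (f' := f') H y n (exist _ x hx))). Qed.

Section Quasi.
Variables (C : sSet).
Hypothesis qC : is_quasicategory C.

Lemma equivalent_trans (x y z : C 0) : equivalent x y -> equivalent y z -> equivalent x z.
Proof.
case=> e [<- ey he] [e' [ey' <- he']]; have [c m] := quasi_comp qC (etrans ey (esym ey')).
exists c; split; [by rewrite -(M_src m)|by rewrite -(M_tgt m)|exact: (q_comp qC m)].
Qed.

Definition pathJ n (g : path_space C n) (v : simplex n 0) : smap J C :=
  scomp g (pair_map (scomp (at_vertex v) (to_point J)) (sid J)).

Lemma pathJE n (g : path_space C n) (v : simplex n 0) (s : J 0) : pathJ g v 0 s = g 0 (v, s).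
Proof. by congr (smap_fun g 0 (_, _)); apply: hom_eq => i; rewrite ord1. Qed.

Lemma path_vertex n (g : path_space C n) i b :
  vertex i (eval_at C (J_end b) n g) = g 0 (hconst 0 i, J_end b).
Proof.
rewrite /vertex; apply: etrans (esym (smapE g (hconst 0 i) (hid n, deg J n (J_end b)))) _.
by congr (smap_fun g 0 (_, _)); exact: hom_eq.
Qed.

Lemma ov_path_start n (g : path_space C n) (y : C 0) :
  ov (sid C) y (path_end C n g) -> ov (sid C) y (path_start C n g).
Proof.
move=> [h1 h2]; split=> [e|i].
  by rewrite -smapE; apply/path_equivalence => //; rewrite smapE; exact: h1.
apply: equivalent_trans (h2 i).
rewrite [sid C 0 _]path_vertex [sid C 0 (vertex _ _)]path_vertex -!pathJE; exact: J_equivalent.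
Qed.

Lemma ov_path_end n (g : path_space C n) (y : C 0) :
  ov (sid C) y (path_start C n g) -> ov (sid C) y (path_end C n g).
Proof.
move=> [h1 h2]; split=> [e|i].
  by rewrite -smapE; apply/path_equivalence => //; rewrite smapE; exact: h1.
apply: equivalent_trans (h2 i).
rewrite [sid C 0 _]path_vertex [sid C 0 (vertex _ _)]path_vertex -!pathJE; exact: J_equivalent.
Qed.

(** A diagonal of Δ^1 x J is an edge at constant time followed by an edge at a constant vertex of
    Δ^1, which comes from J. *)
Lemma M_path (g : path_space C 1) (s : J 1) :
  M (g 1 (hid 1, fun _ => s ord0)) (g 1 (hconst 1 ord_max, s)) (g 1 (hid 1, s)).
Proof.
pose t : sprod (simplex 1) J 2 := (pfst 1 1, fun i : 'I_3 => if i == 2 :> nat then s ord_max else s ord0).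
have H (k : nat) u v : k < 3 -> (forall i : 'I_2, pfst 1 1 (delta (inord k : 'I_3) i) = happ u i :> nat) ->
    (forall i : 'I_2, (if delta (inord k : 'I_3) i == 2 :> nat then s ord_max else s ord0) = v i) ->
    d k (g 2 t) = g 1 (u, v).
  move=> k3 h1 h2; rewrite d_smap; congr (smap_fun g 1 (_, _)).
    by apply: hom_eq => i; apply: ord_inj; exact: h1.
  by apply: funext => i; exact: h2.
by exists (g 2 t); split; apply: H => // -[[|[|//]] hi]; rewrite ?pfstE // deltaV inordK //= ;
  congr (s _); apply: ord_inj.
Qed.

(** Every vertex of the path is joined to its start by an edge from J; every edge splits by [M_path]
    into an edge of one of the two ends and an edge from J. *)
Lemma ov_path n (g : path_space C n) (y : C 0) : ov (sid C) y (path_start C n g) ->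
  forall j q, ov (sid C) y (g j q).
Proof.
move=> h0; have h1 := ov_path_end h0; have E (h : path_space C 1) (s : J 1) :
    is_equivalence (path_start C 1 h) -> is_equivalence (path_end C 1 h) ->
    is_equivalence (h 1 (hid 1, s)).
  move=> e0 e1; apply: (q_comp qC (M_path h s)); last first.
    have -> : h 1 (hconst 1 ord_max, s) = pathJ h (hconst 0 ord_max) 1 s.
      by congr (smap_fun h 1 (_, _)); exact: hom_eq.
    exact: J_equivalence.
  have [es|es] : (fun _ : 'I_2 => s ord0) = jF 1 \/ (fun _ : 'I_2 => s ord0) = jT 1.
    by case: (s ord0); [right|left]; exact: funext.
  - by rewrite es.
  - by rewrite es.
move=> j [v s]; split=> [e|i].
  rewrite -smapE.
  have -> : g 1 (act (sprod (simplex n) J) e (v, s)) =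
    act (path_space C) (hcomp v e) g 1 (hid 1, act J e s).
    by congr (smap_fun g 1 (_, _)); exact: hom_eq.
  by apply: E; rewrite smapE; [exact: h0.1|exact: h1.1].
have -> : vertex i (g j (v, s)) = g 0 (hconst 0 (happ v i), act J (hconst 0 i) s).
  apply: etrans (esym (smapE g _ _)) _; congr (smap_fun g 0 (_, _)); exact: hom_eq.
apply: (equivalent_trans _ (h0.2 (happ v i))).
have e1 : sid C 0 (vertex (happ v i) (path_start C n g)) = _ := path_vertex g (happ v i) false.
rewrite e1 -pathJE -[g 0 (_, J_end false)]pathJE; exact: J_equivalent.
Qed.
End Quasi.

Lemma post_hpb_map (A B D D' : sSet) (a : smap A D) (b : smap B D) (a' : smap A D') (b' : smap B D')
    (w : smap D D') ea eb n z :
  hpb_path a' b' n (@hpb_map A B D D' a b a' b' w ea eb n z) = mapsp_post J w n (hpb_path a b n z).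
Proof.
apply: smap_eq => j [u t]; change (w j (hpG (sid _) j (act (hpullback a b) u z, t)) = w j (hpb_path a b n z j (u, t))).
by congr (smap_fun w j _); exact: esym (uncurryE (hpb_path a b) z u t).
Qed.

(** * The square for Lifts0 *)

Section Square.
Variables (R : ring_spectrum) (C B E : sSet) (D : natural_system R C) (p : smap B C) (f : smap E B).
Variables (L : linear_extension D p f) (X : B 0).
Hypotheses (qC : is_quasicategory C) (qB : is_quasicategory B) (qE : is_quasicategory E).
Local Notation Lambda := (p 0 X).
Local Notation k := (le_k L).
Local Notation m := (sq_map (le_square L)).
Local Notation Q := (hpullback (Dzero D 2) k).

(** Membership in the core of D^n can be tested after projection to C, because the part over BAut(y)
    consists of equivalences ([core_outP]). *)
Lemma ov_Dcat n i (d : Dcat D n i) (y : C 0) : ov (sid C) y (Dproj D n i d) -> ov (Dproj D n) y d.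
Proof.
move=> h; pose z : secs D n (BAut_incl y) i := exist (fun q : sprod (Dcat D n) (BAut y) i =>
  Dproj D n i q.1 = BAut_incl y i q.2) (d, exist _ (Dproj D n i d) h) erefl.
exact: (core_outP qC z).
Qed.

Lemma ov_p n (b : B n) : ov (sid B) X b -> ov (sid C) Lambda (p n b).
Proof.
move=> [h1 h2]; split=> [e|i]; first by rewrite -smapE; exact: smap_is_equivalence.
have -> : vertex i (p n b) = p 0 (vertex i b) by exact: esym (smapE p _ _).
exact: equivalent_map (h2 i).
Qed.

Lemma ov_k n (b : B n) : ov (sid B) X b -> ov (Dproj D 2) Lambda (k n b).
Proof.
move=> /ov_p h; apply: ov_Dcat; rewrite -(le_over_start L b).
by apply: ov_path_start => //; rewrite (le_over_end L b).
Qed.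

Definition kX : smap (BAut X) (Dcore D 2 Lambda) :=
  @sub_lift (BAut X) (Dcat D 2) _ (@over_closed _ _ (Dproj D 2) Lambda) (scomp k (BAut_incl X))
    (fun n b => ov_k (svalP b)).

Local Notation H := (hpullback (Dcore_zero D 2 Lambda) kX).

Definition core_hpb : smap H Q :=
  @hpb_sub (C : sSet) B (Dcat D 2) (BAut Lambda) (BAut X) (Dcore D 2 Lambda) (Dzero D 2) k
    (Dcore_zero D 2 Lambda) kX (BAut_incl Lambda) (BAut_incl X) (over_incl (Dproj D 2) Lambda)
    (fun _ _ => erefl) (fun _ _ => erefl).

Lemma core_hpb_mono : mono_map core_hpb.
Proof. by apply: hpb_sub_mono; exact: incl_mono. Qed.

Lemma core_hpb_surj n (q : Q n) : ov (sid B) X (hpb_snd _ _ n q) -> exists h, core_hpb n h = q.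
Proof.
move=> h; have [e1 e2] := hpb_ends q; have hk := ov_k h.
pose g : path_space C n := mapsp_post J (Dproj D 2) n (hpb_path _ _ n q).
have g1 : ov (sid C) Lambda (path_end C n g).
  have -> : path_end C n g = Dproj D 2 n (k n (hpb_snd _ _ n q)) by rewrite -e2.
  exact: (ov_map (f := Dproj D 2) (f' := sid C) (h := Dproj D 2)).
have g0 := ov_path_start qC g1.
have E1 : path_start C n g = hpb_fst _ _ n q.
  by apply: etrans (congr1 (Dproj D 2 n) e1) _.
apply: hpb_sub_surj; first exact: incl_mono.
- rewrite E1 in g0; by exists (exist _ (hpb_fst _ _ n q) g0).
- by exists (exist _ (hpb_snd _ _ n q) h).
- move=> j s; have hs : ov (Dproj D 2) Lambda (hpb_path _ _ n q j s).
    by apply: ov_Dcat; exact: (ov_path qC g0).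
  by exists (exist _ _ hs).
Qed.

Lemma core_hpb_LF : LF (to_point H).
Proof.
apply: ELP_hpb; [exact: atv_closed|exact: BAut_LF|exact: BAut_LF|exact: Dcore_LF].
Qed.

Lemma left_eq n e : hpb_snd _ _ n (m n e) = f n e.
Proof. exact: le_left. Qed.

(** The conservativity of f, read off from the cartesian square: e is the end of a path that starts
    at the image of a simplex of the Kan complex H, and [path_equivalence] carries invertibility of
    the edges from the start to e. *)
Lemma lift_ov n (e : E n) : ov (sid B) X (f n e) -> ov f X e.
Proof.
move=> h; have [g [[hh [h0 h1]] _]] := le_cartesian L.
have [z zE] : exists z, core_hpb n z = m n e by apply: core_hpb_surj; rewrite left_eq.
split=> [u|i]; last first.
  move: (h.2 i); have -> : vertex i (f n e) = f 0 (vertex i e) by exact: esym (smapE f _ _).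
  by [].
have e1 : path_end E 1 (hh 1 (act E u e)) = act E u e := h1 1 (act E u e).
rewrite -e1; apply/path_equivalence => //; rewrite h0.
have -> : scomp g m 1 (act E u e) = scomp g core_hpb 1 (act H u z).
  by rewrite !smapE; congr (act E u (g n _)); exact: esym zE.
by apply: smap_is_equivalence; apply: LF_edge core_hpb_LF.
Qed.

(** The inverse g and both homotopies of the cartesian square restrict to the subobjects, since
    after projection to B the paths have an end over BAut(X). *)
Lemma Lifts0_square : exists phi : smap (Lifts0 f X) H,
  (forall n e, core_hpb n (phi n e) = m n (over_incl f X n e)) /\ is_equiv phi.
Proof.
have ovf n (e : Lifts0 f X n) : ov (sid B) X (f n (over_incl f X n e)).
  exact: (ov_map (f := f) (f' := sid B) (h := f) (fun _ => erefl) (svalP e)).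
have [phi phiE] : exists phi : smap (Lifts0 f X) H,
    forall n e, core_hpb n (phi n e) = scomp m (over_incl f X) n e.
  apply: mono_lift core_hpb_mono _ => n e; apply: core_hpb_surj.
  rewrite [scomp _ _ _ _]/(m n (over_incl f X n e)) left_eq; exact: ovf.
exists phi; split=> //.
have [g [[h1 [h10 h11]] [h2 [h20 h21]]]] := le_cartesian L.
have snd_ov n (z : H n) : ov (sid B) X (hpb_snd _ _ n (core_hpb n z)).
  exact: (svalP (hpb_snd _ _ n z)).
have h2ov n (z : H n) j q : ov (sid B) X (hpb_snd _ _ j (h2 n (core_hpb n z) j q)).
  pose g2 : path_space B n := mapsp_post J (hpb_snd _ _) n (h2 n (core_hpb n z)).
  have e1 : path_end B n g2 = hpb_snd _ _ n (core_hpb n z).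
    exact: (congr1 (hpb_snd _ _ n) (h21 n (core_hpb n z))).
  have g1 : ov (sid B) X (path_end B n g2) by rewrite e1; exact: snd_ov.
  exact: (ov_path qB (ov_path_start qB g1)).
have psP n (z : H n) : ov f X (scomp g core_hpb n z).
  apply: lift_ov; rewrite -left_eq; have e0 := h20 n (core_hpb n z).
  have -> : m n (scomp g core_hpb n z) = h2 n (core_hpb n z) n (hid n, jF n) := esym e0.
  exact: h2ov.
pose psi : smap H (Lifts0 f X) := @sub_lift H E _ (@over_closed _ _ f X) (scomp g core_hpb) psP.
exists psi; split.
- have [k1 k1E] : exists k1 : smap (Lifts0 f X) (path_space (Lifts0 f X)),
      forall n e, mapsp_post J (over_incl f X) n (k1 n e) = scomp h1 (over_incl f X) n e.
    apply: mono_lift; first exact/mapsp_mono/incl_mono.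
    move=> n e; apply: mapsp_lift; first exact: incl_mono.
    move=> j q; pose g1 : path_space B n := mapsp_post J f n (h1 n (over_incl f X n e)).
    have g11 : ov (sid B) X (path_end B n g1).
      have -> : path_end B n g1 = f n (over_incl f X n e) by exact: (congr1 (f n) (h11 n _)).
      exact: ovf.
    have hq : ov f X (h1 n (over_incl f X n e) j q).
      apply: lift_ov; exact: (ov_path qB (ov_path_start qB g11)).
    by exists (exist _ _ hq).
  exists k1; split=> n e; apply: (@sub_eq _ _ (@over_closed _ _ f X)).
  + apply: etrans (congr1 (path_start E n) (k1E n e)) _; apply: etrans (h10 _ _) _.
    exact: (congr1 (g n) (esym (phiE n e))).
  + by apply: etrans (congr1 (path_end E n) (k1E n e)) _; apply: etrans (h11 _ _) _.
- have [k2 k2E] : exists k2 : smap H (path_space H),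
      forall n z, mapsp_post J core_hpb n (k2 n z) = scomp h2 core_hpb n z.
    apply: mono_lift; first exact/mapsp_mono/core_hpb_mono.
    move=> n z; apply: mapsp_lift; first exact: core_hpb_mono.
    by move=> j q; apply: core_hpb_surj; exact: h2ov.
  exists k2; split=> n z; apply: core_hpb_mono.
  + apply: etrans (congr1 (path_start Q n) (k2E n z)) _; apply: etrans (h20 _ _) _.
    exact: (esym (phiE n (psi n z))).
  + by apply: etrans (congr1 (path_end Q n) (k2E n z)) _; exact: h21.
Qed.

Lemma Lifts0_cartesian : exists w : smap (Dcore D 2 Lambda) (homotopy_orbits D 2 Lambda),
    [/\ is_equiv w,
        homotopic (scomp w (Tw_tgt (Dcore D 2 Lambda))) (Dcore_eval D 2 Lambda) &
        exists kX : smap (BAut X) (Dcore D 2 Lambda),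
        (forall n b, over_incl (Dproj D 2) Lambda n (kX n b) = k n (BAut_incl X n b)) /\
        exists s : square (Lifts0 f X) (scomp w (Dcore_zero D 2 Lambda)) (scomp w kX),
        [/\ forall n e, BAut_incl Lambda n (sq_top s n e) = sq_top (le_square L) n (over_incl f X n e),
            forall n e, BAut_incl X n (sq_left s n e) = f n (over_incl f X n e),
            exists h : smap (Lifts0 f X) (path_space (Dcore D 2 Lambda)),
              (forall n e, mapsp_post J w n (h n e) = sq_filling s n e) /\
              (forall n e, mapsp_post J (over_incl (Dproj D 2) Lambda) n (h n e) =
                 sq_filling (le_square L) n (over_incl f X n e)) &
            cartesian s]].
Proof.
have [w [w1 w2]] := Dcore_orbits D 2 Lambda qC; exists w; split=> //.
exists kX; split=> //; have [phi [phiE pe]] := Lifts0_square.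
pose hm : smap H (hpullback (scomp w (Dcore_zero D 2 Lambda)) (scomp w kX)) :=
  hpb_map (w := w) (a := Dcore_zero D 2 Lambda) (b := kX) (a' := scomp w (Dcore_zero D 2 Lambda))
    (b' := scomp w kX) (fun _ _ => erefl) (fun _ _ => erefl).
exists (Square (scomp hm phi)); split.
- move=> n e; exact: (congr1 (hpb_fst _ _ n) (phiE n e)).
- move=> n e; apply: etrans (left_eq _); exact: (congr1 (hpb_snd _ _ n) (phiE n e)).
- exists (scomp (hpb_path _ _) phi); split=> n e; last exact: (congr1 (hpb_path _ _ n) (phiE n e)).
  by symmetry; exact: post_hpb_map.
- have fK : isfib (BAut Lambda) by apply/LF_FJ/BAut_LF.
  have fX : isfib (BAut X) by apply/LF_FJ/BAut_LF.
  have fD : isfib (Dcore D 2 Lambda) by apply/LF_FJ/Dcore_LF.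
  have fO : isfib (homotopy_orbits D 2 Lambda).
    by apply/LF_FJ/(@orbits_obj_LF _ _ D 2 _ (BAut_incl Lambda))/BAut_LF.
  apply: equiv_comp => //; [exact/LF_FJ/over_LF|exact: isfib_hpb|exact: hpb_map_equiv].
Qed.
End Square.

(** * Weak equivalence of fibrant objects *)

(** Fibrancy of both ends is part of the relation, so that chains of equivalences in either
    direction can be composed. *)
Definition weq (X Y : sSet) : Prop := [/\ isfib X, isfib Y & exists e : smap X Y, is_equiv e].

Lemma weq_sym (X Y : sSet) : weq X Y -> weq Y X.
Proof. by case=> fX fY [e /equiv_inv h]. Qed.

Lemma weq_trans (Y X Z : sSet) : weq X Y -> weq Y Z -> weq X Z.
Proof.
by case=> fX _ [e1 h1] [_ fZ [e2 h2]]; split=> //; exists (scomp e2 e1); exact: equiv_comp.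
Qed.

Lemma weq_iso (X Y : sSet) (f : smap X Y) : mono_map f -> (forall n y, exists x, f n x = y) ->
  isfib X -> weq X Y.
Proof.
move=> mf sf fX; have [g [gf fg]] := bij_inverse mf sf.
by split=> //; [exact: (ELP_retract_obj fg fX)|exists f; exact: (iso_equiv gf fg)].
Qed.

Lemma weq_tfib (X Y : sSet) (f : smap X Y) : trivial_kan_fibration f -> isfib X -> weq X Y.
Proof.
move=> tf fX; have [s sP] := tfib_section tf.
by split=> //; [exact: (ELP_retract_obj sP fX)|exists f; exact: tfib_is_equiv].
Qed.

Lemma isfib_point : isfib point. Proof. exact/LF_FJ/point_LF. Qed.

Section Swap.
Variables (A B D : sSet) (a : smap A D) (b : smap B D).

Definition hpb_swap : smap (hpullback a b) (hpullback b a) :=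
  hpb_mk (a := b) (b := a) (al := hpb_snd a b) (be := hpb_fst a b)
    (G := scomp (hpG (sid _)) (pair_map (sfst _ _) (scomp Jneg (ssnd _ _))))
    (fun n x => hpG1 (sid _) x) (fun n x => hpG0 (sid _) x).

Lemma hpG_swap n x t : hpG hpb_swap n (x, t) = hpG (sid _) n (x, Jneg n t).
Proof. exact: hpG_mk. Qed.
End Swap.

Lemma hpb_swapK (A B D : sSet) (a : smap A D) (b : smap B D) n z : hpb_swap b a n (hpb_swap a b n z) = z.
Proof.
apply: (hpb_mapeq (z := scomp (hpb_swap b a) (hpb_swap a b)) (z' := sid _)) => // i [x t].
change (hpG (hpb_swap b a) i (hpb_swap a b i x, t) = hpG (sid _) i (x, t)); rewrite hpG_swap.
change (hpG (hpb_swap a b) i (x, Jneg i t) = hpG (sid _) i (x, t)); rewrite hpG_swap.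
by congr (hpG _ i (x, _)); apply: funext => j; exact: negbK.
Qed.

Lemma hpb_swap_weq (A B D : sSet) (a : smap A D) (b : smap B D) :
  isfib A -> isfib B -> isfib D -> weq (hpullback a b) (hpullback b a).
Proof.
move=> fA fB fD; split; try exact: isfib_hpb.
by exists (hpb_swap a b); apply: (iso_equiv (g := hpb_swap b a)) => n z; exact: hpb_swapK.
Qed.

Lemma isfib_fibre (Z K : sSet) (p : smap Z K) (v : K 0) : FJ p -> isfib (fibre p v).
Proof.
move=> fp; have := @ELP_pb_snd _ _ _ _ _ _ (at_vertex v) fp; congr ELP; apply: smap_eq => n x; exact: point_eq.
Qed.

Section FibreHpb.
Variables (A B D : sSet) (a : smap A D) (b : smap B D) (y : B 0).
Local Notation P := (hpullback a (at_vertex (b 0 y))).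

Lemma at_smap n (u : point n) : b n (at_vertex y n u) = at_vertex (b 0 y) n u.
Proof. exact: smap_deg. Qed.

Definition to_fibre : smap P (fibre (hpb_snd a b) y) :=
  @sub_lift P (sprod (hpullback a b) point) _ (pullback_closed (f := hpb_snd a b) (g := at_vertex y))
    (pair_map (hpb_pre a (b' := at_vertex (b 0 y)) (b := b) at_smap) (hpb_snd _ _)) (fun _ _ => erefl).

Lemma path_pre n z : hpb_path a b n (hpb_pre a at_smap n z) = hpb_path _ _ n z.
Proof.
by apply: smap_eq => j [u t]; exact: esym (uncurryE (hpb_path a (at_vertex (b 0 y))) z u t).
Qed.

Lemma to_fibre_iso : isfib A -> isfib B -> isfib D -> weq P (fibre (hpb_snd a b) y).
Proof.
move=> fA fB fD; apply: (weq_iso (f := to_fibre)).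
- move=> n z z' e; have e1 := congr1 (fun q : fibre (hpb_snd a b) y n => (sval q).1) e.
  apply: hpb_eq; [exact: (congr1 (hpb_fst a b n) e1)|exact: point_eq|].
  by rewrite -path_pre -[RHS]path_pre; exact: (congr1 (hpb_path a b n) e1).
- move=> n [[q u] h]; have [e1 e2] := hpb_ends q.
  have e3 : hpb_snd a b n q = at_vertex y n u := h.
  have Pq : prod_map a (at_vertex (b 0 y)) n (hpb_fst a b n q, u) =
      pair_map (path_start D) (path_end D) n (hpb_path a b n q).
    congr (_, _); first exact: esym e1.
    by apply: esym; apply: etrans e2 _; rewrite e3; exact: at_smap.
  exists (exist (fun q : sprod (sprod A point) (path_space D) n => prod_map a (at_vertex (b 0 y)) n q.1 =
    pair_map (path_start D) (path_end D) n q.2) ((hpb_fst a b n q, u), hpb_path a b n q) Pq).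
  apply: (@sub_eq _ _ (@pullback_closed _ _ _ _ _)); congr (_, _).
  by apply: hpb_eq => //; exact: path_pre.
- by apply: isfib_hpb => //; exact: isfib_point.
Qed.
End FibreHpb.

(** * Homotopy pullbacks along a section *)

Section SectionFibre.
Variables (Z K : sSet) (p : smap Z K) (z0 : smap K Z) (v : K 0) (zF d : fibre p v 0).
Hypotheses (fp : FJ p) (pz : forall n x, p n (z0 n x) = x) (zE : (sval zF).1 = z0 0 v).
Local Notation P := (hpullback z0 (at_vertex (sval d).1)).
Local Notation W := (hpullback (at_vertex zF) (at_vertex d)).
Local Notation dd := (sval d).1.

Lemma fibre_deg n : p n (deg Z n dd) = deg K n v.
Proof.
have h : p 0 dd = deg K 0 v := svalP d.
by rewrite smap_deg h; exact: act_deg.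
Qed.

Lemma zF_deg n : (sval (deg (fibre p v) n zF)).1 = z0 n (deg K n v).
Proof. by rewrite smap_deg -zE. Qed.

Lemma W_hpG0 n x : pb_fst _ _ n (hpG (sid W) n (x, jF n)) = z0 n (deg K n v).
Proof. by rewrite hpG0; exact: zF_deg. Qed.
Lemma W_hpG1 n x : pb_fst _ _ n (hpG (sid W) n (x, jT n)) = deg Z n dd.
Proof. by rewrite hpG1. Qed.
Lemma W_over n q : p n (pb_fst _ _ n (hpG (sid W) n q)) = deg K n v.
Proof. exact: (svalP (hpG (sid W) n q)). Qed.

(** A path inside the fibre, from the zero point to d, is a point of the homotopy pullback along the
    section whose path in K is constant. *)
Definition from_fibre : smap W P :=
  hpb_mk (a := z0) (b := at_vertex dd) (al := scomp (at_vertex v) (to_point W)) (be := to_point W)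
    (G := scomp (pb_fst _ _) (hpG (sid W))) W_hpG0 W_hpG1.

Lemma hpG_from n q : hpG from_fibre n q = pb_fst _ _ n (hpG (sid W) n q).
Proof. exact: hpG_mk. Qed.

Definition lift_F (X : sSet) (s : smap X Z) (h : forall n x, p n (s n x) = deg K n v) : smap X (fibre p v) :=
  @sub_lift X (sprod Z point) _ (pullback_closed (f := p) (g := at_vertex v)) (pair_map s (to_point X)) h.

Lemma lift_F_eq n (x y : fibre p v n) : pb_fst _ _ n x = pb_fst _ _ n y -> x = y.
Proof.
case: x y => -[x u] h [[y u'] h'] /= e; apply: eq_exist; congr (_, _); [exact: e|exact: point_eq].
Qed.

(* The path in K underlying a point of P drags its source to v. *)
Lemma section_fibre_equiv : is_equiv from_fibre.
Proof.
pose g : smap (sprod P J) K := scomp p (hpG (sid P)).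
pose h0 := hpG (sid P).
have h00 n b : h0 n (b, jF n) = z0 n (hpb_fst _ _ n b) := hpG0 (sid P) b.
have h01 n b : h0 n (b, jT n) = deg Z n dd := hpG1 (sid P) b.
have g1 n b : g n (b, jT n) = deg K n v.
  by change (p n (h0 n (b, jT n)) = deg K n v); rewrite h01; exact: fibre_deg.
have g0 n b : g n (b, jF n) = hpb_fst _ _ n b.
  by change (p n (h0 n (b, jF n)) = hpb_fst _ _ n b); rewrite h00 pz.
(* The base square takes at (s, t) the value of g at the maximum of s and t: at t = [jF] it is the
   path g, and at t = [jT] it is constant at v, so that there the lifted path lies in the fibre. *)
pose vv : smap (sprod (sprod P J) J) K := scomp g (pair_map (scomp (sfst _ _) (sfst _ _))
   (scomp Jor (pair_map (scomp (ssnd _ _) (sfst _ _)) (ssnd _ _)))).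
have vvE n b s t : vv n ((b, s), t) = g n (b, Jor n (s, t)) by [].
have [n b|n b|n b s|n b t|n b t|S [S0 SF ST Sp]] := @square_lift P Z K p vv h0 (scomp z0 g)
    (scomp (at_vertex dd) (to_point _)) fp.
- by rewrite h00; congr (z0 n _); exact: g0.
- by rewrite h01.
- by rewrite vvE JorF.
- by rewrite vvE JFor; exact: pz.
- by rewrite vvE JTor g1; exact: fibre_deg.
have SvT n b s : p n (S n ((b, s), jT n)) = deg K n v by rewrite Sp vvE JorT g1.
have {}SF n b t : S n ((b, jF n), t) = z0 n (g n (b, t)) by exact: SF.
have {}ST n b t : S n ((b, jT n), t) = deg Z n dd by exact: ST.
have SvT' n (q : sprod P J n) : p n (scomp S (cstJ (sprod P J) true) n q) = deg K n v.
  by case: q => b s; exact: SvT.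
pose GT : smap (sprod P J) (fibre p v) := lift_F SvT'.
have GT0 n x : GT n (x, jF n) = at_vertex zF n tt.
  apply: lift_F_eq; apply: etrans (SF n x (jT n)) _; rewrite g1; exact: esym (zF_deg n).
have GT1 n x : GT n (x, jT n) = at_vertex d n tt.
  by apply: lift_F_eq; exact: (ST n x (jT n)).
pose r : smap P W := hpb_mk (a := at_vertex zF) (b := at_vertex d) (al := to_point P) (be := to_point P)
  (G := GT) GT0 GT1.
exists r; split.
- have Si n (y : W n) s t : p n (S n ((from_fibre n y, s), t)) = deg K n v.
    rewrite Sp vvE; change (p n (hpG from_fibre n (y, Jor n (s, t))) = deg K n v).
    by rewrite hpG_from; exact: W_over.
  pose sh : smap (sprod (sprod W J) J) (sprod (sprod P J) J) :=
    pair_map (pair_map (scomp from_fibre (scomp (sfst _ _) (sfst _ _))) (ssnd _ _))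
      (scomp (ssnd _ _) (sfst _ _)).
  pose GW : smap (sprod (sprod W J) J) (fibre p v) :=
    lift_F (s := scomp S sh) (fun n q => Si n q.1.1 q.2 q.1.2).
  have GW0 n x : GW n (x, jF n) = at_vertex zF n tt.
    apply: lift_F_eq; apply: etrans (SF n (from_fibre n x.1) x.2) _; rewrite [RHS]zF_deg; congr (z0 n _).
    change (p n (hpG from_fibre n (x.1, x.2)) = deg K n v); rewrite hpG_from; exact: W_over.
  have GW1 n x : GW n (x, jT n) = at_vertex d n tt.
    by apply: lift_F_eq; exact: (ST n (from_fibre n x.1) x.2).
  pose HW : smap (sprod W J) W := hpb_mk (a := at_vertex zF) (b := at_vertex d) (al := to_point _)
    (be := to_point _) (G := GW) GW0 GW1.
  apply/homotopic_sym/homotopicP; exists HW; split=> n x.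
  + apply: (hpb_mapeq (z := scomp HW (cstJ W false)) (z' := sid W)) => [i y|i y|i [y s]]; try exact: point_eq.
    change (hpG HW i ((y, jF i), s) = hpG (sid W) i (y, s)); rewrite hpG_mk.
    apply: lift_F_eq; apply: etrans (S0 i (from_fibre i y) s) _.
    exact: (hpG_from (y, s)).
  + apply: (hpb_mapeq (z := scomp HW (cstJ W true)) (z' := scomp r from_fibre)) => [i y|i y|i [y s]];
      try exact: point_eq.
    change (hpG HW i ((y, jT i), s) = hpG r i (from_fibre i y, s)); rewrite !hpG_mk.
    exact: lift_F_eq.
- pose sh : smap (sprod (sprod P J) J) (sprod (sprod P J) J) :=
    pair_map (pair_map (scomp (sfst _ _) (sfst _ _)) (ssnd _ _)) (scomp (ssnd _ _) (sfst _ _)).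
  have e0 n (x : sprod P J n) : scomp S sh n (x, jF n) = z0 n (g n x).
    by case: x => b t; exact: (SF n b t).
  have e1 n (x : sprod P J n) : scomp S sh n (x, jT n) = at_vertex dd n (to_point (sprod P J) n x).
    by case: x => b t; exact: (ST n b t).
  pose HP : smap (sprod P J) P := hpb_mk (a := z0) (b := at_vertex dd) (al := g) (be := to_point _)
    (G := scomp S sh) e0 e1.
  apply/homotopic_sym/homotopicP; exists HP; split=> n x.
  + apply: (hpb_mapeq (z := scomp HP (cstJ P false)) (z' := sid P)) => [i y|i y|i [y s]].
    * exact: g0.
    * exact: point_eq.
    change (hpG HP i ((y, jF i), s) = hpG (sid P) i (y, s)); rewrite hpG_mk.
    exact: (S0 i y s).
  + apply: (hpb_mapeq (z := scomp HP (cstJ P true)) (z' := scomp from_fibre r)) => [i y|i y|i [y s]].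
    * exact: g1.
    * exact: point_eq.
    change (hpG HP i ((y, jT i), s) = hpG from_fibre i (r i y, s)); rewrite hpG_mk hpG_from.
    by change (scomp S sh i ((y, jT i), s) = pb_fst _ _ i (hpG r i (y, s))); rewrite hpG_mk.
Qed.

Lemma section_fibre_weq : isfib Z -> isfib K -> weq W P.
Proof.
move=> fZ fK; split; last by exists from_fibre; exact: section_fibre_equiv.
- by apply: isfib_hpb; [exact: isfib_point|exact: isfib_point|exact: isfib_fibre].
- by apply: isfib_hpb => //; exact: isfib_point.
Qed.
End SectionFibre.

(** * Mapping spaces *)

Lemma D1J_end (b : bool) n : D1J n (deg (simplex 1) n (Delta1_end b)) = deg J n (J_end b).
Proof. by apply: funext => i; case: b. Qed.

Section PathMap.
Variables (Y : sSet) (x y : Y 0).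
Local Notation P := (hpullback (at_vertex x) (at_vertex y)).

Lemma hpb_map_spaceP n (z : P n) :
  eval_at Y (Delta1_end false) n (mapsp_pre Y D1J n (hpb_path _ _ n z)) = deg Y n x /\
  eval_at Y (Delta1_end true) n (mapsp_pre Y D1J n (hpb_path _ _ n z)) = deg Y n y.
Proof.
have [e1 e2] := hpb_ends z; split.
- by apply: etrans e1; congr (smap_fun (hpb_path _ _ n z) n (_, _)); exact: D1J_end.
- by apply: etrans e2; congr (smap_fun (hpb_path _ _ n z) n (_, _)); exact: (@D1J_end true).
Qed.

Definition path_map : smap P (map_space x y) :=
  @sub_lift P (mapsp (simplex 1) Y) _ (@map_space_closed Y x y)
    (scomp (mapsp_pre Y D1J) (hpb_path _ _)) hpb_map_spaceP.

(** The relative form of the extension of an edge of a Kan complex to J: [LF_D1J], with A the domain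
    on which the extension is already given. *)
Lemma path_map_tfib : LF (to_point Y) -> trivial_kan_fibration path_map.
Proof.
move=> lY; apply/TFP => W v R RP Rv.
pose v' : smap (sprod W (simplex 1)) Y := uncurry (scomp (incl (@map_space_closed Y x y)) v).
pose T1 : pmap (sprod W J) Y := fun n q u => exists z, R n q.1 z /\ u = hpG (sid P) n (z, q.2).
pose T2 : pmap (sprod W J) Y := fun n q u => exists t, D1J n t = q.2 /\ u = v' n (q.1, t).
have [|||n q|w [wR _]] := LF_D1J lY (A := fun n w => dom R w) (v := to_point _) (R := punion T1 T2).
- by move=> i n h b [z Rz]; exists (act P h z); exact: RP.2.
- apply: punion_is_pmap.
  + split=> [n q u u' [z [Rz ->]] [z' [Rz' ->]]|i n h q u [z [Rz ->]]]; first by rewrite (RP.1 _ _ _ _ Rz Rz').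
    exists (act P h z); split; first exact: (RP.2 _ _ h q.1 z).
    exact: (esym (smapE (hpG (sid P)) h (z, q.2))).
  + split=> [n q u u' [t [et ->]] [t' [et' ->]]|i n h q u [t [et ->]]].
      by rewrite -et in et'; rewrite (D1J_inj et').
    exists (act (simplex 1) h t); split; first by rewrite smapE et.
    exact: (esym (smapE v' h (q.1, t))).
  + move=> n q u u' [z [/Rv Rz ->]] [t [et ->]].
    change (hpG (sid P) n (z, q.2) = sval (v n q.1) n (hid n, t)).
    by rewrite -Rz -et.
- by [].
- split=> [[u [[z [Rz _]]|[t [et _]]]]|[[z Rz]|[t et]]].
  + by left; exists z.
  + by right; exists t.
  + by exists (hpG (sid P) n (z, q.2)); left; exists z.
  + by exists (v' n (q.1, t)); right; exists t.
have w2 n b t : w n (b, D1J n t) = v' n (b, t) by apply: wR; right; exists t.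
have e0 n b : w n (b, jF n) = at_vertex x n tt.
  by rewrite -D1J_end w2; exact: (svalP (v n b)).1.
have e1 n b : w n (b, jT n) = at_vertex y n tt.
  by rewrite -D1J_end w2; exact: (svalP (v n b)).2.
exists (hpb_mk (a := at_vertex x) (b := at_vertex y) (al := to_point W) (be := to_point W) (G := w) e0 e1).
split=> [n b z Rz|n b].
- apply: hpb_eq; [exact: point_eq|exact: point_eq|].
  apply: smap_eq => j [u t]; apply: etrans _ (esym (uncurryE (hpb_path _ _) z u t)).
  apply: wR; left; exists (act P u z); split=> //; exact: (RP.2 _ _ u b z Rz).
- apply: (@sub_eq _ _ (@map_space_closed Y x y)); apply: smap_eq => j [u t].
  apply: etrans (w2 j (act W u b) t) _.
  exact: esym (uncurryE (scomp (incl (@map_space_closed Y x y)) v) b u t).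
Qed.

Lemma path_map_weq : LF (to_point Y) -> weq P (map_space x y).
Proof.
move=> lY; apply: weq_tfib (path_map_tfib lY) _.
by apply: isfib_hpb; [exact: isfib_point|exact: isfib_point|exact: LF_FJ].
Qed.
End PathMap.

Lemma map_space_mono (X Y : sSet) (i : smap X Y) (x y : X 0) : mono_map i -> mono_map (map_space_map i x y).
Proof.
move=> mi n g g' e; apply: (@sub_eq _ _ (@map_space_closed X x y)); apply: (mapsp_mono mi).
exact: (congr1 sval e).
Qed.

Lemma map_space_lift (X Y : sSet) (i : smap X Y) (x y : X 0) n (g : map_space (i 0 x) (i 0 y) n) :
  mono_map i -> (forall j q, exists u, i j u = sval g j q) -> exists g', map_space_map i x y n g' = g.
Proof.
move=> mi /(mapsp_lift mi)[g' eg]; have [e1 e2] := svalP g.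
have h : eval_at X (Delta1_end false) n g' = deg X n x /\ eval_at X (Delta1_end true) n g' = deg X n y.
  split; apply: mi; rewrite smap_deg -?e1 -?e2 -eg; by [].
by exists (exist _ g' h); apply: (@sub_eq _ _ (@map_space_closed Y _ _)).
Qed.

(** A path of arrows with fixed ends is transposed to a lifting problem on (B x Δ^1) x J in which
    the two ends of Δ^1 join A. *)
Lemma map_space_FJ (X Y : sSet) (p : smap X Y) (x y : X 0) : FJ p -> FJ (map_space_map p x y).
Proof.
move=> fp B A v R HA RP Rv Rd.
pose iX := incl (@map_space_closed X x y); pose iY := incl (@map_space_closed Y (p 0 x) (p 0 y)).
pose sh : smap (sprod (sprod B (simplex 1)) J) (sprod (sprod B J) (simplex 1)) :=
  @SMap (sprod (sprod B (simplex 1)) J) (sprod (sprod B J) (simplex 1))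
    (fun n q => ((q.1.1, q.2), q.1.2)) (fun _ _ _ _ => erefl).
pose v' : smap (sprod (sprod B (simplex 1)) J) Y := scomp (uncurry (scomp iY v)) sh.
pose T : pmap (sprod (sprod B (simplex 1)) J) X := fun n q u =>
  exists g, R n (q.1.1, q.2) g /\ u = sval g n (hid n, q.1.2).
pose Eb (b : bool) : pmap (sprod (sprod B (simplex 1)) J) X :=
  on (fun n (q : sprod (sprod B (simplex 1)) J n) => q.1.2 = deg (simplex 1) n (Delta1_end b)) (scomp (at_vertex (if b then y else x)) (to_point _)).
have EbP b : is_pmap (Eb b) by apply: on_is_pmap => i n h q e; exact: (atv_closed h (e : atv _ _)).
have TP : is_pmap T.
  split=> [n q u u' [z [Rz ->]] [z' [Rz' ->]]|i n h q u [z [Rz ->]]]; first by rewrite (RP.1 _ _ _ _ Rz Rz').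
  exists (act (map_space x y) h z); split; first exact: (RP.2 _ _ h (q.1.1, q.2) z).
  exact: (esym (smapE (uncurry iX) h (z, q.1.2))).
have TE b n q u u' : T n q u -> Eb b n q u' -> u = u'.
  by move=> [z [_ ->]] [/= -> ->]; case: b; have [h1 h2] := svalP z; [exact: h2|exact: h1].
have vE b n q : q.1.2 = deg (simplex 1) n (Delta1_end b) -> v' n q = deg Y n (p 0 (if b then y else x)).
  move=> e; change (sval (v n (q.1.1, q.2)) n (hid n, q.1.2) = deg Y n (p 0 (if b then y else x))).
  by rewrite e; have [h1 h2] := svalP (v n (q.1.1, q.2)); case: b {e}; [exact: h2|exact: h1].
have E01 n : deg (simplex 1) n (Delta1_end false) <> deg (simplex 1) n (Delta1_end true).
  by move=> /(congr1 (D1J n)); rewrite !D1J_end => /J_endsE.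
have [|||n q|w [wR wv]] := fp _ (fun n (q : sprod B (simplex 1) n) => [\/ A n q.1, q.2 = deg (simplex 1) n (Delta1_end false) |
    q.2 = deg (simplex 1) n (Delta1_end true)]) v' (punion T (punion (Eb false) (Eb true))).
- move=> i n h q [e|e|e]; [constructor 1; exact: HA|constructor 2|constructor 3];
    exact: (atv_closed h (e : atv _ _)).
- apply: punion_is_pmap => //.
    by apply: punion_is_pmap => // n q u u' [e _] [e' _]; case: (E01 n); rewrite -e -e'.
  by move=> n q u u' h [|]; apply: TE h.
- move=> n q u [[g [/Rv Rg ->]]|[[e ->]|[e ->]]].
  + change (p n (sval g n (hid n, q.1.2)) = sval (v n (q.1.1, q.2)) n (hid n, q.1.2)).
    by rewrite -Rg.
  + by rewrite (vE false) //; exact: smap_deg.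
  + by rewrite (vE true) //; exact: smap_deg.
- split=> [[u [[g [Rg _]]|[[e _]|[e _]]]]|[[e|e|e]|e]].
  + have /Rd [h|h] : dom R ((q.1.1, q.2) : sprod B J n) by exists g.
      by left; constructor 1.
    by right.
  + by left; constructor 2.
  + by left; constructor 3.
  + have [g Rg] : dom R ((q.1.1, q.2) : sprod B J n) by apply/Rd; left.
    by exists (sval g n (hid n, q.1.2)); left; exists g.
  + by exists (deg X n x); right; left.
  + by exists (deg X n y); right; right.
  + have [g Rg] : dom R ((q.1.1, q.2) : sprod B J n) by apply/Rd; right.
    by exists (sval g n (hid n, q.1.2)); left; exists g.
pose sh' : smap (sprod (sprod B J) (simplex 1)) (sprod (sprod B (simplex 1)) J) :=
  @SMap (sprod (sprod B J) (simplex 1)) (sprod (sprod B (simplex 1)) J)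
    (fun n q => ((q.1.1, q.2), q.1.2)) (fun _ _ _ _ => erefl).
have wP n b : eval_at X (Delta1_end false) n (curry (scomp w sh') n b) = deg X n x /\
    eval_at X (Delta1_end true) n (curry (scomp w sh') n b) = deg X n y.
  by split; apply: wR; right; [left|right].
exists (@sub_lift (sprod B J) (mapsp (simplex 1) X) _ (@map_space_closed X x y) (curry (scomp w sh')) wP).
split=> [n b g Rg|n b].
- apply: (@sub_eq _ _ (@map_space_closed X x y)); apply: smap_eq => j [u t].
  apply: etrans _ (esym (uncurryE iX g u t)); apply: wR; left.
  exists (act (map_space x y) u g); split=> //.
  by have := RP.2 _ _ u b g Rg; case: (b).
- apply: (@sub_eq _ _ (@map_space_closed Y _ _)); apply: smap_eq => j [u t].
  apply: etrans (wv j _) _; apply: etrans _ (esym (uncurryE (scomp iY v) b u t)).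
  by case: (b).
Qed.

(** * Connected components *)

Lemma LF_isfib (X : sSet) : LF (to_point X) -> isfib X. Proof. exact: LF_FJ. Qed.

Lemma deg0 (X : sSet) (x : X 0) : deg X 0 x = x.
Proof. by rewrite -[RHS]act_id; congr (act X _ x); apply: hom_eq => i; rewrite !ord1. Qed.

Lemma connected_homotopic (X : sSet) (x y : X 0) : LF (to_point X) ->
  connected x y <-> homotopic (at_vertex x) (at_vertex y).
Proof.
move=> lX; split=> [[e [<- <-]]|/homotopicP[H [H0 H1]]].
  have [h hE] := edge_J e lX; apply/homotopicP; exists (scomp h (ssnd _ _)); split=> n u.
    change (h n (jF n) = deg X n (src e)); rewrite -(@D1J_end false) hE /deg /src /vertex -!act_comp.
    by congr (act X _ e); exact: hom_eq.
  change (h n (jT n) = deg X n (tgt e)); rewrite -(@D1J_end true) hE /deg /tgt /vertex -!act_comp.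
  by congr (act X _ e); exact: hom_eq.
pose c : sprod point J 1 := (tt, D1J 1 (hid 1)).
exists (H 1 c); split.
- rewrite -[RHS]deg0; apply: etrans (esym (smapE H (hconst 0 ord0) c)) _; apply: etrans _ (H0 0 tt).
  by congr (smap_fun H 0 (_, _)); apply: funext.
- rewrite -[RHS]deg0; apply: etrans (esym (smapE H (hconst 0 ord_max) c)) _; apply: etrans _ (H1 0 tt).
  by congr (smap_fun H 0 (_, _)); apply: funext.
Qed.

Lemma at_vertex_map (X Y : sSet) (f : smap X Y) (x : X 0) : at_vertex (f 0 x) = scomp f (at_vertex x).
Proof. apply: smap_eq => n u; exact: (esym (smap_deg f n x)). Qed.

Section Components.
Variables (X : sSet).
Hypothesis lX : LF (to_point X).

Lemma connected_refl (x : X 0) : connected x x.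
Proof. by apply/connected_homotopic => //; exact: homotopic_refl. Qed.
Lemma connected_sym (x y : X 0) : connected x y -> connected y x.
Proof. by move=> /(connected_homotopic _ _ lX)/homotopic_sym h; apply/connected_homotopic. Qed.
Lemma connected_trans (x y z : X 0) : connected x y -> connected y z -> connected x z.
Proof.
move=> /(connected_homotopic _ _ lX) h1 /(connected_homotopic _ _ lX) h2; apply/connected_homotopic => //.
exact: homotopic_trans (LF_isfib lX) h1 h2.
Qed.

Lemma componentP (x y : X 0) : component x = component y <-> connected x y.
Proof.
split=> [e|h].
  have -> : connected x y = connected y y by exact: (congr1 (fun A : pi0 X => sval A y) e).
  exact: connected_refl.
apply: eq_exist; apply: funext => z; apply: propext; split=> h'.
  exact: connected_trans (connected_sym h) h'.
exact: connected_trans h h'.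
Qed.
End Components.

Lemma connected_map (X Y : sSet) (f : smap X Y) (x y : X 0) : connected x y -> connected (f 0 x) (f 0 y).
Proof. by case=> e [<- <-]; exists (f 1 e); split; rewrite /src /tgt /vertex smapE. Qed.

Lemma equiv_connected (X Y : sSet) (f : smap X Y) (x y : X 0) : LF (to_point X) -> LF (to_point Y) ->
  is_equiv f -> connected (f 0 x) (f 0 y) -> connected x y.
Proof.
move=> lX lY [g [gf _]] /(connected_map g) h.
have E z : connected (g 0 (f 0 z)) z.
  by apply/connected_homotopic => //; have := homotopic_pre (at_vertex z) gf; rewrite -!at_vertex_map.
exact: (connected_trans lX (connected_sym lX (E x)) (connected_trans lX h (E y))).
Qed.

Lemma equiv_connected_surj (X Y : sSet) (f : smap X Y) (y : Y 0) : LF (to_point Y) ->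
  is_equiv f -> exists x, connected (f 0 x) y.
Proof.
move=> lY [g [_ fg]]; exists (g 0 y); apply/connected_homotopic => //.
by have := homotopic_pre (at_vertex y) fg; rewrite -!at_vertex_map.
Qed.

Lemma hpb_points (X : sSet) (x y : X 0) : inhabited (hpullback (at_vertex x) (at_vertex y) 0) <->
  homotopic (at_vertex x) (at_vertex y).
Proof.
split=> [[z]|[h [h0 h1]]].
  have [e0 e1] := hpb_ends z; exists (at_vertex (hpb_path _ _ 0 z)); split=> n u.
    apply: etrans (smap_deg (path_start X) n (hpb_path _ _ 0 z)) _; rewrite e0; exact: act_deg.
  apply: etrans (smap_deg (path_end X) n (hpb_path _ _ 0 z)) _; rewrite e1; exact: act_deg.
constructor; exists ((tt, tt), h 0 tt).
by congr (_, _); [exact: esym (h0 0 tt)|exact: esym (h1 0 tt)].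
Qed.

(** * The zero section on fibres *)

Lemma el_zero (R : ring_spectrum) n m (e : el_simplex (Omega_Sigma R n) m) (s : hc_simplex (module_cat R) m) :
  (forall j k (c : cone_chain k j), el_fun e c = basept (hob (el_base e) j : bifibrant_module R) n k) ->
  el_base e = s -> e = zero_element n s.
Proof.
move=> E <-; apply: (@fib_inj _ (Omega_Sigma R n) m e (zero_element n (el_base e)) (el_base e) erefl erefl) => j k c; exact: E.
Qed.

Lemma fibre_section_zero (R : ring_spectrum) (C : sSet) (D : natural_system R C) n (Lambda : C 0) :
  fibre_section (value_zero D n (tw_id Lambda)) = Dzero D n 0 Lambda.
Proof.
have E i (h : hom i 0) : deg C i Lambda = act C h Lambda.
  by congr (act C _ _); apply: hom_eq => x; rewrite !ord1.
apply: eq_exist; congr (_, _); first by rewrite [LHS](E 0 (hid 0)) act_id.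
apply: smap_eq => j th.
change (total_fibre (act (value_space D n (tw_id Lambda)) (Tw_tgt (simplex 0) j th)
  (value_zero D n (tw_id Lambda))) = total_zero D n j (act C th Lambda)).
rewrite -(E _ th); apply: eq_exist; congr (_, _); apply: el_zero => [i k c|].
  change (act (value_space D n (tw_id Lambda)) (min_hom c) (act (value_space D n (tw_id Lambda))
    (Tw_tgt (simplex 0) j th) (value_zero D n (tw_id Lambda))) =
    deg (value_space D n (tw_id Lambda)) k (value_zero D n (tw_id Lambda))).
  by rewrite -act_comp; congr (act _ _ _); apply: hom_eq => x; rewrite !ord1.
have -> : deg C j.*2.+1 Lambda = act (Tw C) (hconst j ord0) (tw_id Lambda) by symmetry; exact: act_deg.
exact: (esym (smapE D (hconst j ord0) (tw_id Lambda))).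
Qed.

Section Core.
Variables (R : ring_spectrum) (C : sSet) (D : natural_system R C) (Lambda : C 0).
Hypothesis qC : is_quasicategory C.
Local Notation K := (BAut Lambda).
Local Notation Z := (Dcore D 2 Lambda).
Local Notation p := (Dcore_proj D 2 Lambda).
Local Notation z0 := (Dcore_zero D 2 Lambda).
Local Notation Y := (value_space D 2 (tw_id Lambda)).
Local Notation y0 := (value_zero D 2 (tw_id Lambda)).

Lemma ov_deg n : ov (sid C) Lambda (deg C n Lambda).
Proof.
split=> [e|i]; first by rewrite act_deg; exact: one_equivalence.
have -> : vertex i (deg C n Lambda) = Lambda.
  rewrite /vertex -[RHS]act_id -act_comp; congr (act C _ _); apply: hom_eq => x; by rewrite !ord1.
by exists (deg C 1 Lambda); split; [exact: src_one|exact: tgt_one|exact: one_equivalence].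
Qed.

Lemma ov_base : ov (sid C) Lambda Lambda.
Proof. by have := ov_deg 0; rewrite /deg (_ : hconst 0 ord0 = hid 0) ?act_id //; apply: hom_eq => x; rewrite !ord1. Qed.

(** The base point is written as the projection of the zero point, so that [map_space_map] of p at
    the zero point has target [map_space vK vK] by conversion, without a transport along [p_z0]. *)
Definition vK : K 0 := p 0 (z0 0 (exist _ Lambda ov_base)).
Local Notation F := (fibre p vK).

Lemma p_z0 n x : p n (z0 n x) = x.
Proof. exact: (@sub_eq _ _ (@over_closed _ _ (sid C) Lambda)). Qed.

Definition zF : F 0 := exist (fun q : sprod Z point 0 => p 0 q.1 = at_vertex vK 0 q.2) (z0 0 (exist _ Lambda ov_base), tt)
  (esym (deg0 vK)).

Lemma Z_isfib : isfib Z. Proof. exact/LF_FJ/Dcore_LF. Qed.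
Lemma K_isfib : isfib K. Proof. exact/LF_FJ/BAut_LF. Qed.
Lemma p_FJ : FJ p. Proof. exact/LF_FJ/Dcore_proj_LF. Qed.
Lemma F_isfib : isfib F. Proof. exact: isfib_fibre p_FJ. Qed.
Lemma F_LF : LF (to_point F).
Proof.
have := @ELP_pb_snd _ _ _ _ _ _ (at_vertex vK) (@Dcore_proj_LF R C D 2 Lambda qC).
by congr ELP; apply: smap_eq => n x; exact: point_eq.
Qed.
Lemma Y_isfib : isfib Y. Proof. exact/LF_FJ/value_LF. Qed.

(** The strict fibre F of the core and the sections over the point Lambda are in bijection by [eps],
    so [fibre_secs] becomes an equivalence to F. The zero element corresponds to the zero section by
    [fibre_section_zero]. *)
Lemma fibre_core : exists yF : smap Y F,
  [/\ is_equiv yF, forall n y, over_incl _ _ n (pb_fst _ _ n (yF n y)) = fibre_section y & yF 0 y0 = zF].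
Proof.
have eP n (x : F n) : Dproj D 2 n (over_incl (Dproj D 2) Lambda n (pb_fst p (at_vertex vK) n x)) =
    at_vertex Lambda n (to_point F n x).
  exact: (congr1 (BAut_incl Lambda n) (svalP x)).
pose eps : smap F (secs D 2 (at_vertex Lambda)) :=
  @sub_lift F (sprod (Dcat D 2) point) _ (pullback_closed (f := Dproj D 2) (g := at_vertex Lambda))
    (pair_map (scomp (over_incl (Dproj D 2) Lambda) (pb_fst _ _)) (to_point F)) eP.
have me : mono_map eps.
  move=> n x x' e; apply: lift_F_eq; apply: incl_mono; exact: (congr1 (fun q => (sval q).1) e).
have se n s : exists x, eps n x = s.
  case: s => -[d u] h; have h1 : Dproj D 2 n d = deg C n Lambda := h.
  have hd : ov (Dproj D 2) Lambda d by apply: ov_Dcat => //; rewrite h1; exact: ov_deg.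
  have hp : p n (exist _ d hd) = at_vertex vK n tt.
    by apply: (@sub_eq _ _ (@over_closed _ _ (sid C) Lambda)); exact: h1.
  exists (exist (fun q : sprod Z point n => p n q.1 = at_vertex vK n q.2) (exist _ d hd, tt) hp).
  by apply: (@sub_eq _ _ (@pullback_closed _ _ _ _ _)); congr (_, _); exact: point_eq.
have [yF yE] := mono_lift (z := fibre_secs D 2 Lambda) me (fun n y => se n _).
have [g [gf fg]] := bij_inverse me se.
exists yF; split.
- apply: (equiv_cancel_l (g := eps) F_isfib); last exact: (iso_equiv gf fg).
  by apply: equiv_ext (fibre_secs_equiv D 2 Lambda) => n y; rewrite -yE.
- by move=> n y; exact: (congr1 (fun q : secs D 2 (at_vertex Lambda) n => (sval q).1) (yE n y)).
- apply: lift_F_eq; apply: incl_mono.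
  apply: etrans (congr1 (fun q : secs D 2 (at_vertex Lambda) 0 => (sval q).1) (yE 0 y0)) _.
  exact: fibre_section_zero.
Qed.

(** * Fibres of the projection of D^2 *)

Lemma hfibre_path n (z : hfibre (Dproj D 2) Lambda n) j q :
  ov (sid C) Lambda (hpb_path _ _ n z j q).
Proof.
have [e0 e1] := hpb_ends z; apply: (ov_path qC); apply: (ov_path_start qC).
by rewrite e1; exact: ov_deg.
Qed.

Definition core_hfibre : smap (hfibre p vK) (hfibre (Dproj D 2) Lambda) :=
  @hpb_sub (Dcat D 2) point C Z point K (Dproj D 2) (at_vertex Lambda) p (at_vertex vK)
    (over_incl (Dproj D 2) Lambda) (sid point) (BAut_incl Lambda) (fun _ _ => erefl) (fun _ _ => erefl).

Lemma core_hfibre_mono : mono_map core_hfibre.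
Proof. by apply: hpb_sub_mono => //; exact: incl_mono. Qed.

Lemma core_hfibre_surj n z : exists x, core_hfibre n x = z.
Proof.
apply: hpb_sub_surj; first exact: incl_mono.
- have [e0 _] := hpb_ends z.
  have h : ov (Dproj D 2) Lambda (hpb_fst _ _ n z).
    by apply: ov_Dcat => //; rewrite -e0; exact: hfibre_path.
  by exists (exist _ _ h).
- by exists (hpb_snd _ _ n z).
- by move=> j q; exists (exist _ _ (hfibre_path z q)).
Qed.

Lemma hfibre_core_LF : LF (to_point (hfibre p vK)).
Proof.
apply: ELP_hpb; [exact: atv_closed|exact: Dcore_LF|exact: point_LF|exact: BAut_LF].
Qed.

Lemma hfibre_LF : LF (to_point (hfibre (Dproj D 2) Lambda)).
Proof.
have [g [gf fg]] := bij_inverse core_hfibre_mono core_hfibre_surj.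
exact: (ELP_retract_obj fg hfibre_core_LF).
Qed.

Lemma fibre_map_core (yF : smap Y F) :
  (forall n y, over_incl _ _ n (pb_fst _ _ n (yF n y)) = fibre_section y) ->
  forall n y, core_hfibre n (fibre_in p vK n (yF n y)) = fibre_map D 2 Lambda n y.
Proof.
move=> yE n y; apply: hpb_eq; [exact: yE|exact: point_eq|].
apply: smap_eq => j [u t].
have e : BAut_incl Lambda n (p n (pb_fst _ _ n (yF n y))) = deg C n Lambda.
  exact: (congr1 (BAut_incl Lambda n) (svalP (yF n y))).
change (BAut_incl Lambda j (p j (pb_fst _ _ j (act F u (yF n y)))) = act C u (deg C n Lambda)).
by rewrite -e !smapE.
Qed.

Lemma fibre_map_equiv : is_equiv (fibre_map D 2 Lambda).
Proof.
have [yF [e1 yE _]] := fibre_core.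
have [g [gf fg]] := bij_inverse core_hfibre_mono core_hfibre_surj.
apply: (equiv_ext (f := scomp (scomp core_hfibre (fibre_in p vK)) yF)).
  exact: fibre_map_core.
apply: equiv_comp => //; [exact: Y_isfib|exact/LF_isfib/hfibre_LF|].
apply: equiv_comp; [exact: F_isfib|exact/LF_isfib/hfibre_LF|exact/fibre_in_equiv/p_FJ|].
exact: (iso_equiv gf fg).
Qed.

Lemma connected_core (yF : smap Y F) (y : Y 0) (d : Z 0) (z : hfibre (Dproj D 2) Lambda 0) :
  (forall n y, over_incl _ _ n (pb_fst _ _ n (yF n y)) = fibre_section y) ->
  over_incl _ _ 0 d = hpb_fst _ _ 0 z -> connected (fibre_map D 2 Lambda 0 y) z ->
  homotopic (at_vertex d) (at_vertex (pb_fst _ _ 0 (yF 0 y))).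
Proof.
move=> yE dE; have [g [gf fg]] := bij_inverse core_hfibre_mono core_hfibre_surj.
move=> /(connected_map (scomp (hpb_fst _ _) g)) h; apply: homotopic_sym.
apply/(connected_homotopic _ _ (@Dcore_LF R C D 2 Lambda qC)); move: h.
have -> : scomp (hpb_fst p (at_vertex vK)) g 0 (fibre_map D 2 Lambda 0 y) = pb_fst _ _ 0 (yF 0 y).
  rewrite -(fibre_map_core yE); exact: (congr1 (hpb_fst p (at_vertex vK) 0) (gf 0 _)).
have -> // : scomp (hpb_fst p (at_vertex vK)) g 0 z = d.
by apply: incl_mono; rewrite [RHS]dE -[in RHS](fg 0 z).
Qed.

(** * Mapping spaces of D^2 *)

Definition to_fibre_map : smap (map_space zF zF) (fibre (map_space_map p (pb_fst _ _ 0 zF) (pb_fst _ _ 0 zF)) (map_id vK)).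
Proof.
refine (@sub_lift (map_space zF zF) (sprod (map_space (pb_fst _ _ 0 zF) (pb_fst _ _ 0 zF)) point) _
  (pullback_closed (f := map_space_map p (pb_fst _ _ 0 zF) (pb_fst _ _ 0 zF)) (g := at_vertex (map_id vK)))
  (pair_map (map_space_map (pb_fst p (at_vertex vK)) zF zF) (to_point _)) _).
move=> n g; apply: (@sub_eq _ _ (@map_space_closed K vK vK)); apply: smap_eq => j q.
exact: (svalP (sval g j q)).
Defined.

Lemma to_fibre_map_weq : isfib (map_space zF zF) ->
  weq (map_space zF zF) (fibre (map_space_map p (pb_fst _ _ 0 zF) (pb_fst _ _ 0 zF)) (map_id vK)).
Proof.
have mF : mono_map (pb_fst p (at_vertex vK)) by move=> n x x'; exact: lift_F_eq.
apply: (weq_iso (f := to_fibre_map)).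
- move=> n g g' e; apply: (map_space_mono mF).
  exact: (congr1 (fun q => (sval q).1) e).
- move=> n [[g u] h].
  have hg j q : p j (sval g j q) = deg K j vK.
    exact: (congr1 (fun q' : map_space vK vK n => sval q' j q) h).
  have [g' eg] : exists g', map_space_map (pb_fst p (at_vertex vK)) zF zF n g' = g.
    apply: map_space_lift => // j q.
    by exists (exist (fun q : sprod Z point j => p j q.1 = at_vertex vK j q.2) (sval g j q, tt) (hg j q)).
  exists g'; apply: (@sub_eq _ _ (@pullback_closed _ _ _ _ _)); congr (_, _); first exact: eg.
  exact: point_eq.
Qed.

(** A path of mapping spaces in C is read at one position s of the mapping interval. The resulting
    path g in C ends at the degenerate simplex on Lambda, so [ov_path] places all its values in the
    core. *)
Lemma zero_maps_path n (z : zero_maps_over_id D 2 Lambda n) i (h : hom i n) (s : simplex 1 i) j q :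
  exists g : path_space C i, [/\ g i (hid i, jF i) = Dproj D 2 i (sval (hpb_fst _ _ n z) i (h, s)),
    ov (sid C) Lambda (g j q) &
    forall t, g i (hid i, t) = sval (hpb_path _ _ n z i (h, t)) i (hid i, s)].
Proof.
pose iC := incl (@map_space_closed C Lambda Lambda).
pose gz : path_space (map_space Lambda Lambda) i := act (path_space _) h (hpb_path _ _ n z).
pose g : path_space C i := scomp (uncurry (scomp iC gz)) (pair_map (sid _) (scomp (classify s) (sfst _ _))).
have gE t : g i (hid i, t) = sval (hpb_path _ _ n z i (h, t)) i (hid i, s).
  change (sval (hpb_path _ _ n z i (hcomp h (hid i), t)) i (hid i, act (simplex 1) (hid i) s) =
    sval (hpb_path _ _ n z i (h, t)) i (hid i, s)).
  by rewrite hcomp1 act_id.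
have gb b : g i (hid i, deg J i (J_end b)) = sval (act (map_space Lambda Lambda) h
    (eval_at _ (J_end b) n (hpb_path _ _ n z))) i (hid i, s).
  rewrite gE; congr (smap_fun (sval _) i _).
  have -> : (h, deg J i (J_end b)) = act (sprod (simplex n) J) h (hid n, deg J n (J_end b)).
    by congr (_, _); exact: hom_eq.
  exact: (smapE (hpb_path _ _ n z) h (hid n, deg J n (J_end b))).
have [e0 e1] := hpb_ends z; exists g; split=> //.
- rewrite (gb false) [eval_at _ _ _ _]e0.
  by change (Dproj D 2 i (sval (hpb_fst _ _ n z) i (hcomp h (hid i), s)) =
    Dproj D 2 i (sval (hpb_fst _ _ n z) i (h, s))); rewrite hcomp1.
- apply: (ov_path qC); apply: (ov_path_start qC).
  have -> : path_end C i g = deg C i Lambda.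
    by apply: etrans (gb true) _; rewrite [eval_at _ _ _ _]e1.
  exact: ov_deg.
Qed.

Lemma zero_maps_core : isfib (hfibre (map_space_map p (pb_fst _ _ 0 zF) (pb_fst _ _ 0 zF)) (map_id vK)) ->
  weq (hfibre (map_space_map p (pb_fst _ _ 0 zF) (pb_fst _ _ 0 zF)) (map_id vK)) (zero_maps_over_id D 2 Lambda).
Proof.
have ea n (g : map_space (pb_fst _ _ 0 zF) (pb_fst _ _ 0 zF) n) :
    map_space_map (Dproj D 2) (Dzero D 2 0 Lambda) (Dzero D 2 0 Lambda) n
      (map_space_map (over_incl (Dproj D 2) Lambda) (pb_fst _ _ 0 zF) (pb_fst _ _ 0 zF) n g) =
    map_space_map (BAut_incl Lambda) vK vK n (map_space_map p (pb_fst _ _ 0 zF) (pb_fst _ _ 0 zF) n g).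
  by apply: (@sub_eq _ _ (@map_space_closed C Lambda Lambda)); exact: smap_eq.
have eb n (u : point n) : at_vertex (map_id Lambda) n u =
    map_space_map (BAut_incl Lambda) vK vK n (at_vertex (map_id vK) n u).
  by apply: (@sub_eq _ _ (@map_space_closed C Lambda Lambda)); exact: smap_eq.
pose ff : smap (hfibre (map_space_map p (pb_fst _ _ 0 zF) (pb_fst _ _ 0 zF)) (map_id vK))
    (zero_maps_over_id D 2 Lambda) :=
  @hpb_sub (map_space (Dzero D 2 0 Lambda) (Dzero D 2 0 Lambda)) point (map_space Lambda Lambda)
    (map_space (pb_fst _ _ 0 zF) (pb_fst _ _ 0 zF)) point (map_space vK vK)
    (map_space_map (Dproj D 2) (Dzero D 2 0 Lambda) (Dzero D 2 0 Lambda)) (at_vertex (map_id Lambda))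
    (map_space_map p (pb_fst _ _ 0 zF) (pb_fst _ _ 0 zF)) (at_vertex (map_id vK))
    (map_space_map (over_incl (Dproj D 2) Lambda) (pb_fst _ _ 0 zF) (pb_fst _ _ 0 zF)) (sid point)
    (map_space_map (BAut_incl Lambda) vK vK) ea eb.
have mD : mono_map (over_incl (Dproj D 2) Lambda) by exact: incl_mono.
have mK : mono_map (BAut_incl Lambda) by exact: incl_mono.
apply: (weq_iso (f := ff)).
- by apply: hpb_sub_mono; [exact: (map_space_mono mD)| |exact: (map_space_mono mK)].
- move=> n z; apply: hpb_sub_surj; first exact: (map_space_mono mK).
  + apply: (@map_space_lift _ _ (over_incl (Dproj D 2) Lambda)) => // i [h s].
    have [g [g0 gov _]] := zero_maps_path z h s (hid i, jF i).
    rewrite g0 in gov.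
    by exists (exist _ _ (ov_Dcat qC gov)).
  + by exists (hpb_snd _ _ n z).
  + move=> j [h t]; apply: (@map_space_lift _ _ (BAut_incl Lambda)) => // i [h' s].
    have [g [_ gov gE]] := zero_maps_path z (hcomp h h') s (hid i, act J h' t).
    rewrite gE in gov.
    have e : sval (hpb_path _ _ n z i (hcomp h h', act J h' t)) i (hid i, s) =
        sval (hpb_path _ _ n z j (h, t)) i (h', s).
      have -> : hpb_path _ _ n z i (hcomp h h', act J h' t) = act (map_space Lambda Lambda) h' (hpb_path _ _ n z j (h, t)).
        exact: (smapE (hpb_path _ _ n z) h' (h, t)).
      by congr (smap_fun (sval (hpb_path _ _ n z j (h, t))) i (_, _)); rewrite hcomp1.
    rewrite e in gov; by exists (exist _ _ gov).
Qed.

(** Mapping spaces commute with fibres: loops of F at the zero point form the fibre over the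
    identity of p on mapping spaces of the core. This map is a fibration, so strict and homotopy
    fibres agree, and the homotopy fibre is the same in D^2 as in the core. *)
Lemma loops_zero_maps : weq (hpullback (at_vertex y0) (at_vertex y0)) (zero_maps_over_id D 2 Lambda).
Proof.
have [yF [e1 yE y0E]] := fibre_core.
have fY := Y_isfib; have fF := F_isfib; have fp := isfib_point.
have w1 : weq (hpullback (at_vertex y0) (at_vertex y0)) (hpullback (at_vertex zF) (at_vertex zF)).
  split; try exact: isfib_hpb.
  have ea n u : at_vertex zF n u = yF n (at_vertex y0 n u) by rewrite [RHS]smap_deg y0E.
  exists (hpb_map (w := yF) ea ea); exact: hpb_map_equiv.
apply: (weq_trans w1); have w2 := path_map_weq zF zF F_LF; apply: (weq_trans w2).
have fm : isfib (map_space zF zF) by case: w2.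
apply: (weq_trans (to_fibre_map_weq fm)).
have [_ fZ _] := path_map_weq (pb_fst _ _ 0 zF) (pb_fst _ _ 0 zF) (@Dcore_LF R C D 2 Lambda qC).
have [_ fK _] := path_map_weq vK vK (@BAut_LF C Lambda qC).
have fh : isfib (hfibre (map_space_map p (pb_fst _ _ 0 zF) (pb_fst _ _ 0 zF)) (map_id vK)).
  exact: isfib_hpb.
apply: weq_trans (zero_maps_core fh); split=> //.
  exact/isfib_fibre/map_space_FJ/p_FJ.
exists (fibre_in (map_space_map p (pb_fst _ _ 0 zF) (pb_fst _ _ 0 zF)) (map_id vK)).
exact/fibre_in_equiv/map_space_FJ/p_FJ.
Qed.

(** The adjoint structure map from level 1 to the loops of level 2 is an equivalence by stable
    fibrancy; [path_map_weq] passes from loops parametrised by the interval to those parametrised by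
    J. *)
Lemma zero_maps_value : weq (zero_maps_over_id D 2 Lambda) (value_space D 1 (tw_id Lambda)).
Proof.
apply: weq_sym; apply: weq_trans loops_zero_maps.
have w2 := path_map_weq y0 y0 (@value_LF R C D 2 Lambda).
apply: weq_trans (weq_sym w2); have [_ fl _] := w2.
split=> //; first exact/LF_FJ/value_LF.
exists (adjoint_structure (ns_value D (tw_id Lambda)) 1); exact: (bm_fib (ns_value D (tw_id Lambda)) 1).2.
Qed.
End Core.

(** * The square for Lifts1 *)

Section Square1.
Variables (R : ring_spectrum) (C B E : sSet) (D : natural_system R C) (p : smap B C) (f : smap E B).
Variables (L : linear_extension D p f) (X : B 0).
Hypotheses (qC : is_quasicategory C) (qB : is_quasicategory B) (qE : is_quasicategory E).
Local Notation Lambda := (p 0 X).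
Local Notation K := (BAut Lambda).
Local Notation Z := (Dcore D 2 Lambda).
Local Notation Y := (value_space D 2 (tw_id Lambda)).
Local Notation y0 := (value_zero D 2 (tw_id Lambda)).
Local Notation kx := (kX L X qC).

Definition base : BAut X 0 := exist _ X (ov_base X).

Definition Lifts0_proj : smap (Lifts0 f X) (BAut X) :=
  over_map (f := f) (f' := sid B) (h := f) (fun _ => erefl) X.

Lemma Lifts1_core : weq (Lifts1 f X) (hpullback (at_vertex base) Lifts0_proj).
Proof.
have fX : isfib (BAut X) by exact/LF_isfib/over_LF.
have fL : isfib (Lifts0 f X) by exact/LF_isfib/over_LF.
apply: weq_sym; apply: (weq_iso (f := @hpb_sub point E B point (Lifts0 f X) (BAut X) (at_vertex X) f
  (at_vertex base) Lifts0_proj (sid point) (over_incl f X) (BAut_incl X) (fun _ _ => erefl) (fun _ _ => erefl))).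
- by apply: hpb_sub_mono => //; exact: incl_mono.
- move=> n z; have [e0 e1] := hpb_ends z.
  have h0 : ov (sid B) X (path_start B n (hpb_path _ _ n z)) by rewrite e0; exact: ov_deg.
  apply: hpb_sub_surj; first exact: incl_mono.
  + by exists (hpb_fst _ _ n z).
  + have h1 := ov_path_end qB h0; rewrite e1 in h1.
    by exists (exist _ _ (lift_ov L qC qB qE h1)).
  + by move=> j q; exists (exist _ _ (ov_path qB h0 q)).
- by apply: isfib_hpb => //; exact: isfib_point.
Qed.

(** Pasting of pullbacks: Lifts1 is the homotopy fibre over X of Lifts0 -> BAut(X), and Lifts0 is
    the homotopy pullback of the zero section and k. *)
Lemma Lifts1_hpb : weq (Lifts1 f X) (hpullback (Dcore_zero D 2 Lambda) (at_vertex (kx 0 base))).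
Proof.
have fX : isfib (BAut X) by exact/LF_isfib/over_LF.
have fK : isfib K by exact: K_isfib.
have fL : isfib (Lifts0 f X) by exact/LF_isfib/over_LF.
have fZ : isfib Z by exact: Z_isfib.
have fp := isfib_point.
have fH : isfib (hpullback (Dcore_zero D 2 Lambda) kx) by exact: isfib_hpb.
apply: (weq_trans Lifts1_core); have [phi [phiE pe]] := Lifts0_square L X qC qB qE.
have e n x : hpb_snd (Dcore_zero D 2 Lambda) kx n (phi n x) = Lifts0_proj n x.
  apply: incl_mono; apply: etrans (left_eq L _).
  exact: (congr1 (hpb_snd _ _ n) (phiE n x)).
have w1 : weq (hpullback (at_vertex base) Lifts0_proj)
    (hpullback (at_vertex base) (hpb_snd (Dcore_zero D 2 Lambda) kx)).
  split; try exact: isfib_hpb.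
  exists (hpb_pre (at_vertex base) e); exact: hpb_pre_equiv.
apply: (weq_trans w1); apply: (weq_trans (hpb_swap_weq _ _ fp fH fX)); apply: weq_sym.
apply: (weq_trans (to_fibre_iso _ kx base fK fX fZ)).
have fs : FJ (hpb_snd (Dcore_zero D 2 Lambda) kx) by apply: ELP_hpb_snd => //; exact: atv_closed.
split; [exact: isfib_fibre|exact: isfib_hpb|].
exists (fibre_in (hpb_snd (Dcore_zero D 2 Lambda) kx) base); exact: fibre_in_equiv.
Qed.

(** The point k(X) of the core is moved along a path to a point of the fibre F; there the homotopy
    pullback along the zero section becomes a space of paths in F, which is compared with the value
    of D at the identity. *)
Lemma Lifts1_square (y : Y 0) : connected (fibre_map D 2 Lambda 0 y) (obstruction_point L X) ->
  weq (Lifts1 f X) (hpullback (at_vertex y0) (at_vertex y)).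
Proof.
have [yF [ye yE y0E]] := fibre_core D Lambda qC => h.
have fK : isfib K by exact: K_isfib.
have fZ : isfib Z by exact: Z_isfib.
have fp := isfib_point; have fF := @F_isfib R C D Lambda qC; have fY : isfib Y by exact: Y_isfib.
apply: (weq_trans Lifts1_hpb).
have hd := connected_core (d := kx 0 base) (z := obstruction_point L X) qC yE erefl h.
have w1 : weq (hpullback (Dcore_zero D 2 Lambda) (at_vertex (kx 0 base)))
    (hpullback (Dcore_zero D 2 Lambda) (at_vertex (pb_fst _ _ 0 (yF 0 y)))).
  split; try exact: isfib_hpb.
  exact: hpb_homotopic hd.
apply: (weq_trans w1); apply: weq_sym.
have zE : (sval (zF D Lambda)).1 = Dcore_zero D 2 Lambda 0 (vK D Lambda).
  by congr (Dcore_zero D 2 Lambda 0 _); symmetry; exact: p_z0.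
apply: weq_trans (section_fibre_weq (yF 0 y) (@p_FJ R C D Lambda qC) (@p_z0 R C D Lambda) zE fZ fK).
split; try exact: isfib_hpb.
have ea n u : at_vertex (zF D Lambda) n u = yF n (at_vertex y0 n u) by rewrite [RHS]smap_deg y0E.
have eb n u : at_vertex (yF 0 y) n u = yF n (at_vertex y n u) by rewrite [RHS]smap_deg.
exists (hpb_map (w := yF) ea eb); exact: hpb_map_equiv.
Qed.

Lemma Lifts1_cartesian : exists o : pi_neg (ns_value D (tw_id Lambda)) 2,
    [/\ forall kappa : Y 0, component kappa = o <->
          connected (fibre_map D 2 Lambda 0 kappa) (obstruction_point L X),
        inhabited (Lifts1 f X 0) <-> o = pi_neg0 (ns_value D (tw_id Lambda)) 2,
        forall kappa : Y 0, component kappa = o ->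
          (exists s : square (Lifts1 f X) (at_vertex y0) (at_vertex kappa), cartesian s) /\
          (forall nullhomotopy : hpullback (at_vertex y0) (at_vertex kappa) 0,
           exists e : smap (Lifts1 f X) (zero_maps_over_id D 2 Lambda), is_equiv e) &
        exists e : smap (zero_maps_over_id D 2 Lambda) (value_space D 1 (tw_id Lambda)), is_equiv e].
Proof.
have lY := @value_LF R C D 2 Lambda; have fY := LF_isfib lY; have fp := isfib_point.
have lH := @hfibre_LF R C D Lambda qC; have ef := fibre_map_equiv D Lambda qC.
(* k(X) is a point of the homotopy fibre of D^2 over Lambda. The obstruction class is the component
   of any preimage, up to a path, under the equivalence [fibre_map]. *)
have [y1 h1] := equiv_connected_surj (obstruction_point L X) lH ef.
have cE y : component y = component y1 <-> connected (fibre_map D 2 Lambda 0 y) (obstruction_point L X).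
  split=> [/(componentP lY) h|h].
    exact: (connected_trans lH (connected_map (fibre_map D 2 Lambda) h) h1).
  apply/(componentP lY); apply: (equiv_connected lY lH ef).
  exact: (connected_trans lH h (connected_sym lH h1)).
have [_ _ [e1 [e2 _]]] := Lifts1_square h1.
exists (component y1); split=> //.
- split=> [[x]|h].
    have : inhabited (hpullback (at_vertex y0) (at_vertex y1) 0) by constructor; exact: (e1 0 x).
    move=> /hpb_points/(connected_homotopic _ _ lY)/(componentP lY) h; exact: esym h.
  have /hpb_points[z] : homotopic (at_vertex y0) (at_vertex y1).
    by apply/(connected_homotopic _ _ lY)/(componentP lY); exact: esym h.
  by constructor; exact: (e2 0 z).
- move=> y /cE hy; have w1 := Lifts1_square hy; split.
    by case: w1 => _ _ [e he]; exists (Square e).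
  move=> z; have /hpb_points hz : inhabited (hpullback (at_vertex y0) (at_vertex y) 0) by constructor.
  have w2 : weq (hpullback (at_vertex y0) (at_vertex y)) (hpullback (at_vertex y0) (at_vertex y0)).
    by split; try exact: isfib_hpb; exact: hpb_homotopic (homotopic_sym hz).
  by have [_ _ h] := weq_trans w1 (weq_trans w2 (loops_zero_maps D Lambda qC)).
- by have [_ _ h] := zero_maps_value D Lambda qC.
Qed.
End Square1.

Theorem theorem6p2p14 (R : connective_E1_ring) (C B E : infty_cat)
    (D : natural_system R C) (p : smap B C) (f : smap E B)
    (L : linear_extension D p f) (X : B 0) :
  let Lambda : C 0 := p 0 X in
  let idL : Tw C 0 := tw_id Lambda in
  let k : smap B (Dcat D 2) := le_k L in
  let t : smap E C := sq_top (le_square L) in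
  (* the square for Lifts0, where w is the identification of the part of the
     groupoid of D^2 over BAut(Lambda) with the homotopy orbits, and kX is the
     restriction of k *)
  (exists w : smap (Dcore D 2 Lambda) (homotopy_orbits D 2 Lambda),
    [/\ is_equiv w,
        homotopic (scomp w (Tw_tgt (Dcore D 2 Lambda))) (Dcore_eval D 2 Lambda) &
        exists kX : smap (BAut X) (Dcore D 2 Lambda),
        (forall n b, over_incl (Dproj D 2) Lambda n (kX n b) = k n (BAut_incl X n b)) /\
        exists s : square (Lifts0 f X) (scomp w (Dcore_zero D 2 Lambda)) (scomp w kX),
        [/\ forall n e, BAut_incl Lambda n (sq_top s n e) = t n (over_incl f X n e),
            forall n e, BAut_incl X n (sq_left s n e) = f n (over_incl f X n e),
            exists h : smap (Lifts0 f X) (path_space (Dcore D 2 Lambda)),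
              (forall n e, mapsp_post J w n (h n e) = sq_filling s n e) /\
              (forall n e, mapsp_post J (over_incl (Dproj D 2) Lambda) n (h n e) =
                 sq_filling (le_square L) n (over_incl f X n e)) &
            cartesian s]]) /\
  (* the obstruction class o, the square for Lifts1 with corner {kappa}, where
     kappa is k(X) seen in Omega^infty Sigma^2 D(id), and the consequences *)
  (exists o : pi_neg (ns_value D idL) 2,
    [/\ forall kappa : value_space D 2 idL 0,
          component kappa = o <->
          connected (fibre_map D 2 Lambda 0 kappa) (obstruction_point L X),
        inhabited (Lifts1 f X 0) <-> o = pi_neg0 (ns_value D idL) 2,
        forall kappa : value_space D 2 idL 0, component kappa = o ->
          (exists s : square (Lifts1 f X) (at_vertex (value_zero D 2 idL))
                        (at_vertex kappa), cartesian s) /\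
          (forall nullhomotopy :
             hpullback (at_vertex (value_zero D 2 idL)) (at_vertex kappa) 0,
           exists e : smap (Lifts1 f X) (zero_maps_over_id D 2 Lambda), is_equiv e) &
        exists e : smap (zero_maps_over_id D 2 Lambda) (value_space D 1 idL),
          is_equiv e]).
Proof.
have qC := @ic_qcat C; have qB := @ic_qcat B; have qE := @ic_qcat E.
split; [exact: (Lifts0_cartesian L X qC qB qE)|exact: (Lifts1_cartesian L X qC qB qE)].
Qed.
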